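(* Let $L=-\sum_{i=1}^nX_i^2$ be a subLaplacian on a stratified group $G$ and let $p$ be the (convolution) kernel of $e^{-\frac L2}$. a) The family of operators $(T_t)_{t\ge0}$ defined on $\mathcal S(G)$ by $$T_t(f)(\gamma)=\int_G f(\delta_{e^{-t}}\gamma\;\delta_{\sqrt{1-e^{-2t}}}g)\,p(g)\,dg=e^{-\frac L2(1-e^{-2t})}(f)(\delta_{e^{-t}}\gamma)$$ is a semi-group whose generator $-N$ is defined on $\mathcal S(G)$ by $N=L+A$. b) The probability measure $p\,d\gamma$ is invariant by $(T_t)_{t\ge0}$, i.e. $\int_G T_t(f)(\gamma)p(\gamma)\,d\gamma=\int_G f(\gamma)p(\gamma)\,d\gamma$; and for $f\in\mathcal S(G)$, $\int_G (Nf)\,p\,dg=0$. c) $(T_t)_{t\ge0}$ extends as a Markovian semi-group of contractions on $L^q(G,p\,d\gamma)$, $1\le q\le\infty$, strongly continuous if $q\ne\infty$. d) If $f\in L^q(p\,d\gamma)$, $1\le q<\infty$, then $\left\| T_t(f)-\int_G fp\,dg\right\|_{L^q(p\,d\gamma)}\to0$ as $t\to\infty$. e) If $G$ is not abelian, $(T_t)_{t>0}$ is not self-adjoint on $L^2(G,p\,d\gamma)$. Formally $\nabla^*\nabla$ is the real part of $N$: for $f,h\in\mathcal S(G)$, $$\langle Nf,h\rangle_{L^2(p)}=\langle(\nabla^*\nabla+iC)f,h\rangle_{L^2(p)},$$ where $C$ is a first order differential operator, non zero when $G$ is not abelian, satisfying $\langle Cf,h\rangle_{L^2(p)}=\langle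 f,Ch\rangle_{L^2(p)}$ for $f,h\in\mathcal S(G)$. In particular, for $f\in\mathcal S(G)$, $$\Re\int_G (Nf)\,\overline f\,p\,d\gamma=\int_G|\nabla f|^2p\,d\gamma=\int_G(\nabla^*\nabla f)\,\overline f\,p\,d\gamma .$$ If moreover $f$ is real valued, the integral $\int_G (Nf)\overline f\,p\,d\gamma$ is real.
   Context: $G$ is a stratified (simply connected nilpotent) Lie group with Lie algebra $\mathcal G=V_1\oplus\dots\oplus V_k$, $[V_j,V_h]\subset V_{j+h}$ (with $V_m=0$ for $m>k$), $[V_1,V_h]=V_{h+1}$ for $1\le h<k$; $dg$ is the (biinvariant) Haar measure and $\mathcal S(G)$ the Schwartz space. Dilations: $\delta_t(Z_1+\dots+Z_k)=tZ_1+t^2Z_2+\dots+t^kZ_k$ for $Z_j\in V_j$, $t\ge0$, $\delta_t(\exp Z)=\exp\delta_t(Z)$ on $G$, and $\delta_t(f)=f\circ\delta_t$ for functions. $A$ is the generator of the group $(\delta_{e^s})_{s\in\mathbb R}$, i.e. $A(f)=\frac{d}{dt}|_{t=1}f\circ\delta_t$. Elements $Z\in\mathcal G$ are identified with left invariant vector fields, $(Zf)(g)=\frac{d}{dt}|_{t=0}f(g\exp tZ)$. $(X_i)_{1\le i\le n}$ is a linear basis of $V_1$, $L=-\sum_{i=1}^nX_i^2$ and $\nabla=(X_1,\dots,X_n)$. The semi-group $e^{-\frac t2L}$ is given by convolution, $e^{-\frac t2L}f(\gamma)=\int_G f(\gamma g^{-1})p_t(g)\,dg$, where $p_t>0$ is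 a Schwartz function with $\int_G p_t\,dg=1$, $p_t(g)=p_t(g^{-1})$, and $p=p_1$. $L^q(p\,d\gamma)$ is the complex $L^q$ space, $\langle f,h\rangle_{L^2(p)}=\int_G f\overline h\,p\,d\gamma$. $\nabla^*\nabla=\sum_{i=1}^nX_i^*X_i$, where $X_i^*$ is the formal adjoint of $X_i$ in $L^2(p\,d\gamma)$; on $\mathcal S(G)$, $\nabla^*\nabla=L-\sum_{i=1}^n\frac{X_ip}{p}X_i$. Markovian means positivity preserving with $T_t(1)=1$. *)

(* Defs.v *)
From HB Require Import structures.
From mathcomp Require Import all_boot all_order all_algebra.
From mathcomp Require Import complex.
From mathcomp Require Import all_classical all_reals all_analysis.

Set Implicit Arguments.
Unset Strict Implicit.
Unset Printing Implicit Defensive.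

Import Order.TTheory GRing.Theory Num.Theory.
Import numFieldNormedType.Exports.

Local Open Scope classical_set_scope.
Local Open Scope ring_scope.

Section calculus.
Context {R : realType}.

Fixpoint Ck {V W : normedModType R} (m : nat) (f : V -> W) : Prop :=
  if m is m'.+1 then
    [/\ continuous f,
        forall v x, derivable f x v &
        forall v, Ck m' (fun x => derive f x v)]
  else continuous f.

Definition smooth {V W : normedModType R} (f : V -> W) := forall m, Ck m f.

Definition iterD {V : normedModType R} (vs : seq V) (f : V -> R) : V -> R :=
  foldr (fun v g x => derive g x v) f vs.

Definition schwartz {V : normedModType R} (f : V -> R) : Prop :=
  smooth f /\
  forall (vs : seq V) (m : nat),
    exists M : R, forall x, `|x| ^+ m * `|iterD vs f x| <= M.

Definition re_part {V : Type} (f : V -> R[i]) : V -> R := fun x => complex.Re (f x).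
Definition im_part {V : Type} (f : V -> R[i]) : V -> R := fun x => complex.Im (f x).

(* The complex-linear extension of a real operator. *)
Definition cext {V : Type} (D : (V -> R) -> (V -> R)) (f : V -> R[i]) : V -> R[i] :=
  fun x => (D (re_part f) x +i* D (im_part f) x)%C.

Definition csmooth {V : normedModType R} (f : V -> R[i]) : Prop :=
  smooth (re_part f) /\ smooth (im_part f).

Definition cschwartz {V : normedModType R} (f : V -> R[i]) : Prop :=
  schwartz (re_part f) /\ schwartz (im_part f).

End calculus.

Section integration.
Context {disp : measure_display} {T : measurableType disp} {R : realType}.
Variable mu : {measure set T -> \bar R}.

Definition cint (f : T -> R[i]) : R[i] :=
  (Rintegral mu setT (re_part f) +i* Rintegral mu setT (im_part f))%C.

Definition cLnorm (q : \bar R) (f : T -> R[i]) : \bar R :=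
  Lnorm mu q (fun x => (Normc.normc (f x))%:E).

(* Elements of the complex L^q space are handled through representatives;
   equality in L^q is equality almost everywhere. *)
Definition inLq (q : \bar R) (f : T -> R[i]) : Prop :=
  [/\ measurable_fun setT (re_part f),
      measurable_fun setT (im_part f) &
      (cLnorm q f < +oo)%E].

End integration.

(* R^d with its Borel sigma-algebra. *)
Notation borelV R d := (g_sigma_algebraType (@open 'rV[R]_d)).

Section stratified.
Context {R : realType} {d : nat}.
Local Notation V := 'rV[R]_d.

(* (Z f)(g) = d/dt f (g exp(tZ)) at t = 0, where exp is the identity. *)
Definition lie_der (mul : V -> V -> V) (Z : V) (f : V -> R) : V -> R :=
  fun g => derive1 (fun t : R => f (mul g (t *: Z))) 0.

(* The subspace [U, W] spanned by all brackets, for a bilinear br. *)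
Definition bracketv (br : V -> V -> V) (U W : {vspace V}) : {vspace V} :=
  <<[seq br u w | u <- vbasis U, w <- vbasis W]>>%VS.

End stratified.

(* A stratified group in exponential coordinates. For a simply connected
   nilpotent Lie group, exp is a global diffeomorphism from the Lie algebra onto
   the group; the group is represented as its Lie algebra R^d, endowed with the
   smooth group law [gmul] for which exp becomes the identity, so that the
   one-parameter subgroups are the lines t |-> tZ ([gmul_exp]).
   [bracket_lie] says that [bracket] is the commutator of the left invariant
   vector fields of this group law. [layer j] is V_j for 1 <= j; [layer 0]
   plays no role. *)
Record stratifiedGroup (R : realType) (d : nat) := StratifiedGroup {
  step : nat;
  layer : nat -> {vspace 'rV[R]_d};
  bracket : 'rV[R]_d -> 'rV[R]_d -> 'rV[R]_d;
  gmul : 'rV[R]_d -> 'rV[R]_d -> 'rV[R]_d;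
  bracket_linl : forall a x y z,
    bracket (a *: x + y) z = a *: bracket x z + bracket y z;
  bracket_linr : forall a x y z,
    bracket z (a *: x + y) = a *: bracket z x + bracket z y;
  bracketxx : forall x, bracket x x = 0;
  bracket_jacobi : forall x y z,
    bracket x (bracket y z) + bracket y (bracket z x)
      + bracket z (bracket x y) = 0;
  step_gt0 : (0 < step)%N;
  layer_direct : directv (\sum_(j < step) layer j.+1)%VS;
  layer_full : (\sum_(j < step) layer j.+1)%VS = fullv;
  layer_out : forall m, (step < m)%N -> layer m = 0%VS;
  layer_bracket : forall j h, (0 < j)%N -> (0 < h)%N ->
    (bracketv bracket (layer j) (layer h) <= layer (j + h)%N)%VS;
  layer_generated : forall h, (0 < h < step)%N ->
    bracketv bracket (layer 1%N) (layer h) = layer h.+1;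
  gmulA : associative gmul;
  gmul0g : left_id 0 gmul;
  gmulg0 : right_id 0 gmul;
  gmul_smooth : smooth (fun xy : 'rV[R]_d * 'rV[R]_d => gmul xy.1 xy.2);
  gmul_exp : forall (Z : 'rV[R]_d) (s t : R),
    gmul (s *: Z) (t *: Z) = (s + t) *: Z;
  bracket_lie : forall (Y Z : 'rV[R]_d) (f : 'rV[R]_d -> R), smooth f ->
    forall g, lie_der gmul Y (lie_der gmul Z f) g
              - lie_der gmul Z (lie_der gmul Y f) g
            = lie_der gmul (bracket Y Z) f g
}.

Section operators.
Context {R : realType} {d : nat}.
Variable G : stratifiedGroup R d.
Local Notation V := 'rV[R]_d.
Implicit Types (f : V -> R[i]) (x g : V).

(* (exp Z)^-1 = exp (- Z). *)
Definition ginv g : V := - g.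

Definition abelian_group : Prop := forall x y, gmul G x y = gmul G y x.

Definition dil (t : R) x : V :=
  \sum_(j < step G)
    t ^+ j.+1 *: sumv_pi (\sum_(i < step G) layer G i.+1)%VS j x.

Definition dilA : (V -> R[i]) -> V -> R[i] :=
  cext (fun (h : V -> R) x => derive1 (fun t : R => h (dil t x)) 1).

Definition vfield (Z : V) : (V -> R[i]) -> V -> R[i] := cext (lie_der (gmul G) Z).

Definition subLaplacian n (X : n.-tuple V) f : V -> R[i] :=
  fun x => - \sum_(i < n) vfield (tnth X i) (vfield (tnth X i) f) x.

Definition opN n (X : n.-tuple V) f : V -> R[i] :=
  fun x => subLaplacian X f x + dilA f x.

Variable mu : {measure set (borelV R d) -> \bar R}.

Definition haar_measure : Prop :=
  [/\ forall g (A : set (borelV R d)), measurable A ->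
        mu ((fun x => gmul G g x) @^-1` A) = mu A,
      forall g (A : set (borelV R d)), measurable A ->
        mu ((fun x => gmul G x g) @^-1` A) = mu A,
      forall K : set V, compact K -> (mu K < +oo)%E &
      mu setT <> 0%E].

Variable p : R -> V -> R.

(* e^{- (s/2) L}: convolution with p_s, the identity for s = 0. *)
Definition heat (s : R) f : V -> R[i] := fun x =>
  if s == 0 then f x
  else cint mu (fun g => f (gmul G x (ginv g)) * ((p s g)%:C)%C).

(* p_t is the convolution kernel of e^{- (t/2) L}: the operators [heat t] form
   a semigroup whose generator in L^2(G, dg) extends - L/2 on S(G).
   Since S(G) is dense and invariant, this determines the semigroup. *)
Definition heat_kernel n (X : n.-tuple V) : Prop :=
  [/\ forall t : R, 0 < t ->
        [/\ schwartz (p t), forall g, 0 < p t g,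
            (\int[mu]_g (p t g)%:E = 1)%E &
            forall g, p t (ginv g) = p t g],
      forall (s t : R) f, 0 < s -> 0 < t -> cschwartz f ->
        heat (s + t) f = heat s (heat t f) &
      forall f, cschwartz f ->
        cLnorm mu 2%:E (fun x : borelV R d =>
          ((t^-1)%:C)%C * (heat t f x - f x) + 2^-1 * subLaplacian X f x)
        @[t --> 0^'+] --> 0%E].

Definition pint f : R[i] := cint mu (fun g => f g * ((p 1 g)%:C)%C).

Definition pdot f h : R[i] := pint (fun x => f x * (conjc (h x))).

Definition opT (t : R) f : V -> R[i] := fun x =>
  pint (fun g =>
    f (gmul G (dil (expR (- t)) x) (dil (Num.sqrt (1 - expR (- 2 * t))) g))).

(* The formal adjoint of Z in L^2(p dg), by integration by parts. *)
Definition vfield_adj (Z : V) f : V -> R[i] := fun x =>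
  - vfield Z f x - ((lie_der (gmul G) Z (p 1) x / p 1 x)%:C)%C * f x.

Definition nablastar_nabla n (X : n.-tuple V) f : V -> R[i] := fun x =>
  \sum_(i < n) vfield_adj (tnth X i) (vfield (tnth X i) f) x.

Definition grad_norm2 n (X : n.-tuple V) f : V -> R := fun x =>
  \sum_(i < n) Normc.normc (vfield (tnth X i) f x) ^+ 2.

End operators.

(* C acts on S(G) as a first order differential operator with smooth complex
   coefficients (a zero order term is allowed). *)
Definition first_order_diffop {R : realType} {d : nat}
    (C : ('rV[R]_d -> R[i]) -> ('rV[R]_d -> R[i])) : Prop :=
  exists (c0 : 'rV[R]_d -> R[i]) (c : 'I_d -> 'rV[R]_d -> R[i]),
    [/\ csmooth c0, forall j, csmooth (c j) &
        forall f : 'rV[R]_d -> R[i], cschwartz f -> forall x,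
          C f x = c0 x * f x
            + \sum_(j < d) c j x * cext (fun h y => derive h y (delta_mx 0 j)) f x].

(* S extends T, given on S(G), as a Markovian semigroup of contractions of
   L^q(nu). S acts on representatives; compatibility with equality almost
   everywhere follows from linearity and contractivity. *)
Definition markov_contraction_extension {R : realType} {d : nat}
    (nu : {measure set (borelV R d) -> \bar R}) (q : \bar R)
    (T S : R -> ('rV[R]_d -> R[i]) -> ('rV[R]_d -> R[i])) : Prop :=
  [/\ forall (t : R) (f : 'rV[R]_d -> R[i]), 0 <= t -> cschwartz f ->
        {ae nu, forall x, S t f x = T t f x},
      forall (t : R) (f : 'rV[R]_d -> R[i]), 0 <= t -> inLq nu q f ->
        inLq nu q (S t f) /\ (cLnorm nu q (S t f) <= cLnorm nu q f)%E,
      forall (t : R) (a : R[i]) (f h : 'rV[R]_d -> R[i]), 0 <= t -> inLq nu q f -> inLq nu q h ->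
        {ae nu, forall x, S t (fun y => a * f y + h y) x = a * S t f x + S t h x},
      (forall f : 'rV[R]_d -> R[i], inLq nu q f -> {ae nu, forall x, S 0 f x = f x}) /\
      (forall (s t : R) (f : 'rV[R]_d -> R[i]), 0 <= s -> 0 <= t -> inLq nu q f ->
        {ae nu, forall x, S (s + t) f x = S s (S t f) x}) &
      (forall t : R, 0 <= t -> {ae nu, forall x, S t (fun=> 1) x = 1}) /\
      (forall (t : R) (f : 'rV[R]_d -> R[i]), 0 <= t -> inLq nu q f -> {ae nu, forall x, 0 <= f x} ->
        {ae nu, forall x, 0 <= S t f x})].

Definition strongly_continuous {R : realType} {d : nat}
    (nu : {measure set (borelV R d) -> \bar R}) (q : \bar R)
    (S : R -> ('rV[R]_d -> R[i]) -> ('rV[R]_d -> R[i])) : Prop :=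
  forall (f : 'rV[R]_d -> R[i]) (t0 : R), inLq nu q f -> 0 <= t0 ->
    cLnorm nu q (fun x : borelV R d => S t f x - S t0 f x)
      @[t --> within [set t | 0 <= t] (nbhs t0)] --> 0%E.

(* Main.v *)
Require Import Defs.
From HB Require Import structures.
From mathcomp Require Import all_boot all_order all_algebra.
From mathcomp Require Import complex.
From mathcomp Require Import all_classical all_reals all_analysis.
From mathcomp Require Import measurable_realfun ess_sup_inf ring lra.
Set Implicit Arguments.
Unset Strict Implicit.
Unset Printing Implicit Defensive.
Import Order.TTheory GRing.Theory Num.Theory.
Import numFieldNormedType.Exports.
Local Open Scope classical_set_scope.
Local Open Scope ring_scope.

(** Everything is read off from the law nu = p dg. In exponential coordinates
    the group law is determined by the bracket through the Maurer-Cartan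
    equation, so the dilations are automorphisms of G and the coefficients of
    left invariant fields are polynomially bounded; hence S(G) is stable under
    the vector fields, the dilations and the convolutions with p_t. The
    L^2 generator condition on the heat kernel upgrades to a uniform Taylor
    estimate for e^{-tL/2} on S(G), which forces uniqueness of the semigroup
    and therefore the scaling law: if g has law p_s then dil_c g has law
    p_{c^2 s}. Consequently dil_a g dil_b g', with g and g' independent of law
    nu, has the law of dil_{sqrt(a^2+b^2)} g, and this single identity yields
    the semigroup law of T_t, the invariance of nu and (by Jensen) contractivity
    on every L^q(nu). Strong continuity and ergodicity follow by density of
    bounded continuous functions, since dil_{e^-t} x dil_{sqrt(1-e^-2t)} g
    depends continuously on t and tends to g. For the last part, N splits as
    the symmetric operator nabla^* nabla plus a real first order derivation D;
    invariance of nu gives int (D u) p = 0, and applied to products u v this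
    says that D is antisymmetric in L^2(p). If D vanished, the dilation field
    would be horizontal everywhere, which fails on V_m for m >= 2. *)

(** Neither the Baker-Campbell-Hausdorff formula nor polynomiality of the group law is among the
    hypotheses; soft arguments replace both. A linear map respecting the bracket carries the
    Maurer-Cartan form to itself because both sides solve the same linear equation along rays, and
    nilpotency turns uniqueness for that equation into an induction over the layers. Growth of the
    law then comes from homogeneity: a smooth function that scales under dilations is controlled by
    its values on a compact ball. The modulus of a dilation comes from uniqueness of the Haar
    measure, without a Jacobian. The heat kernel is constrained only by a semigroup law and an L^2
    limit at time 0; the missing uniformity is bought by waiting a time s0 > 0, since p_tau <= sup
    p_s0 for tau >= s0. The quotients X_i p / p have no a priori growth bound, so identities in
    L^2(p) are proved for functions whose product with p is Schwartz. Self-adjointness of all T_t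
    would make N, hence D, symmetric; being antisymmetric too, D would vanish. *)

Local Notation iterD := Defs.iterD.

(** * Calculus on row vectors *)

Section line_derivative.
Context {R : realType}.

Lemma is_derive_line (V W : normedModType R) (f : V -> W) (x v : V) (t : R) :
  derivable f (x + t *: v) v ->
  is_derive t 1 (fun s : R => f (x + s *: v)) ('D_v f (x + t *: v)).
Proof.
have E : (fun h : R => h^-1 *: (((fun s : R => f (x + s *: v)) \o shift t) (h *: 1)
    - f (x + t *: v))) = (fun h => h^-1 *: ((f \o shift (x + t *: v)) (h *: v)
    - f (x + t *: v))).
  apply/funext => h /=; rewrite [h%:A]mulr1 scalerDl.
  by rewrite addrCA.
by move=> df; apply: DeriveDef; rewrite /derivable /derive E.
Qed.

Lemma MVT_line (V : normedModType R) (f : V -> R) (x v : V) :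
  (forall y, derivable f y v) ->
  exists2 t, 0 <= t <= 1 & f (x + v) - f x = 'D_v f (x + t *: v).
Proof.
move=> df.
have D (t : R) : is_derive t 1 (fun s : R => f (x + s *: v)) ('D_v f (x + t *: v)).
  exact: is_derive_line.
have [|c c01] := @MVT_segment R (fun s : R => f (x + s *: v))
  (fun t => 'D_v f (x + t *: v)) 0 1 ler01 (fun c _ => D c).
  apply: continuous_subspaceT => t.
  apply: differentiable_continuous; apply/derivable1_diffP.
  by have [] := D t.
by rewrite subr0 mulr1 scale1r scale0r addr0 => ->; exists c.
Qed.

(** Homogeneity in the direction holds for bare directional derivatives, by rescaling the increment;
    additivity in the direction needs the continuity exploited in [C1_differentiable]. *)
Lemma derive_scale_dir (V : normedModType R) (f : V -> R) (x v : V) (a : R) :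
  derivable f x v -> is_derive x (a *: v) f (a * 'D_v f x).
Proof.
have [->|a0] := eqVneq a 0; first by rewrite scale0r mul0r => _; exact: is_derive0.
move=> df.
suff : (fun h : R => h^-1 *: ((f \o shift x) (h *: (a *: v)) - f x)) @ 0^' --> a * 'D_v f x.
  by move=> H; apply: DeriveDef; [apply/cvg_ex; eexists; exact: H | exact/cvg_lim].
have := df; rewrite /derivable => /cvg_ex[l lP].
have -> : 'D_v f x = l by exact/cvg_lim.
have E : (fun h : R => h^-1 *: ((f \o shift x) (h *: (a *: v)) - f x)) =
   (fun h : R => a * ((h * a)^-1 *: ((f \o shift x) ((h * a) *: v) - f x))).
  apply/funext => h; rewrite scalerA /=.
  rewrite -[_ *: _]/(_ * _) -[X in _ = a * X]/(_ * _) invfM mulrA.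
  by rewrite [h^-1 * a^-1]mulrC mulrA divff ?mul1r.
rewrite E; apply: cvgM; first exact: cvg_cst.
have := @cvg_comp _ _ _ (fun h : R => h * a) _ _ _ _ _ lP; apply.
move=> A [e /= e0 Ae]; exists (e / `|a|); first by rewrite /= divr_gt0 ?normr_gt0.
move=> h /=; rewrite sub0r normrN => hl h0; apply: Ae => /=.
  by rewrite sub0r normrN normrM -ltr_pdivlMr ?normr_gt0.
by rewrite mulf_neq0.
Qed.

End line_derivative.

Lemma continuous_sumr {R : realType} (T : topologicalType) I (r : seq I) (F : I -> T -> R) :
  (forall i, continuous (F i)) -> continuous (fun x => \sum_(i <- r) F i x).
Proof.
move=> cF; elim: r => [|i r IH].
  rewrite (_ : (fun _ => _) = fun=> 0); first exact: cst_continuous.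
  by apply/funext => x; rewrite big_nil.
rewrite (_ : (fun _ => _) = fun x => F i x + \sum_(i <- r) F i x).
  by move=> x; apply: cvgD; [exact: cF|exact: IH].
by apply/funext => x; rewrite big_cons.
Qed.

Lemma continuous_coordM {R : realType} n (j : 'I_n) (c : R) :
  continuous (fun h : 'rV[R]_n => h 0 j * c).
Proof.
have cc : continuous (fun h : 'rV[R]_n => h 0 j) := @coord_continuous _ _ _ 0 j.
move=> y; apply: (@cvgM _ _ (nbhs y) _ (fun h : 'rV[R]_n => h 0 j) (fun=> c)); first exact: cc.
exact: cvg_cst.
Qed.

Lemma is_diff_bound {R : realType} (V W : normedModType R) (f : V -> W)
    (L : {linear V -> W}) x : continuous L ->
  (forall e, 0 < e -> \forall h \near 0, `|f (x + h) - f x - L h| <= e * `|h|) ->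
  differentiable f x /\ 'd f x = L :> (V -> W).
Proof.
move=> cL H.
have eqo : f \o shift x = cst (f x) + L +o_ 0 id.
  apply/eqaddoP => _/posnumP[e]; have := H e%:num [gt0 of e%:num].
  apply: filterS => h; rewrite /= !fctE /= [h + x]addrC opprD addrA.
  exact.
have dL : 'd f x = L :> (V -> W) by exact: diff_unique.
by split => //; apply/diff_locallyP; rewrite dL.
Qed.

Lemma continuous_family {R : realType} (V : normedModType R) (I : finType)
    (g : I -> V -> R) x e : (forall i, continuous (g i)) -> 0 < e ->
  exists2 d, 0 < d & forall y, `|y - x| < d -> forall i, `|g i y - g i x| <= e.
Proof.
move=> cg e0.
have : \forall y \near x, forall i, `|g i y - g i x| <= e.
  apply: filter_forall => i; have /cvgrPdist_le/(_ _ e0) := cg i x.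
  by apply: filterS => y; rewrite distrC.
move=> /nbhs_ballP[d /= d0 dP]; exists d => // y yd i.
by apply: dP; rewrite -ball_normE /= distrC.
Qed.

Lemma near0_norm {R : realType} (V : normedModType R) (P : V -> Prop) (d : R) : 0 < d ->
  (forall h, `|h| < d -> P h) -> \forall h \near 0, P h.
Proof.
move=> d0 H; near=> h; apply: H; near: h; exact: nbhs0_lt.
Unshelve. all: by end_near. Qed.

Section frechet.
Context {R : realType} {n : nat}.
Local Notation V := 'rV[R]_n.
Implicit Types (f : V -> R) (x v h : V).

Definition coordv (j : 'I_n) : V := delta_mx 0 j.

Lemma row_norm_coord h j : `|h 0 j| <= `|h|.
Proof.
rewrite [leRHS]/Num.Def.normr/= mx_normrE.
exact: (le_bigmax _ (fun ij : 'I_1 * 'I_n => `|h ij.1 ij.2|) (0, j)).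
Qed.

Lemma row_norm_le h (c : R) : 0 <= c -> (forall j, `|h 0 j| <= c) -> `|h| <= c.
Proof.
move=> c0 hc; rewrite [leLHS]/Num.Def.normr/= mx_normrE.
by apply: bigmax_le => // -[i j] _ /=; rewrite (ord1 i).
Qed.

Let trunc (k : nat) h : V := \row_j (if (j < k)%N then h 0 j else 0).

(** The increment telescopes along the path from x to x + h that moves one coordinate at a time,
    with the mean value theorem on each edge. For the sup norm this path stays within distance |h|
    of x, so a bound on that ball suffices. *)
Lemma C1_increment f x h (c : 'I_n -> R) (e : R) :
  (forall y v, derivable f y v) ->
  (forall j y, `|y| <= `|h| -> `|'D_(coordv j) f (x + y) - c j| <= e) ->
  `|f (x + h) - f x - \sum_j h 0 j * c j| <= n%:R * e * `|h|.
Proof.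
move=> df De.
have tr0 : trunc 0 h = 0 by apply/rowP => j; rewrite !mxE.
have trn : trunc n h = h by apply/rowP => j; rewrite !mxE ltn_ord.
have -> : f (x + h) - f x = \sum_(j < n) (f (x + trunc j.+1 h) - f (x + trunc j h)).
  rewrite -(big_mkord xpredT (fun j => f (x + trunc j.+1 h) - f (x + trunc j h))).
  by rewrite telescope_sumr // trn tr0 addr0.
rewrite -sumrB.
apply: (le_trans (ler_norm_sum _ _ _)).
have -> : n%:R * e * `|h| = \sum_(j < n) (e * `|h|).
  by rewrite sumr_const card_ord -mulrA mulr_natl.
apply: ler_sum => j _.
have trS : trunc j.+1 h = trunc j h + h 0 j *: coordv j.
  apply/rowP => k; rewrite !mxE eqxx /= ltnS leq_eqVlt.
  have [->|kj] := eqVneq k j; first by rewrite eqxx ltnn /= mulr1 add0r.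
  have -> : (k == j :> nat) = false by apply/negbTE.
  by rewrite /= mulr0 addr0.
have [t /andP[t0 t1] E] := @MVT_line _ _ f (x + trunc j h) (h 0 j *: coordv j) (fun y => df y _).
rewrite trS addrA E.
have -> : 'D_(h 0 j *: coordv j) f (x + trunc j h + t *: (h 0 j *: coordv j)) =
  h 0 j * 'D_(coordv j) f (x + (trunc j h + t *: (h 0 j *: coordv j))).
  by rewrite addrA; apply: derive_val; apply: derive_scale_dir.
rewrite -mulrBr normrM mulrC; apply: ler_pM => //; last exact: row_norm_coord.
apply: De; apply: row_norm_le => // k; rewrite !mxE eqxx /=.
have [->|kj] := eqVneq k j; last first.
  rewrite !mulr0 addr0; case: ifP => _; rewrite ?normr0 //; exact: row_norm_coord.
rewrite ltnn mulr1 add0r normrM ger0_norm //.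
apply: le_trans (row_norm_coord h j); exact: ler_piMl.
Qed.

(** [Ck] speaks of directional derivatives only; this passage to the Fréchet differential is what
    gives the chain rule on row vectors. *)
Lemma C1_differentiable f x :
  (forall y v, derivable f y v) ->
  (forall v, continuous ('D_v f)) ->
  differentiable f x /\ forall h, 'd f x h = \sum_j h 0 j * 'D_(coordv j) f x.
Proof.
move=> df cf.
pose c : 'cV[R]_n := \col_j 'D_(coordv j) f x.
pose dfl h : R := (h *m c) 0 0.
have lin : linear dfl.
  by move=> a u v; rewrite /dfl mulmxDl -scalemxAl !mxE.
pose L : {linear V -> R} := HB.pack dfl (GRing.isLinear.Build _ _ _ _ dfl lin).
have LE h : L h = \sum_j h 0 j * 'D_(coordv j) f x.
  by rewrite /= /dfl mxE; apply: eq_bigr => j _; rewrite !mxE.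
have cL : continuous L.
  rewrite (_ : (L : V -> R) = fun h => \sum_j h 0 j * 'D_(coordv j) f x).
    by apply: continuous_sumr => j; exact: continuous_coordM.
  exact/funext.
have [e e0|dfx dL] := @is_diff_bound _ _ _ f L x cL; last first.
  by split => // h; rewrite dL LE.
(* Dividing by n + 1 rather than n covers dimension 0, and n e' <= e is all that is used. *)
pose e' := e / n.+1%:R.
have e'0 : 0 < e' by rewrite divr_gt0.
have [d d0 dP] := @continuous_family _ _ _ (fun j => 'D_(coordv j) f) x e' (fun j => cf _) e'0.
apply: (near0_norm d0) => h hd.
have := @C1_increment f x h (fun j => 'D_(coordv j) f x) e' df.
rewrite -LE /= => /(_ _)/le_trans; apply.
  by move=> j y yh; apply: dP; rewrite addrC addKr; exact: le_lt_trans yh hd.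
rewrite ler_wpM2r // /e' mulrCA; apply: ler_piMr; first exact: ltW.
rewrite ler_pdivrMr // mul1r ler_nat.
exact: leqnSn.
Qed.

End frechet.

Section smooth.
Context {R : realType}.
Implicit Types V W : normedModType R.

Lemma smooth_continuous V W (f : V -> W) : smooth f -> continuous f.
Proof. by move=> /(_ 0%N). Qed.

Lemma smooth_derivable V W (f : V -> W) x v : smooth f -> derivable f x v.
Proof. by move=> /(_ 1%N)[]. Qed.

Lemma smooth_D V W (f : V -> W) v : smooth f -> smooth ('D_v f).
Proof. by move=> sf m; have [_ _] := sf m.+1; exact. Qed.

(** A coinduction principle: a class of continuous, derivable functions stable under directional
    derivatives is made of smooth functions. *)
Lemma smooth_coind V W (P : (V -> W) -> Prop) :
  (forall f, P f -> [/\ continuous f, forall v x, derivable f x v &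
    forall v, P ('D_v f)]) ->
  forall f, P f -> smooth f.
Proof.
move=> HP f Pf m; elim: m f Pf => [f /HP[]//|m IH f /HP[cf df Df]].
by split => // v; exact: IH.
Qed.

Lemma smooth_iterD V (f : V -> R) vs : smooth f -> smooth (iterD vs f).
Proof. by elim: vs f => // v vs IH f sf /=; apply: smooth_D; exact: IH. Qed.

Lemma iterD_rcons V (f : V -> R) vs v : iterD (rcons vs v) f = iterD vs ('D_v f).
Proof. by rewrite /iterD foldr_rcons. Qed.

Lemma iterD_class V (P : (V -> R) -> Prop) f vs :
  (forall g, P g -> forall v, P ('D_v g)) -> P f -> P (iterD vs f).
Proof. by move=> HP Pf; elim: vs => //= v vs IH; exact: HP. Qed.

Lemma Ck_le V W (f : V -> W) m : Ck m.+1 f -> Ck m f.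
Proof.
elim: m f => [|m IH] f /= [cf df Df] //.
by split => // v; exact/IH/Df.
Qed.

(** Stated between arbitrary normed spaces, because the smoothness of the group law is given on the
    product V x V whereas the calculus here is developed on row vectors. *)
Lemma smooth_linear_comp (U V W : normedModType R) (L : {linear U -> V}) (f : V -> W) :
  continuous L -> smooth f ->
  smooth (f \o L) /\ forall x v, is_derive x v (f \o L) ('D_(L v) f (L x)).
Proof.
move=> cL sf.
have E (g : V -> W) x v : (fun h : R => h^-1 *: (((g \o L) \o shift x) (h *: v) - (g \o L) x))
    = (fun h => h^-1 *: ((g \o shift (L x)) (h *: L v) - g (L x))).
  by apply/funext => h; congr (_ *: (g _ - _)); exact: linearP.
have D (g : V -> W) x v : smooth g -> is_derive x v (g \o L) ('D_(L v) g (L x)).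
  move=> sg; have := @smooth_derivable _ _ g (L x) (L v) sg.
  by move=> dg; apply: DeriveDef; rewrite /derivable /derive E.
split => [|x v]; last exact: D.
apply: (smooth_coind (P := fun h => exists2 g, smooth g & h = g \o L)); last by exists f.
move=> _ [g sg ->]; split.
- by move=> x; apply: continuous_comp; [exact: cL|exact: smooth_continuous].
- by move=> v x; have [] := D g x v sg.
- move=> v; exists ('D_(L v) g); first exact: smooth_D.
  by apply/funext => x; have [_ ->] := D g x v sg.
Qed.

Lemma smooth_cst V W (c : W) : smooth (fun _ : V => c).
Proof.
apply: (smooth_coind (P := fun h => exists c, h = fun=> c)); last by exists c.
move=> _ [a ->]; split.
- exact: cst_continuous.
- by move=> v x; exact: derivable_cst.
- by move=> v; exists 0; apply/funext => x; exact: derive_cst.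
Qed.

Lemma CkD V (f g : V -> R) m : Ck m f -> Ck m g -> Ck m (fun x => f x + g x).
Proof.
elim: m f g => [|m IH] f g /=; first by move=> cf cg x; apply: cvgD; [exact: cf|exact: cg].
move=> [cf df Df] [cg dg Dg]; split.
- by move=> x; apply: cvgD; [exact: cf|exact: cg].
- by move=> v x; exact: derivableD.
- move=> v; rewrite [X in Ck _ X](_ : _ = fun x => 'D_v f x + 'D_v g x); first exact: IH.
  by apply/funext => x; apply: deriveD.
Qed.

Lemma CkM V (f g : V -> R) m : Ck m f -> Ck m g -> Ck m (fun x => f x * g x).
Proof.
elim: m f g => [|m IH] f g; first by move=> cf cg x; apply: cvgM; [exact: cf|exact: cg].
move=> Cf Cg; have := Ck_le Cf; have := Ck_le Cg; move: Cf Cg => [cf df Df] [cg dg Dg] cg' cf'.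
split.
- by move=> x; apply: cvgM; [exact: cf|exact: cg].
- by move=> v x; exact: derivableM.
- move=> v; have {}Df : Ck m ('D_v f) := Df v; have {}Dg : Ck m ('D_v g) := Dg v.
  have : Ck m (fun x => f x * 'D_v g x + g x * 'D_v f x) by apply: CkD; apply: IH.
  by congr (Ck m _); apply/funext => x; apply/esym; apply: deriveM.
Qed.

Lemma smoothD V (f g : V -> R) : smooth f -> smooth g -> smooth (fun x => f x + g x).
Proof. by move=> sf sg m; apply: CkD. Qed.

Lemma smoothM V (f g : V -> R) : smooth f -> smooth g -> smooth (fun x => f x * g x).
Proof. by move=> sf sg m; apply: CkM. Qed.

Lemma smoothZ V (f : V -> R) c : smooth f -> smooth (fun x => c * f x).
Proof. by move=> sf; apply: smoothM => //; exact: smooth_cst. Qed.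

Lemma smoothN V (f : V -> R) : smooth f -> smooth (fun x => - f x).
Proof.
move=> sf; rewrite (_ : (fun _ => _) = fun x => -1 * f x); first exact: smoothZ.
by apply/funext => x; rewrite mulN1r.
Qed.

Lemma smooth_sum V I (r : seq I) (f : I -> V -> R) :
  (forall i, smooth (f i)) -> smooth (fun x => \sum_(i <- r) f i x).
Proof.
move=> sf; elim: r => [|i r IH].
  rewrite (_ : (fun _ => _) = fun=> 0); first exact: smooth_cst.
  by apply/funext => x; rewrite big_nil.
rewrite (_ : (fun _ => _) = fun x => f i x + \sum_(i <- r) f i x); first exact: smoothD.
by apply/funext => x; rewrite big_cons.
Qed.

Lemma smooth_inv V (f : V -> R) :
  smooth f -> (forall x, f x != 0) -> smooth (fun x => (f x)^-1).
Proof.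
move=> sf f0 m; elim: m => [|m IH] /=.
  by move=> x; apply: cvgV => //; exact: (smooth_continuous sf).
have df v x : derivable f x v by exact: smooth_derivable.
split.
- by move=> x; apply: cvgV => //; exact: (smooth_continuous sf).
- by move=> v x; exact: derivableV.
- move=> v; have : Ck m (fun x => - ('D_v f x) * ((f x)^-1 * (f x)^-1)).
    by apply: CkM; [exact: (smoothN (smooth_D _ sf))|apply: CkM].
  congr (Ck m _); apply/funext => x; have := @deriveV _ _ f x v (f0 x) (df v x).
  rewrite [X in X = _ -> _](_ : _ = derive (fun x0 => (f x0)^-1) x v) // => ->.
  by rewrite -[RHS]/(_ * _) expr2 invfM; ring.
Qed.

Lemma iterD_cst V (c : R) (vs : seq V) :
  iterD vs (fun=> c) = fun=> (if vs is [::] then c else 0).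
Proof.
elim: vs => //= v vs ->; apply/funext => x; exact: derive_cst.
Qed.

Lemma deriveD_smooth V (f g : V -> R) v : smooth f -> smooth g ->
  'D_v (fun x => f x + g x) = fun x => 'D_v f x + 'D_v g x.
Proof. by move=> sf sg; apply/funext => x; apply: deriveD; exact: smooth_derivable. Qed.

Lemma deriveM_smooth V (f g : V -> R) v : smooth f -> smooth g ->
  'D_v (fun x => f x * g x) = fun x => f x * 'D_v g x + g x * 'D_v f x.
Proof. by move=> sf sg; apply/funext => x; apply: deriveM; exact: smooth_derivable. Qed.

Lemma derive_sum_smooth V I (r : seq I) (f : I -> V -> R) v :
  (forall i, smooth (f i)) ->
  'D_v (fun x => \sum_(i <- r) f i x) = fun x => \sum_(i <- r) 'D_v (f i) x.
Proof.
move=> sf; elim: r => [|i r IH].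
  rewrite (_ : (fun _ : V => \sum_(i <- [::]) _) = fun=> 0); last by apply/funext => x; rewrite big_nil.
  by apply/funext => x; rewrite big_nil; exact: derive_cst.
rewrite (_ : (fun _ : V => \sum_(i <- _ :: _) _) = fun x => f i x + \sum_(j <- r) f j x); last first.
  by apply/funext => x; rewrite big_cons.
rewrite deriveD_smooth //; last exact: smooth_sum.
by apply/funext => x; rewrite big_cons -(congr1 (fun g => g x) IH).
Qed.

Lemma iterD_add V (f g : V -> R) vs : smooth f -> smooth g ->
  iterD vs (fun x => f x + g x) = fun x => iterD vs f x + iterD vs g x.
Proof.
by move=> sf sg; elim: vs => //= v vs ->; rewrite deriveD_smooth //; exact: smooth_iterD.
Qed.

Lemma iterD_sum V I (r : seq I) (f : I -> V -> R) vs :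
  (forall i, smooth (f i)) ->
  iterD vs (fun x => \sum_(i <- r) f i x) = fun x => \sum_(i <- r) iterD vs (f i) x.
Proof.
move=> sf; elim: vs => //= v vs ->; rewrite derive_sum_smooth // => i.
exact: smooth_iterD.
Qed.

End smooth.

Section smooth_row.
Context {R : realType} {n : nat}.
Local Notation V := 'rV[R]_n.
Implicit Types (f : V -> R) (x v h : V).

Lemma smooth_differentiable f x : smooth f -> differentiable f x.
Proof.
move=> sf; have [] // := @C1_differentiable _ _ f x.
- by move=> *; exact: smooth_derivable.
- by move=> v; apply/smooth_continuous/smooth_D.
Qed.

Lemma smooth_deriveE f x v : smooth f ->
  'D_v f x = \sum_j v 0 j * 'D_(coordv j) f x.
Proof.
move=> sf; have [|v'|df dE] := @C1_differentiable _ _ f x.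
- by move=> *; exact: smooth_derivable.
- by apply/smooth_continuous/smooth_D.
- by rewrite deriveE // dE.
Qed.

Lemma smooth_coord (j : 'I_n) : smooth (fun x : V => x 0 j).
Proof.
have D x v : is_derive x v (fun x : V => x 0 j) (v 0 j).
  apply: (@is_derive_eq _ _ _ _ _ _ _ _ (derivableP _)).
    exact/diff_derivable/differentiable_coord.
  apply: cvg_lim => //; apply: (@cvg_near_cst _ _ _ _ _ _) => //=.
  near=> h; rewrite !mxE addrK -[_ *: _]/(_ * _) mulrA mulVf ?mul1r //.
  by near: h; exact: nbhs_dnbhs_neq.
move=> [|m] /=; first exact: coord_continuous.
split; first exact: coord_continuous.
- by move=> v x; have [] := D x v.
- move=> v; rewrite (_ : (fun _ => _) = fun=> v 0 j); first exact: smooth_cst.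
  by apply/funext => x; have [_ ->] := D x v.
Unshelve. all: by end_near. Qed.

End smooth_row.

(** * Polynomial growth, rapid decay and the multipliers of the Schwartz space *)

Section growth.
Context {R : realType}.

Definition polybd {n} (f : 'rV[R]_n -> R) :=
  exists M k, forall x, `|f x| <= M * (1 + `|x|) ^+ k.

Definition rapid {n} (f : 'rV[R]_n -> R) :=
  forall m, exists M, forall x, (1 + `|x|) ^+ m * `|f x| <= M.

(** The slowly increasing smooth functions, which act on the Schwartz space by multiplication. *)
Definition moderate {n} (f : 'rV[R]_n -> R) :=
  smooth f /\ forall vs, polybd (iterD vs f).

Lemma norm1_ge1 (V : normedModType R) (x : V) : 1 <= 1 + `|x|.
Proof. by rewrite lerDl. Qed.

Lemma norm1X_ge1 (V : normedModType R) (x : V) k : 1 <= (1 + `|x|) ^+ k.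
Proof. exact/exprn_ege1/norm1_ge1. Qed.

Lemma norm1X_ge0 (V : normedModType R) (x : V) k : 0 <= (1 + `|x|) ^+ k.
Proof. by apply: exprn_ge0; rewrite addr_ge0. Qed.

Lemma norm1X_le (V : normedModType R) (x : V) k l :
  (k <= l)%N -> (1 + `|x|) ^+ k <= (1 + `|x|) ^+ l.
Proof. by move=> kl; apply: ler_weXn2l => //; exact: norm1_ge1. Qed.

Section n.
Variable n : nat.
Local Notation V := 'rV[R]_n.
Implicit Types f g : V -> R.

Lemma polybdP f : polybd f -> exists M k, 0 <= M /\ forall x, `|f x| <= M * (1 + `|x|) ^+ k.
Proof.
move=> [M [k fM]]; exists `|M|, k; split => // x; apply: le_trans (fM x) _.
by rewrite ler_wpM2r ?norm1X_ge0 // ler_norm.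
Qed.

Lemma polybdD f g : polybd f -> polybd g -> polybd (fun x => f x + g x).
Proof.
move=> /polybdP[M [k [M0 fM]]] /polybdP[N [l [N0 gN]]]; exists (M + N), (maxn k l) => x.
apply: le_trans (ler_normD _ _) _; rewrite mulrDl lerD //.
  by apply: le_trans (fM x) _; rewrite ler_wpM2l // norm1X_le // leq_maxl.
by apply: le_trans (gN x) _; rewrite ler_wpM2l // norm1X_le // leq_maxr.
Qed.

Lemma polybdM f g : polybd f -> polybd g -> polybd (fun x => f x * g x).
Proof.
move=> [M [k fM]] [N [l gN]]; exists (M * N), (k + l)%N => x.
by rewrite normrM exprD mulrACA ler_pM.
Qed.

Lemma polybd_cst c : polybd (fun _ : V => c).
Proof. by exists `|c|, 0%N => x; rewrite expr0 mulr1. Qed.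

Lemma rapidD f g : rapid f -> rapid g -> rapid (fun x => f x + g x).
Proof.
move=> rf rg m; have [M fM] := rf m; have [N gN] := rg m; exists (M + N) => x.
apply: le_trans (lerD (fM x) (gN x)); rewrite -mulrDr ler_wpM2l ?norm1X_ge0 //.
exact: ler_normD.
Qed.

Lemma rapid0 : rapid (fun _ : V => 0).
Proof. by move=> m; exists 0 => x; rewrite normr0 mulr0. Qed.

Lemma rapidM f g : polybd f -> rapid g -> rapid (fun x => f x * g x).
Proof.
move=> /polybdP[M [k [M0 fM]]] rg m; have [N gN] := rg (k + m)%N; exists (M * N) => x.
rewrite normrM mulrA [_ ^+ m * _]mulrC -mulrA.
apply: (@le_trans _ _ (M * (1 + `|x|) ^+ k * ((1 + `|x|) ^+ m * `|g x|))).
  by rewrite ler_wpM2r // mulr_ge0 // norm1X_ge0.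
by rewrite -mulrA ler_wpM2l // mulrA -exprD.
Qed.

Lemma norm1X_split (x : V) m : (1 + `|x|) ^+ m <= 2 ^+ m * (1 + `|x| ^+ m).
Proof.
have [x1|x1] := leP `|x| 1.
  apply: (@le_trans _ _ (2 ^+ m * 1)); last by rewrite ler_wpM2l // lerDl exprn_ge0.
  by rewrite mulr1 lerXn2r ?nnegrE ?addr_ge0 //; lra.
apply: (@le_trans _ _ (2 ^+ m * `|x| ^+ m)).
  by rewrite -exprMn lerXn2r ?nnegrE ?mulr_ge0 ?addr_ge0 //; lra.
by rewrite ler_wpM2l // lerDr.
Qed.

(** The weight 1 + |x| replaces |x|: being at least 1, its powers are monotone in the exponent and
    can absorb polynomial bounds. *)
Lemma schwartzP f : schwartz f <-> smooth f /\ forall vs, rapid (iterD vs f).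
Proof.
split => -[sf bf]; split => //.
  move=> vs m; have [M fM] := bf vs m; have [N fN] := bf vs 0%N.
  exists (2 ^+ m * (N + M)) => x.
  apply: (@le_trans _ _ (2 ^+ m * (1 + `|x| ^+ m) * `|iterD vs f x|)).
    by rewrite ler_wpM2r // norm1X_split.
  rewrite -mulrA ler_wpM2l // mulrDl lerD //.
  by have := fN x; rewrite expr0.
move=> vs m; have [M fM] := bf vs m; exists M => x.
apply: le_trans (fM x); rewrite ler_wpM2r // lerXn2r ?nnegrE ?addr_ge0 //.
by rewrite lerDr.
Qed.

Lemma schwartz_smooth f : schwartz f -> smooth f. Proof. by case. Qed.

Lemma schwartz_rapid f : schwartz f -> rapid f.
Proof. by move=> /schwartzP[_ /(_ [::])]. Qed.

Lemma schwartz_D f v : schwartz f -> schwartz ('D_v f).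
Proof.
move=> /schwartzP[sf bf]; apply/schwartzP; split; first exact: smooth_D.
by move=> vs; rewrite -iterD_rcons.
Qed.

Lemma moderate_smooth f : moderate f -> smooth f. Proof. by case. Qed.

Lemma moderate_polybd f : moderate f -> polybd f.
Proof. by move=> [_ /(_ [::])]. Qed.

Lemma moderate_D f v : moderate f -> moderate ('D_v f).
Proof.
move=> [sf bf]; split; first exact: smooth_D.
by move=> vs; rewrite -iterD_rcons.
Qed.

(* The pointwise property [Q] of the products [f * g] is inherited by all their
   iterated derivatives, by Leibniz' rule. *)
Lemma iterD_prod_class (A B Q : (V -> R) -> Prop) :
  (forall f, A f -> smooth f /\ forall v, A ('D_v f)) ->
  (forall f, B f -> smooth f /\ forall v, B ('D_v f)) ->
  (forall f g, Q f -> Q g -> Q (fun x => f x + g x)) ->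
  (forall f g, A f -> B g -> Q (fun x => f x * g x)) ->
  forall vs f g, A f -> B g -> Q (iterD vs (fun x => f x * g x)).
Proof.
move=> HA HB QD QM; elim/last_ind => [|vs v IH] f g Af Bg; first exact: QM.
have [sf Df] := HA _ Af; have [sg Dg] := HB _ Bg.
rewrite iterD_rcons deriveM_smooth // (_ : (fun x => _ + g x * _) =
    (fun x => f x * 'D_v g x + 'D_v f x * g x)); last first.
  by apply/funext => x; rewrite [g x * _]mulrC.
rewrite iterD_add; [|by apply: smoothM => //; exact: smooth_D..].
by apply: QD; apply: IH.
Qed.

Lemma moderateM f g : moderate f -> moderate g -> moderate (fun x => f x * g x).
Proof.
move=> mf mg; split; first by apply: smoothM; apply: moderate_smooth.
have MD (h : V -> R) : moderate h -> smooth h /\ forall v, moderate ('D_v h).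
  by move=> mh; split; [exact: moderate_smooth|move=> v; exact: moderate_D].
move=> vs; apply: (@iterD_prod_class moderate moderate polybd) => //.
- exact: polybdD.
- by move=> h k mh mk; apply: polybdM; apply: moderate_polybd.
Qed.

Lemma schwartzM f g : moderate f -> schwartz g -> schwartz (fun x => f x * g x).
Proof.
move=> mf mg; apply/schwartzP; split.
  by apply: smoothM; [apply: moderate_smooth|apply: schwartz_smooth].
move=> vs; apply: (@iterD_prod_class moderate schwartz rapid) => //.
- by move=> h mh; split; [exact: moderate_smooth|move=> v; exact: moderate_D].
- by move=> h mh; split; [exact: schwartz_smooth|move=> v; exact: schwartz_D].
- exact: rapidD.
- by move=> h k mh mk; apply: rapidM; [apply: moderate_polybd|apply: schwartz_rapid].
Qed.

Lemma schwartz_moderate f : schwartz f -> moderate f.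
Proof.
move=> /schwartzP[sf bf]; split => // vs; have [M fM] := bf vs 0%N.
by exists M, 0%N => x; have := fM x; rewrite expr0 mulr1 mul1r.
Qed.

Lemma moderate_cst c : moderate (fun _ : V => c).
Proof.
split; first exact: smooth_cst.
by move=> vs; rewrite iterD_cst; exact: polybd_cst.
Qed.

Lemma moderateD f g : moderate f -> moderate g -> moderate (fun x => f x + g x).
Proof.
move=> [sf bf] [sg bg]; split; first exact: smoothD.
by move=> vs; rewrite iterD_add //; apply: polybdD.
Qed.

Lemma moderate_sum I (r : seq I) (f : I -> V -> R) :
  (forall i, moderate (f i)) -> moderate (fun x => \sum_(i <- r) f i x).
Proof.
move=> sf; elim: r => [|i r IH].
  rewrite (_ : (fun _ => _) = fun=> 0); first exact: moderate_cst.
  by apply/funext => x; rewrite big_nil.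
rewrite (_ : (fun _ => _) = fun x => f i x + \sum_(i <- r) f i x); first exact: moderateD.
by apply/funext => x; rewrite big_cons.
Qed.

Lemma schwartzD f g : schwartz f -> schwartz g -> schwartz (fun x => f x + g x).
Proof.
move=> /schwartzP[sf bf] /schwartzP[sg bg]; apply/schwartzP; split; first exact: smoothD.
by move=> vs; rewrite iterD_add //; apply: rapidD.
Qed.

Lemma schwartzZ f c : schwartz f -> schwartz (fun x => c * f x).
Proof. by move=> sf; apply: schwartzM => //; exact: moderate_cst. Qed.

Lemma schwartzN f : schwartz f -> schwartz (fun x => - f x).
Proof.
move=> sf; rewrite (_ : (fun _ => _) = fun x => -1 * f x); first exact: schwartzZ.
by apply/funext => x; rewrite mulN1r.
Qed.

Lemma schwartzB f g : schwartz f -> schwartz g -> schwartz (fun x => f x - g x).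
Proof. by move=> sf sg; apply: schwartzD => //; exact: schwartzN. Qed.

Lemma schwartz0 : schwartz (fun _ : V => 0).
Proof.
apply/schwartzP; split; first exact: smooth_cst.
by move=> [|v vs]; rewrite iterD_cst; exact: rapid0.
Qed.

Lemma schwartz_sum I (r : seq I) (f : I -> V -> R) :
  (forall i, schwartz (f i)) -> schwartz (fun x => \sum_(i <- r) f i x).
Proof.
move=> sf; elim: r => [|i r IH].
  rewrite (_ : (fun _ => _) = fun=> 0); first exact: schwartz0.
  by apply/funext => x; rewrite big_nil.
rewrite (_ : (fun _ => _) = fun x => f i x + \sum_(i <- r) f i x); first exact: schwartzD.
by apply/funext => x; rewrite big_cons.
Qed.

Lemma derive_coord (j : 'I_n) (v : V) : 'D_v (fun x : V => x 0 j) = fun=> v 0 j.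
Proof.
apply/funext => x; apply: cvg_lim => //; apply: (@cvg_near_cst _ _ _ _ _ _) => //=.
near=> h; rewrite !mxE addrK -[_ *: _]/(_ * _) mulrA mulVf ?mul1r //.
by near: h; exact: nbhs_dnbhs_neq.
Unshelve. all: by end_near. Qed.

Lemma moderate_coord (j : 'I_n) : moderate (fun x : V => x 0 j).
Proof.
split; first exact: smooth_coord.
elim/last_ind => [|vs v _] /=.
  by exists 1, 1%N => x; rewrite mul1r expr1 (le_trans (row_norm_coord _ _)) // lerDr.
by rewrite iterD_rcons derive_coord iterD_cst; exact: polybd_cst.
Qed.

End n.

Section composition.
Context {n m : nat}.
Variable Phi : 'rV[R]_m -> 'rV[R]_n.
Hypothesis sPhi : forall j, smooth (fun x => Phi x 0 j).

Lemma smooth_row_differentiable x : differentiable Phi x.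
Proof.
have -> : Phi = \sum_(j < n) (fun x => Phi x 0 j *: coordv j).
  by apply/funext => y; rewrite fct_sumE; exact: row_sum_delta.
apply: differentiable_sum => j.
exact: (differentiableZl (coordv j) (smooth_differentiable x (sPhi j))).
Qed.

Lemma derive_row x v j : ('D_v Phi x) 0 j = 'D_v (fun x => Phi x 0 j) x.
Proof.
have dPhi : derivable Phi x v by exact/diff_derivable/smooth_row_differentiable.
by rewrite derive_mx // mxE.
Qed.

Lemma derive_comp (f : 'rV[R]_n -> R) x v : smooth f ->
  is_derive x v (f \o Phi) ('D_('D_v Phi x) f (Phi x)).
Proof.
move=> sf; have df := smooth_differentiable (Phi x) sf.
have dP := smooth_row_differentiable x.
have dfP : differentiable (f \o Phi) x by exact: differentiable_comp.
apply: DeriveDef; first exact: diff_derivable.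
by rewrite (deriveE v dfP) (diff_comp dP df) /= -(deriveE v dP) -(deriveE _ df).
Qed.

Lemma derive_comp_sum (f : 'rV[R]_n -> R) v : smooth f ->
  'D_v (f \o Phi) = fun x => \sum_j 'D_(coordv j) f (Phi x) * 'D_v (fun x => Phi x 0 j) x.
Proof.
move=> sf; apply/funext => x; have [_ ->] := derive_comp x v sf.
rewrite smooth_deriveE //; apply: eq_bigr => j _.
by rewrite derive_row mulrC.
Qed.

Lemma continuous_row : continuous Phi.
Proof. by move=> x; exact/differentiable_continuous/smooth_row_differentiable. Qed.

Lemma smooth_comp (f : 'rV[R]_n -> R) : smooth f -> smooth (f \o Phi).
Proof.
move=> sf k; elim: k f sf => [|k IH] f sf.
  by move=> x; apply: continuous_comp; [exact: continuous_row|exact: smooth_continuous].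
split.
- by move=> x; apply: continuous_comp; [exact: continuous_row|exact: smooth_continuous].
- by move=> v x; have [] := derive_comp x v sf.
- move=> v; have : Ck k (fun x => \sum_j 'D_(coordv j) f (Phi x) * 'D_v (fun x => Phi x 0 j) x).
    elim: (index_enum _) => [|j r IHr].
      have := @smooth_cst R 'rV[R]_m _ (0 : R) k; congr (Ck k _).
      by apply/funext => x; rewrite big_nil.
    have := CkD (CkM (IH _ (smooth_D (coordv j) sf)) (smooth_D v (sPhi j) k)) IHr; congr (Ck k _).
    by apply/funext => x; rewrite big_cons.
  by rewrite -derive_comp_sum.
Qed.

(** The factor f is there to close the induction: a derivative of f times g o Phi is a sum of terms
    of the same shape, in which the partial derivatives of Phi have been absorbed by the moderate
    factor. *)
Lemma iterD_comp_class (B : ('rV[R]_n -> R) -> Prop) (Q : ('rV[R]_m -> R) -> Prop) :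
  (forall j, moderate (fun x => Phi x 0 j)) ->
  (forall f, B f -> smooth f /\ forall v, B ('D_v f)) ->
  Q (fun=> 0) ->
  (forall f g, Q f -> Q g -> Q (fun x => f x + g x)) ->
  (forall f g, moderate f -> B g -> Q (fun x => f x * g (Phi x))) ->
  forall vs f g, moderate f -> B g -> Q (iterD vs (fun x => f x * g (Phi x))).
Proof.
move=> mPhi HB Q0 QD QM; elim/last_ind => [|vs v IH] f g mf Bg; first exact: QM.
have [sg Dg] := HB _ Bg; have sf := moderate_smooth mf.
have sgP := smooth_comp sg.
have -> : iterD (rcons vs v) (fun x => f x * g (Phi x)) = iterD vs (fun x => \sum_j
   (f x * 'D_v (fun x => Phi x 0 j) x) * 'D_(coordv j) g (Phi x) + 'D_v f x * g (Phi x)).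
  rewrite iterD_rcons; congr (iterD vs _).
  rewrite [LHS](deriveM_smooth v sf sgP).
  apply/funext => x; rewrite (congr1 (fun h => h x) (derive_comp_sum v sg)) /= mulr_sumr [_ * 'D_v f x]mulrC; congr (_ + _).
  by apply: eq_bigr => j _; rewrite -mulrA; congr (_ * _); rewrite mulrC.
have sterm j : smooth (fun x => (f x * 'D_v (fun x => Phi x 0 j) x) * 'D_(coordv j) g (Phi x)).
  apply: smoothM; first by apply: smoothM => //; exact: smooth_D.
  exact: (smooth_comp (smooth_D _ sg)).
rewrite iterD_add; [|exact: smooth_sum|by apply: smoothM => //; exact: smooth_D].
apply: (QD); last by apply: IH => //; exact: moderate_D.
rewrite iterD_sum //; elim: (index_enum _) => [|j r IHr].
  rewrite (_ : (fun _ => _) = fun=> 0) //; by apply/funext => x; rewrite big_nil.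
rewrite (_ : (fun x => \sum_(i <- _ :: _) _) = fun x => iterD vs (fun x => (f x * 'D_v (fun x => Phi x 0 j) x) * 'D_(coordv j) g (Phi x)) x + \sum_(i <- r) iterD vs (fun x => (f x * 'D_v (fun x => Phi x 0 i) x) * 'D_(coordv i) g (Phi x)) x); last by apply/funext => x; rewrite big_cons.
apply: (QD) IHr; apply: (IH (fun x => f x * 'D_v (fun x => Phi x 0 j) x) ('D_(coordv j) g)) => //.
by apply: moderateM => //; exact: moderate_D.
Qed.

End composition.
End growth.
Lemma row_coordD {R : realType} {n} (x y : 'rV[R]_n) j : (x + y) 0 j = x 0 j + y 0 j.
Proof. by rewrite mxE. Qed.

Lemma row_coordN {R : realType} {n} (x : 'rV[R]_n) j : (- x) 0 j = - x 0 j.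
Proof. by rewrite mxE. Qed.

Lemma row_coordB {R : realType} {n} (x y : 'rV[R]_n) j : (x - y) 0 j = x 0 j - y 0 j.
Proof. by rewrite !mxE. Qed.

Lemma row_coordZ {R : realType} {n} (a : R) (x : 'rV[R]_n) j : (a *: x) 0 j = a * x 0 j.
Proof. by rewrite mxE. Qed.

(** * Derivatives along curves *)

Section curves.
Context {R : realType}.

Lemma is_derive_unique {V W : normedModType R} (f : V -> W) x v a b :
  is_derive x v f a -> is_derive x v f b -> a = b.
Proof. by move=> [_ <-] [_ <-]. Qed.

Lemma is_derive_rowP {V : normedModType R} {n} (c : V -> 'rV[R]_n) t v (c' : 'rV[R]_n) :
  (forall j, is_derive t v (fun s => c s 0 j) (c' 0 j)) -> is_derive t v c c'.
Proof.
move=> H; have dc : derivable c t v.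
  by apply/derivable_mxP => i j; rewrite (ord1 i); have [] := H j.
apply: DeriveDef => //; rewrite derive_mx //; apply/rowP => j; rewrite mxE.
by have [_ ->] := H j.
Qed.

Lemma is_derive_coord {V : normedModType R} {n} (c : V -> 'rV[R]_n) t v (c' : 'rV[R]_n) j :
  is_derive t v c c' -> is_derive t v (fun s => c s 0 j) (c' 0 j).
Proof.
move=> [dc <-]; apply: DeriveDef; first by move/derivable_mxP : dc => /(_ 0 j).
by rewrite derive_mx // mxE.
Qed.

Lemma is_derive_curve {n} (f : 'rV[R]_n -> R) (c : R -> 'rV[R]_n) (t : R) (c' : 'rV[R]_n) :
  smooth f -> is_derive t 1 c c' -> is_derive t 1 (f \o c) ('D_c' f (c t)).
Proof.
move=> sf [/derivable1_diffP dc cE].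
have df := smooth_differentiable (c t) sf.
have dfc : differentiable (f \o c) t by exact: differentiable_comp.
apply: DeriveDef; first exact: diff_derivable.
by rewrite (deriveE (1 : R) dfc) (diff_comp dc df) /= -(deriveE (1 : R) dc) cE -(deriveE _ df).
Qed.

Lemma is_derive_curve_row {m n} (F : 'rV[R]_m -> 'rV[R]_n) (c : R -> 'rV[R]_m) (t : R) (c' : 'rV[R]_m) :
  (forall j, smooth (fun x => F x 0 j)) -> is_derive t 1 c c' ->
  is_derive t 1 (F \o c) ('D_c' F (c t)).
Proof.
move=> sF dc; apply: is_derive_rowP => j; rewrite derive_row //.
exact: (is_derive_curve (sF j) dc).
Qed.

Lemma is_derive_row_mx {m n} (a : R -> 'rV[R]_m) (b : R -> 'rV[R]_n) (t : R) (a' : 'rV[R]_m) (b' : 'rV[R]_n) :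
  is_derive t 1 a a' -> is_derive t 1 b b' ->
  is_derive t 1 (fun s => row_mx (a s) (b s)) (row_mx a' b').
Proof.
move=> da db; apply: is_derive_rowP => j; rewrite mxE.
rewrite (_ : (fun s => _) = (fun s => match fintype.split j with inl k => a s 0 k | inr k => b s 0 k end)).
  by case: (fintype.split j) => k; exact: is_derive_coord.
by apply/funext => s; rewrite mxE.
Qed.

Lemma is_derive_line0 {V : normedModType R} (x v : V) (t : R) :
  is_derive t 1 (fun s : R => x + s *: v) v.
Proof.
have := @is_derive_line R _ _ (@id V) x v t (@derivable_id _ V _ _).
by rewrite derive_id.
Qed.

Lemma is_derive_scale {V : normedModType R} (v : V) (t : R) :
  is_derive t 1 (fun s : R => s *: v) v.
Proof.
have := is_derive_line0 0 v t; rewrite (_ : (fun s => 0 + _) = (fun s : R => s *: v)) //.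
by apply/funext => s; rewrite add0r.
Qed.

Lemma is_derive_scale_curve {n} (c : R -> 'rV[R]_n) (t : R) (c' : 'rV[R]_n) :
  is_derive t 1 c c' -> is_derive t 1 (fun s => s *: c s) (c t + t *: c').
Proof.
move=> dc; apply: is_derive_rowP => j.
rewrite (_ : (fun s => _) = id * (fun s => c s 0 j)); last by apply/funext => s; rewrite row_coordZ.
apply: is_derive_eq; first by apply: is_deriveM; exact: is_derive_coord.
by rewrite row_coordD row_coordZ addrC -[_ *: _]/(_ * _) -[X in _ + X]/(_ * _) mulr1.
Qed.

Lemma is_derive_linear {n m} (D : {linear 'rV[R]_n -> 'rV[R]_m}) (c : R -> 'rV[R]_n) (t : R) (c' : 'rV[R]_n) :
  is_derive t 1 c c' -> is_derive t 1 (D \o c) (D c').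
Proof.
move=> dc; have DE x : D x = \sum_j x 0 j *: D (coordv j).
  by rewrite {1}(row_sum_delta x) linear_sum; apply: eq_bigr => j _; rewrite linearZ.
apply: is_derive_rowP => k.
rewrite (_ : (fun s => _) = \sum_j (fun s => c s 0 j) * (cst (D (coordv j) 0 k))); last first.
  apply/funext => s; rewrite fct_sumE /= DE summxE; apply: eq_bigr => j _.
  by rewrite mxE.
rewrite DE summxE; apply: is_derive_eq.
  apply: is_derive_sum => j; apply: is_deriveM; exact: is_derive_coord.
by apply: eq_bigr => j _; rewrite scaler0 add0r mxE mulrC.
Qed.

Lemma derive0_const {n} (c : R -> 'rV[R]_n) :
  (forall t : R, is_derive t 1 c 0) -> forall t, c t = c 0.
Proof.
move=> dc t; apply/rowP => j.
have dj (s : R) : is_derive s 1 (fun s => c s 0 j) 0.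
  by have := is_derive_coord j (dc s); rewrite mxE.
have cj : continuous (fun s => c s 0 j).
  by move=> s; apply/differentiable_continuous/derivable1_diffP; have [] := dj s.
have [t0|t0] := leP 0 t.
  have [|x _] := @MVT_segment R (fun s => c s 0 j) (fun=> 0) 0 t t0 (fun s _ => dj s).
    exact: continuous_subspaceT.
  by rewrite mul0r => /subr0_eq.
have [|x _] := @MVT_segment R (fun s => c s 0 j) (fun=> 0) t 0 (ltW t0) (fun s _ => dj s).
  exact: continuous_subspaceT.
by rewrite mul0r => /subr0_eq.
Qed.

Lemma smooth_post {V : normedModType R} {n} (f : V -> 'rV[R]_n) j :
  smooth f -> smooth (fun x => f x 0 j).
Proof.
move=> sf; apply: (smooth_coind (P := fun h => exists2 g : V -> 'rV[R]_n, smooth g & h = fun x => g x 0 j)); last by exists f.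
move=> _ [g sg ->]; split.
- have cc : continuous (fun h : 'rV[R]_n => h 0 j) := @coord_continuous _ _ _ 0 j.
  move=> x; apply: (@continuous_comp _ _ _ g (fun h : 'rV[R]_n => h 0 j)); last exact: cc.
  exact: smooth_continuous.
- by move=> v x; have [] := is_derive_coord j (derivableP (smooth_derivable (x := x) (v := v) sg)).
- move=> v; exists ('D_v g); first exact: smooth_D.
  apply/funext => x.
  by have [_ ->] := is_derive_coord j (derivableP (smooth_derivable (x := x) (v := v) sg)).
Qed.

End curves.

(** * The group law, its left invariant frame and the Maurer-Cartan form *)

Section group_law.
Context {R : realType} {d : nat}.
Variable G : stratifiedGroup R d.
Local Notation V := 'rV[R]_d.
Local Notation mul := (gmul G).
Local Notation br := (bracket G).

Lemma br0l u : br 0 u = 0.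
Proof. by have := bracket_linl G (-1) 0 0 u; rewrite scaler0 addr0 scaleN1r addNr. Qed.

Lemma br0r u : br u 0 = 0.
Proof. by have := bracket_linr G (-1) 0 0 u; rewrite scaler0 addr0 scaleN1r addNr. Qed.

Lemma brZl a x y : br (a *: x) y = a *: br x y.
Proof. by have := bracket_linl G a x 0 y; rewrite br0l !addr0. Qed.

Lemma brZr a x y : br x (a *: y) = a *: br x y.
Proof. by have := bracket_linr G a y 0 x; rewrite br0r !addr0. Qed.

Lemma brDl x y z : br (x + y) z = br x z + br y z.
Proof. by have := bracket_linl G 1 x y z; rewrite !scale1r. Qed.

Lemma brDr x y z : br z (x + y) = br z x + br z y.
Proof. by have := bracket_linr G 1 x y z; rewrite !scale1r. Qed.

Lemma brBr x y z : br z (x - y) = br z x - br z y.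
Proof. by rewrite brDr -scaleN1r brZr scaleN1r. Qed.

Lemma br_suml I (r : seq I) (F : I -> V) y : br (\sum_(i <- r) F i) y = \sum_(i <- r) br (F i) y.
Proof. by elim: r => [|i r IH]; rewrite ?big_nil ?br0l // !big_cons brDl IH. Qed.

Lemma br_sumr I (r : seq I) (F : I -> V) y : br y (\sum_(i <- r) F i) = \sum_(i <- r) br y (F i).
Proof. by elim: r => [|i r IH]; rewrite ?big_nil ?br0r // !big_cons brDr IH. Qed.

Lemma gmulgN g : mul g (- g) = 0.
Proof.
by have := gmul_exp G g 1 (-1); rewrite scale1r scaleN1r subrr scale0r.
Qed.

Lemma gmulNg g : mul (- g) g = 0.
Proof.
by have := gmul_exp G g (-1) 1; rewrite scale1r scaleN1r addrC subrr scale0r.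
Qed.

Lemma gmulKg g x : mul (- g) (mul g x) = x.
Proof. by rewrite gmulA gmulNg gmul0g. Qed.

Lemma gmulVKg g x : mul g (mul (- g) x) = x.
Proof. by rewrite gmulA gmulgN gmul0g. Qed.

Lemma gmulgK g x : mul (mul x g) (- g) = x.
Proof. by rewrite -gmulA gmulgN gmulg0. Qed.

Lemma gmulgVK g x : mul (mul x (- g)) g = x.
Proof. by rewrite -gmulA gmulNg gmulg0. Qed.

Lemma ginvM x y : - (mul x y) = mul (- y) (- x).
Proof.
rewrite -[RHS](gmulKg (mul x y)) -gmulA [mul y _]gmulVKg gmulgN gmulg0 //.
Qed.

(** The group law read on concatenated rows, so that the chain rule and the growth classes for row
    vectors apply to it as to a function of one variable. *)
Definition gm2 (z : 'rV[R]_(d + d)) : V := mul (lsubmx z) (rsubmx z).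

Lemma gm2E x y : gm2 (row_mx x y) = mul x y.
Proof. by rewrite /gm2 row_mxKl row_mxKr. Qed.

Lemma gm2_smooth j : smooth (fun z => gm2 z 0 j).
Proof.
pose phi (z : 'rV[R]_(d + d)) : V * V := (lsubmx z, rsubmx z).
have lin : linear phi by move=> a x y; rewrite /phi !linearP.
pose L : {linear 'rV[R]_(d + d) -> (V * V)%type} :=
  HB.pack phi (GRing.isLinear.Build _ _ _ _ phi lin).
have cL : continuous L.
  move=> z; apply: differentiable_continuous.
  apply: (@differentiable_pair _ _ _ _ (@lsubmx R 1 d d) (@rsubmx R 1 d d)).
    exact: differentiable_lsubmx.
  exact: differentiable_rsubmx.
have [sc _] := smooth_linear_comp cL (gmul_smooth G).
exact: (smooth_post j sc).
Qed.

Lemma is_derive_gmul (a b : R -> V) (t : R) (a' b' : V) :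
  is_derive t 1 a a' -> is_derive t 1 b b' ->
  is_derive t 1 (fun s => mul (a s) (b s)) ('D_(row_mx a' b') gm2 (row_mx (a t) (b t))).
Proof.
move=> da db; have := is_derive_curve_row gm2_smooth (is_derive_row_mx da db).
by rewrite (_ : gm2 \o _ = fun s => mul (a s) (b s)) //; apply/funext => s /=; rewrite gm2E.
Qed.

(* [dL g h v] is the derivative of [mul g] at [h] along [v]; [frame g] is the
   differential at the identity of the left translation by [g], and [coframe g]
   its inverse, the Maurer-Cartan form. *)
Fact dL_subproof : {f : V -> V -> V -> V |
  f = fun g h v => 'D_(row_mx 0 v) gm2 (row_mx g h)}.
Proof. by eexists. Qed.
Definition dL := sval dL_subproof.
Lemma dLE g h v : dL g h v = 'D_(row_mx 0 v) gm2 (row_mx g h).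
Proof. by rewrite /dL (svalP dL_subproof). Qed.

Definition frame (g Z : V) : V := dL g 0 Z.
Definition coframe (g v : V) : V := dL (- g) g v.

Lemma is_derive_gmulr g (b : R -> V) (t : R) (b' : V) :
  is_derive t 1 b b' -> is_derive t 1 (fun s => mul g (b s)) (dL g (b t) b').
Proof. by move=> db; rewrite dLE; apply: is_derive_gmul db; exact: is_derive_cst. Qed.

Lemma is_derive_frame g Z : is_derive (0 : R) 1 (fun s : R => mul g (s *: Z)) (frame g Z).
Proof.
have := is_derive_gmulr g (is_derive_scale Z 0).
by rewrite scale0r.
Qed.

Lemma coframeK g Z : coframe g (frame g Z) = Z.
Proof.
have := is_derive_gmulr (- g) (is_derive_frame g Z); rewrite scale0r gmulg0.
rewrite (_ : (fun s => _) = fun s : R => s *: Z); last by apply/funext => s; rewrite gmulKg.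
by move=> /is_derive_unique; apply; exact: is_derive_scale.
Qed.

Lemma frameK g v : frame g (coframe g v) = v.
Proof.
have db : is_derive (0 : R) 1 (fun s : R => mul (- g) (g + s *: v)) (coframe g v).
  have := is_derive_gmulr (- g) (is_derive_line0 g v 0).
  by rewrite scale0r addr0.
have := is_derive_gmulr g db; rewrite scale0r addr0 gmulNg.
rewrite (_ : (fun s => _) = fun s : R => g + s *: v); last by apply/funext => s; rewrite gmulVKg.
by move=> /is_derive_unique; apply; exact: is_derive_line0.
Qed.

(** One-parameter subgroups are lines, so the left invariant field generated by u is the constant u
    along the line of u. *)
Lemma frame_exp (t : R) u : frame (t *: u) u = u.
Proof.
have := is_derive_frame (t *: u) u.
rewrite (_ : (fun s => _) = fun s : R => t *: u + s *: u); last first.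
  by apply/funext => s; rewrite gmul_exp scalerDl.
by move=> /is_derive_unique; apply; exact: is_derive_line0.
Qed.

Lemma lie_derE Z f g : smooth f -> lie_der mul Z f g = 'D_(frame g Z) f g.
Proof.
move=> sf; have [_] := is_derive_curve sf (is_derive_frame g Z).
by rewrite scale0r gmulg0 /lie_der derive1E => <-.
Qed.

Lemma smooth_row_mx0 j : smooth (fun x : V => (row_mx x (0 : V)) 0 j).
Proof.
rewrite (_ : (fun x => _) = fun x : V => match fintype.split j with inl k => x 0 k | inr k => 0 end).
  by case: (fintype.split j) => k; [exact: smooth_coord|exact: smooth_cst].
by apply/funext => x; rewrite mxE; case: (fintype.split j) => k //; rewrite mxE.
Qed.

Lemma smooth_row_mxN j : smooth (fun x : V => (row_mx (- x) x) 0 j).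
Proof.
rewrite (_ : (fun x => _) = fun x : V => match fintype.split j with inl k => - x 0 k | inr k => x 0 k end).
  by case: (fintype.split j) => k; [apply: smoothN; exact: smooth_coord|exact: smooth_coord].
by apply/funext => x; rewrite mxE; case: (fintype.split j) => k //; rewrite mxE.
Qed.

Lemma smooth_frame Z j : smooth (fun x => frame x Z 0 j).
Proof.
rewrite (_ : (fun x => _) = ('D_(row_mx 0 Z) (fun z => gm2 z 0 j)) \o (fun x => row_mx x 0)).
  by apply: smooth_comp; [exact: smooth_row_mx0|exact/smooth_D/gm2_smooth].
by apply/funext => x; rewrite /frame dLE derive_row //; exact: gm2_smooth.
Qed.

Lemma smooth_coframe v j : smooth (fun x => coframe x v 0 j).
Proof.
rewrite (_ : (fun x => _) = ('D_(row_mx 0 v) (fun z => gm2 z 0 j)) \o (fun x => row_mx (- x) x)).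
  by apply: smooth_comp; [exact: smooth_row_mxN|exact/smooth_D/gm2_smooth].
by apply/funext => x; rewrite /coframe dLE derive_row //; exact: gm2_smooth.
Qed.

Lemma dL_sum g h v : dL g h v = \sum_k v 0 k *: dL g h (coordv k).
Proof.
apply/rowP => j; rewrite dLE derive_row ?summxE; last exact: gm2_smooth.
rewrite smooth_deriveE; last exact: gm2_smooth.
rewrite big_split_ord /= big1 ?add0r => [|k _]; last by rewrite row_mxEl mxE mul0r.
apply: eq_bigr => k _; rewrite row_mxEr mxE dLE derive_row; last exact: gm2_smooth.
suff -> : coordv (rshift d k) = row_mx (0 : V) (coordv k) :> 'rV[R]_(d + d) by [].
apply/rowP => l; rewrite !mxE eqxx /=.
case: splitP => l' ll'; rewrite !mxE ?eqxx /=.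
  by rewrite -val_eqE /= ll' ltn_eqF // (leq_trans (ltn_ord l')) // leq_addr.
by rewrite -val_eqE /= ll' eqn_add2l val_eqE.
Qed.

Lemma dL_linear g h a u v : dL g h (a *: u + v) = a *: dL g h u + dL g h v.
Proof.
rewrite dL_sum [dL g h u]dL_sum [dL g h v]dL_sum scaler_sumr -big_split /=.
by apply: eq_bigr => k _; rewrite !mxE scalerDl scalerA.
Qed.

Lemma frameZ g a u : frame g (a *: u) = a *: frame g u.
Proof.
have := dL_linear g 0 a u 0; rewrite addr0 /frame => ->.
have := dL_linear g 0 (-1) 0 0; rewrite scaler0 addr0 scaleN1r addNr => ->.
by rewrite addr0.
Qed.

Lemma frameD g u v : frame g (u + v) = frame g u + frame g v.
Proof. by have := dL_linear g 0 1 u v; rewrite !scale1r. Qed.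

Fact dframe_subproof : {f : V -> V -> V -> V | f = fun u Z g => 'D_u (frame^~ Z) g}.
Proof. by eexists. Qed.
Definition dframe := sval dframe_subproof.

Lemma dframe_coord u Z g j : dframe u Z g 0 j = 'D_u (fun x => frame x Z 0 j) g.
Proof. by rewrite /dframe (svalP dframe_subproof); apply: derive_row; exact: smooth_frame. Qed.

Lemma lie_der_coord W j : lie_der mul W (fun x => x 0 j) = fun x => frame x W 0 j.
Proof.
apply/funext => x; rewrite lie_derE; last exact: smooth_coord.
exact: (congr1 (fun g => g x) (derive_coord j _)).
Qed.

(** The hypothesis on commutators of left invariant fields, tested on the coordinate functions. *)
Lemma dframe_bracket Y Z g :
  dframe (frame g Y) Z g - dframe (frame g Z) Y g = frame g (br Y Z).
Proof.
apply/rowP => j; rewrite row_coordB.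
have := @bracket_lie _ _ G Y Z (fun x => x 0 j) (@smooth_coord R d j) g.
rewrite !lie_der_coord !lie_derE; [|exact: smooth_frame..] => <-.
by rewrite !dframe_coord.
Qed.

Lemma frame_sum g Z j : frame g Z 0 j = \sum_k Z 0 k * frame g (coordv k) 0 j.
Proof.
have -> : frame g Z = \sum_k Z 0 k *: frame g (coordv k) by exact: dL_sum.
by rewrite summxE; apply: eq_bigr => k _; rewrite row_coordZ.
Qed.

Lemma dframe_sum g u Z j :
  dframe u Z g 0 j = \sum_k Z 0 k * 'D_u (fun x => frame x (coordv k) 0 j) g.
Proof.
rewrite dframe_coord.
have -> : (fun x => frame x Z 0 j) = fun x => \sum_k Z 0 k * frame x (coordv k) 0 j.
  by apply/funext => x; exact: frame_sum.
rewrite [LHS](congr1 (fun h => h g) (derive_sum_smooth _ _ _)) /=; last first.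
  by move=> k; apply: smoothZ; exact: smooth_frame.
apply: eq_bigr => k _.
have := deriveM_smooth u (@smooth_cst R V R (Z 0 k)) (smooth_frame (coordv k) j).
move=> /(congr1 (fun h => h g)) /= ->.
by rewrite derive_cst mulr0 addr0.
Qed.

Lemma is_derive_frame_curve (a b : R -> V) (t : R) (a' b' : V) :
  is_derive t 1 a a' -> is_derive t 1 b b' ->
  is_derive t 1 (fun s => frame (a s) (b s))
    (dframe a' (b t) (a t) + frame (a t) b').
Proof.
move=> da db; apply: is_derive_rowP => j.
rewrite (_ : (fun s => _) = \sum_k (fun s => b s 0 k) * (fun s => frame (a s) (coordv k) 0 j)); last first.
  by apply/funext => s; rewrite fct_sumE frame_sum.
apply: is_derive_eq.
  apply: is_derive_sum => k; apply: is_deriveM; first exact: is_derive_coord.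
  exact: (is_derive_curve (smooth_frame (coordv k) j) da).
rewrite row_coordD dframe_sum (frame_sum _ b') -big_split /=; apply: eq_bigr => k _.
by congr (_ + _); rewrite -[LHS]/(_ * _) mulrC.
Qed.

(** The derivative along v of the identity [frame x x = x], which is [frame_exp] at time 1. *)
Lemma dframe_diag x v : dframe v x x + frame x v = v.
Proof.
have dl := is_derive_line0 x v 0.
have := is_derive_frame_curve dl dl; rewrite scale0r addr0.
rewrite (_ : (fun s => frame _ _) = fun s : R => x + s *: v).
  by move=> /is_derive_unique; apply; exact: is_derive_line0.
by apply/funext => s; have := frame_exp 1 (x + s *: v); rewrite scale1r.
Qed.

Lemma dframeZ g u (a : R) Z : dframe u (a *: Z) g = a *: dframe u Z g.
Proof.
apply/rowP => j; rewrite row_coordZ dframe_sum (dframe_sum _ _ Z) mulr_sumr.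
by apply: eq_bigr => k _; rewrite row_coordZ mulrA.
Qed.

(* The Maurer-Cartan equation along the ray through [u], where
   [coframe (t u) u = u]: a linear equation whose solution depends only on the
   bracket. *)
Lemma is_derive_coframe_ray u v (t : R) :
  is_derive t 1 (fun s : R => s *: coframe (s *: u) v) (v - br u (t *: coframe (t *: u) v)).
Proof.
pose q (s : R) := coframe (s *: u) v.
have [q' dq] : exists q' : V, is_derive t 1 q q'.
  eexists; exact: (is_derive_curve_row (smooth_coframe v) (is_derive_scale u t)).
(* Differentiates the constant [frame (s u) (q s) = v] along the ray. *)
have eq0 : dframe u (q t) (t *: u) + frame (t *: u) q' = 0.
  have := is_derive_frame_curve (is_derive_scale u t) dq.
  have -> : (fun s => frame (s *: u) (q s)) = cst v.
    by apply/funext => s; rewrite frameK.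
  by move=> /is_derive_unique; apply; exact: is_derive_cst.
have eq1 := dframe_bracket u (q t) (t *: u).
rewrite frame_exp frameK in eq1.
have eq2 := dframe_diag (t *: u) v; rewrite dframeZ in eq2.
(* Checked after applying the invertible map [frame (t u)]: the derivative of q is traded for a
   derivative of the frame by [eq0], the two derivatives of the frame are compared by [eq1], and the
   remaining one is known from [eq2]. *)
have key : q t + t *: q' = v - t *: br u (q t).
  rewrite -[LHS](coframeK (t *: u)) -[RHS](coframeK (t *: u)); congr (coframe _ _).
  rewrite !frameD -scaleN1r !frameZ scaleN1r frameK -eq1.
  have -> : frame (t *: u) q' = - dframe u (q t) (t *: u).
    by apply/eqP; rewrite -addr_eq0 addrC eq0.
  rewrite scalerN -[X in X - _]eq2 scalerBr.
  move: (frame _ v) (dframe _ _ _) (dframe _ _ _) => x y z.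
  by rewrite opprB [t *: z + x]addrC -addrA.
have := is_derive_scale_curve dq; rewrite key.
suff -> : br u (t *: q t) = t *: br u (q t) by [].
exact: brZr.
Qed.

End group_law.

Section row_linear.
Context {R : realType}.

Lemma linear_rowE {n m} (L : {linear 'rV[R]_n -> 'rV[R]_m}) x k :
  L x 0 k = \sum_j x 0 j * L (coordv j) 0 k.
Proof.
rewrite {1}(row_sum_delta x) linear_sum summxE; apply: eq_bigr => j _.
by rewrite linearZ /= mxE.
Qed.

Lemma linear_row_smooth {n m} (L : {linear 'rV[R]_n -> 'rV[R]_m}) k : moderate (fun x => L x 0 k).
Proof.
rewrite (_ : (fun x : 'rV[R]_n => _) = fun x : 'rV[R]_n => \sum_j x 0 j * L (coordv j) 0 k).
  by apply: moderate_sum => j; apply: moderateM; [exact: moderate_coord|exact: moderate_cst].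
by apply/funext => x; exact: linear_rowE.
Qed.

Lemma linear_row_continuous {n m} (L : {linear 'rV[R]_n -> 'rV[R]_m}) : continuous L.
Proof. by apply: continuous_row => k; have [] := linear_row_smooth L k. Qed.

Lemma linear_row_bound {n m} (L : {linear 'rV[R]_n -> 'rV[R]_m}) :
  exists2 C, 0 < C & forall x, `|L x| <= C * `|x|.
Proof. exact/linear_lipschitz/linear_row_continuous. Qed.

Lemma compact_closed_ball n (r : R) : compact [set x : 'rV[R]_n | `|x| <= r].
Proof.
apply: bounded_closed_compact.
  by exists r; split; [exact: num_real|move=> M rM x /= xr; exact/ltW/(le_lt_trans xr)].
by apply: (@preimage_closed _ _ (fun x : 'rV[R]_n => `|x|) [set y | y <= r]) => [x _|];
  [exact: norm_continuous|exact: closed_le].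
Qed.

Lemma continuous_bounded_ball n (f : 'rV[R]_n -> R) (r : R) : continuous f ->
  exists M, forall x, `|x| <= r -> `|f x| <= M.
Proof.
move=> cf; have [r0|r0] := leP 0 r; last first.
  by exists 0 => x xr; have := le_lt_trans xr r0; rewrite normr_lt0.
have A0 : [set x : 'rV[R]_n | `|x| <= r] !=set0 by exists 0; rewrite /= normr0.
have [|c _ H] := @EVT_max_rV R n (fun x => `|f x|) _ A0 (@compact_closed_ball n r).
  by apply: continuous_subspaceT => x; apply: continuous_comp; [exact: cf|exact: norm_continuous].
by exists `|f c| => x xr; apply: H; rewrite inE.
Qed.

End row_linear.

(** * Dilations *)

Section dilations.
Context {R : realType} {d : nat}.
Variable G : stratifiedGroup R d.
Local Notation V := 'rV[R]_d.
Local Notation mul := (gmul G).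
Local Notation br := (bracket G).
Local Notation N := (step G).

Definition lpi (j : 'I_N) : 'End(V) := sumv_pi (\sum_(i < N) layer G i.+1)%VS j.

Lemma lpi_mem j x : lpi j x \in layer G j.+1.
Proof. exact: (@memv_sum_pi _ _ _ _ _ (fun i : 'I_N => layer G i.+1)). Qed.

Lemma lpi_sum x : \sum_j lpi j x = x.
Proof. by apply: sumv_pi_sum; rewrite layer_full memvf. Qed.

Lemma lpi_layer (j : 'I_N) x i : x \in layer G j.+1 -> lpi i x = if i == j then x else 0.
Proof.
move=> xj; have /directv_sum_unique/(_ (fun i => lpi i x) (fun i => if i == j then x else 0)) := layer_direct G.
rewrite lpi_sum -big_mkcond big_pred1_eq eqxx => H.
have K (k : 'I_N) : true -> (if k == j then x else 0) \in layer G k.+1.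
  by case: eqP => [->|_] //; rewrite mem0v.
have := H (fun k _ => lpi_mem k x) K.
by move=> /esym/forallP/(_ i)/implyP/(_ isT)/eqP.
Qed.

Lemma dil_linear t : linear (dil G t).
Proof.
move=> a x y; rewrite /dil scaler_sumr -big_split; apply: eq_bigr => j _ /=.
by rewrite linearP scalerDr !scalerA mulrC.
Qed.

Definition dill t : {linear V -> V} :=
  HB.pack (dil G t) (GRing.isLinear.Build _ _ _ _ (dil G t) (dil_linear t)).

Lemma dil_0 t : dil G t 0 = 0.
Proof. by rewrite /dil big1 // => j _; rewrite linear0 scaler0. Qed.

Lemma dilZ t a x : dil G t (a *: x) = a *: dil G t x.
Proof. by have := dil_linear t a x 0; rewrite dil_0 !addr0. Qed.

Lemma dilN t x : dil G t (- x) = - dil G t x.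
Proof. exact: (linearN (dill t)). Qed.

Lemma dil_sum t I (r : seq I) (F : I -> V) :
  dil G t (\sum_(i <- r) F i) = \sum_(i <- r) dil G t (F i).
Proof. exact: (linear_sum (dill t)). Qed.

Lemma dil_layer t m x : (0 < m)%N -> x \in layer G m -> dil G t x = t ^+ m *: x.
Proof.
case: m => // m _ xm; have [mN|Nm] := ltnP m N; last first.
  move: xm; rewrite layer_out ?ltnS // memv0 => /eqP ->.
  by rewrite dil_0 scaler0.
rewrite /dil (bigD1 (Ordinal mN)) //= -/(lpi _) (@lpi_layer (Ordinal mN)) // eqxx.
rewrite big1 ?addr0 // => j jm.
by rewrite -/(lpi _) (@lpi_layer (Ordinal mN)) // (negbTE jm) scaler0.
Qed.

Lemma dil_lpi t j x : dil G t (lpi j x) = t ^+ j.+1 *: lpi j x.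
Proof. by apply: dil_layer => //; exact: lpi_mem. Qed.

Lemma lpi_dil t j x : lpi j (dil G t x) = t ^+ j.+1 *: lpi j x.
Proof.
rewrite /dil linear_sum (bigD1 j) //= linearZ /= -/(lpi _) (@lpi_layer j) ?lpi_mem // eqxx.
rewrite big1 ?addr0 // => i ij.
by rewrite linearZ /= -/(lpi _) (@lpi_layer i) ?lpi_mem // eq_sym (negbTE ij) scaler0.
Qed.

Lemma dil1 x : dil G 1 x = x.
Proof. by rewrite -[RHS]lpi_sum; apply: eq_bigr => j _; rewrite expr1n scale1r. Qed.

Lemma dil0 x : dil G 0 x = 0.
Proof. by rewrite /dil big1 // => j _; rewrite expr0n scale0r. Qed.

Lemma dil_comp s t x : dil G s (dil G t x) = dil G (s * t) x.
Proof.
rewrite [RHS]/dil [dil G t x]/dil dil_sum; apply: eq_bigr => j _.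
by rewrite dilZ -/(lpi _) dil_lpi scalerA exprMn mulrC.
Qed.

Lemma dilK t x : t != 0 -> dil G t^-1 (dil G t x) = x.
Proof. by move=> t0; rewrite dil_comp mulVf // dil1. Qed.

Lemma dilVK t x : t != 0 -> dil G t (dil G t^-1 x) = x.
Proof. by move=> t0; rewrite dil_comp divff // dil1. Qed.

Lemma br_layer i j x y : (0 < i)%N -> (0 < j)%N ->
  x \in layer G i -> y \in layer G j -> br x y \in layer G (i + j).
Proof.
move=> i0 j0 xi yj; have /subvP := @layer_bracket _ _ G i j i0 j0; apply.
rewrite (coord_vbasis xi) (coord_vbasis yj) br_suml.
apply: memv_suml => k _; rewrite brZl; apply: memvZ; rewrite br_sumr.
apply: memv_suml => l _; rewrite brZr; apply: memvZ; apply: memv_span.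
by apply/allpairsP; exists ((vbasis (layer G i))`_k, (vbasis (layer G j))`_l); split => //=;
  apply: mem_nth; rewrite size_tuple.
Qed.

Lemma br_lpi x y : br x y = \sum_i \sum_j br (lpi i x) (lpi j y).
Proof.
rewrite -{1}[x]lpi_sum br_suml; apply: eq_bigr => i _.
by rewrite -{1}[y]lpi_sum br_sumr.
Qed.

Lemma dil_br t x y : dil G t (br x y) = br (dil G t x) (dil G t y).
Proof.
rewrite br_lpi [RHS]br_lpi dil_sum; apply: eq_bigr => i _.
rewrite dil_sum; apply: eq_bigr => j _.
rewrite !lpi_dil brZl brZr scalerA -exprD; apply: dil_layer => //.
by apply: br_layer => //; exact: lpi_mem.
Qed.

(** Bracketing with any vector raises the lowest layer, since every layer has degree at least 1. The
    index shift matters: [lpi j] projects onto the layer of degree j + 1. *)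
Lemma lpi_br_raise k w y : (forall j : 'I_N, (j < k)%N -> lpi j y = 0) ->
  forall j : 'I_N, (j < k.+1)%N -> lpi j (br w y) = 0.
Proof.
move=> H j jk; rewrite br_lpi linear_sum big1 // => i _; rewrite linear_sum big1 // => l _ /=.
have [lk|kl] := ltnP l k; first by rewrite (H l lk) br0r linear0.
have bl := @br_layer i.+1 l.+1 (lpi i w) (lpi l y) isT isT (lpi_mem _ _) (lpi_mem _ _).
have [ilN|Nil] := ltnP (i.+1 + l)%N N; last first.
  move: bl; rewrite addnS layer_out ?ltnS // memv0 => /eqP ->; exact: linear0.
rewrite addnS in bl.
rewrite (@lpi_layer (Ordinal ilN) _ j bl); case: eqP => // /(congr1 val) /= jE.
by move: jk; rewrite jE ltnS addSn leqNgt ltnS (leq_trans kl) // leq_addl.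
Qed.

(** Uniqueness for E' = -[w, E] without any theorem on differential equations: once the components
    of E in the layers below a given one vanish, the component in that layer has derivative zero,
    because the bracket only sees the lower ones. *)
Lemma bracket_ode_zero w (E : R -> V) : E 0 = 0 ->
  (forall t : R, is_derive t 1 E (- br w (E t))) -> forall t, E t = 0.
Proof.
move=> E0 dE t.
suff H k : forall s (j : 'I_N), (j < k)%N -> lpi j (E s) = 0.
  by rewrite -[LHS]lpi_sum big1 // => j _; exact: (H N t j).
elim: k => [//|k IH] s j; rewrite ltnS leq_eqVlt => /orP[/eqP jk|]; last exact: IH.
have := @derive0_const R _ (lpi j \o E) _ s; rewrite /= E0 linear0; apply => r.
have := is_derive_linear (lpi j) (dE r).
suff E1 : lpi j (- br w (E r)) = 0 by move=> dF; exact: is_derive_eq dF E1.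
by rewrite raddfN /= (@lpi_br_raise k) ?oppr0 ?jk // => i; exact: IH.
Qed.

Section automorphism.
Variable D : {linear V -> V}.
Hypothesis D_br : forall x y, D (br x y) = br (D x) (D y).

(** Both sides, multiplied by t and taken along the ray t u, solve the Maurer-Cartan equation of
    [is_derive_coframe_ray] for D u and D v; their difference solves the homogeneous equation. *)
Lemma coframe_aut u v : D (coframe G u v) = coframe G (D u) (D v).
Proof.
pose E (t : R) := D (t *: coframe G (t *: u) v) - t *: coframe G (t *: D u) (D v).
suff : E 1 = 0 by rewrite /E !scale1r => /subr0_eq.
apply: (@bracket_ode_zero (D u)) => [|t].
  by rewrite /E !scale0r linear0 subr0.
have d1 := is_derive_linear D (is_derive_coframe_ray G u v t).
have d2 := is_derive_coframe_ray G (D u) (D v) t.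
have := is_deriveB d1 d2; rewrite (_ : (_ - _ : R -> V) = E) // => dE.
apply: is_derive_eq dE _.
by rewrite /E raddfB /= D_br brBr opprD addrACA subrr add0r opprD.
Qed.

Lemma frame_aut u Z : D (frame G u Z) = frame G (D u) (D Z).
Proof. by rewrite -[LHS](frameK G (D u)) -coframe_aut coframeK. Qed.

Lemma is_derive_gmul_exp x y (t : R) :
  is_derive t 1 (fun s : R => mul x (s *: y)) (frame G (mul x (t *: y)) y).
Proof.
have := is_derive_frame G (mul x (t *: y)) y.
have E : (fun s : R => mul x (s *: y)) \o (fun s => t + s) =
    fun s : R => mul (mul x (t *: y)) (s *: y).
  by apply/funext => s /=; rewrite -gmulA gmul_exp.
rewrite -E => -[d1 d2].
have F h : (h^-1 *: ((((fun s : R => mul x (s *: y)) \o (fun s => t + s)) \o shift 0) (h *: 1) -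
     ((fun s : R => mul x (s *: y)) \o (fun s => t + s)) 0)) =
   h^-1 *: (((fun s : R => mul x (s *: y)) \o shift t) (h *: 1) - mul x (t *: y)).
  by rewrite /= !addr0 [t + _]addrC.
by apply: DeriveDef; [move: d1|move: d2]; rewrite /derivable /derive (funext F).
Qed.

(** The curve c(t) = D(x exp(t y)) is an integral curve of the left invariant field of w = D y, so
    c(t) exp(-t w) is constant; compare t = 1 with t = 0. *)
Lemma gmul_aut x y : D (mul x y) = mul (D x) (D y).
Proof.
pose w := D y.
pose c (t : R) := D (mul x (t *: y)).
have dc (t : R) : is_derive t 1 c (frame G (c t) w).
  have := is_derive_linear D (is_derive_gmul_exp x y t); rewrite frame_aut.
  by rewrite -/(c t) (_ : D \o _ = c).
have H (t : R) : is_derive t 1 (fun s => mul (c s) (s *: - w)) 0.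
  have d1 := is_derive_gmul G (dc t) (is_derive_scale (- w) t).
  suff <- : 'D_(row_mx (frame G (c t) w) (- w)) (gm2 G) (row_mx (c t) (t *: - w)) = 0 by [].
  (* The derivative of a product depends only on the two tangent vectors, so c may be replaced near
     t by s -> c(t) exp(s w); along this curve the product is constant. *)
  have := is_derive_gmul G (is_derive_frame G (c t) w) (is_derive_line0 (t *: - w) (- w) 0).
  rewrite !scale0r gmulg0 addr0.
  rewrite (_ : (fun s => _) = cst (mul (c t) (t *: - w))).
    by move=> /is_derive_unique; apply; exact: is_derive_cst.
  apply/funext => s /=; rewrite -gmulA -scalerDl !scalerN -!scaleNr gmul_exp.
  by rewrite addrC opprD addrNK.
have := derive0_const H 1; rewrite /c !scale1r !scale0r !gmulg0 => <-.
by rewrite gmulgVK.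
Qed.

End automorphism.

Lemma dilM t x y : dil G t (mul x y) = mul (dil G t x) (dil G t y).
Proof. exact: (@gmul_aut (dill t) (dil_br t)). Qed.

(** For t <= 1 all powers t^j with j >= 1 are at most t. *)
Lemma dil_bound : exists2 C, 1 <= C & forall t x, 0 <= t <= 1 -> `|dil G t x| <= C * t * `|x|.
Proof.
have /choice[C HC] j : exists C, 0 < C /\ forall x, `|lpi j x| <= C * `|x|.
  by have [C C0 HC] := linear_row_bound (lpi j); exists C; split.
exists (1 + \sum_j C j); first by rewrite lerDl sumr_ge0 // => j _; have [/ltW] := HC j.
move=> t x /andP[t0 t1]; rewrite /dil; apply: le_trans (ler_norm_sum _ _ _) _.
apply: (@le_trans _ _ (\sum_j C j * t * `|x|)).
  apply: ler_sum => j _; have [C0 HCj] := HC j.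
  rewrite -/(lpi j) normrZ ger0_norm ?exprn_ge0 // [C j * t]mulrC -mulrA.
  apply: ler_pM => //; first exact: exprn_ge0.
  by rewrite exprS ler_piMr // exprn_ile1.
rewrite -!mulr_suml ler_wpM2r // ler_wpM2r // lerDr; exact: ler01.
Qed.

Lemma is_derive_dil (t : R) x :
  is_derive t 1 (fun s => dil G s x) (\sum_(j < N) (j.+1%:R * t ^+ j) *: lpi j x).
Proof.
rewrite (_ : (fun s => _) = \sum_(j < N) (fun s : R => s ^+ j.+1 *: lpi j x)); last first.
  by apply/funext => s; rewrite fct_sumE.
apply: is_derive_sum => j; apply: is_derive_rowP => k.
rewrite (_ : (fun s => _) = (fun s : R => s ^+ j.+1) * (cst (lpi j x 0 k))); last first.
  by apply/funext => s; rewrite row_coordZ.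
have de : is_derive t 1 (fun s : R => s ^+ j.+1) (j.+1%:R * t ^+ j).
  apply: DeriveDef; first exact: exprn_derivable.
  by rewrite exp_derive [LHS]mulr1.
rewrite row_coordZ; apply: is_derive_eq (is_deriveM de (is_derive_cst _ _ _)) _.
by rewrite /= scaler0 add0r -[LHS]/(_ * _) mulrC.
Qed.

Lemma continuous_dil x : continuous (fun t => dil G t x).
Proof.
move=> t; apply/differentiable_continuous/derivable1_diffP.
by have [] := is_derive_dil t x.
Qed.

(* The dilations of the group G x G, on concatenated rows. *)
Definition dil2 t (z : 'rV[R]_(d + d)) : 'rV[R]_(d + d) :=
  row_mx (dil G t (lsubmx z)) (dil G t (rsubmx z)).
Definition pi2 j (z : 'rV[R]_(d + d)) : 'rV[R]_(d + d) :=
  row_mx (lpi j (lsubmx z)) (lpi j (rsubmx z)).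

Lemma dil2_linear t : linear (dil2 t).
Proof.
move=> a x y; rewrite /dil2 !linearP !dil_linear scale_row_mx.
by rewrite add_row_mx.
Qed.

Definition dil2l t : {linear 'rV[R]_(d + d) -> 'rV[R]_(d + d)} :=
  HB.pack (dil2 t) (GRing.isLinear.Build _ _ _ _ (dil2 t) (dil2_linear t)).

Lemma pi2_sum z : \sum_j pi2 j z = z.
Proof.
rewrite -[RHS]hsubmxK -[lsubmx z in RHS]lpi_sum -[rsubmx z in RHS]lpi_sum.
elim/big_rec3: _ => [|j a b c _ ->]; first by rewrite row_mx0.
by rewrite add_row_mx.
Qed.

Lemma dil2_pi2 t j z : dil2 t (pi2 j z) = t ^+ j.+1 *: pi2 j z.
Proof. by rewrite /dil2 /pi2 row_mxKl row_mxKr !dil_lpi scale_row_mx. Qed.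

Lemma norm_row_mx (x y : V) c : 0 <= c -> `|x| <= c -> `|y| <= c -> `|row_mx x y| <= c.
Proof.
move=> c0 xc yc; apply: row_norm_le => // j; rewrite mxE.
by case: (fintype.split j) => k; [apply: le_trans (row_norm_coord _ _) xc|apply: le_trans (row_norm_coord _ _) yc].
Qed.

Lemma norm_lsubmx (z : 'rV[R]_(d + d)) : `|lsubmx z| <= `|z|.
Proof. by apply: row_norm_le => // j; rewrite mxE; exact: row_norm_coord. Qed.

Lemma norm_rsubmx (z : 'rV[R]_(d + d)) : `|rsubmx z| <= `|z|.
Proof. by apply: row_norm_le => // j; rewrite mxE; exact: row_norm_coord. Qed.

Lemma dil2_bound : exists2 C, 1 <= C & forall t z, 0 <= t <= 1 -> `|dil2 t z| <= C * t * `|z|.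
Proof.
have [C C1 HC] := dil_bound; exists C => // t z t01; have /andP[t0 _] := t01.
have C0 : 0 <= C * t by rewrite mulr_ge0 // (le_trans ler01).
apply: norm_row_mx; first by rewrite mulr_ge0.
  by apply: le_trans (HC _ _ t01) _; rewrite ler_wpM2l // norm_lsubmx.
by apply: le_trans (HC _ _ t01) _; rewrite ler_wpM2l // norm_rsubmx.
Qed.

(** Smooth functions homogeneous of degree k - l under the dilations. Writing the degree as a
    difference keeps natural exponents when differentiation lowers it. *)
Definition quasihom (u : 'rV[R]_(d + d) -> R) := smooth u /\
  exists k l, forall t z, 0 < t -> t ^+ l * u (dil2 t z) = t ^+ k * u z.

(** A point with |z| > 1 is brought by the dilation of ratio 1/|z| into a fixed compact ball, where
    u is bounded by continuity; homogeneity returns a bound by |z|^k. *)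
Lemma quasihom_polybd u : quasihom u -> polybd u.
Proof.
move=> [su [k [l H]]]; have [C C1 HC] := dil2_bound.
have [M HM] := continuous_bounded_ball C (smooth_continuous su).
exists M, k => z; have [z1|z1] := leP `|z| 1.
  apply: le_trans (HM z (le_trans z1 C1)) _; rewrite ler_peMr ?norm1X_ge1 //.
  exact: le_trans (HM z (le_trans z1 C1)).
have z0 : 0 < `|z| by exact: lt_trans z1.
have t1 : `|z|^-1 <= 1 by rewrite invf_le1 // ltW.
have zi0 : 0 < `|z|^-1 by rewrite invr_gt0.
have := H _ z zi0.
have -> : `|z|^-1 ^+ k * u z = u z / `|z| ^+ k by rewrite exprVn mulrC.
have zk : `|z| ^+ k != 0 by rewrite expf_neq0 // gt_eqF.
move=> /(congr1 (fun a => a * `|z| ^+ k)); rewrite divfK // => <-.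
have HM' : `|u (dil2 `|z|^-1 z)| <= M.
  apply: HM; apply: le_trans (HC _ _ _) _; first by rewrite t1 ltW.
  by rewrite mulfVK // gt_eqF.
rewrite normrM normrM ger0_norm ?exprn_ge0 ?(ltW zi0) //.
rewrite [`|_ ^+ k|]ger0_norm ?exprn_ge0 //.
apply: ler_pM; rewrite ?mulr_ge0 ?exprn_ge0 ?(ltW zi0) //.
  apply: le_trans HM'; rewrite ler_piMl // exprn_ile1 // ltW //.
by rewrite lerXn2r ?nnegrE ?addr_ge0 // lerDr.
Qed.

(** A derivative along the layer of degree j + 1 lowers the homogeneity by j + 1, which is recorded
    in l. *)
Lemma quasihom_D u j v : quasihom u -> quasihom ('D_(pi2 j v) u).
Proof.
move=> [su [k [l H]]]; split; first exact: smooth_D.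
exists k, (l + j.+1)%N => t z t0.
have [sc dc] := smooth_linear_comp (@linear_row_continuous _ _ _ (dil2l t)) su.
have [_ D1] := dc z (pi2 j v).
have [_ D2] := derive_scale_dir (t ^+ j.+1) (smooth_derivable (x := dil2 t z) (v := pi2 j v) su).
rewrite exprD -mulrA -D2 -dil2_pi2 -[dil2 t (pi2 _ _)]/(dil2l t _) -D1.
have E : (fun z => t ^+ l * (u \o dil2l t) z) = fun z => t ^+ k * u z.
  by apply/funext => y; exact: H.
have := congr1 (fun h => 'D_(pi2 j v) h z) E => /=.
have := deriveM_smooth (pi2 j v) (@smooth_cst R 'rV[R]_(d + d) R (t ^+ l)) sc.
move=> /(congr1 (fun h => h z)) /= ->.
have := deriveM_smooth (pi2 j v) (@smooth_cst R 'rV[R]_(d + d) R (t ^+ k)) su.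
move=> /(congr1 (fun h => h z)) /= ->.
by rewrite !derive_cst !mulr0 !addr0.
Qed.

(** Sums are required because a derivative in an arbitrary direction splits over the layers into
    terms of different degrees. *)
Inductive quasihom_span : ('rV[R]_(d + d) -> R) -> Prop :=
| qspan_base u : quasihom u -> quasihom_span u
| qspan_cst0 : quasihom_span (fun=> 0)
| qspan_add u v : quasihom_span u -> quasihom_span v -> quasihom_span (fun z => u z + v z).

Lemma quasihom_span_sum I (r : seq I) (F : I -> 'rV[R]_(d + d) -> R) :
  (forall i, quasihom_span (F i)) -> quasihom_span (fun z => \sum_(i <- r) F i z).
Proof.
move=> HF; elim: r => [|i r IH].
  rewrite (_ : (fun _ => _) = fun=> 0); first exact: qspan_cst0.
  by apply/funext => z; rewrite big_nil.
rewrite (_ : (fun _ => _) = fun z => F i z + \sum_(i <- r) F i z); first exact: qspan_add.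
by apply/funext => z; rewrite big_cons.
Qed.

Lemma derive_pi2 (u : 'rV[R]_(d + d) -> R) v z : smooth u -> 'D_v u z = \sum_j 'D_(pi2 j v) u z.
Proof.
move=> su; rewrite smooth_deriveE //.
under [in RHS]eq_bigr do rewrite smooth_deriveE //.
rewrite exchange_big /=; apply: eq_bigr => k _; rewrite -mulr_suml; congr (_ * _).
by rewrite -{1}[v]pi2_sum summxE.
Qed.

Lemma quasihom_span_smooth u : quasihom_span u -> smooth u.
Proof.
elim => [{}u []//| |{}u v _ su _ sv]; first exact: smooth_cst.
exact: smoothD.
Qed.

Lemma quasihom_span_D u v : quasihom_span u -> quasihom_span ('D_v u).
Proof.
elim => [{}u qu| |{}u w qu IHu qw IHw].
- rewrite (_ : 'D_v u = fun z => \sum_j 'D_(pi2 j v) u z).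
    by apply: quasihom_span_sum => j; apply: qspan_base; exact: quasihom_D.
  by apply/funext => z; apply: derive_pi2; case: qu.
- rewrite (_ : 'D_v _ = fun=> 0); first exact: qspan_cst0.
  by apply/funext => z; exact: derive_cst.
- rewrite deriveD_smooth; [|exact: quasihom_span_smooth..].
  exact: qspan_add.
Qed.

Lemma quasihom_span_moderate u : quasihom_span u -> moderate u.
Proof.
move=> qu; split; first exact: quasihom_span_smooth.
move=> vs; have : quasihom_span (iterD vs u).
  by apply: iterD_class qu => g qg v; exact: quasihom_span_D.
elim => [{}u' /quasihom_polybd//| |u1 u2 _ p1 _ p2]; first exact: polybd_cst.
exact: polybdD.
Qed.

Lemma gm2_dil2 t z : gm2 G (dil2 t z) = dil G t (gm2 G z).
Proof. by rewrite /dil2 gm2E -dilM. Qed.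

(** Dilations being automorphisms, the part of the group law in each layer is homogeneous; this
    yields the polynomial bounds that the Baker-Campbell-Hausdorff formula would give. *)
Lemma moderate_gm2 i : moderate (fun z => gm2 G z 0 i).
Proof.
apply: quasihom_span_moderate.
rewrite (_ : (fun z => _) = fun z => \sum_j lpi j (gm2 G z) 0 i); last first.
  by apply/funext => z; rewrite -summxE lpi_sum.
apply: quasihom_span_sum => j; apply: qspan_base; split.
  apply: (@smooth_comp _ _ _ (gm2 G) (gm2_smooth G) (fun x => lpi j x 0 i)).
  by have [] := linear_row_smooth (lpi j) i.
exists j.+1, 0%N => t z t0.
by rewrite expr0 mul1r gm2_dil2 lpi_dil row_coordZ.
Qed.

End dilations.

(** * Growth classes under composition *)

Section growth_composition.
Context {R : realType}.

Lemma polybd_norm {n m} (Phi : 'rV[R]_m -> 'rV[R]_n) :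
  (forall j, polybd (fun x => Phi x 0 j)) ->
  exists M k, 1 <= M /\ forall x, 1 + `|Phi x| <= M * (1 + `|x|) ^+ k.
Proof.
move=> bP.
have [M [k [M0 HM]]] : exists M k, 0 <= M /\ forall x, \sum_j `|Phi x 0 j| <= M * (1 + `|x|) ^+ k.
  elim: (index_enum _) => [|j r [M [k [M0 IH]]]].
    by exists 0, 0%N; split => // x; rewrite big_nil mul0r.
  have /polybdP[N [l [N0 HN]]] := bP j.
  exists (N + M), (maxn k l); split => [|x]; first exact: addr_ge0.
  rewrite big_cons mulrDl lerD //.
    by apply: le_trans (HN x) _; rewrite ler_wpM2l // norm1X_le // leq_maxr.
  by apply: le_trans (IH x) _; rewrite ler_wpM2l // norm1X_le // leq_maxl.
exists (1 + M), k; split => [|x]; first by rewrite lerDl.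
rewrite mulrDl mul1r; apply: lerD; first exact: norm1X_ge1.
apply: le_trans (HM x); apply: row_norm_le; first by apply: sumr_ge0.
by move=> j; rewrite (bigD1 j) //= lerDl sumr_ge0.
Qed.

Lemma polybd_comp {n m} (Phi : 'rV[R]_m -> 'rV[R]_n) f :
  (forall j, polybd (fun x => Phi x 0 j)) -> polybd f -> polybd (fun x => f (Phi x)).
Proof.
move=> /polybd_norm[M [k [M1 HM]]] /polybdP[N [l [N0 HN]]].
have M0 : 0 <= M by exact: le_trans M1.
exists (N * M ^+ l), (k * l)%N => x; apply: le_trans (HN _) _.
rewrite -mulrA ler_wpM2l // exprM -exprMn lerXn2r ?nnegrE ?addr_ge0 //.
by rewrite mulr_ge0 // norm1X_ge0.
Qed.

Lemma moderate_comp {n m} (Phi : 'rV[R]_m -> 'rV[R]_n) f :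
  (forall j, moderate (fun x => Phi x 0 j)) -> moderate f -> moderate (fun x => f (Phi x)).
Proof.
move=> mP mf; have sP j := moderate_smooth (mP j).
split; first exact: (smooth_comp sP (moderate_smooth mf)).
move=> vs; have -> : (fun x => f (Phi x)) = fun x => 1 * f (Phi x).
  by apply/funext => x; rewrite mul1r.
apply: (@iterD_comp_class _ _ _ Phi sP moderate polybd) => //.
- by move=> h mh; split; [exact: moderate_smooth|move=> v; exact: moderate_D].
- exact: polybd_cst.
- exact: polybdD.
- move=> g h mg mh; apply: polybdM; first exact: moderate_polybd.
  by apply: polybd_comp; [move=> j; exact: moderate_polybd|exact: moderate_polybd].
- exact: moderate_cst.
Qed.

(** Decay survives composition only if Phi x goes to infinity with x; the linear lower bound is
    enough for dilations and for inversion. *)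
Lemma rapid_comp_proper {n m} (Phi : 'rV[R]_m -> 'rV[R]_n) f C : 0 <= C ->
  (forall x, `|x| <= C * `|Phi x|) -> rapid f -> rapid (fun x => f (Phi x)).
Proof.
move=> C0 HC rf l; have [M HM] := rf l; exists ((1 + C) ^+ l * M) => x.
apply: (@le_trans _ _ ((1 + C) ^+ l * ((1 + `|Phi x|) ^+ l * `|f (Phi x)|))); last first.
  by rewrite ler_wpM2l ?exprn_ge0 ?addr_ge0.
rewrite mulrA ler_wpM2r // -exprMn lerXn2r ?nnegrE ?mulr_ge0 ?addr_ge0 //.
have := HC x; have := normr_ge0 (Phi x); nra.
Qed.

Lemma schwartz_comp_proper {n m} (Phi : 'rV[R]_m -> 'rV[R]_n) f C : 0 <= C ->
  (forall j, moderate (fun x => Phi x 0 j)) -> (forall x, `|x| <= C * `|Phi x|) ->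
  schwartz f -> schwartz (fun x => f (Phi x)).
Proof.
move=> C0 mP HC mf; have sP j := moderate_smooth (mP j).
apply/schwartzP; split; first exact: (smooth_comp sP (schwartz_smooth mf)).
move=> vs; have -> : (fun x => f (Phi x)) = fun x => 1 * f (Phi x).
  by apply/funext => x; rewrite mul1r.
apply: (@iterD_comp_class _ _ _ Phi sP schwartz rapid) => //.
- by move=> h mh; split; [exact: schwartz_smooth|move=> v; exact: schwartz_D].
- exact: rapid0.
- exact: rapidD.
- move=> g h mg mh; apply: rapidM; first exact: moderate_polybd.
  by apply: rapid_comp_proper HC _ => //; exact: schwartz_rapid.
- exact: moderate_cst.
Qed.

Lemma schwartz_bounded {n} (f : 'rV[R]_n -> R) : schwartz f -> exists2 M, 0 <= M & forall x, `|f x| <= M.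
Proof.
move=> /schwartz_rapid/(_ 0%N)[M HM]; exists `|M| => // x.
by have := HM x; rewrite expr0 mul1r => /le_trans; apply; exact: ler_norm.
Qed.

Lemma is_derive_translate {W : normedModType R} (h : R -> W) (t : R) (l : W) :
  is_derive (0 : R) 1 (fun s => h (t + s)) l -> is_derive t 1 h l.
Proof.
move=> [d1 d2].
have F k : (k^-1 *: (((fun s => h (t + s)) \o shift 0) (k *: 1) - h (t + 0))) =
   k^-1 *: ((h \o shift t) (k *: 1) - h t).
  by rewrite /= !addr0 [t + _]addrC.
by apply: DeriveDef; [move: d1|move: d2]; rewrite /derivable /derive (funext F).
Qed.

End growth_composition.

(** * Invariant vector fields, the Euler field and convolution kernels on Schwartz functions *)

Section operators_real.
Context {R : realType} {d : nat}.
Variable G : stratifiedGroup R d.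
Local Notation V := 'rV[R]_d.
Local Notation mul := (gmul G).
Local Notation lie := (lie_der (gmul G)).
Implicit Types f h : V -> R.

Lemma moderate_row_mxl j : moderate (fun x : V => (row_mx x (0 : V)) 0 j).
Proof.
rewrite (_ : (fun x => _) = fun x : V => match fintype.split j with inl k => x 0 k | inr k => 0 end).
  by case: (fintype.split j) => k; [exact: moderate_coord|exact: moderate_cst].
by apply/funext => x; rewrite mxE; case: (fintype.split j) => k //; rewrite mxE.
Qed.

Lemma moderate_row_mxr j : moderate (fun x : V => (row_mx (0 : V) x) 0 j).
Proof.
rewrite (_ : (fun x => _) = fun x : V => match fintype.split j with inl k => 0 | inr k => x 0 k end).
  by case: (fintype.split j) => k; [exact: moderate_cst|exact: moderate_coord].
by apply/funext => x; rewrite mxE; case: (fintype.split j) => k //; rewrite mxE.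
Qed.

Lemma moderate_frame Z j : moderate (fun x => frame G x Z 0 j).
Proof.
rewrite (_ : (fun x => _) = fun x => ('D_(row_mx 0 Z) (fun z => gm2 G z 0 j)) (row_mx x 0)).
  apply: (@moderate_comp _ _ _ (fun x : V => row_mx x (0 : V)) ('D_(row_mx 0 Z) (fun z => gm2 G z 0 j))).
    exact: moderate_row_mxl.
  exact/moderate_D/moderate_gm2.
by apply/funext => x; rewrite /frame dLE derive_row //; exact: gm2_smooth.
Qed.

Lemma lie_sum Z f : smooth f ->
  lie Z f = fun x => \sum_j frame G x Z 0 j * 'D_(coordv j) f x.
Proof. by move=> sf; apply/funext => x; rewrite lie_derE // smooth_deriveE. Qed.

Lemma smooth_lie Z f : smooth f -> smooth (lie Z f).
Proof.
move=> sf; rewrite lie_sum //; apply: smooth_sum => j; apply: smoothM.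
  exact: smooth_frame.
exact: smooth_D.
Qed.

Lemma schwartz_lie Z f : schwartz f -> schwartz (lie Z f).
Proof.
move=> sf; rewrite lie_sum; last exact: schwartz_smooth.
apply: schwartz_sum => j; apply: schwartzM; first exact: moderate_frame.
exact: schwartz_D.
Qed.

Lemma lieM Z f h x : smooth f -> smooth h ->
  lie Z (fun y => f y * h y) x = f x * lie Z h x + h x * lie Z f x.
Proof.
move=> sf sh; rewrite !lie_derE //; last exact: smoothM.
exact: (congr1 (fun g => g x) (deriveM_smooth _ sf sh)).
Qed.

Lemma lieZ Z f c x : smooth f -> lie Z (fun y => c * f y) x = c * lie Z f x.
Proof.
move=> sf; rewrite lieM //; last exact: smooth_cst.
rewrite [lie Z (fun=> c) x]lie_derE ?derive_cst ?mulr0 ?addr0 //; exact: smooth_cst.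
Qed.

Lemma lie_scale c Z f x : smooth f -> lie (c *: Z) f x = c * lie Z f x.
Proof.
move=> sf; rewrite !lie_sum // mulr_sumr; apply: eq_bigr => j _.
by rewrite frameZ row_coordZ mulrA.
Qed.

Lemma lie_dil c Z f x : lie Z (fun y => f (dil G c y)) x = lie (dil G c Z) f (dil G c x).
Proof.
rewrite /lie_der; congr (derive1 _ _); apply/funext => t.
by rewrite dilM dilZ.
Qed.

(** The infinitesimal generator of the dilations, as a linear vector field; its weights are the
    degrees j + 1. *)
Definition euler_field x : V := \sum_(j < step G) j.+1%:R *: lpi j x.

Definition eulerD f : V -> R := fun x => derive1 (fun t : R => f (dil G t x)) 1.

Lemma is_derive_dil_fun f x (t : R) : smooth f ->
  is_derive t 1 (fun s => f (dil G s x)) ('D_(\sum_(j < step G) (j.+1%:R * t ^+ j) *: lpi j x) f (dil G t x)).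
Proof. by move=> sf; exact: (is_derive_curve sf (is_derive_dil G t x)). Qed.

Lemma eulerDE f x : smooth f -> eulerD f x = 'D_(euler_field x) f x.
Proof.
move=> sf; rewrite /eulerD derive1E; have [_ ->] := is_derive_dil_fun x 1 sf.
rewrite dil1; congr (derive f x _); apply: eq_bigr => j _.
by rewrite expr1n mulr1.
Qed.

Lemma derive_dil_euler f x (t : R) : smooth f -> t != 0 ->
  is_derive t 1 (fun s => f (dil G s x)) (t^-1 * eulerD f (dil G t x)).
Proof.
move=> sf t0; apply: is_derive_eq (is_derive_dil_fun x t sf) _.
rewrite eulerDE // !smooth_deriveE // mulr_sumr; apply: eq_bigr => k _.
rewrite mulrA; congr (_ * _); rewrite /euler_field !summxE mulr_sumr; apply: eq_bigr => j _.
rewrite lpi_dil !row_coordZ mulrCA -!mulrA; congr (_ * _).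
by rewrite exprS -mulrA [RHS]mulrA mulVf // mul1r.
Qed.

Lemma euler_field_linear : linear euler_field.
Proof.
move=> a x y; rewrite /euler_field scaler_sumr -big_split; apply: eq_bigr => j _ /=.
by rewrite linearP scalerDr !scalerA mulrC.
Qed.

Definition euler_lin : {linear V -> V} :=
  HB.pack euler_field (GRing.isLinear.Build _ _ _ _ euler_field euler_field_linear).

Lemma moderate_euler_field j : moderate (fun x => euler_field x 0 j).
Proof. exact: (linear_row_smooth euler_lin). Qed.

Lemma eulerD_sum f : smooth f ->
  eulerD f = fun x => \sum_j euler_field x 0 j * 'D_(coordv j) f x.
Proof. by move=> sf; apply/funext => x; rewrite eulerDE // smooth_deriveE. Qed.

Lemma schwartz_euler f : schwartz f -> schwartz (eulerD f).
Proof.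
move=> sf; rewrite eulerD_sum; last exact: schwartz_smooth.
apply: schwartz_sum => j; apply: schwartzM; first exact: moderate_euler_field.
exact: schwartz_D.
Qed.

Lemma eulerD_M f h x : smooth f -> smooth h ->
  eulerD (fun y => f y * h y) x = f x * eulerD h x + h x * eulerD f x.
Proof.
move=> sf sh; rewrite !eulerDE //; last exact: smoothM.
exact: (congr1 (fun g => g x) (deriveM_smooth _ sf sh)).
Qed.

Lemma moderate_dil c j : moderate (fun x => dil G c x 0 j).
Proof. exact: (linear_row_smooth (dill G c)). Qed.

Lemma schwartz_dil c f : c != 0 -> schwartz f -> schwartz (fun x => f (dil G c x)).
Proof.
move=> c0 sf; have [C C0 HC] := linear_row_bound (dill G c^-1).
apply: (@schwartz_comp_proper _ _ _ (dil G c) f C) => //; first exact: ltW.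
  exact: moderate_dil.
by move=> x; have := HC (dil G c x); rewrite /= dilK.
Qed.

Lemma schwartz_opp f : schwartz f -> schwartz (fun x => f (- x)).
Proof.
move=> sf; apply: (@schwartz_comp_proper _ _ _ (fun x : V => - x) f 1) => //.
  move=> j; rewrite (_ : (fun x => _) = fun x : V => -1 * x 0 j).
    by apply: moderateM; [exact: moderate_cst|exact: moderate_coord].
  by apply/funext => x; rewrite row_coordN mulN1r.
by move=> x; rewrite normrN mul1r.
Qed.

(** The derivative of s -> f(exp(s z) y) is a right invariant field applied to f. Its coefficients
    are moderate, so the functions [b j k] are Schwartz and hence bounded, which makes the constant
    uniform in the base point. *)
Lemma right_lipschitz f : schwartz f ->
  exists2 C, 0 <= C & forall z x, `|f (mul z x) - f x| <= C * `|z|.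
Proof.
move=> sf; have smf := schwartz_smooth sf.
pose e k : 'rV[R]_(d + d) := row_mx (coordv k) 0.
pose b j k y := 'D_(e k) (fun z => gm2 G z 0 j) (row_mx 0 y) * 'D_(coordv j) f y.
have sb j k : schwartz (b j k).
  apply: schwartzM; last exact: schwartz_D.
  apply: (@moderate_comp _ _ _ (fun x : V => row_mx (0 : V) x) ('D_(e k) (fun z => gm2 G z 0 j))).
    exact: moderate_row_mxr.
  exact/moderate_D/moderate_gm2.
have /choice[M HM] jk : exists M, 0 <= M /\ forall y, `|b jk.1 jk.2 y| <= M.
  by have [M M0 HM] := schwartz_bounded (sb jk.1 jk.2); exists M.
exists (\sum_j \sum_k M (j, k)) => [|z x].
  by apply: sumr_ge0 => j _; apply: sumr_ge0 => k _; have [] := HM (j, k).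
pose l y := \sum_j \sum_k z 0 k * b j k y.
have D (t : R) : is_derive t 1 (fun s : R => f (mul (s *: z) x)) (l (mul (t *: z) x)).
  apply: is_derive_translate.
  rewrite (_ : (fun s => _) = f \o (fun s : R => mul (s *: z) (mul (t *: z) x))); last first.
    by apply/funext => s /=; rewrite gmulA gmul_exp [t + s]addrC.
  set y := mul (t *: z) x.
  have dm := is_derive_gmul G (is_derive_scale z 0) (is_derive_cst y _ _).
  apply: is_derive_eq (is_derive_curve smf dm) _.
  rewrite scale0r gmul0g smooth_deriveE // /l; apply: eq_bigr => j _.
  rewrite derive_row; last exact: gm2_smooth.
  rewrite smooth_deriveE; last exact: gm2_smooth.
  rewrite big_split_ord /= [X in _ + X]big1 ?addr0 => [|k _]; last by rewrite row_mxEr mxE mul0r.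
  rewrite mulr_suml; apply: eq_bigr => k _; rewrite row_mxEl -mulrA; congr (_ * (_ * _)).
  suff -> : coordv (lshift d k) = e k by [].
  apply/rowP => i; rewrite !mxE eqxx /=.
  case: splitP => i' ii'; rewrite !mxE ?eqxx /=; first by rewrite -val_eqE /= ii'.
  by rewrite -val_eqE /= ii' gtn_eqF // (leq_trans (ltn_ord k)) // leq_addr.
have [|c _] := @MVT_segment R (fun s : R => f (mul (s *: z) x)) (fun t => l (mul (t *: z) x)) 0 1 ler01 (fun c _ => D c).
  apply: continuous_subspaceT => t; apply: differentiable_continuous; apply/derivable1_diffP.
  by have [] := D t.
rewrite subr0 mulr1 scale1r scale0r gmul0g => ->.
rewrite /l mulr_suml; apply: le_trans (ler_norm_sum _ _ _) _; apply: ler_sum => j _.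
rewrite mulr_suml; apply: le_trans (ler_norm_sum _ _ _) _; apply: ler_sum => k _.
rewrite normrM mulrC; apply: ler_pM => //; last exact: row_norm_coord.
by have [_] := HM (j, k); exact.
Qed.

(* Kernels [h (x, g)], encoded on the concatenation [row_mx x g], that decay
   rapidly in [x] up to a polynomial loss in [g]. *)
Definition kbd (h : 'rV[R]_(d + d) -> R) := forall m, exists M k, 0 <= M /\
  forall x g : V, (1 + `|x|) ^+ m * `|h (row_mx x g)| <= M * (1 + `|g|) ^+ k.

Definition kern (h : 'rV[R]_(d + d) -> R) := smooth h /\ forall vs, kbd (iterD vs h).

Lemma kern_D (h : 'rV[R]_(d + d) -> R) v : kern h -> kern ('D_v h).
Proof.
move=> [sh bh]; split; first exact: smooth_D.
by move=> vs; rewrite -iterD_rcons.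
Qed.

Lemma kern_kbd (h : 'rV[R]_(d + d) -> R) : kern h -> kbd h.
Proof. by move=> [_ /(_ [::])]. Qed.

Lemma kbdD (h h' : 'rV[R]_(d + d) -> R) : kbd h -> kbd h' -> kbd (fun z => h z + h' z).
Proof.
move=> bh bh' m; have [M [k [M0 HM]]] := bh m; have [M' [k' [M'0 HM']]] := bh' m.
exists (M + M'), (maxn k k'); split => [|x g]; first exact: addr_ge0.
apply: (@le_trans _ _ ((1 + `|x|) ^+ m * `|h (row_mx x g)| + (1 + `|x|) ^+ m * `|h' (row_mx x g)|)).
  by rewrite -mulrDr ler_wpM2l ?norm1X_ge0 // ler_normD.
rewrite mulrDl lerD //.
  by apply: le_trans (HM x g) _; rewrite ler_wpM2l // norm1X_le // leq_maxl.
by apply: le_trans (HM' x g) _; rewrite ler_wpM2l // norm1X_le // leq_maxr.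
Qed.

Definition convmap (z : 'rV[R]_(d + d)) : V := mul (lsubmx z) (- rsubmx z).

Lemma convmapE x g : convmap (row_mx x g) = mul x (- g).
Proof. by rewrite /convmap row_mxKl row_mxKr. Qed.

Lemma moderate_convmap j : moderate (fun z => convmap z 0 j).
Proof.
rewrite (_ : (fun z => _) = fun z => gm2 G (row_mx (lsubmx z) (- rsubmx z)) 0 j).
  apply: (@moderate_comp _ _ _ (fun z : 'rV[R]_(d + d) => row_mx (lsubmx z) (- rsubmx z))
    (fun z => gm2 G z 0 j)); last exact: moderate_gm2.
  move=> i; rewrite (_ : (fun z => _) = fun z : 'rV[R]_(d + d) =>
      match fintype.split i with inl k => z 0 (lshift d k) | inr k => -1 * z 0 (rshift d k) end).
    case: (fintype.split i) => k; first exact: moderate_coord.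
    by apply: moderateM; [exact: moderate_cst|exact: moderate_coord].
  by apply/funext => z; rewrite mxE; case: (fintype.split i) => k; rewrite !mxE // mulN1r.
by apply/funext => z; rewrite gm2E.
Qed.

Lemma norm1_row_mx (x g : V) : 1 + `|row_mx x g| <= (1 + `|x|) * (1 + `|g|).
Proof.
have : `|row_mx x g| <= `|x| + `|g|.
  by apply: norm_row_mx; [exact: addr_ge0|rewrite lerDl|rewrite lerDr].
have := normr_ge0 x; have := normr_ge0 g; nra.
Qed.

(** With y = x g^-1, hence x = y g, the size of x is polynomially controlled by those of y and g:
    decay of f at y becomes decay in x at the price of a power of 1 + |g|. *)
Lemma kern_conv f : schwartz f -> kern (fun z => f (convmap z)).
Proof.
move=> sf; have sP j := moderate_smooth (moderate_convmap j).
split; first exact: (smooth_comp sP (schwartz_smooth sf)).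
move=> vs; have -> : (fun x => f (convmap x)) = fun x => 1 * f (convmap x).
  by apply/funext => x; rewrite mul1r.
apply: (@iterD_comp_class _ _ _ convmap sP schwartz kbd) => //; first exact: moderate_convmap.
- by move=> h mh; split; [exact: schwartz_smooth|move=> v; exact: schwartz_D].
- by move=> m; exists 0, 0%N; split => // x g; rewrite normr0 mulr0 mul0r.
- exact: kbdD.
- move=> c h mc sh m.
  have [A [a [A1 HA]]] := polybd_norm (fun j => moderate_polybd (moderate_gm2 G j)).
  have A0 : 0 <= A by exact: le_trans A1.
  have /polybdP[B [b [B0 HB]]] := moderate_polybd mc.
  (* The exponent pays for the weight m and for the growth b of the factor c, both converted from x
     to y at the rate a of the group law. *)
  have [C HC] := schwartz_rapid sh (a * (m + b))%N.
  have C0 : 0 <= C by apply: le_trans (HC 0); rewrite mulr_ge0 ?norm1X_ge0.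
  exists (B * A ^+ (m + b) * C), (b + a * (m + b))%N.
  split => [|x g]; first by rewrite !mulr_ge0 ?exprn_ge0.
  rewrite convmapE normrM; set y := mul x (- g).
  have xy : 1 + `|x| <= A * ((1 + `|y|) * (1 + `|g|)) ^+ a.
    have := HA (row_mx y g); rewrite gm2E /y gmulgVK => /le_trans; apply.
    by rewrite ler_wpM2l // lerXn2r ?nnegrE ?mulr_ge0 ?addr_ge0 // norm1_row_mx.
  have cB : `|c (row_mx x g)| <= B * ((1 + `|x|) ^+ b * (1 + `|g|) ^+ b).
    apply: le_trans (HB _) _; rewrite ler_wpM2l // -exprMn.
    by rewrite lerXn2r ?nnegrE ?mulr_ge0 ?addr_ge0 // norm1_row_mx.
  apply: (@le_trans _ _ ((1 + `|x|) ^+ m * (B * ((1 + `|x|) ^+ b * (1 + `|g|) ^+ b) * `|h y|))).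
    by rewrite ler_wpM2l ?norm1X_ge0 // ler_wpM2r.
  have -> : (1 + `|x|) ^+ m * (B * ((1 + `|x|) ^+ b * (1 + `|g|) ^+ b) * `|h y|) =
     B * (1 + `|g|) ^+ b * ((1 + `|x|) ^+ (m + b) * `|h y|) by rewrite exprD; ring.
  have xmb : (1 + `|x|) ^+ (m + b) <= A ^+ (m + b) *
      ((1 + `|y|) ^+ (a * (m + b)) * (1 + `|g|) ^+ (a * (m + b))).
    rewrite -exprMn exprM -exprMn lerXn2r ?nnegrE ?addr_ge0 //.
    by rewrite mulr_ge0 // exprn_ge0 // mulr_ge0 // addr_ge0.
  apply: (@le_trans _ _ (B * (1 + `|g|) ^+ b * (A ^+ (m + b) *
      ((1 + `|y|) ^+ (a * (m + b)) * (1 + `|g|) ^+ (a * (m + b))) * `|h y|))).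
    rewrite ler_wpM2l ?mulr_ge0 ?norm1X_ge0 //; rewrite ler_wpM2r //.
  have -> : B * (1 + `|g|) ^+ b * (A ^+ (m + b) *
      ((1 + `|y|) ^+ (a * (m + b)) * (1 + `|g|) ^+ (a * (m + b))) * `|h y|) =
    B * A ^+ (m + b) * ((1 + `|y|) ^+ (a * (m + b)) * `|h y|) * (1 + `|g|) ^+ (b + a * (m + b)).
    by rewrite [(1 + `|g|) ^+ (b + _)]exprD; ring.
  by rewrite ler_wpM2r ?norm1X_ge0 // ler_wpM2l // mulr_ge0 // exprn_ge0.
- exact: moderate_cst.
Qed.

End operators_real.

(** * Borel measures on row vectors *)

Section borel.
Context {R : realType}.

Lemma borel_open {n} (A : set 'rV[R]_n) : open A -> measurable (A : set (borelV R n)).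
Proof. by move=> oA; exact: sub_sigma_algebra. Qed.

Lemma borel_closed {n} (A : set 'rV[R]_n) : closed A -> measurable (A : set (borelV R n)).
Proof.
by move=> /closed_openC/borel_open/measurableC; rewrite setCK.
Qed.

Lemma borel_measurable_fun {disp} {T : measurableType disp} {n} (F : T -> borelV R n) :
  (forall A : set 'rV[R]_n, open A -> measurable (F @^-1` A)) -> measurable_fun setT F.
Proof.
move=> H; apply: (@measurability _ _ T (borelV R n) setT F (@open 'rV[R]_n) erefl) => _ [A oA <-].
by rewrite setTI; exact: H.
Qed.

Lemma continuous_measurable_row {m n} (F : 'rV[R]_m -> 'rV[R]_n) : continuous F ->
  measurable_fun setT (F : borelV R m -> borelV R n).
Proof.
move=> cF; apply: borel_measurable_fun => A oA; apply: borel_open.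
by apply: open_comp => // x _; exact: cF.
Qed.

Lemma continuous_measurable {n} (f : 'rV[R]_n -> R) : continuous f ->
  measurable_fun setT (f : borelV R n -> R).
Proof.
move=> cf; apply: (measurability (RGenOInfty.G (R := R))); first exact: RGenOInfty.measurableE.
move=> _ [_ [a ->] <-]; rewrite setTI; apply: borel_open.
apply: open_comp => [x _|]; first exact: cf.
exact: interval_open.
Qed.

Definition ratrow {n} (q : 'rV[rat]_n) : 'rV[R]_n := map_mx ratr q.

Lemma ratrow_dense {n} (x : 'rV[R]_n) e : 0 < e -> exists q, `|x - ratrow q| < e.
Proof.
move=> e0; have /choice[q qP] j : exists q : rat, `|x 0 j - ratr q| < e / 2.
  have [|q] := @rat_in_itvoo R (x 0 j - e / 2) (x 0 j + e / 2).
    by rewrite ltrBlDr -addrA ltrDl -splitr.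
  rewrite in_itv /= => /andP[q1 q2]; exists q; rewrite ltr_norml; apply/andP; split; lra.
exists (\row_j q j); apply: (@le_lt_trans _ _ (e / 2)); last by rewrite ltr_pdivrMr // ltr_pMr // ltr1n.
apply: row_norm_le; first by rewrite divr_ge0 // ltW.
by move=> j; rewrite row_coordB !mxE; exact/ltW/qP.
Qed.

Lemma open_ballP {n} (A : set 'rV[R]_n) x : open A -> A x ->
  exists2 e, 0 < e & forall y, `|y - x| < e -> A y.
Proof.
move=> oA Ax; have : nbhs x A by rewrite nbhsE; exists A.
move=> /nbhs_ballP[e e0 eA]; exists e => // y yx; apply: eA.
by rewrite -ball_normE /= distrC.
Qed.

Lemma continuous_dist {V : normedModType R} (x : V) : continuous (fun y => `|y - x|).
Proof.
move=> y; apply: (@continuous_comp _ _ _ (fun y : V => y - x) (fun z => `|z|)).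
  by apply: cvgB; [exact: cvg_id|exact: cvg_cst].
exact: norm_continuous.
Qed.

Lemma borel_ball {n} (x : 'rV[R]_n) e : measurable ([set y | `|y - x| < e] : set (borelV R n)).
Proof.
have := @continuous_measurable n (fun y => `|y - x|) (@continuous_dist _ x).
move=> /(_ measurableT `]-oo, e[%classic (measurable_itv _)); rewrite setTI.
by congr measurable; apply/seteqP; split => y /=; rewrite in_itv.
Qed.

Lemma ball_inv_nat (e : R) : 0 < e -> exists k : nat, k.+1%:R^-1 < e.
Proof.
move=> e0; have [k] := ltr_add_invr e0; rewrite add0r => ke.
by exists k.
Qed.

(** Compares the product sigma-algebra, in which Fubini's theorem lives, with the Borel one: an open
    set is the countable union of the rational boxes that it contains. *)
Lemma measurable_row_mx {m n} :
  measurable_fun setT (fun xy : borelV R m * borelV R n => row_mx xy.1 xy.2 : borelV R (m + n)).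
Proof.
apply: borel_measurable_fun => O oO.
pose I := ('rV[rat]_m * 'rV[rat]_n * nat)%type.
pose B (i : I) : set (borelV R m * borelV R n) :=
  [set x | `|x - ratrow i.1.1| < i.2.+1%:R^-1] `*` [set y | `|y - ratrow i.1.2| < i.2.+1%:R^-1].
pose F (i : I) := if `[< B i `<=` (fun xy => O (row_mx xy.1 xy.2)) >] then B i else set0.
rewrite (_ : _ @^-1` O = \bigcup_i F i).
  apply: countable_bigcupT_measurable; first exact: countableP.
  move=> i; rewrite /F; case: asboolP => _; last exact: measurable0.
  by apply: measurableX; exact: borel_ball.
apply/seteqP; split => [[x y] /= Oxy|[x y] [i _]]; last first.
  by rewrite /F; case: asboolP => // H /H.
have [e e0 He] := open_ballP oO Oxy.
have [k ke] : exists k : nat, k.+1%:R^-1 < e / 2 by apply: ball_inv_nat; rewrite divr_gt0.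
have k0 : (0 : R) < k.+1%:R^-1 by rewrite invr_gt0.
have [q xq] := ratrow_dense x k0; have [r yr] := ratrow_dense y k0.
exists (q, r, k) => //; rewrite /F; case: asboolP => [_|]; first by split.
move=> H; exfalso; apply: H => -[x' y'] [/= x'q y'r]; apply: He.
rewrite opp_row_mx add_row_mx.
have tri p (a b c : 'rV[R]_p) : `|a - c| < k.+1%:R^-1 -> `|b - c| < k.+1%:R^-1 -> `|a - b| < e.
  move=> ac bc; rewrite -(subrKA c) (splitr e); apply: le_lt_trans (ler_normD _ _) _.
  by rewrite ltrD //; [exact: lt_trans ke|rewrite distrC; exact: lt_trans ke].
have h1 := tri _ _ _ _ x'q xq; have h2 := tri _ _ _ _ y'r yr.
have : `|row_mx (x' - x) (y' - y)| <= Num.max `|x' - x| `|y' - y|.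
  apply: row_norm_le; first by rewrite le_max normr_ge0.
  move=> j; rewrite mxE; case: (fintype.split j) => l; rewrite le_max row_norm_coord ?orbT //.
by move=> /le_lt_trans; apply; rewrite gt_max h1 h2.
Qed.

End borel.

Section change_of_variables.
Context {disp : measure_display} {T : measurableType disp} {R : realType}.
Variable mu : {measure set T -> \bar R}.
Local Open Scope ereal_scope.

Lemma ge0_integral_scaled (phi : T -> T) (c : {nonneg R}) (f : T -> \bar R) :
  measurable_fun setT phi ->
  (forall A, measurable A -> mu (phi @^-1` A) = c%:num%:E * mu A) ->
  measurable_fun setT f -> (forall x, 0 <= f x) ->
  \int[mu]_x f (phi x) = c%:num%:E * \int[mu]_x f x.
Proof.
move=> mphi muphi mf f0.
have := @ge0_integral_pushforward _ _ _ _ _ phi mphi mu setT f measurableT mf (fun x _ => f0 x).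
rewrite preimage_setT => <-.
rewrite -ge0_integral_mscale //; apply: eq_measure_integral => A mA _.
by rewrite /= /pushforward muphi.
Qed.

Lemma ge0_integral_invariant (phi : T -> T) (f : T -> \bar R) :
  measurable_fun setT phi ->
  (forall A, measurable A -> mu (phi @^-1` A) = mu A) ->
  measurable_fun setT f -> (forall x, 0 <= f x) ->
  \int[mu]_x f (phi x) = \int[mu]_x f x.
Proof.
move=> mphi muphi mf f0; rewrite (@ge0_integral_scaled phi (1%:nng)%R) ?mul1e //.
by move=> A mA; rewrite mul1e muphi.
Qed.

Lemma integrable_scaled (phi : T -> T) (c : {nonneg R}) (f : T -> R) :
  measurable_fun setT phi ->
  (forall A, measurable A -> mu (phi @^-1` A) = c%:num%:E * mu A) ->
  mu.-integrable setT (EFin \o f) -> mu.-integrable setT (EFin \o (f \o phi)).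
Proof.
move=> mphi muphi /integrableP[mf foo]; apply/integrableP; split.
  exact: (measurableT_comp (f := EFin \o f) mf mphi).
rewrite (@ge0_integral_scaled phi c (fun x => `|(f x)%:E|)) //.
- by rewrite lte_mul_pinfty.
- exact: measurableT_comp.
Qed.

Lemma integral_scaled (phi : T -> T) (c : {nonneg R}) (f : T -> R) :
  measurable_fun setT phi ->
  (forall A, measurable A -> mu (phi @^-1` A) = c%:num%:E * mu A) ->
  mu.-integrable setT (EFin \o f) ->
  (\int[mu]_x f (phi x) = c%:num * \int[mu]_x f x)%R.
Proof.
move=> mphi muphi fi; have /integrableP[mf _] := fi.
rewrite /Rintegral integralE [in RHS]integralE.
have Ep : \int[mu]_x (fun x => (f (phi x))%:E)^\+ x = c%:num%:E * \int[mu]_x (EFin \o f)^\+ x.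
  rewrite -(@ge0_integral_scaled phi c (EFin \o f)^\+ mphi muphi (measurable_funepos mf)) //.
  by apply: eq_integral => x _; rewrite !funeposE.
have En : \int[mu]_x (fun x => (f (phi x))%:E)^\- x = c%:num%:E * \int[mu]_x (EFin \o f)^\- x.
  rewrite -(@ge0_integral_scaled phi c (EFin \o f)^\- mphi muphi (measurable_funeneg mf)) //.
  by apply: eq_integral => x _; rewrite !funenegE.
rewrite Ep En.
have fp : \int[mu]_x (EFin \o f)^\+ x \is a fin_num.
  by have := integrable_pos_fin_num measurableT fi.
have fn : \int[mu]_x (EFin \o f)^\- x \is a fin_num.
  by have := integrable_neg_fin_num measurableT fi.
rewrite -[X in c%:num%:E * X - _](fineK fp) -[X in _ - c%:num%:E * X](fineK fn).
rewrite -!EFinM -EFinB /= -mulrBr; congr (_ * _)%R; apply/esym; exact: (fineB fp fn).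
Qed.

End change_of_variables.

Section measure_structures.
Context {disp : measure_display} {T : measurableType disp} {R : realType}.

(** The theorem is about bare measures. Equality with a measure carrying the structure lets one
    rewrite once and then use Tonelli's theorem; [probability_of] plays the same role for nu. *)
Lemma sigma_finite_measure_of (mu : {measure set T -> \bar R}) : sigma_finite setT mu ->
  exists m : {sigma_finite_measure set T -> \bar R}, mu = m :> {measure set T -> \bar R}.
Proof.
move=> sf.
pose H2 := isSFinite.Build _ _ _ _ (sfinite_measure_sigma_finite sf).
pose H3 := isSigmaFinite.Build _ _ _ _ sf.
pose m := HB.pack_for (SigmaFiniteMeasure.type T R) (Measure.sort mu) H2 H3.
by exists m; exact: eq_measure.
Qed.

Lemma pushforward_of {disp'} {T' : measurableType disp'} (mu : {measure set T -> \bar R}) (phi : T -> T') :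
  measurable_fun setT phi ->
  exists l : {measure set T' -> \bar R}, forall A, l A = mu (phi @^-1` A).
Proof.
move=> mphi.
by exists (measure_function_pushforward__canonical__measure_function_Measure mu mphi).
Qed.

Lemma probability_of (mu : {measure set T -> \bar R}) : mu setT = 1%E ->
  exists m : probability T R, mu = m :> {measure set T -> \bar R}.
Proof.
move=> mu1.
have fin : fin_num_fun mu by apply: lty_fin_num_fun; rewrite mu1 ltry.
have sf : sigma_finite setT mu by apply: fin_num_fun_sigma_finite => //; rewrite measure0.
pose H1 := isFinite.Build _ _ _ _ fin.
pose H2 := isSFinite.Build _ _ _ _ (sfinite_measure_sigma_finite sf).
pose H3 := isSigmaFinite.Build _ _ _ _ sf.
have mu1' : (mu setT <= 1)%E by rewrite mu1.
pose H4 := isSubProbability.Build _ _ _ _ mu1'.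
pose H5 := isProbability.Build _ _ _ _ mu1.
pose m := HB.pack_for (Probability.type T R) (Measure.sort mu) H1 H2 H3 H4 H5.
by exists m; exact: eq_measure.
Qed.

End measure_structures.

(** * The Haar measure: sigma-finiteness, inversion and dilations *)

Section haar_sigma_finite.
Context {R : realType} {d : nat}.
Variable G : stratifiedGroup R d.
Local Notation V := 'rV[R]_d.
Local Notation T := (borelV R d).
Local Notation mul := (gmul G).
Variable mu : {measure set (borelV R d) -> \bar R}.
Hypothesis haar_mu : haar_measure G mu.

Lemma continuous_gmull g : continuous (mul g).
Proof.
apply: continuous_row => j.
rewrite (_ : (fun x => _) = (fun z => gm2 G z 0 j) \o (fun x => row_mx g x)).
  apply: smooth_comp; last exact: gm2_smooth.
  move=> i; rewrite (_ : (fun x => _) = fun x : V => match fintype.split i with inl k => g 0 k | inr k => x 0 k end).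
    by case: (fintype.split i) => k; [exact: smooth_cst|exact: smooth_coord].
  by apply/funext => x; rewrite mxE.
by apply/funext => x /=; rewrite gm2E.
Qed.

Lemma continuous_gmulr g : continuous (mul^~ g).
Proof.
apply: continuous_row => j.
rewrite (_ : (fun x => _) = (fun z => gm2 G z 0 j) \o (fun x => row_mx x g)).
  apply: smooth_comp; last exact: gm2_smooth.
  move=> i; rewrite (_ : (fun x => _) = fun x : V => match fintype.split i with inl k => x 0 k | inr k => g 0 k end).
    by case: (fintype.split i) => k; [exact: smooth_coord|exact: smooth_cst].
  by apply/funext => x; rewrite mxE.
by apply/funext => x /=; rewrite gm2E.
Qed.

Lemma continuous_gm2 : continuous (gm2 G).
Proof. by apply: continuous_row => j; exact: gm2_smooth. Qed.

Lemma continuous_oppr : continuous (fun x : V => - x).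
Proof.
apply: continuous_row => j; rewrite (_ : (fun x => _) = fun x : V => - x 0 j).
  by apply: smoothN; exact: smooth_coord.
by apply/funext => x; rewrite row_coordN.
Qed.

Lemma measurable_gmul2 : measurable_fun setT (fun xy : T * T => mul xy.1 xy.2 : T).
Proof.
have := measurableT_comp (continuous_measurable_row continuous_gm2) (@measurable_row_mx R d d).
by rewrite (_ : _ \o _ = fun xy : T * T => mul xy.1 xy.2 : T) //; apply/funext => xy /=; rewrite gm2E.
Qed.

Lemma measurable_gmul {disp} {S : measurableType disp} (a b : S -> T) :
  measurable_fun setT a -> measurable_fun setT b -> measurable_fun setT (fun s => mul (a s) (b s) : T).
Proof.
move=> ma mb.
exact: (measurableT_comp measurable_gmul2 (measurable_fun_pair ma mb)).
Qed.

Lemma measurable_opp_row : measurable_fun setT (fun x : T => - x : T).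
Proof. exact: (continuous_measurable_row continuous_oppr). Qed.

Lemma mu_bounded (A : set T) r : measurable A -> (forall x : V, A x -> `|x| <= r) -> (mu A < +oo)%E.
Proof.
move=> mA Ar; have [_ _ H _] := haar_mu.
have := H _ (@compact_closed_ball R d r); apply: le_lt_trans; apply: le_measure; rewrite ?inE //.
by apply: borel_closed; apply: compact_closed; [exact: norm_hausdorff|exact: compact_closed_ball].
Qed.

Lemma row_ball_cover : setT = \bigcup_(k : nat) [set x : T | `|x - 0| < k%:R].
Proof.
apply/esym/seteqP; split => // x _.
have [k _ xk] : exists2 k : nat, true & `|x : V| < k%:R.
  by exists (Num.truncn `|x : V|).+1 => //; exact: truncnS_gt.
by exists k => //=; rewrite subr0.
Qed.

Lemma mu_sigma_finite : sigma_finite setT mu.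
Proof.
exists (fun k : nat => [set x : T | `|x - 0| < k%:R]) => [|k]; first exact: row_ball_cover.
split; first exact: borel_ball.
apply: (@mu_bounded _ k%:R); first exact: borel_ball.
by move=> x /=; rewrite subr0 => /ltW.
Qed.

End haar_sigma_finite.

Section haar.
Context {R : realType} {d : nat}.
Variable G : stratifiedGroup R d.
Local Notation V := 'rV[R]_d.
Local Notation T := (borelV R d).
Local Notation mul := (gmul G).
Variable mu : {sigma_finite_measure set (borelV R d) -> \bar R}.
Hypothesis haar_mu : haar_measure G mu.

Lemma haar_left g A : measurable A -> mu ((mul g : T -> T) @^-1` A) = mu A.
Proof. by have [H _ _ _] := haar_mu; exact: H. Qed.

Lemma haar_right g A : measurable A -> mu ((mul^~ g : T -> T) @^-1` A) = mu A.
Proof. by have [_ H _ _] := haar_mu; exact: H. Qed.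

Lemma measurable_gmull g : measurable_fun setT (mul g : T -> T).
Proof. exact: (continuous_measurable_row (@continuous_gmull _ _ G g)). Qed.

Lemma measurable_gmulr g : measurable_fun setT (mul^~ g : T -> T).
Proof. exact: (continuous_measurable_row (@continuous_gmulr _ _ G g)). Qed.

Lemma measurable_dil t : measurable_fun setT (dil G t : T -> T).
Proof. exact: (continuous_measurable_row (@linear_row_continuous _ _ _ (dill G t))). Qed.

(** If the ball were null, so would be its left translates by rational points; these are countably
    many and cover the group, against [mu setT <> 0]. *)
Lemma mu_ball_gt0 (e : R) : 0 < e -> (0 < mu [set x : T | (`|x - 0| < e)%R])%E.
Proof.
move=> e0; rewrite lt0e measure_ge0 andbT; apply/eqP => mu0.
have [_ _ _] := haar_mu; apply.
pose F (q : 'rV[rat]_d) : set T := (mul (- ratrow q) : T -> T) @^-1` [set x : T | `|x - 0| < e].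
have mF q : measurable (F q).
  by have := measurable_gmull (- ratrow q) measurableT (borel_ball 0 e); rewrite setTI.
have muF q : mu (F q) = 0%E by rewrite /F haar_left //; exact: borel_ball.
have cov (x : T) : exists q, F q x.
  have cx : continuous (fun y : V => `|mul (- y) x|).
    move=> y; apply: continuous_comp; last exact: norm_continuous.
    exact: (continuous_comp (@continuous_oppr _ _ y) (@continuous_gmulr _ _ G x _)).
  have e20 : 0 < e / 2 by rewrite divr_gt0.
  have [r r0 Hr] := @continuous_family R V 'I_1 (fun=> fun y : V => `|mul (- y) x|) x (e / 2) (fun=> cx) e20.
  have [q xq] := ratrow_dense x r0; exists q.
  have := Hr (ratrow q); rewrite distrC => /(_ xq ord0); rewrite gmulNg normr0 subr0 normr_id.
  by rewrite /F /= subr0 => /le_lt_trans; apply; rewrite ltr_pdivrMr // ltr_pMr // ltr1n.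
pose F' (k : nat) : set T := if unpickle k is Some q then F q else set0.
have : mu.-negligible (\bigcup_k F' k).
  apply: negligible_bigcup => k; rewrite /F'; case: (unpickle k) => [q|]; last exact: negligible_set0.
  by apply/negligibleP; [exact: mF|exact: muF].
rewrite (_ : \bigcup_k F' k = setT); first by move=> /negligibleP; exact.
apply/seteqP; split => // x _; have [q Fq] := cov x.
by exists (pickle q) => //; rewrite /F' pickleK.
Qed.

Lemma mu_ball_fin (e : R) : (mu [set x : T | (`|x - 0| < e)%R] < +oo)%E.
Proof.
apply: (@mu_bounded _ _ _ _ haar_mu _ e); first exact: borel_ball.
by move=> x /=; rewrite subr0 => /ltW.
Qed.

(* The uniqueness of the Haar measure, in the form of an exchange formula. *)
Lemma haar_exchange (l : {sigma_finite_measure set (borelV R d) -> \bar R}) (f g : T -> \bar R) :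
  (forall y A, measurable A -> l ((mul y : T -> T) @^-1` A) = l A) ->
  (forall y A, measurable A -> l ((mul^~ y : T -> T) @^-1` A) = l A) ->
  measurable_fun setT f -> measurable_fun setT g ->
  (forall x, 0 <= f x)%E -> (forall x, 0 <= g x)%E ->
  (\int[mu]_x f x * \int[l]_y g y = \int[mu]_x g x * \int[l]_y f (- y)%R)%E.
Proof.
move=> lL lR mf mg f0 g0.
have mf1 : measurable_fun setT (fun xy : T * T => f xy.1) by exact: measurableT_comp.
have mg1 : measurable_fun setT (fun xy : T * T => g xy.1) by exact: measurableT_comp.
have mgm : measurable_fun setT (fun xy : T * T => g (mul xy.2 xy.1)).
  exact: (measurableT_comp mg (measurable_gmul G (measurable_snd) (measurable_fst))).
have mNsnd : measurable_fun setT (fun xy : T * T => - xy.2 : T).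
  exact: (measurableT_comp measurable_opp_row (measurable_snd)).
have mfm : measurable_fun setT (fun xy : T * T => f (mul (- xy.2)%R xy.1)).
  exact: (measurableT_comp mf (measurable_gmul G mNsnd (measurable_fst))).
(* Three translations separated by Tonelli: y to y x in l, then x to y^-1 x in mu, and finally y to
   x^-1 y in l applied to f(y^-1). *)
transitivity (\int[mu]_x (f x * \int[l]_y g (mul y x)))%E.
  rewrite -(@ge0_integralZr _ _ _ mu setT measurableT f mf _ (fun x _ => f0 x)); last by apply: integral_ge0.
  apply: eq_integral => x _; congr (_ * _)%E.
  by rewrite (ge0_integral_invariant (measurable_gmulr x) (lR x) mg g0).
transitivity (\int[mu]_x (\int[l]_y (f x * g (mul y x))))%E.
  apply: eq_integral => x _.
  by rewrite (@ge0_integralZl _ _ _ l setT measurableT _ (measurableT_comp mg (measurable_gmulr x)) _ (fun y _ => g0 _) (f0 x)).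
rewrite (@fubini_tonelli _ _ _ _ _ mu l (fun xy => f xy.1 * g (mul xy.2 xy.1))%E); last 2 first.
- exact: emeasurable_funM.
- by move=> xy; exact: mule_ge0.
transitivity (\int[l]_y (\int[mu]_x (f (mul (- y)%R x) * g x)))%E.
  apply: eq_integral => y _ /=.
  have mfg : measurable_fun setT (fun x : T => f x * g (mul y x))%E.
    by apply: emeasurable_funM => //; exact: (measurableT_comp mg (measurable_gmull y)).
  rewrite -(ge0_integral_invariant (measurable_gmull (- y)) (@haar_left (- y)) mfg (fun x => mule_ge0 (f0 _) (g0 _))).
  by apply: eq_integral => x _; rewrite gmulVKg.
rewrite -(@fubini_tonelli _ _ _ _ _ mu l (fun xy => f (mul (- xy.2)%R xy.1) * g xy.1)%E); last 2 first.
- exact: emeasurable_funM.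
- by move=> xy; exact: mule_ge0.
rewrite -(@ge0_integralZr _ _ _ mu setT measurableT g mg _ (fun x _ => g0 x)); last by apply: integral_ge0.
apply: eq_integral => x _ /=.
have mfN : measurable_fun setT (fun y : T => f (- y)%R) by exact: (measurableT_comp mf measurable_opp_row).
rewrite -[in RHS](ge0_integral_invariant (measurable_gmull (- x)) (lL (- x)) mfN (fun y => f0 _)).
rewrite -(@ge0_integralZl _ _ _ l setT measurableT _ (measurableT_comp mfN (measurable_gmull (- x))) _ (fun y _ => f0 _) (g0 x)).
by apply: eq_integral => y _; rewrite muleC /= ginvM opprK.
Qed.

Let B := [set x : T | `|x - 0| < 1].

Let mB : measurable B. Proof. exact: borel_ball. Qed.

Let BN : (fun y : T => - y : T) @^-1` B = B.
Proof. by apply/seteqP; split => x; rewrite /B /= !subr0 normrN. Qed.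

Let muB : exists2 b : R, 0 < b & mu B = b%:E.
Proof.
have := mu_ball_gt0 ltr01; have := mu_ball_fin 1; rewrite -/B.
by case: (mu B) => // b _; rewrite lte_fin => b0; exists b.
Qed.

(** The exchange formula with l = mu, f = 1_A and g = 1_B, for the unit ball B, reads mu(A) mu(B) =
    mu(B) mu(A^-1), and mu(B) is positive and finite. *)
Lemma haar_opp A : measurable A -> mu ((fun y : T => - y : T) @^-1` A) = mu A.
Proof.
move=> mA; have [b b0 bE] := muB.
have mNA : measurable ((fun y : T => - y : T) @^-1` A).
  by have := measurable_opp_row measurableT mA; rewrite setTI.
have m1 C : measurable C -> measurable_fun setT (fun x : T => (\1_C x : R)%:E).
  by move=> mC; apply/measurable_EFinP; exact: measurable_indic.
have p1 C (x : T) : (0 <= (\1_C x : R)%:E)%E by rewrite lee_fin.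
have := haar_exchange haar_left haar_right (m1 _ mA) (m1 _ mB) (p1 A) (p1 B).
have -> : (\int[mu]_y (\1_A (- y)%R)%:E = \int[mu]_y (\1_((fun y : T => - y : T) @^-1` A) y)%:E)%E.
  by apply: eq_integral => y _; rewrite /= !indicE.
have iE C : measurable C -> (\int[mu]_x (\1_C x : R)%:E = mu C)%E.
  by move=> mC; rewrite integral_indic // setIT.
rewrite !iE // bE => H.
have b1 : (1 = b^-1%:E * b%:E)%E by rewrite -EFinM mulVf // gt_eqF.
by rewrite -[LHS]mul1e -[RHS]mul1e b1 -!muleA -H [(mu A * _)%E]muleC.
Qed.

Lemma haar_dil t : 0 < t -> exists2 k : {nonneg R}, 0 < k%:num &
  forall A, measurable A -> mu ((dil G t : T -> T) @^-1` A) = (k%:num%:E * mu A)%E.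
Proof.
move=> t0; have t0' : t != 0 by rewrite gt_eqF.
have md := measurable_dil t.
pose l0 := pushforward mu (dil G t : T -> T).
have l0b e : (l0 [set x : T | (`|x - 0| < e)%R] < +oo)%E.
  have [C C0 HC] := linear_row_bound (dill G t^-1).
  apply: (@mu_bounded _ _ _ _ haar_mu _ (C * e)).
    by have := md measurableT _ (borel_ball 0 e); rewrite setTI.
  move=> x /=; rewrite subr0 => xe; have := HC (dil G t x); rewrite /= dilK // => /le_trans; apply.
  by rewrite ler_pM2l // ltW.
have [l lE] : exists l : {sigma_finite_measure set (borelV R d) -> \bar R},
    forall A, measurable A -> l A = mu ((dil G t : T -> T) @^-1` A).
  have [l1 l1E] := pushforward_of mu md.
  have [|m mE] := @sigma_finite_measure_of _ _ _ l1.
    exists (fun k : nat => [set x : T | `|x - 0| < k%:R]) => [|k]; first exact: row_ball_cover.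
    by split; [exact: borel_ball|rewrite l1E; exact: l0b].
  by exists m => A mA; rewrite -l1E mE.
have lL y A : measurable A -> l ((mul y : T -> T) @^-1` A) = l A.
  move=> mA; rewrite !lE //; last by have := measurable_gmull y measurableT mA; rewrite setTI.
  rewrite -(@haar_left (dil G t^-1 y) ((dil G t : T -> T) @^-1` A)).
    by congr (mu _); apply/seteqP; split => x /=; rewrite dilM dilVK.
  by have := md measurableT _ mA; rewrite setTI.
have lR y A : measurable A -> l ((mul^~ y : T -> T) @^-1` A) = l A.
  move=> mA; rewrite !lE //; last by have := measurable_gmulr y measurableT mA; rewrite setTI.
  rewrite -(@haar_right (dil G t^-1 y) ((dil G t : T -> T) @^-1` A)).
    by congr (mu _); apply/seteqP; split => x /=; rewrite dilM dilVK.
  by have := md measurableT _ mA; rewrite setTI.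
have key A : measurable A -> (mu B * l A = mu A * l B)%E.
  move=> mA.
  have m1 C : measurable C -> measurable_fun setT (fun x : T => (\1_C x : R)%:E).
    by move=> mC; apply/measurable_EFinP; exact: measurable_indic.
  have p1 C (x : T) : (0 <= (\1_C x : R)%:E)%E by rewrite lee_fin.
  have := haar_exchange lL lR (m1 _ mB) (m1 _ mA) (p1 B) (p1 A).
  have -> : (\int[l]_y (\1_B (- y)%R)%:E = \int[l]_y (\1_B y)%:E)%E.
    by apply: eq_integral => y _; rewrite /= !indicE -[in RHS]BN.
  by rewrite !integral_indic // !setIT.
have [b b0 bE] := muB.
have [c c0 cE] : exists2 c : R, 0 < c & l B = c%:E.
  have lBfin : (l B < +oo)%E by rewrite lE //; exact: l0b.
  have lB0 : (0 < l B)%E.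
    rewrite lt0e measure_ge0 andbT; apply/eqP => lB0.
    have [_ _ _] := haar_mu; apply.
    have := key setT measurableT; rewrite lB0 mule0 bE => /eqP; rewrite mule_eq0 eqe gt_eqF //= => /eqP.
    by rewrite lE // preimage_setT.
  by move: lBfin lB0; case: (l B) => // c _; rewrite lte_fin => c0; exists c.
have k0 : 0 <= c / b by rewrite divr_ge0 // ltW.
exists (NngNum k0) => [|A mA]; first by rewrite /= divr_gt0.
have := key A mA; rewrite lE // bE cE => H.
rewrite /= mulrC EFinM -muleA [(c%:E * _)%E]muleC -H muleA -EFinM mulVf ?mul1e //.
by rewrite gt_eqF.
Qed.

End haar.

(** * Integration of rapidly decaying functions *)

Section invariant_change_of_variables.
Context {disp : measure_display} {T : measurableType disp} {R : realType}.
Variables (mu : {measure set T -> \bar R}) (phi : T -> T).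
Hypotheses (mphi : measurable_fun setT phi)
  (muphi : forall A, measurable A -> mu (phi @^-1` A) = mu A).

Let one : {nonneg R} := NngNum (@ler01 R).

Let muphi1 A : measurable A -> mu (phi @^-1` A) = (one%:num%:E * mu A)%E.
Proof. by move=> mA; rewrite mul1e muphi. Qed.

Lemma integrable_invariant (f : T -> R) :
  mu.-integrable setT (EFin \o f) -> mu.-integrable setT (EFin \o (f \o phi)).
Proof. exact: integrable_scaled muphi1. Qed.

Lemma integral_invariant (f : T -> R) :
  mu.-integrable setT (EFin \o f) -> \int[mu]_x f (phi x) = \int[mu]_x f x.
Proof. by move=> fi; rewrite (integral_scaled mphi muphi1 fi) mul1r. Qed.

End invariant_change_of_variables.

Section continuous_algebra.
Context {R : realType}.

Lemma derive_line0 {V : normedModType R} (f : V -> R) x v :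
  'D_v f x = 'D_1 (fun t : R => f (t *: v + x)) 0.
Proof.
rewrite /derive; set u := (X in lim (X @ _) = _); set w := (X in _ = lim (X @ _)).
suff -> : u = w by [].
by apply/funext => t; rewrite /u /w /= addr0 scale0r add0r [_%:A]mulr1.
Qed.

Lemma continuousM_fun {T : topologicalType} (f g : T -> R) :
  continuous f -> continuous g -> continuous (fun x => f x * g x).
Proof. by move=> cf cg x; apply: cvgM; [exact: cf|exact: cg]. Qed.

Lemma continuous_norm_fun {T : topologicalType} (f : T -> R) :
  continuous f -> continuous (fun x => `|f x|).
Proof. by move=> cf x; apply: continuous_comp; [exact: cf|exact: norm_continuous]. Qed.

Lemma continuous_norm1X {V : normedModType R} m : continuous (fun x : V => (1 + `|x|) ^+ m : R).
Proof.
move=> x; apply: (@continuous_comp _ _ _ (fun x : V => 1 + `|x|) (fun y : R => y ^+ m)); last exact: exprn_continuous.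
by apply: cvgD; [exact: cvg_cst|exact: norm_continuous].
Qed.

Lemma continuous_inv_fun {T : topologicalType} (f : T -> R) :
  (forall x, f x != 0) -> continuous f -> continuous (fun x => (f x)^-1).
Proof. by move=> f0 cf x; apply: cvgV; [exact: f0|exact: cf]. Qed.

Lemma lipschitz_continuous {V : normedModType R} (f : V -> R) e : 0 <= e ->
  (forall x y, `|f (x + y) - f x| <= e * `|y|) -> continuous f.
Proof.
move=> e0 L x; apply/cvgrPdist_le => eps eps0.
have d0 : 0 < eps / (e + 1) by rewrite divr_gt0 // ltr_wpDl.
apply: (@filterS _ _ _ [set y : V | `|y - x| < eps / (e + 1)]).
  move=> y /= yx; rewrite distrC.
  have := L x (y - x); rewrite [x + (y - x)]addrC subrK => /le_trans; apply.
  apply: (@le_trans _ _ ((e + 1) * `|y - x|)); first by rewrite ler_wpM2r // lerDl.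
  by rewrite mulrC -ler_pdivlMr ?ltr_wpDl // ltW.
apply/nbhs_ballP; exists (eps / (e + 1)) => //= y.
by rewrite -ball_normE /= distrC.
Qed.

End continuous_algebra.

Section integration.
Context {R : realType} {d : nat}.
Variable G : stratifiedGroup R d.
Local Notation V := 'rV[R]_d.
Local Notation T := (borelV R d).
Local Notation mul := (gmul G).
Local Notation lie := (lie_der (gmul G)).
Variable mu : {sigma_finite_measure set (borelV R d) -> \bar R}.
Hypothesis haar_mu : haar_measure G mu.
Implicit Types f h w : V -> R.
Local Notation intble f := (mu.-integrable setT (EFin \o (f : T -> R))).

(** By [dil_bound] the dilation of ratio 2^-j sends the ball of radius 2^j into the fixed ball of
    radius C0, and each halving multiplies the measure of a preimage by q. *)
Lemma mu_ball_growth : exists (M q : R), [/\ 0 <= M, 0 < q &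
  forall j, (mu [set x : T | (`|x - 0| < 2 ^+ j)%R] <= (M * q ^+ j)%:E)%E].
Proof.
have [C0 C01 HC] := dil_bound G.
have [q q0 Hq] := haar_dil haar_mu (t := 2^-1) ltac:(by []).
pose A j : set T := (dil G ((2^-1) ^+ j) : T -> T) @^-1` [set x : T | `|x - 0| < C0].
have mA j : measurable (A j).
  by have := measurable_dil G ((2^-1) ^+ j) measurableT (borel_ball 0 C0); rewrite setTI.
have AS j : A j.+1 = (dil G 2^-1 : T -> T) @^-1` (A j).
  by apply/seteqP; split => x; rewrite /A /= dil_comp exprSr.
have muA j : mu (A j) = ((q%:num ^+ j)%:E * mu (A 0%N))%E.
  by elim: j => [|j IH]; rewrite ?mul1e // AS Hq // IH muleA -EFinM exprS.
have A0fin : (mu (A 0%N) < +oo)%E.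
  apply: (@mu_bounded _ _ _ _ haar_mu _ C0) => // x.
  by rewrite /A /= expr0 dil1 subr0 => /ltW.
have [M MM] : exists M : R, mu (A 0%N) = M%:E.
  by exists (fine (mu (A 0%N))); rewrite fineK // ge0_fin_numE.
exists M, q%:num; split => //; first by rewrite -lee_fin -MM.
move=> j; rewrite mulrC EFinM -MM -muA; apply: le_measure; rewrite ?inE //; first exact: borel_ball.
move=> x; rewrite /A /= !subr0 => xj.
have t01 : 0 <= (2^-1 : R) ^+ j <= 1 by rewrite exprn_ge0 // exprn_ile1 // invf_le1 // ler1n.
apply: le_lt_trans (HC _ _ t01) _; rewrite -mulrA gtr_pMr ?(lt_le_trans ltr01) //.
by rewrite exprVn mulrC ltr_pdivrMr ?mul1r // exprn_gt0.
Qed.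

(** Up to a factor 2^m, the weight is dominated by the sum over j of 2^(-jm) on the ball of radius
    2^j. With 2 q <= 2^m the integrals of the terms are at most M 2^-j, a geometric series. *)
Lemma integrable_weight : exists m, intble (fun x : V => ((1 + `|x|) ^+ m)^-1).
Proof.
have [M [q [M0 q0 Hq]]] := mu_ball_growth.
have [m qm] : exists m : nat, q * 2 <= 2 ^+ m.
  exists (Num.truncn (q * 2)).+1.
  apply: le_trans (ltW (truncnS_gt (q * 2))) _.
  by rewrite -natrX ler_nat ltnW // ltn_expl.
exists m.
have cw : continuous (fun x : V => ((1 + `|x|) ^+ m)^-1).
  apply: continuous_inv_fun; last exact: continuous_norm1X.
  by move=> x; rewrite gt_eqF // (lt_le_trans ltr01) // norm1X_ge1.
pose B j := [set x : T | `|x - 0| < 2 ^+ j].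
pose u j (x : T) := (((2 ^+ (j * m))^-1 * \1_(B j) x : R)%:E)%E.
have u0 j x : (0 <= u j x)%E by rewrite lee_fin mulr_ge0 // invr_ge0 exprn_ge0.
have mB j : measurable (B j) by exact: borel_ball.
have mu_ j : measurable_fun setT (u j).
  by apply/measurable_EFinP; apply: measurable_funM => //; exact: measurable_indic.
apply/integrableP; split; first by apply/measurable_EFinP; exact: continuous_measurable.
apply: (@le_lt_trans _ _ ((2 ^+ m)%:E * \int[mu]_x (\sum_(j <oo) u j x))%E).
  rewrite -ge0_integralZl //; last 2 first.
  - exact: ge0_emeasurable_sum.
  - by move=> x _; exact: nneseries_ge0.
  apply: ge0_le_integral => //.
  - by apply: measurableT_comp => //; apply/measurable_EFinP; exact: continuous_measurable.
  - by apply: emeasurable_funM => //; exact: ge0_emeasurable_sum.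
  move=> x _; rewrite /= ger0_norm ?invr_ge0 ?norm1X_ge0 //.
  have [j Bj jP] : exists2 j, B j x & ((1 + `|x : V|) ^+ m)^-1 <= 2 ^+ m * (2 ^+ (j * m))^-1.
    have ex : exists j, `|x : V| < 2 ^+ j.
      exists (Num.truncn `|x : V|).+1; apply: lt_le_trans (truncnS_gt _) _.
      by rewrite -natrX ler_nat ltnW // ltn_expl.
    (* The least j with |x| < 2^j: for positive j, minimality gives 2^(j-1) <= |x|, and the lost
       power of 2 is the factor 2^m. *)
    case: (ex_minnP ex) => -[|j] xj Hj; [exists 0%N|exists j.+1]; rewrite /B /= ?subr0 //.
      rewrite mul0n expr0 invr1 mulr1; apply: (@le_trans _ _ 1); last by rewrite exprn_ege1 // ler1n.
      by rewrite invf_le1 ?norm1X_ge1 // (lt_le_trans ltr01) // norm1X_ge1.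
    have xj' : 2 ^+ j <= `|x : V|.
      by rewrite leNgt; apply/negP => /Hj; rewrite ltnn.
    rewrite mulSn exprD invfM mulrA divff ?expf_neq0 // mul1r exprM.
    rewrite lef_pV2 ?posrE ?exprn_gt0 // ?ltr_pwDl // lerXn2r ?nnegrE ?addr_ge0 ?exprn_ge0 //.
    by rewrite (le_trans xj') // lerDr.
  apply: (@le_trans _ _ ((2 ^+ m)%:E * u j x)%E).
    by rewrite /u indicE mem_set // mulr1 -EFinM lee_fin.
  rewrite lee_pmul2l ?lte_fin ?exprn_gt0 //.
  apply: le_trans (nneseries_lim_ge j.+1 _) => //.
  by rewrite big_nat_recr //= leeDr // sume_ge0.
rewrite lte_mul_pinfty // ?lee_fin ?exprn_ge0 //.
rewrite integral_nneseries //.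
apply: (@le_lt_trans _ _ (M * 2)%:E); last exact: ltry.
apply: lime_le; first by apply: is_cvg_nneseries => j _ _; apply: integral_ge0.
near=> n.
apply: (@le_trans _ _ (\sum_(0 <= j < n) (M * (2^-1) ^+ j)%:E)%E).
  apply: lee_sum => j _; rewrite /u.
  under eq_integral do rewrite EFinM.
  rewrite ge0_integralZl //; last by apply/measurable_EFinP; exact: measurable_indic.
  rewrite integral_indic // setIT.
  apply: (@le_trans _ _ ((2 ^+ (j * m))^-1%:E * (M * q ^+ j)%:E)%E).
    by apply: lee_wpmul2l; [rewrite lee_fin invr_ge0 exprn_ge0|exact: Hq].
  rewrite -EFinM lee_fin mulrCA ler_wpM2l // mulnC exprM mulrC -expr_div_n.
  rewrite lerXn2r ?nnegrE ?divr_ge0 ?exprn_ge0 ?(ltW q0) //.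
  by rewrite ler_pdivrMr ?exprn_gt0 // mulrC ler_pdivlMr.
rewrite sumEFin lee_fin -mulr_sumr ler_wpM2l //.
have E k : \sum_(0 <= j < k) (2^-1 : R) ^+ j = 2 - 2 * (2^-1) ^+ k.
  elim: k => [|k IH]; first by rewrite big_geq // expr0 mulr1 subrr.
  rewrite big_nat_recr //= IH exprS; lra.
by rewrite E gerBl mulr_ge0 // exprn_ge0.
Unshelve. all: by end_near. Qed.

Lemma rapid_integrable f : continuous f -> rapid f -> intble f.
Proof.
move=> cf rf; have [m im] := integrable_weight; have [M HM] := rf m.
have mf : measurable_fun setT (EFin \o (f : T -> R)).
  by apply/measurable_EFinP; exact: continuous_measurable.
apply: (le_integrable measurableT mf _ (integrableZl measurableT M im)).
move=> x _; rewrite /= lee_fin [leRHS]ger0_norm.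
  by rewrite ler_pdivlMr ?(lt_le_trans ltr01) ?norm1X_ge1 // mulrC.
by rewrite divr_ge0 ?norm1X_ge0 // (le_trans _ (HM 0)) // mulr_ge0 // norm1X_ge0.
Qed.

Lemma schwartz_continuous f : schwartz f -> continuous f.
Proof. by move=> /schwartz_smooth/smooth_continuous. Qed.

Lemma schwartz_integrable f : schwartz f -> intble f.
Proof. by move=> sf; apply: rapid_integrable; [exact: schwartz_continuous|exact: schwartz_rapid]. Qed.

Lemma Rintegral_left g f : intble f -> \int[mu]_x f (mul g x) = \int[mu]_x f x.
Proof.
move=> fi; apply: (@integral_invariant _ T R mu (mul g : T -> T)) => //.
- exact: measurable_gmull.
- exact: haar_left.
Qed.

Lemma Rintegral_right g f : intble f -> \int[mu]_x f (mul x g) = \int[mu]_x f x.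
Proof.
move=> fi; apply: (@integral_invariant _ T R mu (mul^~ g : T -> T)) => //.
- exact: measurable_gmulr.
- exact: haar_right.
Qed.

Lemma Rintegral_opp f : intble f -> \int[mu]_x f (- x) = \int[mu]_x f x.
Proof.
move=> fi; apply: (@integral_invariant _ T R mu (fun x : T => - x : T)) => //.
- exact: measurable_opp_row.
- exact: (haar_opp haar_mu).
Qed.

Section kernel_integral.
Variable w : V -> R.
Hypotheses (cw : continuous w) (rw : rapid w).

Definition kint (h : 'rV[R]_(d + d) -> R) (x : V) : R := \int[mu]_g (h (row_mx x g) * w g).

Lemma continuous_row_mxr (x : V) : continuous (fun g : V => row_mx x g).
Proof.
apply: continuous_row => i.
rewrite (_ : (fun g => _) = fun g : V => match fintype.split i with inl k => x 0 k | inr k => g 0 k end).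
  by case: (fintype.split i) => k; [exact: smooth_cst|exact: smooth_coord].
by apply/funext => g; rewrite mxE.
Qed.

Lemma kern_continuous (h : 'rV[R]_(d + d) -> R) (x : V) :
  kern h -> continuous (fun g : V => h (row_mx x g) * w g).
Proof.
move=> [sh _]; apply: continuousM_fun => // g.
apply: (@continuous_comp _ _ _ (fun g : V => row_mx x g) h); first exact: continuous_row_mxr.
exact: smooth_continuous.
Qed.

Lemma weight_integrable k M : intble (fun g : V => M * (1 + `|g|) ^+ k * `|w g|).
Proof.
apply: rapid_integrable.
  apply: continuousM_fun; last exact: continuous_norm_fun.
  by apply: continuousM_fun; [exact: cst_continuous|exact: continuous_norm1X].
apply: rapidM.
  by exists `|M|, k => x; rewrite normrM [`|_ ^+ k|]ger0_norm ?norm1X_ge0.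
by move=> m; have [N HN] := rw m; exists N => x; rewrite normr_id.
Qed.

Lemma kern_integrable (h : 'rV[R]_(d + d) -> R) (x : V) : kern h -> intble (fun g : V => h (row_mx x g) * w g).
Proof.
move=> kh; have [M [k [M0 HM]]] := kern_kbd kh 0%N.
have mf : measurable_fun setT (EFin \o ((fun g : V => h (row_mx x g) * w g) : T -> R)).
  by apply/measurable_EFinP; apply: continuous_measurable; exact: kern_continuous.
apply: (le_integrable measurableT mf _ (weight_integrable k M)).
move=> g _; rewrite /= lee_fin normrM [leRHS]ger0_norm ?mulr_ge0 ?norm1X_ge0 //.
by rewrite ler_wpM2r //; have := HM x g; rewrite expr0 mul1r.
Qed.

Lemma kint_bound (h : 'rV[R]_(d + d) -> R) m : kern h -> exists M, forall x, (1 + `|x|) ^+ m * `|kint h x| <= M.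
Proof.
move=> kh; have [M [k [M0 HM]]] := kern_kbd kh m.
exists (\int[mu]_g (M * (1 + `|g : V|) ^+ k * `|w g|)) => x.
have kint_x := kern_integrable x kh.
apply: (@le_trans _ _ ((1 + `|x|) ^+ m * \int[mu]_g `|h (row_mx x g) * w g|)).
  by rewrite ler_wpM2l ?norm1X_ge0 //; exact: le_normr_Rintegral.
have ai : intble (fun g : V => `|h (row_mx x g) * w g|).
  by have := integrable_abse kint_x.
rewrite -RintegralZl //; apply: le_Rintegral => //.
- exact: (integrableZl measurableT ((1 + `|x|) ^+ m) ai).
- exact: weight_integrable.
- by move=> g _; rewrite normrM mulrA ler_wpM2r.
Qed.

(** The bound of [kbd] with exponent 0 does not depend on x, so a single integrable function
    dominates the derivatives along the whole segment. *)
Lemma is_derive_kint (h : 'rV[R]_(d + d) -> R) (x v : V) : kern h -> is_derive x v (kint h) (kint ('D_(row_mx v 0) h) x).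
Proof.
move=> kh; have [sh _] := kh.
pose F (t : R) (g : T) := h (row_mx (x + t *: v) g) * w g.
have dF (g : V) (t : R) : is_derive t 1 (F^~ g) ('D_(row_mx v 0) h (row_mx (x + t *: v) g) * w g).
  have := is_derive_line (smooth_derivable (x := row_mx x g + t *: row_mx v 0) (v := row_mx v 0) sh).
  rewrite (_ : row_mx x g + t *: row_mx v 0 = row_mx (x + t *: v) g); last first.
    by rewrite scale_row_mx add_row_mx scaler0 addr0.
  rewrite (_ : (fun s : R => _) = fun s : R => h (row_mx (x + s *: v) g)); last first.
    by apply/funext => s; rewrite scale_row_mx add_row_mx scaler0 addr0.
  move=> dh; have := is_deriveM dh (is_derive_cst (w g) _ _).
  by rewrite scaler0 add0r => dd; apply: is_derive_eq dd _; rewrite -[LHS]/(_ * _) mulrC.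
have kD := kern_D (row_mx v 0) kh.
have [M [k [M0 HM]]] := kern_kbd kD 0%N.
have intF (t : R) : `]-1, 1[%classic t -> intble (F t) by move=> _; exact: kern_integrable.
have Fub (t : R) (g : T) : `]-1, 1[%classic t -> setT g ->
    `|partial1of2 F t g| <= M * (1 + `|g : V|) ^+ k * `|w g|.
  move=> _ _; rewrite partial1of2E; have [_ ->] := dF g t.
  by rewrite normrM ler_wpM2r //; have := HM (x + t *: v) g; rewrite expr0 mul1r.
have I0 : `]-1, 1[%classic (0 : R) by rewrite /= in_itv /= ltrN10 ltr01.
have derF (t : R) (g : T) : `]-1, 1[%classic t -> setT g -> derivable (F^~ g) t 1.
  by move=> _ _; have [] := dF g t.
have G0 (g : T) : 0 <= M * (1 + `|g : V|) ^+ k * `|w g| by rewrite !mulr_ge0 // norm1X_ge0.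
have d1 := derivable_under_integral measurableT I0 intF derF G0 (weight_integrable k M) Fub.
have d2 := differentiation_under_integral measurableT I0 intF derF G0 (weight_integrable k M) Fub.
have E : (fun y : R => kint h (y *: v + x)) = fun t => \int[mu]_y F t y.
  by apply/funext => t; rewrite /kint /F addrC.
apply: DeriveDef.
  by apply/derivable1P; rewrite E.
rewrite derive_line0 E -derive1E d2; apply: eq_Rintegral => g _.
rewrite partial1of2E; have [_ ->] := dF g 0.
by rewrite scale0r addr0.
Qed.

(** Bounded partial derivatives make the function Lipschitz, by [C1_increment] with all comparison
    slopes equal to 0. *)
Lemma kint_continuous (h : 'rV[R]_(d + d) -> R) : kern h -> continuous (kint h).
Proof.
move=> kh.
have /choice[M HM] j : exists M, forall x, `|'D_(coordv j) (kint h) x| <= M.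
  have [M HM] := kint_bound 0%N (kern_D (row_mx (coordv j) 0) kh); exists M => x.
  by have [_ ->] := is_derive_kint x (coordv j) kh; have := HM x; rewrite expr0 mul1r.
pose e := \sum_j `|M j|.
have He j x : `|'D_(coordv j) (kint h) x| <= e.
  apply: le_trans (HM j x) _; apply: le_trans (ler_norm _) _.
  by rewrite /e (bigD1 j) //= lerDl sumr_ge0.
have L x y : `|kint h (x + y) - kint h x| <= d%:R * e * `|y|.
  have := @C1_increment R d (kint h) x y (fun=> 0) e.
  rewrite big1 ?subr0 => [|j _]; last by rewrite mulr0.
  apply => [z v|j z _]; first by have [] := is_derive_kint z v kh.
  by rewrite subr0.
have e0 : 0 <= d%:R * e by rewrite mulr_ge0 // sumr_ge0.
exact: (lipschitz_continuous e0 L).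
Qed.

Lemma kint_schwartz (h : 'rV[R]_(d + d) -> R) : kern h -> schwartz (kint h).
Proof.
move=> kh.
have HD (h' : 'rV[R]_(d + d) -> R) (v : V) : kern h' -> 'D_v (kint h') = kint ('D_(row_mx v 0) h').
  by move=> kh'; apply/funext => x; have [_ ->] := is_derive_kint x v kh'.
pose P (u : V -> R) := exists2 h' : 'rV[R]_(d + d) -> R, kern h' & u = kint h'.
have PD u v : P u -> P ('D_v u).
  by move=> [h' kh' ->]; exists ('D_(row_mx v 0) h'); [exact: kern_D|exact: HD].
apply/schwartzP; split.
  apply: (smooth_coind (P := P)); last by exists h.
  move=> _ [h' kh' ->]; split.
  - exact: kint_continuous.
  - by move=> v x; have [] := is_derive_kint x v kh'.
  - by move=> v; apply: PD; exists h'.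
move=> vs; have [h' kh' ->] : P (iterD vs (kint h)).
  by apply: iterD_class; [move=> g Pg v; exact: PD|exists h].
by move=> m; exact: kint_bound.
Qed.

End kernel_integral.

(** By right invariance the integral of f(x exp(t Z)) does not depend on t; its derivative at 0 is
    the left-hand side. The domination for |t| < 1 is the kernel estimate of [kern_conv] with g = -t
    Z. *)
Lemma integral_lie0 Z f : schwartz f -> \int[mu]_x lie Z f x = 0.
Proof.
move=> sf; have smf := schwartz_smooth sf.
pose F (t : R) (x : T) := f (mul x (t *: Z)).
have dF (x : V) (t : R) : is_derive t 1 (F^~ x) (lie Z f (mul x (t *: Z))).
  rewrite lie_derE //; exact: (is_derive_curve smf (is_derive_gmul_exp G x Z t)).
have [m im] := integrable_weight.
have [M [k [M0 HM]]] := kern_kbd (kern_conv G (schwartz_lie G Z sf)) m.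
pose W (x : T) := M * (1 + `|Z|) ^+ k * ((1 + `|x : V|) ^+ m)^-1.
have iW : intble W by exact: (integrableZl measurableT (M * (1 + `|Z|) ^+ k) im).
have W0 x : 0 <= W x by rewrite mulr_ge0 ?invr_ge0 ?mulr_ge0 ?norm1X_ge0.
have intF (t : R) : `]-1, 1[%classic t -> intble (F t).
  move=> _; have hr := @haar_right _ _ G mu haar_mu (t *: Z).
  exact: (@integrable_invariant _ T R mu (mul^~ (t *: Z) : T -> T) (measurable_gmulr _ _) hr f (schwartz_integrable sf)).
have Fub (t : R) (x : T) : `]-1, 1[%classic t -> setT x -> `|partial1of2 F t x| <= W x.
  rewrite /= in_itv /= => t1 _; rewrite partial1of2E; have [_ ->] := dF x t.
  have := HM x (- (t *: Z)); rewrite convmapE opprK normrN normrZ => H.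
  rewrite /W ler_pdivlMr ?(lt_le_trans ltr01) ?norm1X_ge1 // mulrC.
  apply: le_trans H _; rewrite ler_wpM2l // lerXn2r ?nnegrE ?addr_ge0 ?mulr_ge0 //.
  by rewrite lerD2l ler_piMl // ler_norml; case/andP: t1 => /ltW -> /ltW ->.
have I0 : `]-1, 1[%classic (0 : R) by rewrite /= in_itv /= ltrN10 ltr01.
have derF (t : R) (x : T) : `]-1, 1[%classic t -> setT x -> derivable (F^~ x) t 1.
  by move=> _ _; have [] := dF x t.
have := differentiation_under_integral measurableT I0 intF derF W0 iW Fub.
rewrite [X in (X^`()%classic)](_ : _ = cst (\int[mu]_x f x)); last first.
  by apply/funext => t; rewrite /F (Rintegral_right _ (schwartz_integrable sf)).
rewrite derive1_cst => ->; apply: eq_Rintegral => x _.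
by rewrite partial1of2E; have [_ ->] := dF x 0; rewrite scale0r gmulg0.
Qed.

End integration.

(** * The heat semigroup on Schwartz functions *)

Section telescoping.
Context {R : realType}.
Implicit Types (phi : R -> R) (s M : R).

(** A mean value inequality for a function whose increments are controlled uniformly only on times
    tau >= s0 > 0, with mere continuity at 0. That is what the heat semigroup offers, the smoothing
    bounds being lost as tau tends to 0. *)
Lemma telescoping_bound phi s M : 0 < s -> 0 <= M ->
  (forall e, 0 < e -> exists2 dl, 0 < dl & forall r, 0 < r < dl -> `|phi r - phi 0| <= e) ->
  (forall s0 e, 0 < s0 -> 0 < e -> exists2 dl, 0 < dl & forall tau r,
     s0 <= tau -> tau + r <= s -> 0 < r < dl -> `|phi (tau + r) - phi tau| <= r * (M + e)) ->
  `|phi s - phi 0| <= s * M.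
Proof.
move=> s_gt0 M0 H0 H; apply/ler_addgt0Pr => e e0.
have e2 : 0 < e / 2 by rewrite divr_gt0.
have [d0 d00 Hd0] := H0 _ e2.
(* Half of the error e pays for the jump from 0 to s0; the other half is spread as e / (2 s) per
   unit of time over N equal steps of length r < dl. *)
pose s0 := Num.min (d0 / 2) (s / 2).
have s00 : 0 < s0 by rewrite lt_min !divr_gt0.
have s0d : s0 < d0 by rewrite gt_min; apply/orP; left; lra.
have s0s : s0 < s by rewrite gt_min; apply/orP; right; lra.
have es : 0 < e / 2 / s by rewrite divr_gt0.
have [dl dl0 Hd] := H _ _ s00 es.
pose N := (Num.truncn ((s - s0) / dl)).+1.
pose r := (s - s0) / N%:R.
have N0 : 0 < N%:R :> R by rewrite ltr0n.
have r0 : 0 < r by rewrite divr_gt0 // subr_gt0.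
have rd : r < dl.
  rewrite /r ltr_pdivrMr // mulrC -ltr_pdivrMr //; exact: truncnS_gt.
have IH k : (k <= N)%N -> `|phi (s0 + k%:R * r) - phi s0| <= k%:R * r * (M + e / 2 / s).
  elim: k => [|k IH] kN; first by rewrite !mul0r addr0 subrr normr0.
  have -> : s0 + k.+1%:R * r = (s0 + k%:R * r) + r by rewrite -natr1; lra.
  rewrite -(subrK (phi (s0 + k%:R * r)) (phi (_ + r))) -addrA.
  apply: le_trans (ler_normD _ _) _.
  have -> : k.+1%:R * r * (M + e / 2 / s) = r * (M + e / 2 / s) + k%:R * r * (M + e / 2 / s).
    by rewrite -natr1; ring.
  apply: lerD; last by apply: IH; exact: ltnW.
  apply: Hd; rewrite ?r0 //.
    by rewrite lerDl mulr_ge0 // ltW.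
  rewrite -addrA -{2}[r]mul1r -mulrDl natr1.
  apply: (@le_trans _ _ (s0 + N%:R * r)); first by rewrite lerD2l ler_pM2r // ler_nat.
  by rewrite /r mulrC divfK ?gt_eqF // addrC subrK.
have := IH N (leqnn N); rewrite [N%:R * r]mulrC /r divfK ?gt_eqF // [s0 + _]addrC subrK => IN.
rewrite -(subrK (phi s0) (phi s)) -addrA.
apply: le_trans (ler_normD _ _) _.
have := Hd0 s0; rewrite s00 s0d => /(_ isT) H2.
apply: le_trans (lerD IN H2) _.
have : (s - s0) * (M + e / 2 / s) <= s * (M + e / 2 / s).
  by rewrite ler_wpM2r ?addr_ge0 ?(ltW es) // gerBl ltW.
have -> : s * (M + e / 2 / s) = s * M + e / 2 by field; rewrite gt_eqF.
lra.
Qed.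

End telescoping.

Section Rintegral_exchange.
Context {d1 d2 : measure_display} {T1 : measurableType d1} {T2 : measurableType d2} {R : realType}.
Variables (m1 : {sigma_finite_measure set T1 -> \bar R}) (m2 : {sigma_finite_measure set T2 -> \bar R}).

Lemma EFin_Rintegral {disp} {T : measurableType disp} (m : {measure set T -> \bar R}) (f : T -> R) :
  m.-integrable setT (EFin \o f) -> (\int[m]_x f x)%:E = (\int[m]_x (f x)%:E)%E.
Proof. by move=> fi; rewrite /Rintegral fineK //; exact: (integrable_fin_num measurableT). Qed.

Section real_integrable.
Context {disp : measure_display} {T : measurableType disp}.
Variable m : {measure set T -> \bar R}.
Implicit Types (f g : T -> R) (c : R).
Local Notation intble f := (m.-integrable setT (EFin \o f)).

Lemma intbleZ c f : intble f -> intble (fun x => c * f x).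
Proof. exact: integrableZl. Qed.

Lemma intbleD f g : intble f -> intble g -> intble (fun x => f x + g x).
Proof. exact: integrableD. Qed.

Lemma intbleB f g : intble f -> intble g -> intble (fun x => f x - g x).
Proof. exact: integrableB. Qed.

Lemma intble_norm f : intble f -> intble (fun x => `|f x|).
Proof. exact: integrable_abse. Qed.

Lemma intble_measurable f : intble f -> measurable_fun setT f.
Proof. by move=> /integrableP[mf _]; apply/measurable_EFinP. Qed.

Lemma intble_le f g : measurable_fun setT f -> (forall x, `|f x| <= g x) -> intble g -> intble f.
Proof.
move=> mf fg gi; have mf' : measurable_fun setT (EFin \o f) by apply/measurable_EFinP.
apply: (le_integrable measurableT mf' _ gi) => x _ /=.
by rewrite lee_fin (le_trans (fg x)) // ler_norm.
Qed.

Lemma measurable_normc (f : T -> R[i]) :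
  measurable_fun setT (re_part f) -> measurable_fun setT (im_part f) ->
  measurable_fun setT (fun x => Normc.normc (f x)).
Proof.
move=> mr mi.
rewrite (_ : (fun x => _) = fun x => Num.sqrt (re_part f x ^+ 2 + im_part f x ^+ 2)).
  apply: (measurableT_comp (f := Num.sqrt : R -> R)).
    by apply: continuous_measurable_fun; exact: sqrt_continuous.
  by apply: measurable_funD; apply: measurable_funX.
by apply/funext => x; rewrite /re_part /im_part; case: (f x).
Qed.

End real_integrable.

Lemma Rintegral_exchange (F : T1 -> T2 -> R) :
  measurable_fun setT (fun z : T1 * T2 => F z.1 z.2) ->
  (forall x, m2.-integrable setT (EFin \o F x)) ->
  (forall y, m1.-integrable setT (EFin \o (F^~ y))) ->
  (\int[m2]_y \int[m1]_x `|F x y|%:E < +oo)%E ->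
  \int[m1]_x \int[m2]_y F x y = \int[m2]_y \int[m1]_x F x y.
Proof.
move=> mF i1 i2 ioo.
have mF' : measurable_fun setT (fun z : T1 * T2 => (F z.1 z.2)%:E) by apply/measurable_EFinP.
have iF : (m1 \x m2)%E.-integrable setT (fun z : T1 * T2 => (F z.1 z.2)%:E).
  by apply/(integrable21ltyP _ _ mF').
have := Fubini iF => /= FF.
congr fine.
under eq_integral do rewrite EFin_Rintegral //.
by under [RHS]eq_integral do rewrite EFin_Rintegral //.
Qed.

End Rintegral_exchange.

Section heat.
Context {R : realType} {d : nat}.
Variable G : stratifiedGroup R d.
Local Notation V := 'rV[R]_d.
Local Notation T := (borelV R d).
Local Notation mul := (gmul G).
Local Notation lie := (lie_der (gmul G)).
Variable mu : {sigma_finite_measure set (borelV R d) -> \bar R}.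
Hypothesis haar_mu : haar_measure G mu.
Implicit Types f h w : V -> R.
Local Notation intble f := (mu.-integrable setT (EFin \o (f : T -> R))).

Lemma integrable_left g f : intble f -> intble (fun x => f (mul g x)).
Proof. exact: (@integrable_invariant _ T R mu (mul g : T -> T) (measurable_gmull _ _) (@haar_left _ _ G mu haar_mu g) f). Qed.

Lemma integrable_right g f : intble f -> intble (fun x => f (mul x g)).
Proof. exact: (@integrable_invariant _ T R mu (mul^~ g : T -> T) (measurable_gmulr _ _) (@haar_right _ _ G mu haar_mu g) f). Qed.

Lemma integrable_oppv f : intble f -> intble (fun x => f (- x)).
Proof. exact: (@integrable_invariant _ T R mu (fun x : T => - x : T) (@measurable_opp_row _ _) (@haar_opp _ _ G mu haar_mu) f). Qed.

Lemma ball_integral_le f c e : intble f -> (forall x, 0 <= f x) -> 0 <= c ->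
  (forall x, `|x| < e -> c <= f x) ->
  (c%:E * mu [set x : T | (`|x - 0| < e)%R] <= (\int[mu]_x f x)%:E)%E.
Proof.
move=> fi f0 c0 Hc; rewrite EFin_Rintegral //.
set B := [set x : T | _].
have mB : measurable B by exact: borel_ball.
have mB1 : measurable_fun setT (fun x : T => (\1_B x : R)%:E).
  by apply/measurable_EFinP; exact: measurable_indic.
have -> : (c%:E * mu B = \int[mu]_x (c%:E * (\1_B x : R)%:E))%E.
  by rewrite ge0_integralZl // integral_indic // setIT.
apply: ge0_le_integral => //.
- by move=> x _; rewrite mule_ge0 // lee_fin.
- exact: measurable_funeM.
- by case/integrableP: fi.
- move=> x _; rewrite -EFinM lee_fin indicE; case: (boolP (x \in B)) => [|_]; last by rewrite mulr0.
  by rewrite inE /B /= subr0 mulr1; exact: Hc.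
Qed.

Lemma continuous_integral0 f : continuous f -> (forall x, 0 <= f x) -> intble f ->
  \int[mu]_x f x = 0 -> forall x, f x = 0.
Proof.
move=> cf f0 fi If x; apply/eqP; apply/negPn/negP => fx.
have {fx} fx : 0 < f x by rewrite lt_def fx f0.
pose c := f x / 2; have c0 : 0 < c by rewrite divr_gt0.
have oA : open [set y : V | c < f (mul x y)].
  apply: (@open_comp _ _ (fun y : V => f (mul x y)) [set z | c < z]); last exact: open_gt.
  move=> y _; apply: (@continuous_comp _ _ _ (mul x) f); first exact: continuous_gmull.
  exact: cf.
have A0 : [set y : V | c < f (mul x y)] 0.
  by rewrite /= gmulg0 /c; lra.
have [e e0 He] := open_ballP oA A0.
have := @ball_integral_le (fun y => f (mul x y)) c e (integrable_left x fi) (fun y => f0 _) (ltW c0).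
rewrite (Rintegral_left haar_mu _ fi) If => /(_ _)/wrap[].
  by move=> y ye; apply/ltW/He; rewrite subr0.
rewrite leNgt mule_gt0 ?lte_fin //; exact: (mu_ball_gt0 haar_mu).
Qed.

Lemma schwartz_mul f h : schwartz f -> schwartz h -> schwartz (fun x => f x * h x).
Proof. by move=> sf; exact/schwartzM/schwartz_moderate. Qed.

(** The test function is f - h itself, followed by the positivity of the Haar measure on balls. *)
Lemma schwartz_weak_eq f h : schwartz f -> schwartz h ->
  (forall w, schwartz w -> \int[mu]_x (w x * f x) = \int[mu]_x (w x * h x)) -> f = h.
Proof.
move=> sf sh H; apply/funext => x; apply/eqP; rewrite -subr_eq0 -sqrf_eq0; apply/eqP.
have sB := schwartzB sf sh.
apply: (@continuous_integral0 (fun x => (f x - h x) ^+ 2)) => [||| ] //.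
- apply: (schwartz_continuous (f := fun x => (f x - h x) ^+ 2)); exact: (schwartz_mul sB sB).
- by move=> y; exact: sqr_ge0.
- exact: (schwartz_integrable haar_mu (schwartz_mul sB sB)).
have E1 := H _ sB.
transitivity (\int[mu]_x ((f x - h x) * f x - (f x - h x) * h x)).
  by apply: eq_Rintegral => y _; rewrite -mulrBr expr2.
rewrite RintegralB //; first by rewrite E1 subrr.
- exact: (schwartz_integrable haar_mu (schwartz_mul sB sf)).
- exact: (schwartz_integrable haar_mu (schwartz_mul sB sh)).
Qed.

Variable p : R -> V -> R.

(* Sealed, as is [lap] below: unfolding either makes unification explode. *)
Fact hr_subproof : {F : R -> (V -> R) -> V -> R | forall s f x,
  F s f x = if s == 0 then f x else \int[mu]_g (f (mul x (- g)) * p s g)}.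
Proof. by exists (fun s f x => if s == 0 then f x else \int[mu]_g (f (mul x (- g)) * p s g)). Qed.

Definition hr := sval hr_subproof.

Lemma hr_def s f x : hr s f x = if s == 0 then f x else \int[mu]_g (f (mul x (- g)) * p s g).
Proof. exact: (svalP hr_subproof). Qed.

Lemma hr0 f : hr 0 f = f.
Proof. by apply/funext => x; rewrite hr_def eqxx. Qed.

Lemma hrE s f x : 0 < s -> hr s f x = \int[mu]_g (f (mul x (- g)) * p s g).
Proof. by move=> s0; rewrite hr_def gt_eqF. Qed.

Lemma ReMr (z : R[i]) (r : R) : complex.Re (z * (r%:C)%C) = complex.Re z * r.
Proof. by case: z => a b /=; rewrite mulr0 subr0. Qed.

Lemma ImMr (z : R[i]) (r : R) : complex.Im (z * (r%:C)%C) = complex.Im z * r.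
Proof. by case: z => a b /=; rewrite mulr0 add0r. Qed.

(** Like the other operators of the theorem, the heat operator extends a real one complex-linearly;
    the analysis is thus done on real functions. *)
Lemma heat_cext s : heat G mu p s = cext (hr s).
Proof.
apply/funext => f; apply/funext => x; rewrite /heat /cext !hr_def.
case: (s =P 0) => _; first by rewrite /re_part /im_part; case: (f x).
by rewrite /cint; congr (_ +i* _)%C; apply: eq_Rintegral => g _; rewrite /re_part /im_part ?ReMr ?ImMr.
Qed.

Variables (n : nat) (X : n.-tuple V).

Fact lap_subproof : {F : (V -> R) -> V -> R | forall f x,
  F f x = - \sum_(i < n) lie (tnth X i) (lie (tnth X i) f) x}.
Proof. by exists (fun f x => - \sum_(i < n) lie (tnth X i) (lie (tnth X i) f) x). Qed.

Definition lap := sval lap_subproof.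

Lemma lapE f x : lap f x = - \sum_(i < n) lie (tnth X i) (lie (tnth X i) f) x.
Proof. exact: (svalP lap_subproof). Qed.

Lemma lap_cext : subLaplacian G X = cext lap.
Proof.
apply/funext => f; apply/funext => x; rewrite /subLaplacian /cext !lapE /vfield.
apply/eqP; rewrite eq_complex; apply/andP; split; apply/eqP; rewrite /= -!sumrN raddf_sum //=.
Qed.

Lemma schwartz_lap f : schwartz f -> schwartz (lap f).
Proof.
move=> sf; rewrite (_ : lap f = fun x => - \sum_(i < n) lie (tnth X i) (lie (tnth X i) f) x).
  by apply: schwartzN; apply: schwartz_sum => i; do 2 apply: schwartz_lie.
by apply/funext => x; rewrite lapE.
Qed.

Lemma lapZ c f : smooth f -> lap (fun y => c * f y) = fun y => c * lap f y.
Proof.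
move=> sf; apply/funext => x; rewrite !lapE mulrN mulr_sumr; congr (- _); apply: eq_bigr => i _.
rewrite (_ : lie (tnth X i) (fun y => c * f y) = fun y => c * lie (tnth X i) f y).
  by rewrite lieZ //; exact: smooth_lie.
by apply/funext => y; rewrite lieZ.
Qed.

Hypothesis heat_p : heat_kernel G mu p X.

Lemma p_schwartz s : 0 < s -> schwartz (p s).
Proof. by move=> s0; have [/(_ s s0)[]] := heat_p. Qed.

Lemma p_gt0 s g : 0 < s -> 0 < p s g.
Proof. by move=> s0; have [/(_ s s0)[]] := heat_p. Qed.

Lemma p_opp s g : 0 < s -> p s (- g) = p s g.
Proof. by move=> s0; have [/(_ s s0)[_ _ _ H] _ _] := heat_p; exact: H. Qed.

Lemma p_int1 s : 0 < s -> \int[mu]_g p s g = 1.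
Proof. by move=> s0; have [/(_ s s0)[_ _ H _] _ _] := heat_p; rewrite /Rintegral H. Qed.

Let p_cont s (s0 : 0 < s) := schwartz_continuous (p_schwartz s0).
Let p_rapid s (s0 : 0 < s) := schwartz_rapid (p_schwartz s0).
Let p_intble s (s0 : 0 < s) := schwartz_integrable haar_mu (p_schwartz s0).

Lemma measurable_p s : 0 < s -> measurable_fun setT (fun g : T => (p s g)%:E).
Proof. by move=> s0; apply/measurable_EFinP; apply: continuous_measurable; exact: p_cont. Qed.

Lemma hr_intble s f x : 0 < s -> schwartz f -> intble (fun g : V => f (mul x (- g)) * p s g).
Proof.
move=> s0 sf; have := kern_integrable haar_mu (p_cont s0) (p_rapid s0) x (kern_conv G sf).
by rewrite (_ : (fun g => _) = fun g : V => f (mul x (- g)) * p s g) //; apply/funext => g; rewrite convmapE.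
Qed.

Lemma hr_schwartz s f : 0 <= s -> schwartz f -> schwartz (hr s f).
Proof.
rewrite le_eqVlt => /predU1P[<-|s0] sf; first by rewrite hr0.
rewrite (_ : hr s f = kint mu (p s) (fun z => f (convmap G z))).
  exact: (kint_schwartz haar_mu (p_cont s0) (p_rapid s0) (kern_conv G sf)).
by apply/funext => x; rewrite hrE // /kint; apply: eq_Rintegral => g _; rewrite convmapE.
Qed.

Lemma hrB s f h x : 0 <= s -> schwartz f -> schwartz h ->
  hr s (fun y => f y - h y) x = hr s f x - hr s h x.
Proof.
rewrite le_eqVlt => /predU1P[<-|s0] sf sh; first by rewrite !hr0.
rewrite !hrE // -RintegralB //; [|exact: hr_intble..].
by apply: eq_Rintegral => g _; rewrite mulrBl.
Qed.

Lemma hrD s f h x : 0 <= s -> schwartz f -> schwartz h ->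
  hr s (fun y => f y + h y) x = hr s f x + hr s h x.
Proof.
rewrite le_eqVlt => /predU1P[<-|s0] sf sh; first by rewrite !hr0.
rewrite !hrE // -RintegralD //; [|exact: hr_intble..].
by apply: eq_Rintegral => g _; rewrite mulrDl.
Qed.

Lemma hrZ s c f x : 0 <= s -> schwartz f -> hr s (fun y => c * f y) x = c * hr s f x.
Proof.
rewrite le_eqVlt => /predU1P[<-|s0] sf; first by rewrite !hr0.
rewrite !hrE // -RintegralZl //; last exact: hr_intble.
by apply: eq_Rintegral => g _; rewrite mulrA.
Qed.

Lemma hr_bound s f x M : 0 <= s -> schwartz f -> (forall y, `|f y| <= M) -> `|hr s f x| <= M.
Proof.
rewrite le_eqVlt => /predU1P[<-|s0] sf fM; first by rewrite hr0.
rewrite hrE //; have ii := hr_intble x s0 sf.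
apply: le_trans (le_normr_Rintegral measurableT ii) _.
rewrite -[M]mulr1 -(p_int1 s0) -RintegralZl //; last exact: p_intble.
apply: le_Rintegral => //.
- exact: (integrable_abse ii).
- exact: (integrableZl measurableT M (p_intble s0)).
- by move=> g _; rewrite normrM (ger0_norm (ltW (p_gt0 g s0))) ler_wpM2r // ltW // p_gt0.
Qed.

Lemma cschwartz_real f : schwartz f -> cschwartz (fun x => (f x)%:C%C).
Proof. by move=> sf; split => //; exact: schwartz0. Qed.

Lemma hrS s t f : 0 <= s -> 0 <= t -> schwartz f -> hr (s + t) f = hr s (hr t f).
Proof.
rewrite le_eqVlt => /predU1P[<-|s0]; first by rewrite add0r hr0.
rewrite le_eqVlt => /predU1P[<-|t0] sf; first by rewrite addr0 hr0.
have [_ H _] := heat_p.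
have := H s t _ s0 t0 (cschwartz_real sf); rewrite !heat_cext => /(congr1 re_part).
rewrite /cext /re_part /=.
by move=> E; apply/funext => x; have := congr1 (fun u => u x) E.
Qed.

Lemma hr_left s f z x : hr s f (mul z x) = hr s (fun y => f (mul z y)) x.
Proof.
by rewrite !hr_def; case: (s =P 0) => // _; apply: eq_Rintegral => g _; rewrite gmulA.
Qed.

Lemma ReMl (z : R[i]) (r : R) : complex.Re ((r%:C)%C * z) = r * complex.Re z.
Proof. by rewrite mulrC ReMr mulrC. Qed.

Lemma ImMl (z : R[i]) (r : R) : complex.Im ((r%:C)%C * z) = r * complex.Im z.
Proof. by rewrite mulrC ImMr mulrC. Qed.

Lemma ReD (z w : R[i]) : complex.Re (z + w) = complex.Re z + complex.Re w.
Proof. by case: z; case: w. Qed.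

Lemma ImD (z w : R[i]) : complex.Im (z + w) = complex.Im z + complex.Im w.
Proof. by case: z; case: w. Qed.

Lemma half_complex : (2^-1 : R[i]) = ((2^-1)%:C)%C.
Proof. by rewrite fmorphV rmorph_nat. Qed.

Lemma Re_le_normc (z : R[i]) : complex.Re z ^+ 2 <= Normc.normc z ^+ 2.
Proof. by case: z => a b /=; rewrite sqr_sqrtr ?addr_ge0 ?sqr_ge0 // lerDl sqr_ge0. Qed.

Lemma cvge0_lt {U : Type} (F : set_system U) {FF : Filter F} (u : U -> \bar R) (e : R) :
  u @ F --> 0%E -> 0 < e -> \forall t \near F, (u t < e%:E)%E.
Proof.
move=> u0 e0; apply: (u0 [set y | (y < e%:E)%E]); apply: open_nbhs_nbhs; split.
  exact: open_ereal_lt_ereal.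
by rewrite /= lte_fin.
Qed.

Lemma poweR_le (x y : \bar R) (r : R) : 0 <= r -> (0 <= x)%E -> (x <= y)%E -> (x `^ r <= y `^ r)%E.
Proof.
move=> r0 x0 xy; apply: (gt0_ler_poweR r0) => //; rewrite in_itv /= leey andbT //.
exact: le_trans xy.
Qed.

Lemma generator_L2 f e : schwartz f -> 0 < e -> exists2 dl, 0 < dl &
  forall r, 0 < r < dl -> \int[mu]_x (r^-1 * (hr r f x - f x) + 2^-1 * lap f x) ^+ 2 <= e.
Proof.
move=> sf e0; have [_ _ /(_ _ (cschwartz_real sf)) H] := heat_p.
have se0 : 0 < Num.sqrt e by rewrite sqrtr_gt0.
have [dl /= dl0 Hdl] := cvge0_lt H se0.
exists dl => // r /andP[r0 rdl].
have {Hdl} := Hdl r; rewrite /= sub0r normrN gtr0_norm // => /(_ rdl r0).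
rewrite /cLnorm; set F := (X in Lnorm _ _ X) => HF.
have su : schwartz (fun x => r^-1 * (hr r f x - f x) + 2^-1 * lap f x).
  apply: schwartzD; apply: schwartzZ; last exact: schwartz_lap.
  by apply: schwartzB => //; apply: hr_schwartz => //; exact: ltW.
have iu := schwartz_integrable haar_mu (schwartz_mul su su).
rewrite -lee_fin EFin_Rintegral //.
have <- : ((Num.sqrt e)%:E `^ 2 = e%:E)%E.
  by rewrite poweR_EFin powR_mulrn ?sqrtr_ge0 // sqr_sqrtr // ltW.
apply: (@le_trans _ _ ((Lnorm mu 2%:E F) `^ 2)%E); last first.
  by apply: poweR_le; [|exact: Lnorm_ge0|exact: ltW].
have n0 (z : R[i]) : 0 <= Normc.normc z by case: z => a b; exact: sqrtr_ge0.
have FE x : (`|F x| `^ 2 = (Normc.normc ((r^-1)%:C%C * (heat G mu p r (fun x => (f x)%:C%C) x - (f x)%:C%C) +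
     2^-1 * subLaplacian G X (fun x => (f x)%:C%C) x) ^+ 2)%:E)%E.
  by rewrite /F /= ger0_norm // powR_mulrn.
rewrite poweR_Lnorm //; under [leRHS]eq_integral do rewrite FE.
apply: ge0_le_integral => //.
- by move=> x _; rewrite lee_fin sqr_ge0.
- by case/integrableP: iu.
- apply/measurable_EFinP; apply: measurable_funX.
  rewrite heat_cext lap_cext; apply: measurable_normc.
    rewrite (_ : re_part _ = fun x : T => r^-1 * (hr r f x - f x) + 2^-1 * lap f x).
      by apply: continuous_measurable; exact: schwartz_continuous.
    by apply/funext => x; rewrite /re_part half_complex raddfD /= !mul0r !subr0.
  rewrite (_ : im_part _ = fun x : T => r^-1 * (hr r (fun=> 0) x - 0) + 2^-1 * lap (fun=> 0) x).
    apply: continuous_measurable; apply: schwartz_continuous.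
    have s0 := @schwartz0 R d.
    apply: schwartzD; apply: schwartzZ; last exact: schwartz_lap.
    by apply: schwartzB => //; apply: hr_schwartz => //; exact: ltW.
  by apply/funext => x; rewrite /im_part half_complex raddfD /= !mul0r !addr0.
move=> x _; rewrite lee_fin; apply: le_trans (Re_le_normc _).
by rewrite half_complex ReD !ReMl heat_cext lap_cext.
Qed.

(** Right convolution commutes with left translations and averages with total mass 1, so the
    Lipschitz constant of f under left translations serves for all times. *)
Lemma hr_lipschitz f : schwartz f -> exists2 C, 0 <= C &
  forall s z x, 0 <= s -> `|hr s f (mul z x) - hr s f x| <= C * `|z|.
Proof.
move=> sf; have [C C0 HC] := right_lipschitz G sf; exists C => // s z x.
rewrite le_eqVlt => /predU1P[<-|s0]; first by rewrite hr0.
rewrite hr_left !hrE //.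
have i1 : intble (fun g : V => f (mul z (mul x (- g))) * p s g).
  by have := hr_intble (mul z x) s0 sf; under eq_fun do rewrite -gmulA.
have i2 := hr_intble x s0 sf.
rewrite -RintegralB //.
have i3 := integrableB measurableT i1 i2.
apply: le_trans (le_normr_Rintegral measurableT i3) _.
rewrite -[_ * `|z|]mulr1 -(p_int1 s0) -RintegralZl //; last exact: p_intble.
apply: le_Rintegral => //.
- exact: (integrable_abse i3).
- exact: (integrableZl measurableT _ (p_intble s0)).
- by move=> g _; rewrite -mulrBl normrM (ger0_norm (ltW (p_gt0 g s0))) ler_wpM2r // ltW // p_gt0.
Qed.

(* Test the semigroup property at the identity against [f]: Fubini moves the
   translation from [f] to the kernel. *)
Lemma pS s t : 0 < s -> 0 < t -> p (s + t) = hr s (p t).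
Proof.
move=> s0 t0; have st0 : 0 < s + t by exact: addr_gt0.
apply: schwartz_weak_eq; [exact: p_schwartz|by apply: hr_schwartz; [exact: ltW|exact: p_schwartz]|].
move=> f sf.
have sfo := schwartz_opp sf.
have := congr1 (fun u => u 0) (hrS (ltW s0) (ltW t0) sfo).
rewrite !hrE //.
have -> : \int[mu]_g (f (- mul 0 (- g)) * p (s + t) g) = \int[mu]_x (f x * p (s + t) x).
  by apply: eq_Rintegral => g _; rewrite gmul0g opprK.
move=> ->.
have [M M0 HM] := schwartz_bounded sf.
pose F (y g : T) : R := f y * p t (mul y (- g)) * p s g.
have iFg (g : T) : intble (F^~ g).
  rewrite (_ : F^~ g = fun y => p s g * (f y * p t (mul y (- g)))); last first.
    by apply/funext => y; rewrite /F mulrC.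
  apply: intbleZ.
  have mfp : measurable_fun setT ((fun y => f y * p t (mul y (- g))) : T -> R).
    apply: measurable_funM.
      by apply: continuous_measurable; exact: schwartz_continuous.
    apply: (measurableT_comp (f := p t : T -> R)); last exact: measurable_gmulr.
    by apply: continuous_measurable; exact: p_cont.
  apply: (intble_le mfp _ (intbleZ M (integrable_right (- g) (p_intble t0)))).
  by move=> y; rewrite !normrM (ger0_norm (ltW (p_gt0 _ t0))) ler_wpM2r // ltW // p_gt0.
have iFy (y : T) : intble (F y).
  have := intbleZ (f y) (hr_intble y s0 (p_schwartz t0)).
  by rewrite /F; under eq_fun do rewrite mulrA.
have mF : measurable_fun setT (fun z : T * T => F z.1 z.2).
  have ms u : continuous u -> measurable_fun setT (u : T -> R) by exact: continuous_measurable.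
  apply: measurable_funM; first apply: measurable_funM.
  - exact: (measurableT_comp (ms _ (schwartz_continuous sf)) measurable_fst).
  - apply: (measurableT_comp (ms _ (@p_cont t t0))).
    apply: (measurable_gmul G measurable_fst).
    exact: (measurableT_comp (@measurable_opp_row _ _) measurable_snd).
  - exact: (measurableT_comp (ms _ (@p_cont s s0)) measurable_snd).
have ig (g : T) : intble (fun y => f y * p t (mul y (- g))).
  have := intbleZ (p s g)^-1 (iFg g).
  rewrite (_ : (fun y => _) = (fun y => f y * p t (mul y (- g)))) //.
  by apply/funext => y; rewrite /F mulrC mulfK // gt_eqF // p_gt0.
transitivity (\int[mu]_g (\int[mu]_y F y g)).
  apply: eq_Rintegral => g _; rewrite hrE //.
  transitivity ((\int[mu]_y (f (mul y g) * p t y)) * p s g).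
    congr (_ * _); apply: eq_Rintegral => y _; congr (f _ * _).
    by rewrite gmul0g -ginvM opprK.
  transitivity ((\int[mu]_y (f y * p t (mul y (- g)))) * p s g).
    congr (_ * _).
    rewrite -(Rintegral_right haar_mu g (ig g)); apply: eq_Rintegral => y _.
    by rewrite gmulgK.
  by rewrite -RintegralZr //; exact: ig.
rewrite -(Rintegral_exchange mF iFy iFg); last first.
  apply: (@le_lt_trans _ _ M%:E); last exact: ltry.
  apply: (@le_trans _ _ (\int[mu]_g (M * p s g)%:E)%E).
    apply: ge0_le_integral => //.
    - by move=> g _; apply: integral_ge0.
    - apply: (measurable_fun_fubini_tonelli_G (fun z : T * T => `|F z.1 z.2|%:E)) => //.
      by apply/measurable_EFinP; exact: measurableT_comp.
    - by apply/measurable_EFinP; apply: measurable_funM => //; apply: continuous_measurable; exact: p_cont.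
    - move=> g _.
      rewrite -(EFin_Rintegral (intble_norm (iFg g))) lee_fin.
      have ir := integrable_right (- g) (p_intble t0).
      have ii := intbleZ (M * p s g) ir.
      apply: (@le_trans _ _ (\int[mu]_y (M * p s g * p t (mul y (- g))))).
        apply: le_Rintegral => //; first exact: (intble_norm (iFg g)).
        move=> y _; rewrite /F !normrM (ger0_norm (ltW (p_gt0 g s0))) (ger0_norm (ltW (p_gt0 _ t0))).
        by rewrite -!mulrA [p s g * _]mulrC ler_wpM2r // mulr_ge0 // ltW // p_gt0.
      by rewrite RintegralZl // (Rintegral_right haar_mu _ (p_intble t0)) p_int1 // mulr1.
  have ii := intbleZ M (p_intble s0).
  by rewrite -(EFin_Rintegral ii) RintegralZl // ?p_int1 ?mulr1 //; exact: p_intble.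
apply: eq_Rintegral => y _; rewrite hrE // -RintegralZl //; last exact: hr_intble (p_schwartz t0).
by apply: eq_Rintegral => g _; rewrite /F mulrA.
Qed.

(** L^2 smallness becomes uniform smallness after a waiting time: for tau >= s0 the kernel p_tau =
    e^{-(tau - s0) L/2} p_s0 is at most sup p_s0, and a probability density bounded by K has L^2
    norm squared at most K. *)
Lemma hr_small s0 e : 0 < s0 -> 0 < e -> exists2 dl, 0 < dl & forall u, schwartz u ->
  \int[mu]_x (u x ^+ 2) <= dl -> forall tau x, s0 <= tau -> `|hr tau u x| <= e.
Proof.
move=> s00 e0; have [K K0 HK] := schwartz_bounded (p_schwartz s00).
(* Balances the two terms of the inequality 2 |u| p <= a^-1 u^2 + a p^2: the first integrates to at
   most e when the integral of u^2 is at most a e, the second to at most a K <= e. *)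
pose a := e / (K + 1).
have K1 : 0 < K + 1 by rewrite ltr_wpDl.
have a0 : 0 < a by rewrite divr_gt0.
exists (a * e); first exact: mulr_gt0.
move=> u su Iu tau x tau0.
have tau_gt0 : 0 < tau by exact: lt_le_trans tau0.
have pK g : p tau g <= K.
  move: tau0; rewrite le_eqVlt => /predU1P[<-|st]; first by apply: le_trans (HK g); rewrite ler_norm.
  have -> : tau = (tau - s0) + s0 by rewrite subrK.
  rewrite pS ?subr_gt0 //; apply: le_trans (ler_norm _) _.
  by apply: hr_bound => //; [rewrite subr_ge0 ltW|exact: p_schwartz].
rewrite hrE //; have ii := hr_intble x tau_gt0 su.
apply: le_trans (le_normr_Rintegral measurableT ii) _.
have iu2 : intble (fun x => u x ^+ 2) by exact: (schwartz_integrable haar_mu (schwartz_mul su su)).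
have iu3 := integrable_oppv (integrable_left x iu2).
have ipp := p_intble tau_gt0.
have i4 := intbleD (intbleZ (2^-1 * a^-1) iu3) (intbleZ (2^-1 * a * K) ipp).
apply: (@le_trans _ _ (\int[mu]_g (2^-1 * a^-1 * u (mul x (- g)) ^+ 2 + 2^-1 * a * K * p tau g))).
  apply: le_Rintegral => //; first exact: (integrable_abse ii).
  move=> g _; set b := u _; set q := p tau g.
  have q0 : 0 <= q by rewrite ltW // p_gt0.
  rewrite normrM (ger0_norm q0).
  (* AM-GM *)
  have H1 : 2 * (`|b| * q) <= a^-1 * b ^+ 2 + a * q ^+ 2.
    have : 0 <= a^-1 * (`|b| - a * q) ^+ 2 by rewrite mulr_ge0 ?sqr_ge0 // invr_ge0 ltW.
    have -> : a^-1 * (`|b| - a * q) ^+ 2 = a^-1 * b ^+ 2 + a * q ^+ 2 - 2 * (`|b| * q).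
      by rewrite -[b ^+ 2]real_normK ?num_real //; field; rewrite gt_eqF.
    by rewrite subr_ge0.
  have H2 : a * q ^+ 2 <= a * K * q.
    by rewrite -mulrA ler_pM2l // expr2 ler_wpM2r // pK.
  have -> : 2^-1 * a^-1 * b ^+ 2 + 2^-1 * a * K * q = 2^-1 * (a^-1 * b ^+ 2 + a * K * q) by ring.
  lra.
rewrite RintegralD //; [|exact: intbleZ|exact: intbleZ].
rewrite !RintegralZl // p_int1 // mulr1.
rewrite (Rintegral_opp haar_mu (integrable_left x iu2)) (Rintegral_left haar_mu _ iu2).
have H1 : a^-1 * \int[mu]_x0 u x0 ^+ 2 <= e by rewrite mulrC ler_pdivrMr // mulrC.
have H2 : a * K <= e.
  by rewrite /a mulrAC ler_pdivrMr // ler_pM2l // lerDl.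
have -> : 2^-1 * a^-1 * \int[mu]_x0 u x0 ^+ 2 + 2^-1 * a * K = 2^-1 * (a^-1 * \int[mu]_x0 u x0 ^+ 2 + a * K) by ring.
lra.
Qed.

(* [hr r f - f] is small in L^2 and equi-Lipschitz along left translations,
   hence small at every point. *)
Lemma hr_cont0 f x e : schwartz f -> 0 < e -> exists2 dl, 0 < dl &
  forall r, 0 < r < dl -> `|hr r f x - f x| <= e.
Proof.
move=> sf e0; have [C C0 HC] := hr_lipschitz sf.
(* On the ball of radius rho, each of the two Lipschitz errors, for [hr r f] and for f, is at most e
   / 4. *)
pose rho := e / (4 * C + 1).
have C1 : 0 < 4 * C + 1 by rewrite ltr_wpDl // mulr_ge0.
have rho0 : 0 < rho by rewrite divr_gt0.
have [b b0 bE] : exists2 b : R, 0 < b & mu [set y : T | (`|y - 0| < rho)%R] = b%:E.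
  have := mu_ball_gt0 haar_mu rho0; have := mu_ball_fin haar_mu rho.
  by case: (mu _) => // b _; rewrite lte_fin => b0; exists b.
pose A := \int[mu]_y (lap f y ^+ 2).
have A0 : 0 <= A by apply: Rintegral_ge0 => y _; exact: sqr_ge0.
have [d1 d10 Hd1] := generator_L2 sf (@ltr01 R).
(* If the difference exceeded e at x, it would be at least e / 2 at all z x with |z| < rho, and its
   squared L^2 norm would be at least c. *)
pose c := (e / 2) ^+ 2 * b.
have c0 : 0 < c by rewrite mulr_gt0 // exprn_gt0 // divr_gt0.
(* The generator estimate bounds that squared norm by r^2 (2 + A), and r < d2 makes this smaller
   than c. *)
pose d2 := Num.min 1 (c / (2 + A + 1)).
have A3 : 0 < 2 + A + 1 by lra.
have d20 : 0 < d2 by rewrite lt_min ltr01 divr_gt0.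
exists (Num.min d1 d2); first by rewrite lt_min d10.
move=> r /andP[r0]; rewrite lt_min => /andP[rd1 rd2].
have {Hd1 rd1} I1 : \int[mu]_x0 (r^-1 * (hr r f x0 - f x0) + 2^-1 * lap f x0) ^+ 2 <= 1.
  by apply: Hd1; rewrite r0.
have sv : schwartz (fun y => hr r f y - f y) by apply: schwartzB => //; apply: hr_schwartz => //; exact: ltW.
have sl := schwartz_lap sf.
have su : schwartz (fun x => r^-1 * (hr r f x - f x) + 2^-1 * lap f x).
  by apply: schwartzD; apply: schwartzZ.
have iv2 : intble (fun y => (hr r f y - f y) ^+ 2) by exact: (schwartz_integrable haar_mu (schwartz_mul sv sv)).
have iu2 : intble (fun y => (r^-1 * (hr r f y - f y) + 2^-1 * lap f y) ^+ 2).
  exact: (schwartz_integrable haar_mu (schwartz_mul su su)).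
have il2 : intble (fun y => lap f y ^+ 2) by exact: (schwartz_integrable haar_mu (schwartz_mul sl sl)).
have Iv : \int[mu]_y (hr r f y - f y) ^+ 2 <= r ^+ 2 * (2 + A).
  apply: (@le_trans _ _ (\int[mu]_y (2 * r ^+ 2 * (r^-1 * (hr r f y - f y) + 2^-1 * lap f y) ^+ 2 +
      r ^+ 2 / 2 * lap f y ^+ 2))).
    apply: le_Rintegral => //; first by apply: intbleD; exact: intbleZ.
    move=> y _; set v := hr r f y - f y; set l := lap f y.
    have : 0 <= (v + r * l) ^+ 2 by exact: sqr_ge0.
    have -> : 2 * r ^+ 2 * (r^-1 * v + 2^-1 * l) ^+ 2 + r ^+ 2 / 2 * l ^+ 2 = v ^+ 2 + (v + r * l) ^+ 2.
      by field; rewrite gt_eqF.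
    lra.
  rewrite RintegralD //; [|exact: intbleZ..].
  rewrite !RintegralZl // -/A.
  have r2 : 0 <= r ^+ 2 by exact: sqr_ge0.
  have := ler_wpM2l r2 I1; have := mulr_ge0 r2 A0; nra.
have Iv' : \int[mu]_y (hr r f y - f y) ^+ 2 < c.
  apply: le_lt_trans Iv _.
  have r1 : r < 1 by rewrite (lt_le_trans rd2) // ge_min lexx.
  have rc : r < c / (2 + A + 1) by rewrite (lt_le_trans rd2) // ge_min lexx orbT.
  move: rc; rewrite ltr_pdivlMr // => rc.
  apply: le_lt_trans rc; rewrite expr2 -mulrA ler_pM2l //.
  apply: (@le_trans _ _ (1 * (2 + A))); last lra.
  by rewrite ler_wpM2r ?(ltW r1) // addr_ge0.
rewrite leNgt; apply/negP => ex.
have iz := integrable_right x iv2.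
have := @ball_integral_le (fun z => (hr r f (mul z x) - f (mul z x)) ^+ 2) ((e / 2) ^+ 2) rho iz
  (fun z => sqr_ge0 _) (sqr_ge0 _).
rewrite (Rintegral_right haar_mu _ iv2) bE -EFinM lee_fin -/c leNgt Iv' => /(_ _)/wrap[] //.
move=> z zr.
have H1 := HC r z x (ltW r0).
have H2 := HC 0 z x (lexx _); rewrite !hr0 in H2.
have Cz : C * `|z| <= e / 4.
  have : (4 * C + 1) * `|z| <= e by rewrite mulrC -ler_pdivlMr // ltW.
  have : 0 <= `|z| by []. lra.
rewrite -[leRHS]real_normK ?num_real // lerXn2r ?nnegrE ?(ltW (divr_gt0 e0 _)) //.
have H3 : `|hr r f x - f x| <= `|hr r f (mul z x) - f (mul z x)| + (`|hr r f (mul z x) - hr r f x| + `|f (mul z x) - f x|).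
  have -> : hr r f x - f x = (hr r f (mul z x) - f (mul z x)) + (- (hr r f (mul z x) - hr r f x) + (f (mul z x) - f x)) by ring.
  apply: le_trans (ler_normD _ _) _; rewrite lerD2l.
  by apply: le_trans (ler_normD _ _) _; rewrite normrN.
lra.
Qed.

(** The remainder of the generator condition is small in L^2; applying the heat operator at a time
    tau >= s0 makes it uniformly small, by [hr_small]. *)
Let hr_step f e s0 : schwartz f -> 0 < s0 -> 0 < e -> exists2 dl, 0 < dl & forall tau r x,
  s0 <= tau -> 0 < r < dl -> `|hr (tau + r) f x - hr tau f x + r / 2 * hr tau (lap f) x| <= r * e.
Proof.
move=> sf s00 e0; have [d1 d10 Hd1] := hr_small s00 e0.
have [d2 d20 Hd2] := generator_L2 sf d10.
exists d2 => // tau r x st rd; have /andP[r0 _] := rd.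
have t0 : 0 <= tau by rewrite (le_trans _ st) // ltW.
have sr := hr_schwartz (ltW r0) sf.
have sv := schwartzB sr sf.
have sl := schwartz_lap sf.
have su : schwartz (fun x => r^-1 * (hr r f x - f x) + 2^-1 * lap f x).
  by apply: schwartzD; apply: schwartzZ.
have := Hd1 _ su (Hd2 _ rd) tau x st.
rewrite hrD //; [|exact: schwartzZ..].
rewrite !hrZ // hrB // -hrS // ?(ltW r0) // => H.
have -> : hr (tau + r) f x - hr tau f x + r / 2 * hr tau (lap f) x =
   r * (r^-1 * (hr (tau + r) f x - hr tau f x) + 2^-1 * hr tau (lap f) x).
  by field; rewrite gt_eqF.
by rewrite normrM gtr0_norm // ler_pM2l.
Qed.

Lemma hr_lip s f x M : 0 <= s -> schwartz f -> (forall y, `|lap f y| <= M) ->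
  `|hr s f x - f x| <= s * (M / 2).
Proof.
rewrite le_eqVlt => /predU1P[<-|s0] sf HM; first by rewrite hr0 subrr normr0 mul0r.
have M0 : 0 <= M by exact: le_trans (HM 0).
have := @telescoping_bound R (fun tau => hr tau f x) s (M / 2) s0 (divr_ge0 M0 (ler0n _ _)).
rewrite hr0; apply => [e e0|s1 e s10 e0]; first exact: hr_cont0.
have [dl dl0 Hdl] := hr_step sf s10 e0.
exists dl => // tau r st _ rd; have := Hdl tau r x st rd; have /andP[r0 _] := rd.
have t0 : 0 <= tau by rewrite (le_trans _ st) // ltW.
have := hr_bound x t0 (schwartz_lap sf) HM.
set a := hr (tau + r) f x - hr tau f x; set b := hr tau (lap f) x => Hb Ha.
have -> : a = (a + r / 2 * b) + - (r / 2 * b) by ring.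
apply: le_trans (ler_normD _ _) _; rewrite normrN mulrDr addrC; apply: lerD => //.
by rewrite normrM ger0_norm ?divr_ge0 ?(ltW r0) // mulrAC mulrA ler_wpM2r // ler_wpM2l // ltW.
Qed.

(** The function tau -> e^{-tau L/2} f + (tau/2) L f has increments of rate -(1/2)(e^{-tau L/2} L f
    - L f), which [hr_lip] applied to L f bounds by tau M / 4. *)
Lemma hr_taylor s f x M : 0 <= s -> schwartz f -> (forall y, `|lap (lap f) y| <= M) ->
  `|hr s f x - f x + s / 2 * lap f x| <= s ^+ 2 * (M / 4).
Proof.
rewrite le_eqVlt => /predU1P[<-|s0] sf HM; first by rewrite hr0 subrr !mul0r addr0 normr0 expr0n mul0r.
have M0 : 0 <= M by exact: le_trans (HM 0).
have sl := schwartz_lap sf.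
have -> : hr s f x - f x + s / 2 * lap f x = (hr s f x + s / 2 * lap f x) - (hr 0 f x + 0 / 2 * lap f x).
  by rewrite hr0 !mul0r addr0 addrAC.
have -> : s ^+ 2 * (M / 4) = s * (s * (M / 4)) by ring.
apply: (@telescoping_bound R (fun tau => hr tau f x + tau / 2 * lap f x) s (s * (M / 4)) s0).
- by rewrite mulr_ge0 ?divr_ge0 // ltW.
- move=> e e0; have e2 : 0 < e / 2 by rewrite divr_gt0.
  have [dl dl0 Hdl] := hr_cont0 x sf e2.
  pose a := `|lap f x| + 1; have a0 : 0 < a by rewrite ltr_wpDl.
  exists (Num.min dl (e / a)); first by rewrite lt_min dl0 divr_gt0.
  move=> r /andP[r0]; rewrite lt_min => /andP[r1 r2].
  have := Hdl r; rewrite r0 r1 => /(_ isT) H1.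
  rewrite hr0 !mul0r addr0 addrAC; apply: le_trans (ler_normD _ _) _.
  rewrite [e]splitr; apply: lerD => //.
  rewrite normrM ger0_norm ?divr_ge0 ?(ltW r0) // mulrAC ler_pM2r ?invr_gt0 //.
  have : r * a <= e by rewrite -ler_pdivlMr // ltW.
  apply: le_trans; rewrite ler_pM2l // /a; lra.
move=> s1 e s10 e0.
have [dl dl0 Hdl] := hr_step sf s10 e0.
exists dl => // tau r st ts rd; have := Hdl tau r x st rd; have /andP[r0 _] := rd.
have t0 : 0 <= tau by rewrite (le_trans _ st) // ltW.
have := hr_lip x t0 sl HM.
set b := hr tau (lap f) x; set l := lap f x => Hb Ha.
have -> : hr (tau + r) f x + (tau + r) / 2 * l - (hr tau f x + tau / 2 * l) =
  (hr (tau + r) f x - hr tau f x + r / 2 * b) + - (r / 2 * (b - l)) by field.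
apply: le_trans (ler_normD _ _) _; rewrite normrN [r * (_ + e)]mulrDr [leRHS]addrC; apply: lerD => //.
rewrite normrM ger0_norm ?divr_ge0 ?(ltW r0) //.
apply: (@le_trans _ _ (r / 2 * (tau * (M / 2)))); first by rewrite ler_wpM2l // divr_ge0 // ltW.
have -> : r / 2 * (tau * (M / 2)) = r * (tau * (M / 4)) by field.
rewrite ler_pM2l // ler_wpM2r ?divr_ge0 //.
by rewrite (le_trans _ ts) // lerDl ltW.
Qed.

Lemma squeeze0 (a C : R) : (forall r, 0 < r -> r * `|a| <= r ^+ 2 * C) -> a = 0.
Proof.
move=> H; apply/eqP; rewrite -normr_le0; apply/ler_addgt0Pr => e e0; rewrite add0r.
pose r := e / (`|C| + 1).
have C1 : 0 < `|C| + 1 by rewrite ltr_wpDl.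
have r0 : 0 < r by rewrite divr_gt0.
have := H r r0; rewrite expr2 -mulrA ler_pM2l // => /le_trans; apply.
apply: (@le_trans _ _ (r * (`|C| + 1))); last by rewrite /r divfK // gt_eqF.
by rewrite ler_pM2l // (le_trans (ler_norm C)) // lerDl.
Qed.

(** Two expansions of e^{-(s+r) L/2} f in r are compared: the Taylor estimate at e^{-sL/2} f, and
    the image under e^{-sL/2} of the Taylor estimate at f. The terms of first order must agree. *)
Lemma lap_hr s f : 0 <= s -> schwartz f -> lap (hr s f) = hr s (lap f).
Proof.
move=> s0 sf; apply/funext => x; apply/eqP; rewrite -subr_eq0; apply/eqP.
have sh := hr_schwartz s0 sf; have sl := schwartz_lap sf.
have [M1 _ H1] := schwartz_bounded (schwartz_lap (schwartz_lap sh)).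
have [M2 _ H2] := schwartz_bounded (schwartz_lap sl).
apply: (@squeeze0 _ (2 * (M1 / 4 + M2 / 4))) => r r0; have r0' := ltW r0.
have E1 := hr_taylor x r0' sh H1.
have sr := hr_schwartz r0' sf.
have E2 : `|hr s (hr r f) x - hr s f x + r / 2 * hr s (lap f) x| <= r ^+ 2 * (M2 / 4).
  rewrite -hrZ // -hrB // -hrD //; [|exact: schwartzB|exact: schwartzZ].
  apply: hr_bound => //; last by move=> y; exact: hr_taylor.
  by apply: schwartzD; [exact: schwartzB|exact: schwartzZ].
rewrite -hrS // [s + r]addrC hrS // in E2.
have E3 := le_trans (ler_normB _ _) (lerD E1 E2).
have E4 : r / 2 * `|lap (hr s f) x - hr s (lap f) x| <= r ^+ 2 * (M1 / 4) + r ^+ 2 * (M2 / 4).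
  apply: le_trans E3; rewrite -[X in X * _]ger0_norm ?divr_ge0 // -normrM le_eqVlt; apply/orP; left.
  by apply/eqP; congr `|_|; ring.
lra.
Qed.

Hypothesis X_layer : forall i, tnth X i \in layer G 1%N.

Lemma lap_dil c f x : smooth f -> lap (fun y => f (dil G c y)) x = c ^+ 2 * lap f (dil G c x).
Proof.
move=> sf; rewrite !lapE mulrN mulr_sumr; congr (- _); apply: eq_bigr => i _.
have L h y : smooth h -> lie (tnth X i) (fun z => h (dil G c z)) y = c * lie (tnth X i) h (dil G c y).
  by move=> sh; rewrite lie_dil (dil_layer _ _ (X_layer i)) // expr1 lie_scale.
have -> : lie (tnth X i) (fun y => f (dil G c y)) = fun y => c * lie (tnth X i) f (dil G c y).
  by apply/funext => y; exact: L.
have sl := smooth_lie G (tnth X i) sf.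
rewrite lieZ; last exact: (smooth_comp (fun j => moderate_smooth (moderate_dil G c j)) sl).
by rewrite L // mulrA expr2.
Qed.

(** * Scaling of the heat kernel under dilations *)

Section scaling.
Variable c : R.
Hypothesis c0 : 0 < c.
Let cV f y := f (dil G c^-1 y).
(** The heat semigroup conjugated by the dilation of ratio c and run at speed c^2. As L is
    homogeneous of degree 2, it has the same generator as the original one. *)
Let hc s f x := hr (c ^+ 2 * s) (cV f) (dil G c x).

Let c2 s : 0 <= s -> 0 <= c ^+ 2 * s. Proof. by move=> ?; rewrite mulr_ge0 // sqr_ge0. Qed.
Let cVs f : schwartz f -> schwartz (cV f).
Proof. by apply: schwartz_dil; rewrite invr_eq0 gt_eqF. Qed.

Let hc_schwartz s f : 0 <= s -> schwartz f -> schwartz (hc s f).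
Proof.
move=> s0 sf; apply: (@schwartz_dil _ _ G c (hr (c ^+ 2 * s) (cV f))); first by rewrite gt_eqF.
by apply: hr_schwartz; [exact: c2|exact: cVs].
Qed.

Let hcS s t f : 0 <= s -> 0 <= t -> schwartz f -> hc (s + t) f = hc s (hc t f).
Proof.
move=> s0 t0 sf; apply/funext => x; rewrite /hc mulrDr hrS ?c2 //; last exact: cVs.
congr (hr _ _ _); apply/funext => y; rewrite /cV dilVK // gt_eqF //.
Qed.

Let hcB s f h x : 0 <= s -> schwartz f -> schwartz h -> hc s (fun y => f y - h y) x = hc s f x - hc s h x.
Proof. by move=> s0 sf sh; rewrite /hc -hrB ?c2 //; exact: cVs. Qed.

Let hc_bound s f x M : 0 <= s -> schwartz f -> (forall y, `|f y| <= M) -> `|hc s f x| <= M.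
Proof. by move=> s0 sf fM; apply: hr_bound; [exact: c2|exact: cVs|move=> y; exact: fM]. Qed.

Let lap_cV f : schwartz f -> lap (cV f) = fun y => (c ^+ 2)^-1 * cV (lap f) y.
Proof.
move=> sf; apply/funext => y; rewrite /cV lap_dil; last exact: schwartz_smooth.
by rewrite exprVn.
Qed.

Let hc_taylor s f x M : 0 <= s -> schwartz f -> (forall y, `|lap (lap f) y| <= M) ->
  `|hc s f x - f x + s / 2 * lap f x| <= s ^+ 2 * (M / 4).
Proof.
move=> s0 sf HM; have cn0 : c != 0 by rewrite gt_eqF.
have sl := schwartz_lap sf.
have H2 y : `|lap (lap (cV f)) y| <= (c ^+ 4)^-1 * M.
  rewrite lap_cV // (_ : (fun y => _) = cV (fun z => (c ^+ 2)^-1 * lap f z)) // lap_cV; last exact: schwartzZ.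
  rewrite lapZ; last exact: schwartz_smooth.
  rewrite /cV !normrM !(ger0_norm (_ : 0 <= (c ^+ 2)^-1)) ?invr_ge0 ?sqr_ge0 // mulrA -invfM -exprD.
  by rewrite ler_wpM2l // invr_ge0 exprn_ge0 // ltW.
have := hr_taylor (dil G c x) (c2 s0) (cVs sf) H2.
rewrite -/(hc s f x) lap_cV // {1 2}/cV dilK //.
have -> : c ^+ 2 * s / 2 * ((c ^+ 2)^-1 * lap f x) = s / 2 * lap f x by field.
by have -> : (c ^+ 2 * s) ^+ 2 * ((c ^+ 4)^-1 * M / 4) = s ^+ 2 * (M / 4) by field.
Qed.

(** Two contraction semigroups with the same second order Taylor estimate coincide: each of N steps
    of length s / N costs s^2 M / (2 N^2), so the total error is O(1/N). The bound M on L L f is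
    kept at all steps because L commutes with the heat operators, which are contractions for the sup
    norm. *)
Lemma hr_scale s f x : 0 <= s -> schwartz f ->
  hr (c ^+ 2 * s) (fun y => f (dil G c^-1 y)) (dil G c x) = hr s f x.
Proof.
move=> s0 sf; rewrite -/(cV f) -/(hc s f x).
have [M M0 HM] := schwartz_bounded (schwartz_lap (schwartz_lap sf)).
have step r h y : 0 <= r -> schwartz h -> (forall z, `|lap (lap h) z| <= M) ->
    `|hr r h y - hc r h y| <= r ^+ 2 * (M / 2).
  move=> r0 sh Hh; have := hr_taylor y r0 sh Hh; have := hc_taylor y r0 sh Hh.
  move=> A B; have := le_trans (ler_normB _ _) (lerD B A).
  have -> : r ^+ 2 * (M / 4) + r ^+ 2 * (M / 4) = r ^+ 2 * (M / 2) by field.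
  apply: le_trans; rewrite le_eqVlt; apply/orP; left; apply/eqP; congr `|_|; ring.
have tele (N : nat) r h y : 0 <= r -> schwartz h -> (forall z, `|lap (lap h) z| <= M) ->
    `|hr (N%:R * r) h y - hc (N%:R * r) h y| <= N%:R * (r ^+ 2 * (M / 2)).
  move=> r0; elim: N h y => [|N IH] h y sh Hh.
    by rewrite !mul0r /hc mulr0 !hr0 /cV dilK ?gt_eqF // subrr normr0.
  have Nr0 : 0 <= N%:R * r by rewrite mulr_ge0.
  have sr := hr_schwartz r0 sh; have scr := hc_schwartz r0 sh.
  have -> : N.+1%:R * r = N%:R * r + r by rewrite -natr1 mulrDl mul1r.
  rewrite hrS // hcS //.
  have -> : hr (N%:R * r) (hr r h) y - hc (N%:R * r) (hc r h) y =
    (hr (N%:R * r) (hr r h) y - hc (N%:R * r) (hr r h) y) + hc (N%:R * r) (fun z => hr r h z - hc r h z) y.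
    by rewrite hcB //; ring.
  apply: le_trans (ler_normD _ _) _; rewrite -natr1 mulrDl mul1r; apply: lerD.
    apply: IH => // z; rewrite lap_hr // lap_hr //; last exact: schwartz_lap.
    by apply: hr_bound => //; do 2 apply: schwartz_lap.
  by apply: hc_bound => //; [exact: schwartzB|move=> z; exact: step].
apply/esym/eqP; rewrite -subr_eq0; apply/eqP; set a := _ - _.
apply/eqP; rewrite -normr_le0 leNgt; apply/negP => a0.
pose N := (Num.truncn (s ^+ 2 * (M / 2) / `|a|)).+1.
have N0 : N%:R != 0 :> R by rewrite pnatr_eq0.
have Npos : 0 < N%:R :> R by rewrite ltr0n.
have := tele N (s / N%:R) f x (divr_ge0 s0 (ler0n _ _)) sf HM.
rewrite [N%:R * (s / _)]mulrC divfK // -/a.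
have -> : N%:R * ((s / N%:R) ^+ 2 * (M / 2)) = s ^+ 2 * (M / 2) / N%:R by field.
rewrite ler_pdivlMr // mulrC -ler_pdivlMr // leNgt truncnS_gt //.
Qed.

Lemma p_scale s : 0 < s -> exists k l : {nonneg R}, [/\ l%:num * k%:num = 1,
  forall A, measurable A -> mu ((dil G c : T -> T) @^-1` A) = (k%:num%:E * mu A)%E &
  forall g, p s g = l%:num * p (c ^+ 2 * s) (dil G c g)].
Proof.
move=> s0; have cn0 : c != 0 by rewrite gt_eqF.
have cs0 : 0 < c ^+ 2 * s by rewrite mulr_gt0 // exprn_gt0.
have ci0 : 0 < c^-1 by rewrite invr_gt0.
have [k k0 Hk] := haar_dil haar_mu c0.
have [l l0 Hl] := haar_dil haar_mu ci0.
have sp := schwartz_dil G cn0 (p_schwartz cs0).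
have E : p s = fun g => l%:num * p (c ^+ 2 * s) (dil G c g).
  apply: schwartz_weak_eq; [exact: p_schwartz|exact: schwartzZ|].
  move=> w sw; have := hr_scale 0 (ltW s0) (schwartz_opp sw).
  rewrite dil_0 !hrE //.
  have -> : \int[mu]_g0 (w (- mul 0 (- g0)) * p s g0) = \int[mu]_x (w x * p s x).
    by apply: eq_Rintegral => y _; rewrite gmul0g opprK.
  move=> <-.
  pose F y := w y * p (c ^+ 2 * s) (dil G c y).
  have iF : intble F by exact: (schwartz_integrable haar_mu (schwartz_mul sw sp)).
  have := integral_scaled (measurable_dil G c^-1) Hl iF.
  have -> : \int[mu]_x F (dil G c^-1 x) =
     \int[mu]_g0 (w (- dil G c^-1 (mul 0 (- g0))) * p (c ^+ 2 * s) g0).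
    by apply: eq_Rintegral => y _; rewrite /F dilVK // gmul0g dilN opprK.
  move=> ->; rewrite -RintegralZl //.
  by apply: eq_Rintegral => y _; rewrite /F mulrCA.
exists k, l; split => //; last by move=> g; rewrite E.
have := integral_scaled (measurable_dil G c) Hk (p_intble cs0).
rewrite p_int1 // mulr1 => <-; rewrite -(p_int1 s0) -RintegralZl //.
  by apply: eq_Rintegral => y _; rewrite E.
exact: (schwartz_integrable haar_mu sp).
Qed.

Lemma p_dil_law s (f : T -> \bar R) : 0 < s -> measurable_fun setT f -> (forall x, 0 <= f x)%E ->
  (\int[mu]_g (f (dil G c g) * (p s g)%:E) = \int[mu]_g (f g * (p (c ^+ 2 * s) g)%:E))%E.
Proof.
move=> s0 mf f0; have [k [l [lk Hk E]]] := p_scale s0.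
have cs0 : 0 < c ^+ 2 * s by rewrite mulr_gt0 // exprn_gt0.
pose F (g : T) : \bar R := (f g * (p (c ^+ 2 * s) g)%:E)%E.
have mF : measurable_fun setT F.
  by apply: emeasurable_funM => //; exact: measurable_p.
have F0 x : (0 <= F x)%E by rewrite mule_ge0 // lee_fin ltW // p_gt0.
transitivity (\int[mu]_g (l%:num%:E * F (dil G c g)))%E.
  by apply: eq_integral => g _; rewrite E EFinM muleCA.
rewrite ge0_integralZl //; last exact: (measurableT_comp mF (measurable_dil G c)).
by rewrite (ge0_integral_scaled (measurable_dil G c) Hk mF F0) muleA -EFinM lk mul1e.
Qed.

Lemma p_dil_integral s (f : V -> R) : 0 < s -> intble (fun g => f g * p (c ^+ 2 * s) g) ->
  \int[mu]_g (f (dil G c g) * p s g) = \int[mu]_g (f g * p (c ^+ 2 * s) g).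
Proof.
move=> s0 fi; have [k [l [lk Hk E]]] := p_scale s0.
have := integral_scaled (measurable_dil G c) Hk fi => H.
transitivity (l%:num * \int[mu]_g (f (dil G c g) * p (c ^+ 2 * s) (dil G c g))).
  rewrite -RintegralZl //; first by apply: eq_Rintegral => g _; rewrite E mulrCA.
  exact: (integrable_scaled (measurable_dil G c) Hk fi).
by rewrite H mulrA lk mul1r.
Qed.

End scaling.

(** If x and g are independent of laws p_s and p_t, then x g has law p_{s+t}: substitute y = x g,
    exchange the integrals and recognise the convolution [pS]. For f with values in [0, +oo], no
    integrability enters. *)
Lemma p_conv_law s t (f : T -> \bar R) : 0 < s -> 0 < t -> measurable_fun setT f -> (forall x, 0 <= f x)%E ->
  (\int[mu]_x ((p s x)%:E * \int[mu]_g (f (mul x g) * (p t g)%:E)) =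
   \int[mu]_g (f g * (p (s + t) g)%:E))%E.
Proof.
move=> s0 t0 mf f0.
have mp := measurable_p.
have p0 r g : 0 < r -> (0 <= (p r g)%:E)%E by move=> r0; rewrite lee_fin ltW // p_gt0.
pose F (z : T * T) : \bar R := (f z.2 * (p t (mul (- z.1) z.2))%:E * (p s z.1)%:E)%E.
have mN : measurable_fun setT (fun z : T * T => - z.1 : T).
  exact: (measurableT_comp (@measurable_opp_row _ _) measurable_fst).
have mF : measurable_fun setT F.
  apply: emeasurable_funM; first apply: emeasurable_funM.
  - exact: (measurableT_comp mf measurable_snd).
  - exact: (measurableT_comp (mp t t0) (measurable_gmul G mN measurable_snd)).
  - exact: (measurableT_comp (mp s s0) measurable_fst).
have F0 z : (0 <= F z)%E by rewrite !mule_ge0 ?p0.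
transitivity (\int[mu]_x \int[mu]_y F (x, y))%E.
  apply: eq_integral => x _.
  have mfp : measurable_fun setT (fun y : T => f y * (p t (mul (- (x : V)) y))%:E)%E.
    by apply: emeasurable_funM => //; exact: (measurableT_comp (mp t t0) (measurable_gmull _ _)).
  have := @ge0_integralZr _ _ _ mu setT measurableT _ mfp (p s x)%:E (fun y _ => mule_ge0 (f0 y) (p0 _ _ t0)) (p0 _ _ s0).
  rewrite /F /= => ->.
  rewrite muleC; congr (_ * _)%E.
  rewrite -[RHS](ge0_integral_invariant (measurable_gmull G x) (@haar_left _ _ G mu haar_mu x) mfp) //.
    by apply: eq_integral => y _; rewrite gmulKg.
  by move=> y; rewrite mule_ge0 ?p0.
rewrite fubini_tonelli //; apply: eq_integral => y _; rewrite /F /=.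
have sp := p_schwartz s0; have st := p_schwartz t0.
transitivity (\int[mu]_x (f y * (p s x * p t (mul (- (x : V)) y))%:E))%E.
  by apply: eq_integral => x _; rewrite -muleA; congr (_ * _)%E; rewrite -EFinM mulrC.
have mps : measurable_fun setT (fun x : T => (p s x * p t (mul (- (x : V)) y))%:E).
  under eq_fun do rewrite EFinM.
  apply: emeasurable_funM; first exact: mp.
  apply: (measurableT_comp (mp t t0)).
  exact: (measurableT_comp (measurable_gmulr G y) (@measurable_opp_row _ _)).
rewrite ge0_integralZl //; last by move=> x _; rewrite lee_fin mulr_ge0 // ltW // p_gt0.
congr (_ * _)%E.
rewrite addrC pS // hrE // EFin_Rintegral; last exact: hr_intble.
pose H (x : T) : \bar R := (p s (mul y (- (x : V))) * p t x)%:E.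
have mH : measurable_fun setT H.
  rewrite /H; under eq_fun do rewrite EFinM.
  apply: emeasurable_funM; last exact: mp.
  exact: (measurableT_comp (mp s s0) (measurableT_comp (measurable_gmull G y) (@measurable_opp_row _ _))).
have H0 x : (0 <= H x)%E by rewrite lee_fin mulr_ge0 // ltW // p_gt0.
have mHy : measurable_fun setT (fun x : T => H (mul x y)).
  exact: (measurableT_comp mH (measurable_gmulr G y)).
rewrite -[RHS](ge0_integral_invariant (measurable_gmulr G y) (@haar_right _ _ G mu haar_mu y) mH H0).
rewrite -(ge0_integral_invariant (@measurable_opp_row _ _) (haar_opp haar_mu) mHy (fun=> H0 _)).
by apply: eq_integral => x _; rewrite /H ginvM opprK gmulVKg.
Qed.

End heat.

(** * Markov operators on L^q of a probability space *)

Section density_measure.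
Context {disp : measure_display} {T : measurableType disp} {R : realType}.
Variables (mu nu : {measure set T -> \bar R}) (w : T -> R).
Hypotheses (mw : measurable_fun setT w) (w0 : forall x, 0 <= w x).
Hypothesis nuE : forall A, measurable A -> nu A = (\int[mu]_(x in A) (w x)%:E)%E.
Local Open Scope ereal_scope.
Import HBNNSimple.

Let mwE : measurable_fun setT (fun x => (w x)%:E). Proof. exact/measurable_EFinP. Qed.
Let w0E x : 0 <= (w x)%:E. Proof. by rewrite lee_fin. Qed.

(** nu is known through its values on sets only; simple functions and monotone convergence carry the
    density over to integrals. *)
Lemma ge0_integral_density (f : T -> \bar R) : measurable_fun setT f -> (forall x, 0 <= f x) ->
  \int[nu]_x f x = \int[mu]_x (f x * (w x)%:E).
Proof.
move=> mf f0; pose h := nnsfun_approx measurableT mf.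
have fE x : f x = lim ((EFin \o h n) x @[n --> \oo]).
  by apply/esym/cvg_lim => //; exact: cvg_nnsfun_approx.
have -> : \int[nu]_x f x = lim (\int[nu]_x (EFin \o h n) x @[n --> \oo]).
  under eq_integral do rewrite fE.
  apply: monotone_convergence => //.
  - by move=> n; apply/measurable_EFinP.
  - by move=> n x _; rewrite lee_fin.
  - by move=> x _ a b ab; rewrite lee_fin; exact/lefP/nd_nnsfun_approx.
have -> : \int[mu]_x (f x * (w x)%:E) = lim (\int[mu]_x ((EFin \o h n) x * (w x)%:E) @[n --> \oo]).
  have fg x : f x * (w x)%:E = lim (((EFin \o h n) x * (w x)%:E) @[n --> \oo]).
    by apply/esym/cvg_lim => //; apply: cvgeZr => //; exact: cvg_nnsfun_approx.
  under eq_integral do rewrite fg.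
  apply: monotone_convergence => //.
  - by move=> n; apply: emeasurable_funM => //; exact/measurable_EFinP.
  - by move=> n x _; rewrite mule_ge0 // lee_fin.
  - by move=> x _ a b ab; rewrite lee_wpmul2r ?lee_fin //; exact/lefP/nd_nnsfun_approx.
suff suf n : \int[nu]_x (EFin \o h n) x = \int[mu]_x ((EFin \o h n) x * (w x)%:E).
  by under eq_fun do rewrite suf.
transitivity (\int[nu]_x (\sum_(y \in range (h n)) (y * \1_(h n @^-1` [set y]) x)%:E)).
  by apply: eq_integral => t _; rewrite /= fimfunE -fsumEFin.
have indich m r : measurable_fun setT (fun x => (r * \1_(h m @^-1` [set r]) x)%:E).
  by apply: (measurable_comp measurableT) => //; exact: measurable_funM.
rewrite ge0_integral_fsum //; last by move=> m y Ey; exact: nnfun_muleindic_ge0.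
transitivity (\int[mu]_x (\sum_(y \in range (h n)) (y * \1_(h n @^-1` [set y]) x)%:E * (w x)%:E)); last first.
  apply: eq_integral => x _.
  rewrite -ge0_mule_fsuml => [|y]; last exact: nnfun_muleindic_ge0.
  by rewrite fsumEFin // -(fimfunE _ x).
rewrite ge0_integral_fsum //; last 2 first.
  - by move=> y; apply: emeasurable_funM.
  - by move=> m y Ey; rewrite mule_ge0 // nnfun_muleindic_ge0.
apply: eq_fsbigr => r rhn.
under eq_integral do rewrite EFinM.
rewrite integralZl_indic_nnsfun => //.
under [RHS]eq_integral do rewrite EFinM -muleA.
have mA : measurable (h n @^-1` [set r]) by exact: measurable_funPTI.
have mi : measurable_fun setT (fun x => (\1_(h n @^-1` [set r]) x : R)%:E).
  by apply/measurable_EFinP; exact: measurable_indic.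
rewrite ge0_integralZl //.
- congr (_ * _); rewrite integral_indic // setIT nuE // integral_mkcond.
  by apply: eq_integral => x _; rewrite epatch_indic muleC.
- exact: emeasurable_funM.
- by move=> x _; rewrite mule_ge0 // lee_fin.
- by move: rhn; rewrite inE => -[t _ <-]; rewrite lee_fin.
Qed.

Lemma Rintegral_density (f : T -> R) : measurable_fun setT f ->
  (\int[nu]_x f x = \int[mu]_x (f x * w x))%R.
Proof.
move=> mf; congr fine; rewrite integralE [RHS]integralE.
have mfE : measurable_fun setT (EFin \o f) by exact/measurable_EFinP.
rewrite !ge0_integral_density //; [|exact: measurable_funeneg|exact: measurable_funepos].
congr (_ - _); apply: eq_integral => x _.
  by rewrite !funeposE -!EFin_max -EFinM maxr_pMl // mul0r.
by rewrite !funenegE -!EFinN -!EFin_max -EFinM maxr_pMl // mul0r mulNr.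
Qed.

End density_measure.

Section complex_norm.
Context {R : realType}.
Implicit Types z w : R[i].

Lemma normc_ge0 z : 0 <= Normc.normc z.
Proof. by case: z => a b; exact: sqrtr_ge0. Qed.

Lemma normcE z : Normc.normc z = Num.sqrt (complex.Re z ^+ 2 + complex.Im z ^+ 2).
Proof. by case: z. Qed.

Lemma sqr_normc z : Normc.normc z ^+ 2 = complex.Re z ^+ 2 + complex.Im z ^+ 2.
Proof. by rewrite normcE sqr_sqrtr // addr_ge0 ?sqr_ge0. Qed.

Lemma normRe_le z : `|complex.Re z| <= Normc.normc z.
Proof. by rewrite normcE -sqrtr_sqr ler_wsqrtr // lerDl sqr_ge0. Qed.

Lemma normIm_le z : `|complex.Im z| <= Normc.normc z.
Proof. by rewrite normcE -sqrtr_sqr ler_wsqrtr // lerDr sqr_ge0. Qed.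

Lemma normc_leD z : Normc.normc z <= `|complex.Re z| + `|complex.Im z|.
Proof.
rewrite -(@ler_pXn2r _ 2) ?nnegrE ?normc_ge0 ?addr_ge0 // sqr_normc sqrrD !real_normK ?num_real //.
by rewrite lerD2r lerDl mulrn_wge0 // mulr_ge0.
Qed.

Lemma cauchy2 (a b c d : R) : a * c + b * d <= Num.sqrt (a ^+ 2 + b ^+ 2) * Num.sqrt (c ^+ 2 + d ^+ 2).
Proof.
have h0 (x y : R) : 0 <= x ^+ 2 + y ^+ 2 by rewrite addr_ge0 ?sqr_ge0.
rewrite -sqrtrM //; apply: le_trans (ler_norm _) _; rewrite -sqrtr_sqr ler_wsqrtr //.
have : 0 <= (a * d - b * c) ^+ 2 by exact: sqr_ge0.
have -> : (a ^+ 2 + b ^+ 2) * (c ^+ 2 + d ^+ 2) = (a * c + b * d) ^+ 2 + (a * d - b * c) ^+ 2 by ring.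
by rewrite lerDl.
Qed.

End complex_norm.

Section equal_laws.
Context {d1 d2 d : measure_display} {S1 : measurableType d1} {S2 : measurableType d2}
  {T : measurableType d} {R : realType}.
Variables (m1 : {measure set S1 -> \bar R}) (m2 : {measure set S2 -> \bar R}).
Variables (phi : S1 -> T) (psi : S2 -> T).
Hypotheses (mphi : measurable_fun setT phi) (mpsi : measurable_fun setT psi).
Hypothesis law : forall A, measurable A -> m1 (phi @^-1` A) = m2 (psi @^-1` A).
Local Open Scope ereal_scope.

Lemma ge0_integral_law (F : T -> \bar R) : measurable_fun setT F -> (forall x, 0 <= F x) ->
  \int[m1]_x F (phi x) = \int[m2]_y F (psi y).
Proof.
move=> mF F0.
have := @ge0_integral_pushforward _ _ _ _ _ phi mphi m1 setT F measurableT mF (fun x _ => F0 x).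
have := @ge0_integral_pushforward _ _ _ _ _ psi mpsi m2 setT F measurableT mF (fun x _ => F0 x).
rewrite !preimage_setT => <- <-.
by apply: eq_measure_integral => A mA _; rewrite /= /pushforward law.
Qed.

Lemma integral_law (F : T -> \bar R) : measurable_fun setT F ->
  \int[m1]_x F (phi x) = \int[m2]_y F (psi y).
Proof.
move=> mF; rewrite integralE [RHS]integralE.
have pE (S : Type) (h : S -> T) x : (fun x => F (h x))^\+ x = F^\+ (h x) by rewrite !funeposE.
have nE (S : Type) (h : S -> T) x : (fun x => F (h x))^\- x = F^\- (h x) by rewrite !funenegE.
under eq_integral do rewrite pE; under [X in _ - X]eq_integral do rewrite nE.
under [X in _ = X - _]eq_integral do rewrite pE; under [X in _ = _ - X]eq_integral do rewrite nE.
by rewrite !ge0_integral_law //; [exact: measurable_funeneg|exact: measurable_funepos].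
Qed.

Lemma integrable_law (F : T -> \bar R) : measurable_fun setT F ->
  m2.-integrable setT (F \o psi) -> m1.-integrable setT (F \o phi).
Proof.
move=> mF /integrableP[_ Fo]; apply/integrableP; split; first exact: measurableT_comp.
rewrite (ge0_integral_law (F := fun x => `|F x|)) //; exact: measurableT_comp.
Qed.

End equal_laws.

Section complex_triangle.
Context {disp : measure_display} {T : measurableType disp} {R : realType}.
Variable m : {measure set T -> \bar R}.

(** With I the integral, |I|^2 = Re I times the integral of Re f plus Im I times that of Im f, and
    the integrand is at most |I| |f| by the Cauchy inequality in the plane. *)
Lemma normc_cint_le (f : T -> R[i]) :
  measurable_fun setT (re_part f) -> measurable_fun setT (im_part f) ->
  ((Normc.normc (cint m f))%:E <= \int[m]_x (Normc.normc (f x))%:E)%E.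
Proof.
move=> mr mi.
have mn := measurable_normc mr mi.
have [oo|nfin] := eqVneq (\int[m]_x (Normc.normc (f x))%:E)%E +oo%E; first by rewrite oo leey.
have ni : m.-integrable setT (EFin \o (fun x => Normc.normc (f x))).
  apply/integrableP; split; first exact/measurable_EFinP.
  under eq_integral do rewrite /= ger0_norm ?normc_ge0 //.
  by rewrite ltey.
have ri : m.-integrable setT (EFin \o re_part f) by apply: intble_le ni => // x; exact: normRe_le.
have ii : m.-integrable setT (EFin \o im_part f) by apply: intble_le ni => // x; exact: normIm_le.
rewrite -(EFin_Rintegral ni) lee_fin.
set c := Normc.normc (cint m f).
have [->|c0] := eqVneq c 0; first by apply: Rintegral_ge0 => x _; exact: normc_ge0.
have {c0} c0 : 0 < c by rewrite lt_def c0 normc_ge0.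
rewrite -(ler_pM2l c0) -expr2 /c sqr_normc -/c /cint /=.
set A := (\int[m]_x re_part f x)%R; set B := (\int[m]_x im_part f x)%R.
rewrite !expr2 /A -{2}/A /B -{2}/B -!RintegralZl // -RintegralD //; [|exact: intbleZ..].
apply: le_Rintegral => //; [by apply: intbleD; exact: intbleZ|exact: intbleZ|].
move=> x _; rewrite /c /cint (normcE (_ +i* _)%C) (normcE (f x)); exact: cauchy2.
Qed.

End complex_triangle.

Section Lq_probability.
Context {disp : measure_display} {T : measurableType disp} {R : realType}.
Variable nu : probability T R.
Implicit Types (u v : T -> R) (f h : T -> R[i]) (q : \bar R) (r : R).
Local Open Scope ereal_scope.
Local Notation nrm q u := (Lnorm nu q (EFin \o u)).

Lemma prob1 : nu [set: T] = 1. Proof. exact: probability_setT. Qed.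

Lemma Lnormy (F : T -> \bar R) : Lnorm nu +oo F = ess_sup nu (abse \o F).
Proof. by rewrite unlock /= ifT // [X in 0 < X]prob1 lte01. Qed.

Lemma le_Lnorm q u v : 1 <= q -> measurable_fun setT u -> measurable_fun setT v ->
  {ae nu, forall x, `|u x| <= `|v x|}%R -> nrm q u <= nrm q v.
Proof.
case: q => [r||] // q1 mu mv uv.
- rewrite unlock.
  have r0 : (0 < r)%R by rewrite (lt_le_trans ltr01) // -lee_fin.
  have mp (w : T -> R) : measurable_fun setT w -> measurable_fun setT (fun x : T => `|(EFin \o w) x| `^ r).
    move=> mw; apply: (measurableT_comp (measurable_poweR r)).
    by apply: measurableT_comp => //; exact/measurable_EFinP.
  apply: poweR_le; [by rewrite invr_ge0 ltW|by apply: integral_ge0 => x _; exact: poweR_ge0|].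
  apply: ae_ge0_le_integral => //; [by move=> x _; exact: poweR_ge0|exact: mp|by move=> x _; exact: poweR_ge0|exact: mp|].
  by apply: filterS uv => x uvx _; apply: poweR_le; rewrite ?(ltW r0) //= lee_fin.
- by rewrite !Lnormy; apply: le_ess_sup; apply: filterS uv => x uvx /=; rewrite lee_fin.
Qed.

Lemma integral_le_Lnorm q u : 1 <= q -> measurable_fun setT u -> \int[nu]_x `|u x|%:E <= nrm q u.
Proof.
case: q => [r||] //.
- rewrite lee_fin le_eqVlt => /predU1P[<-|r1] mu; first by rewrite Lnorm1.
  have r0 : (0 < r)%R by exact: lt_trans r1.
  pose r' := (1 - r^-1)^-1%R.
  have r'0 : (0 < r')%R by rewrite invr_gt0 subr_gt0 invf_lt1.
  have rr : (r^-1 + r'^-1 = 1)%R by rewrite invrK addrC subrK.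
  have := hoelder nu mu (@measurable_cst _ _ _ _ setT (1 : R)%R) r0 r'0 rr.
  rewrite Lnorm1; under eq_integral do rewrite /= mulr1.
  have -> : nrm r'%:E (cst (1:R)%R) = 1.
    by rewrite Lnorm_cst1 [X in X `^ _](_ : _ = 1) ?poweR1r //; exact: prob1.
  by rewrite mule1.
- move=> _ mu; rewrite Lnormy.
  set M := ess_sup _ _.
  have HM : \forall x \ae nu, `|u x|%:E <= M by exact: ess_sup_ge.
  have M0 : 0 <= M by apply: ess_sup_gee; [by rewrite [X in 0 < X]prob1 lte01|apply: nearW => x /=; rewrite lee_fin].
  apply: (@le_trans _ _ (\int[nu]_x cst M x)); last first.
    by rewrite integral_cst // [X in _ * X]prob1 mule1.
  apply: ae_ge0_le_integral => //.
  + by apply/measurable_EFinP; exact: measurableT_comp.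
  + by apply: filterS HM => x.
Qed.

Lemma inLq_norm q f : inLq nu q f -> measurable_fun setT (fun x : T => Normc.normc (f x)) /\
  nrm q (fun x => Normc.normc (f x)) < +oo.
Proof. by move=> [mr mi fo]; split => //; exact: measurable_normc. Qed.

Lemma Lq_integrable q u : 1 <= q -> measurable_fun setT u -> nrm q u < +oo ->
  nu.-integrable setT (EFin \o u).
Proof.
move=> q1 mu uo; apply/integrableP; split; first exact/measurable_EFinP.
by apply: le_lt_trans uo; apply: integral_le_Lnorm.
Qed.

Lemma inLq_integrable q f : 1 <= q -> inLq nu q f ->
  [/\ nu.-integrable setT (EFin \o (fun x => Normc.normc (f x))),
      nu.-integrable setT (EFin \o re_part f) & nu.-integrable setT (EFin \o im_part f)].
Proof.
move=> q1 fq; have [mn no] := inLq_norm fq; have [mr mi _] := fq.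
have ni := Lq_integrable q1 mn no; split => //.
- by apply: intble_le ni => // x; exact: normRe_le.
- by apply: intble_le ni => // x; exact: normIm_le.
Qed.

(** Jensen's inequality for the power r, read off from Hölder's inequality against the constant 1 on
    a probability space. *)
Lemma jensen_poweR r u : (1 <= r)%R -> measurable_fun setT u -> (forall x, 0 <= u x)%R ->
  (\int[nu]_x (u x)%:E) `^ r <= \int[nu]_x ((u x)%:E `^ r).
Proof.
move=> r1 mu u0; have r0 : (0 < r)%R by exact: lt_le_trans r1.
have aE x : `|(EFin \o u) x| = (u x)%:E by rewrite /= ger0_norm.
have := integral_le_Lnorm (q := r%:E) r1 mu.
under eq_integral do rewrite ger0_norm //.
move=> H; have := poweR_le (ltW r0) _ H.
rewrite poweR_Lnorm ?gt_eqF // => /(_ _)/wrap[].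
  by apply: integral_ge0 => x _; rewrite lee_fin.
by under [leRHS]eq_integral do rewrite aE.
Qed.

Section operator.
Variable phi : T * T -> T.
Hypotheses (mphi : measurable_fun setT phi)
  (inv_phi : forall A, measurable A -> (nu \x nu) (phi @^-1` A) = nu A).

(** One step of a Markov chain: the state x moves to [phi (x, g)] with a noise g of law nu, and
    [inv_phi] says that nu is a stationary law. *)
Definition Kr u (x : T) : R := (\int[nu]_g u (phi (x, g)))%R.
Definition Kc f (x : T) : R[i] := cint nu (fun g => f (phi (x, g))).

Lemma KcE f x : Kc f x = (Kr (re_part f) x +i* Kr (im_part f) x)%C.
Proof. by []. Qed.

Lemma measurable_slice (F : T -> \bar R) x : measurable_fun setT F ->
  measurable_fun setT (fun g => F (phi (x, g))).
Proof.
by move=> mF; apply: measurableT_comp => //; apply: (measurableT_comp mphi); exact: pair1_measurable.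
Qed.

Lemma measurable_sliceR u x : measurable_fun setT u -> measurable_fun setT (fun g => u (phi (x, g))).
Proof.
by move=> mF; apply: measurableT_comp => //; apply: (measurableT_comp mphi); exact: pair1_measurable.
Qed.

Let mF_ (F : T -> \bar R) : measurable_fun setT F -> (forall x, 0 <= F x) ->
  measurable_fun setT (fun x => \int[nu]_g F (phi (x, g))).
Proof.
move=> mF F0; apply: (measurable_fun_fubini_tonelli_F (fun z => F (phi z))) => //.
exact: measurableT_comp.
Qed.

Lemma ge0_invariant (F : T -> \bar R) : measurable_fun setT F -> (forall x, 0 <= F x) ->
  \int[nu]_x \int[nu]_g F (phi (x, g)) = \int[nu]_x F x.
Proof.
move=> mF F0.
rewrite -(@fubini_tonelli1 _ _ _ _ _ nu nu (fun z => F (phi z))) //; last exact: measurableT_comp.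
exact: (@ge0_integral_law _ _ _ _ _ _ _ (nu \x nu) nu phi id).
Qed.

Lemma measurable_Kr u : measurable_fun setT u -> measurable_fun setT (Kr u).
Proof.
move=> mu; rewrite /Kr.
have mE : measurable_fun setT (EFin \o u) by exact/measurable_EFinP.
rewrite (_ : (fun x => _) = fine \o (fun x => \int[nu]_g (EFin \o u)^\+ (phi (x, g)) -
    \int[nu]_g (EFin \o u)^\- (phi (x, g)))).
  apply: (measurableT_comp (f := fine)); first exact: fine_measurable.
  by apply: emeasurable_funB; apply: mF_ => //; [exact: measurable_funepos|exact: measurable_funeneg].
apply/funext => x; rewrite /Rintegral /= integralE; congr (fine (_ - _)); apply: eq_integral => g _.
  by rewrite !funeposE.
by rewrite !funenegE.
Qed.

Lemma Kc_le f x : measurable_fun setT (re_part f) -> measurable_fun setT (im_part f) ->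
  (Normc.normc (Kc f x))%:E <= \int[nu]_g (Normc.normc (f (phi (x, g))))%:E.
Proof.
move=> mr mi; apply: (@normc_cint_le _ _ _ nu (fun g => f (phi (x, g)))).
  exact: (measurable_sliceR x mr).
exact: (measurable_sliceR x mi).
Qed.

(** For finite q this is Jensen on each slice followed by stationarity. For q infinite with
    essential supremum c, the excess of |f| over c has integral 0, so by stationarity it integrates
    to 0 along almost every slice. *)
Lemma Kc_Lnorm q f : 1 <= q -> inLq nu q f -> cLnorm nu q (Kc f) <= cLnorm nu q f.
Proof.
move=> q1 fq; have [mn no] := inLq_norm fq; have [mr mi _] := fq.
have mKn : measurable_fun setT (fun x => Normc.normc (Kc f x)).
  by apply: measurable_normc; [exact: (measurable_Kr mr)|exact: (measurable_Kr mi)].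
have mnE : measurable_fun setT (fun x => (Normc.normc (f x))%:E) by exact/measurable_EFinP.
have n0 z : 0 <= (Normc.normc (f z))%:E by rewrite lee_fin normc_ge0.
move: q1 no; rewrite /cLnorm; case: q fq => [r||] // fq q1 no.
- have r1 : (1 <= r)%R by rewrite -lee_fin.
  have r0 : (0 < r)%R by exact: lt_le_trans r1.
  have mP w : measurable_fun setT w -> measurable_fun setT (fun x : T => w x `^ r).
    exact: (measurableT_comp (measurable_poweR r)).
  rewrite unlock; apply: poweR_le; [by rewrite invr_ge0 ltW|by apply: integral_ge0 => x _; exact: poweR_ge0|].
  have aE (h : T -> R[i]) x : `|(EFin \o (fun x => Normc.normc (h x))) x| = (Normc.normc (h x))%:E.
    by rewrite /= ger0_norm // normc_ge0.
  under eq_integral do rewrite aE; under [leRHS]eq_integral do rewrite aE.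
  rewrite -(ge0_invariant (mP _ mnE) (fun=> poweR_ge0 _ _)).
  apply: ge0_le_integral => //.
  + by move=> x _; exact: poweR_ge0.
  + by apply: mP; exact/measurable_EFinP.
  + exact: (mF_ (mP _ mnE) (fun=> poweR_ge0 _ _)).
  + move=> x _; apply: (@le_trans _ _ ((\int[nu]_g (Normc.normc (f (phi (x, g))))%:E) `^ r)).
      by apply: poweR_le; [exact: ltW|rewrite lee_fin normc_ge0|exact: Kc_le].
    apply: (jensen_poweR (u := fun g => Normc.normc (f (phi (x, g))))) => //.
      exact: (measurable_sliceR x mn).
    by move=> g; exact: normc_ge0.
- move: no; rewrite !Lnormy.
  set M := ess_sup _ _ => Mo.
  have M0 : 0 <= M by apply: ess_sup_gee; [by rewrite [X in 0 < X]prob1 lte01|apply: nearW => x /=; rewrite lee_fin].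
  have [c c0 cM] : exists2 c : R, (0 <= c)%R & M = c%:E.
    by move: M0 Mo; case: (M) => // c; rewrite lee_fin => c0 _; exists c.
  have HM : \forall x \ae nu, (Normc.normc (f x))%:E <= c%:E.
    have := ess_sup_ge nu (abse \o (EFin \o (fun x => Normc.normc (f x)))).
    by apply: filterS => x; rewrite -/M cM /= ger0_norm // normc_ge0.
  pose F x : \bar R := (Num.max (Normc.normc (f x) - c) 0)%:E.
  have mF : measurable_fun setT F.
    apply/measurable_EFinP; apply: measurable_maxr => //; exact: measurable_funB.
  have F0 x : 0 <= F x by rewrite lee_fin le_max lexx orbT.
  have IF : \int[nu]_x F x = 0.
    rewrite (ge0_ae_eq_integral (g := cst 0)) ?integral0 //.
    apply: filterS HM => x; rewrite lee_fin => Hx _; rewrite /F /=.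
    by rewrite (max_idPr _) // subr_le0.
  have := ge0_invariant mF F0; rewrite IF => I2.
  have aeK : \forall x \ae nu, \int[nu]_g F (phi (x, g)) = 0.
    have [/(_ _)/wrap[]] := @ae_eq_integral_abs _ _ _ nu setT measurableT _ (mF_ mF F0).
      rewrite -[RHS]I2; apply: eq_integral => x _; rewrite gee0_abs //; exact: integral_ge0.
    by move=> H _; apply: filterS H => x; apply.
  apply/ess_supP; apply: filterS aeK => x Kx /=.
  rewrite ger0_norm ?normc_ge0 // cM; apply: le_trans (Kc_le x mr mi) _.
  apply: (@le_trans _ _ (\int[nu]_g (c%:E + F (phi (x, g))))).
    apply: ge0_le_integral => //.
    + exact: (measurable_slice x mnE).
    + by apply: emeasurable_funD => //; exact: measurable_slice.
    + move=> g _; rewrite /F -EFinD lee_fin -lerBlDl le_max lexx //.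
  rewrite ge0_integralD //; last exact: measurable_slice.
  by rewrite Kx adde0 integral_cst // [X in _ * X]prob1 mule1.
Qed.

Lemma Kc_inLq q f : 1 <= q -> inLq nu q f -> inLq nu q (Kc f).
Proof.
move=> q1 fq; have [mr mi fo] := fq; split.
- exact: (measurable_Kr mr).
- exact: (measurable_Kr mi).
- exact: le_lt_trans (Kc_Lnorm q1 fq) fo.
Qed.

Lemma ae_slice_integrable u : nu.-integrable setT (EFin \o u) ->
  {ae nu, forall x, nu.-integrable setT (EFin \o (fun g => u (phi (x, g))))}.
Proof.
move=> ui; have mu := intble_measurable ui.
have ip : (nu \x nu).-integrable setT ((EFin \o u) \o phi).
  apply: (@integrable_law _ _ _ _ _ _ _ (nu \x nu) nu phi id) => //.
  exact/measurable_EFinP.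
exact: (ae_integrable1 ip).
Qed.

(** Linearity holds only almost everywhere: at other points the slices need not be integrable and
    their integrals take a default value. *)
Lemma Kc_linear q a f h : 1 <= q -> inLq nu q f -> inLq nu q h ->
  {ae nu, forall x, Kc (fun y => a * f y + h y)%R x = (a * Kc f x + Kc h x)%R}.
Proof.
move=> q1 fq hq; have [_ f1 f2] := inLq_integrable q1 fq; have [_ h1 h2] := inLq_integrable q1 hq.
near=> x.
have i1 : nu.-integrable setT (EFin \o (fun g => re_part f (phi (x, g)))).
  by near: x; exact: ae_slice_integrable.
have i2 : nu.-integrable setT (EFin \o (fun g => im_part f (phi (x, g)))).
  by near: x; exact: ae_slice_integrable.
have i3 : nu.-integrable setT (EFin \o (fun g => re_part h (phi (x, g)))).
  by near: x; exact: ae_slice_integrable.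
have i4 : nu.-integrable setT (EFin \o (fun g => im_part h (phi (x, g)))).
  by near: x; exact: ae_slice_integrable.
rewrite !KcE; case: a => a b.
transitivity ((a * Kr (re_part f) x - b * Kr (im_part f) x + Kr (re_part h) x) +i*
  (a * Kr (im_part f) x + b * Kr (re_part f) x + Kr (im_part h) x))%C%R; last by [].
congr (_ +i* _)%C; rewrite /Kr.
- rewrite -!RintegralZl // -RintegralB //; [|exact: intbleZ..].
  rewrite -RintegralD //; last by apply: intbleB; exact: intbleZ.
  by apply: eq_Rintegral => g _; rewrite /re_part /im_part; case: (f _); case: (h _).
- rewrite -!RintegralZl // -RintegralD //; [|exact: intbleZ..].
  rewrite -RintegralD //; last by apply: intbleD; exact: intbleZ.
  by apply: eq_Rintegral => g _; rewrite /re_part /im_part; case: (f _); case: (h _).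
Unshelve. all: by end_near. Qed.

Lemma Kc1 x : Kc (fun=> 1%R) x = 1%R.
Proof.
rewrite KcE /Kr /re_part /im_part /=; congr (_ +i* _)%C.
  by rewrite Rintegral_cst // [X in fine X]prob1 mulr1.
by rewrite Rintegral_cst // mul0r.
Qed.

(** The negative part of u has integral 0, hence by stationarity integrates to 0 along almost every
    slice. *)
Lemma Kr_ge0 u : measurable_fun setT u -> {ae nu, forall x, 0 <= u x}%R -> {ae nu, forall x, 0 <= Kr u x}%R.
Proof.
move=> mu u0; pose F := (EFin \o u)^\-.
have mF : measurable_fun setT F by apply: measurable_funeneg; exact/measurable_EFinP.
have F0 x : 0 <= F x by exact: funeneg_ge0.
have IF : \int[nu]_x F x = 0.
  rewrite (ge0_ae_eq_integral (g := cst 0)) ?integral0 //.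
  by apply: filterS u0 => x ux _; rewrite /F funenegE /= (max_idPr _) // lee_fin oppr_le0.
have := ge0_invariant mF F0; rewrite IF => I2.
have : \forall x \ae nu, \int[nu]_g F (phi (x, g)) = 0.
  have [/(_ _)/wrap[]] := @ae_eq_integral_abs _ _ _ nu setT measurableT _ (mF_ mF F0).
    rewrite -[RHS]I2; apply: eq_integral => x _; rewrite gee0_abs //; exact: integral_ge0.
  by move=> H _; apply: filterS H => x; apply.
apply: filterS => x Kx; rewrite /Kr /Rintegral integralE.
have -> : \int[nu]_x0 (fun g => (u (phi (x, g)))%:E)^\- x0 = 0.
  by rewrite -[RHS]Kx; apply: eq_integral => g _; rewrite /F !funenegE.
by rewrite sube0; apply: fine_ge0; apply: integral_ge0.
Qed.

(** The order of complex numbers forces the imaginary part to vanish; real positivity is applied to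
    it and to its opposite. *)
Lemma Kc_ge0 q f : 1 <= q -> inLq nu q f ->
  {ae nu, forall x, 0 <= f x}%R -> {ae nu, forall x, 0 <= Kc f x}%R.
Proof.
move=> q1 fq f0; have [mr mi _] := fq; have [_ _ fi] := inLq_integrable q1 fq.
have r0 : {ae nu, forall x, 0 <= re_part f x}%R.
  by apply: filterS f0 => x; rewrite lecE => /andP[].
have i0 : {ae nu, forall x, 0 <= im_part f x}%R.
  by apply: filterS f0 => x; rewrite lecE /= => /andP[/eqP + _]; rewrite /im_part => ->.
have i1 : {ae nu, forall x, 0 <= - im_part f x}%R.
  by apply: filterS f0 => x; rewrite lecE /= => /andP[/eqP + _]; rewrite /im_part => ->; rewrite oppr0.
have mNi : measurable_fun setT (fun x => - im_part f x)%R by exact: measurableT_comp.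
near=> x.
have h1 : (0 <= Kr (re_part f) x)%R by near: x; exact: Kr_ge0.
have h2 : (0 <= Kr (im_part f) x)%R by near: x; exact: Kr_ge0.
have h3 : (0 <= Kr (fun x => - im_part f x) x)%R by near: x; exact: Kr_ge0.
rewrite KcE lecE /= h1 andbT eq_le h2 andbT -oppr_ge0.
suff <- : Kr (fun x => - im_part f x)%R x = (- Kr (im_part f) x)%R by [].
have ii : nu.-integrable setT (EFin \o (fun g => im_part f (phi (x, g)))).
  by near: x; exact: ae_slice_integrable.
by rewrite /Kr -mulN1r -RintegralZl //; apply: eq_Rintegral => g _; rewrite mulN1r.
Unshelve. all: by end_near. Qed.

End operator.

(** A Chapman-Kolmogorov relation at a fixed x: two successive independent noises are required to
    move x to the same law as a single noise through [phi3]. *)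
Lemma Kr_comp (phi1 phi2 phi3 : T * T -> T) u x :
  measurable_fun setT phi1 -> measurable_fun setT phi2 -> measurable_fun setT phi3 ->
  (forall A, measurable A -> (nu \x nu) ((fun z => phi2 (phi1 (x, z.1), z.2)) @^-1` A) =
    nu ((fun g => phi3 (x, g)) @^-1` A)) ->
  measurable_fun setT u -> nu.-integrable setT (EFin \o (fun g => u (phi3 (x, g)))) ->
  Kr phi3 u x = Kr phi1 (Kr phi2 u) x.
Proof.
move=> m1 m2 m3 law mu ui.
have mE : measurable_fun setT (EFin \o u) by exact/measurable_EFinP.
pose psi z := phi2 (phi1 (x, z.1), z.2).
have mphi1x : measurable_fun setT (fun g => phi1 (x, g)).
  by apply: (measurableT_comp m1); exact: pair1_measurable.
have mpsi : measurable_fun setT psi.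
  apply: (measurableT_comp m2); apply: measurable_fun_pair; last exact: measurable_snd.
  exact: (measurableT_comp mphi1x measurable_fst).
have m3x : measurable_fun setT (fun g => phi3 (x, g)).
  by apply: (measurableT_comp m3); exact: pair1_measurable.
have ip : (nu \x nu).-integrable setT ((EFin \o u) \o psi).
  exact: (@integrable_law _ _ _ _ _ _ _ (nu \x nu) nu psi (fun g => phi3 (x, g))).
have := @integral_law _ _ _ _ _ _ _ (nu \x nu) nu psi (fun g => phi3 (x, g)) mpsi m3x law _ mE.
rewrite /Kr /Rintegral => <-; congr fine.
rewrite -(integral12_prod_meas1 ip); apply: ae_eq_integral => //.
- exact: (measurable_fubini_F ip).
- have := measurable_Kr m2 mu; rewrite /Kr => mK.
  by apply/measurable_EFinP; exact: (measurableT_comp mK mphi1x).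
(* The inner integral of Fubini's theorem is finite for almost every g, and there [fine] loses
   nothing. *)
have := integrable_ae measurableT (integrable_fubini_F ip).
by apply: filterS => g Fg _; rewrite fineK //; exact: Fg.
Qed.

Lemma Kr_linear phi a u v : measurable_fun setT phi ->
  (forall A, measurable A -> (nu \x nu) (phi @^-1` A) = nu A) ->
  nu.-integrable setT (EFin \o u) -> nu.-integrable setT (EFin \o v) ->
  {ae nu, forall x, Kr phi (fun y => a * u y + v y)%R x = (a * Kr phi u x + Kr phi v x)%R}.
Proof.
move=> mphi iphi iu iv; near=> x.
have i1 : nu.-integrable setT (EFin \o (fun g => u (phi (x, g)))).
  by near: x; exact: (ae_slice_integrable mphi iphi iu).
have i2 : nu.-integrable setT (EFin \o (fun g => v (phi (x, g)))).
  by near: x; exact: (ae_slice_integrable mphi iphi iv).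
by rewrite /Kr -RintegralZl // -RintegralD //; exact: intbleZ.
Unshelve. all: by end_near. Qed.

Lemma Kr_Lnorm phi q u : measurable_fun setT phi ->
  (forall A, measurable A -> (nu \x nu) (phi @^-1` A) = nu A) ->
  1 <= q -> measurable_fun setT u -> nrm q u < +oo -> nrm q (Kr phi u) <= nrm q u.
Proof.
move=> mphi iphi q1 mu uo.
have nE v : (fun x : T => (Normc.normc ((v x)%:C)%C)%:E) = abse \o (EFin \o v).
  by apply/funext => x /=; rewrite expr0n addr0 sqrtr_sqr.
have uq : inLq nu q (fun x => ((u x)%:C)%C).
  split; [exact: mu|exact: measurable_cst|].
  by rewrite /cLnorm nE Lnorm_abse.
have := Kc_Lnorm mphi iphi q1 uq; rewrite /cLnorm nE Lnorm_abse.
have -> : Kc phi (fun x => ((u x)%:C)%C) = fun x => ((Kr phi u x)%:C)%C.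
  apply/funext => x; rewrite KcE; congr (_ +i* _)%C.
  by rewrite /Kr /im_part /= Rintegral_cst // mul0r.
by rewrite nE Lnorm_abse.
Qed.

Lemma cLnorm_le q f : 1 <= q -> measurable_fun setT (re_part f) -> measurable_fun setT (im_part f) ->
  cLnorm nu q f <= nrm q (re_part f) + nrm q (im_part f).
Proof.
move=> q1 mr mi; rewrite /cLnorm.
have m1 : measurable_fun setT (fun x : T => `|re_part f x|)%R by exact: measurableT_comp.
have m2 : measurable_fun setT (fun x : T => `|im_part f x|)%R by exact: measurableT_comp.
have aE w : nrm q (fun x => `|w x|%R) = nrm q w by rewrite -[RHS]Lnorm_abse.
have := eminkowski nu m1 m2 q1; rewrite !aE.
apply: le_trans; apply: le_Lnorm => //.
- exact: measurable_normc.
- exact: measurable_funD.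
- apply: nearW => x; rewrite (ger0_norm (normc_ge0 _)) ger0_norm ?addr_ge0 //; exact: normc_leD.
Qed.

Section convergence.
Variables (phi_ : nat -> T * T -> T) (phi : T * T -> T).
Hypotheses (mphi_ : forall n, measurable_fun setT (phi_ n)) (mphi : measurable_fun setT phi).
Hypotheses (iphi_ : forall n A, measurable A -> (nu \x nu) (phi_ n @^-1` A) = nu A)
  (iphi : forall A, measurable A -> (nu \x nu) (phi @^-1` A) = nu A).

Let prod1 : (nu \x nu) setT = 1.
Proof. by have := iphi measurableT; rewrite preimage_setT prob1. Qed.

(** For differences bounded by C one has |a|^r <= C^(r-1) |a|, which reduces the L^r norm to the
    integral of |v(phi_n) - v(phi)| over the product space; dominated convergence settles that
    integral. *)
Lemma Kr_cvg_bounded r v M e : (1 <= r)%R -> measurable_fun setT v -> (forall x, `|v x| <= M)%R ->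
  (forall z, v (phi_ n z) @[n --> \oo] --> v (phi z)) -> (0 < e)%R ->
  \forall n \near \oo, nrm r%:E (fun x => Kr (phi_ n) v x - Kr phi v x)%R < e%:E.
Proof.
move=> r1 mv vM vcvg e0; have r0 : (0 < r)%R by exact: lt_le_trans r1.
have M0 : (0 <= M)%R by exact: le_trans (vM point).
pose w n z := `|v (phi_ n z) - v (phi z)|%R.
pose C := (2 * M + 1)%R; have C0 : (0 < C)%R by rewrite ltr_wpDl // mulr_ge0.
have wC n z : (w n z <= C)%R.
  apply: le_trans (ler_normB _ _) _; apply: le_trans (lerD (vM _) (vM _)) _; rewrite /C; lra.
have mw n : measurable_fun setT (w n).
  by apply: measurableT_comp => //; apply: measurable_funB; exact: measurableT_comp.
have vslice (f : T * T -> T) x : measurable_fun setT f -> nu.-integrable setT (EFin \o (fun g => v (f (x, g)))).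
  move=> mf; apply: (@intble_le _ _ _ nu _ (cst M)).
  - by apply: (measurableT_comp mv); apply: (measurableT_comp mf); exact: pair1_measurable.
  - by move=> g; exact: vM.
  - exact: finite_measure_integrable_cst.
have wslice n x : nu.-integrable setT (EFin \o (fun g => w n (x, g))).
  by apply: intble_norm; apply: intbleB; exact: vslice.
have dle n x : (`|Kr (phi_ n) v x - Kr phi v x| <= \int[nu]_g w n (x, g))%R.
  rewrite /Kr -RintegralB; [|exact: measurableT|exact: vslice|exact: vslice].
  by apply: le_normr_Rintegral => //; apply: intbleB; exact: vslice.
have dC n x : (`|Kr (phi_ n) v x - Kr phi v x| <= C)%R.
  apply: le_trans (dle n x) _; rewrite -lee_fin EFin_Rintegral //.
  apply: (@le_trans _ _ (\int[nu]_g cst C%:E g)); last first.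
    by rewrite integral_cst // [X in _ * X]prob1 mule1.
  apply: ge0_le_integral => //; [by move=> g _; rewrite lee_fin /w|by case/integrableP: (wslice n x)|].
  by move=> g _; rewrite lee_fin; exact: wC.
pose W n := \int[nu \x nu]_z (w n z)%:E.
have W0 : W n @[n --> \oo] --> 0.
  have -> : 0 = \int[nu \x nu]_z cst 0 z :> \bar R by rewrite integral0.
  apply: (@dominated_cvg _ _ _ (nu \x nu) setT measurableT (fun n z => (w n z)%:E) (cst 0) (cst C%:E)) => //.
  - by move=> n; exact/measurable_EFinP.
  - move=> z _; apply/fine_cvgP; split; first by near=> n.
    have /cvgrPdist_lt Hz := vcvg z.
    by apply/cvgrPdist_lt => eps /Hz; apply: filterS => n; rewrite /= sub0r normrN normr_id distrC.
  - by apply/integrableP; split => //; rewrite integral_cst //= prod1 mule1 ltry.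
  - by move=> n z _; rewrite /= lee_fin (ger0_norm (normr_ge0 _)); exact: wC.
pose D := (C `^ (r - 1) + 1)%R.
have D0 : (0 < D)%R by rewrite ltr_wpDl // powR_ge0.
have eD : (0 < e `^ r / D)%R by rewrite divr_gt0 // powR_gt0.
have HW : \forall n \near \oo, W n < (e `^ r / D)%:E by exact: cvge0_lt W0 eD.
apply: filterS HW => n Wn.
rewrite ltNge; apply/negP => en.
have := @poweR_le _ e%:E _ r (ltW r0) _ en; rewrite lee_fin (ltW e0) => /(_ isT).
rewrite poweR_Lnorm ?gt_eqF // leNgt => /negP; apply.
apply: (@le_lt_trans _ _ (D%:E * W n)); last first.
  by rewrite poweR_EFin muleC -lte_pdivlMr.
have mK (f : T * T -> T) : measurable_fun setT f -> measurable_fun setT (Kr f v) by move=> mf; exact: measurable_Kr.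
have md : measurable_fun setT (fun x => Kr (phi_ n) v x - Kr phi v x)%R.
  by apply: measurable_funB; exact: mK.
have w0 z : 0 <= (w n z)%:E by rewrite lee_fin /w.
have mwE : measurable_fun setT (fun z => (w n z)%:E) by exact/measurable_EFinP.
have -> : W n = \int[nu]_x \int[nu]_g (w n (x, g))%:E by rewrite /W fubini_tonelli1.
have mI : measurable_fun setT (fun x => \int[nu]_g (w n (x, g))%:E).
  exact: (measurable_fun_fubini_tonelli_F (fun z => (w n z)%:E)).
rewrite -ge0_integralZl //; [|by move=> x _; exact: integral_ge0|exact: ltW].
apply: ge0_le_integral => //.
- by move=> x _; exact: poweR_ge0.
- apply: (measurableT_comp (measurable_poweR r)); apply: measurableT_comp => //; exact/measurable_EFinP.
- exact: measurable_funeM.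
- move=> x _; rewrite /= -(EFin_Rintegral (wslice n x)) -EFinM lee_fin.
  set a := `|_|%R; rewrite -mulr_powRB1 ?normr_ge0 // mulrC.
  apply: ler_pM; [exact: powR_ge0|exact: normr_ge0| |exact: dle].
  apply: (@le_trans _ _ (C `^ (r - 1))%R); last by rewrite /D lerDl.
  apply: ge0_ler_powR; rewrite ?nnegrE ?subr_ge0 ?normr_ge0 ?(ltW C0) //; exact: dC.
Unshelve. all: by end_near. Qed.

(** A three-epsilon argument: the operators are contractions, so the error u - v made in replacing u
    by a good v is not amplified, whatever n. *)
Lemma Kr_cvg r u e : (1 <= r)%R -> measurable_fun setT u -> nrm r%:E u < +oo ->
  (forall e : R, (0 < e)%R -> exists v, [/\ measurable_fun setT v, exists M, forall x, (`|v x| <= M)%R,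
     forall z, v (phi_ n z) @[n --> \oo] --> v (phi z) &
     nrm r%:E (fun x => u x - v x)%R < e%:E]) -> (0 < e)%R ->
  \forall n \near \oo, nrm r%:E (fun x => Kr (phi_ n) u x - Kr phi u x)%R < e%:E.
Proof.
move=> r1 mu uo dense e0.
have e3 : (0 < e / 3)%R by rewrite divr_gt0.
have [v [mv [M vM] vcvg uv]] := dense _ e3.
have r1' : 1 <= r%:E by rewrite lee_fin.
pose w x := (u x - v x)%R.
have mw : measurable_fun setT w by exact: measurable_funB.
have iv : nu.-integrable setT (EFin \o v).
  apply: (@intble_le _ _ _ nu _ (cst M)) => //; exact: finite_measure_integrable_cst.
have wo : nrm r%:E w < +oo by apply: lt_trans uv _; exact: ltry.
have iw := Lq_integrable r1' mw wo.
have mK (f : T * T -> T) (z : T -> R) : measurable_fun setT f -> measurable_fun setT z -> measurable_fun setT (Kr f z).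
  by move=> mf mz; exact: measurable_Kr.
have split (f : T * T -> T) : measurable_fun setT f -> (forall A, measurable A -> (nu \x nu) (f @^-1` A) = nu A) ->
    {ae nu, forall x, Kr f u x = Kr f w x + Kr f v x}%R.
  move=> mf jf; have := Kr_linear 1 mf jf iw iv; apply: filterS => x.
  rewrite mul1r => <-; congr (Kr f _ x); apply/funext => y; by rewrite mul1r subrK.
have sphi := split _ mphi iphi.
have := Kr_cvg_bounded r1 mv vM vcvg e3; apply: filterS => n Hn.
have sn := split _ (mphi_ n) (@iphi_ n).
pose a x := Kr (phi_ n) w x; pose b x := (Kr (phi_ n) v x - Kr phi v x)%R; pose c x := (- Kr phi w x)%R.
have ma : measurable_fun setT a by exact: mK.
have mb : measurable_fun setT b by apply: measurable_funB; exact: mK.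
have mc : measurable_fun setT c by apply: measurableT_comp => //; exact: mK.
have H1 : nrm r%:E (fun x => Kr (phi_ n) u x - Kr phi u x)%R <= nrm r%:E (a \+ (b \+ c))%R.
  apply: le_Lnorm => //; [by apply: measurable_funB; exact: mK|exact: (measurable_funD ma (measurable_funD mb mc))|].
  near=> x; rewrite le_eqVlt; apply/orP; left; apply/eqP; congr `|_|%R.
  have -> : Kr (phi_ n) u x = (Kr (phi_ n) w x + Kr (phi_ n) v x)%R by near: x.
  have -> : Kr phi u x = (Kr phi w x + Kr phi v x)%R by near: x.
  by rewrite /= /a /b /c; ring.
apply: le_lt_trans H1 _.
apply: le_lt_trans (eminkowski nu ma (measurable_funD mb mc) r1') _.
have Ha : nrm r%:E a < (e / 3)%:E by apply: le_lt_trans uv; exact: (Kr_Lnorm (mphi_ n) (@iphi_ n) r1' mw wo).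
have Hc : nrm r%:E c < (e / 3)%:E.
  apply: le_lt_trans uv; rewrite (_ : EFin \o c = (\- (EFin \o Kr phi w))) //.
  by rewrite oppe_Lnorm; exact: (Kr_Lnorm mphi iphi r1' mw wo).
have -> : e%:E = (e / 3)%:E + ((e / 3)%:E + (e / 3)%:E) by rewrite -!EFinD; congr EFin; field.
apply: lteD => //; apply: le_lt_trans (eminkowski nu mb mc r1') _.
exact: lteD.
Unshelve. all: by end_near. Qed.

Lemma Kc_cvg r f e : (1 <= r)%R -> inLq nu r%:E f ->
  (forall u (e : R), measurable_fun setT u -> nrm r%:E u < +oo -> (0 < e)%R ->
     exists v, [/\ measurable_fun setT v, exists M, forall x, (`|v x| <= M)%R,
     forall z, v (phi_ n z) @[n --> \oo] --> v (phi z) &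
     nrm r%:E (fun x => u x - v x)%R < e%:E]) -> (0 < e)%R ->
  \forall n \near \oo, cLnorm nu r%:E (fun x => Kc (phi_ n) f x - Kc phi f x)%R < e%:E.
Proof.
move=> r1 fq dense e0; have r1' : 1 <= r%:E by rewrite lee_fin.
have e2 : (0 < e / 2)%R by rewrite divr_gt0.
have [mr mi _] := fq; have [mn no] := inLq_norm fq.
have ro : nrm r%:E (re_part f) < +oo.
  apply: le_lt_trans no; apply: le_Lnorm => //; apply: nearW => x.
  by rewrite [leRHS]ger0_norm ?normc_ge0 //; exact: normRe_le.
have io : nrm r%:E (im_part f) < +oo.
  apply: le_lt_trans no; apply: le_Lnorm => //; apply: nearW => x.
  by rewrite [leRHS]ger0_norm ?normc_ge0 //; exact: normIm_le.
near=> n.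
have H1 : nrm r%:E (fun x => Kr (phi_ n) (re_part f) x - Kr phi (re_part f) x)%R < (e / 2)%:E.
  by near: n; apply: Kr_cvg => // e' e'0; exact: dense.
have H2 : nrm r%:E (fun x => Kr (phi_ n) (im_part f) x - Kr phi (im_part f) x)%R < (e / 2)%:E.
  by near: n; apply: Kr_cvg => // e' e'0; exact: dense.
have mK (g : T * T -> T) (z : T -> R) : measurable_fun setT g -> measurable_fun setT z -> measurable_fun setT (Kr g z).
  by move=> mg mz; exact: measurable_Kr.
have E1 : re_part (fun x => Kc (phi_ n) f x - Kc phi f x)%R =
  (fun x => Kr (phi_ n) (re_part f) x - Kr phi (re_part f) x)%R by [].
have E2 : im_part (fun x => Kc (phi_ n) f x - Kc phi f x)%R =
  (fun x => Kr (phi_ n) (im_part f) x - Kr phi (im_part f) x)%R by [].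
apply: le_lt_trans (cLnorm_le r1' _ _) _; rewrite ?E1 ?E2.
- by apply: measurable_funB; exact: mK.
- by apply: measurable_funB; exact: mK.
- by rewrite [e]splitr EFinD; exact: lteD.
Unshelve. all: by end_near. Qed.

End convergence.

End Lq_probability.

(** * Density of bounded continuous functions in L^r *)

Section near_sequences.
Context {R : realType}.

(** Dominated convergence is used along sequences; this reduces limits in a real parameter to them
    when the sets B n form a countable base of the filter. *)
Lemma near_sequences (F : set_system R) (B : nat -> set R) (P : set R) :
  (forall Q : set R, (exists n, B n `<=` Q) -> F Q) ->
  (forall u : nat -> R, (forall n, B n (u n)) -> exists n, P (u n)) -> F P.
Proof.
move=> FB H; apply: contrapT => FP.
have /choice[u Hu] n : exists t, B n t /\ ~ P t.
  apply: contrapT => K; apply: FP; apply: FB; exists n => t Bt.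
  by apply: contrapT => Pt; apply: K; exists t.
have [n Pn] := H u (fun n => (Hu n).1).
exact: (Hu n).2 Pn.
Qed.

End near_sequences.

Section bounded_convergence.
Context {disp : measure_display} {T : measurableType disp} {R : realType}.
Variable nu : probability T R.

Lemma bounded_cvg0 (w : nat -> T -> R) C e : (forall n, measurable_fun setT (w n)) ->
  (forall n x, 0 <= w n x <= C) -> (forall x, w n x @[n --> \oo] --> 0) -> 0 < e ->
  exists n, (\int[nu]_x (w n x)%:E < e%:E)%E.
Proof.
move=> mw wC wcvg e0.
have W0 : (\int[nu]_x (w n x)%:E @[n --> \oo] --> (0 : \bar R))%E.
  have -> : (0 = \int[nu]_x cst 0 x :> \bar R)%E by rewrite integral0.
  apply: (@dominated_cvg _ _ _ nu setT measurableT (fun n x => (w n x)%:E) (cst 0%E) (cst C%:E)) => //.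
  - by move=> n; exact/measurable_EFinP.
  - by move=> x _; apply/fine_cvgP; split; [exact: nearW|exact: wcvg].
  - exact: (finite_measure_integrable_cst nu C).
  - by move=> n x _; have /andP[w0 wc] := wC n x; rewrite /= lee_fin ger0_norm.
have [n _ Hn] : \forall n \near \oo, (\int[nu]_x (w n x)%:E < e%:E)%E by exact: cvge0_lt W0 e0.
by exists n; apply: Hn => /=.
Qed.

End bounded_convergence.

Section continuous_approximation.
Context {R : realType} {d : nat}.
Local Notation V := 'rV[R]_d.
Local Notation T := (borelV R d).
Variable nu : probability T R.

(** The sets whose indicators are L^1 limits of continuous functions with values in [0, 1]; they
    will form a sigma-algebra containing the open sets, hence include all Borel sets. *)
Definition approximable (A : set T) := measurable A /\
  forall e : R, 0 < e -> exists h : V -> R,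
    [/\ continuous h, forall x, 0 <= h x <= 1 & (\int[nu]_x `|\1_A x - h x|%:E < e%:E)%E].

Lemma continuousD_fun {U : topologicalType} (f g : U -> R) :
  continuous f -> continuous g -> continuous (fun x => f x + g x).
Proof. by move=> cf cg x; apply: cvgD; [exact: cf|exact: cg]. Qed.

Lemma continuousB_fun {U : topologicalType} (f g : U -> R) :
  continuous f -> continuous g -> continuous (fun x => f x - g x).
Proof. by move=> cf cg x; apply: cvgB; [exact: cf|exact: cg]. Qed.

Let indic01 (A : set T) x : 0 <= (\1_A x : R) <= 1.
Proof. by rewrite indicE; case: (x \in A); rewrite /= ?lexx ler01. Qed.

Let mdiff (A : set T) (h : V -> R) : measurable A -> continuous h ->
  measurable_fun setT (fun x : T => `|\1_A x - h x| : R).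
Proof.
move=> mA ch; apply: measurableT_comp => //; apply: measurable_funB; first exact: measurable_indic.
exact: continuous_measurable.
Qed.

Lemma approximableC A : approximable A -> approximable (~` A).
Proof.
move=> [mA HA]; split; first exact: measurableC.
move=> e /HA[h [ch h01 Hh]]; exists (fun x => 1 - h x); split.
- by apply: continuousB_fun => //; exact: cst_continuous.
- by move=> x; have /andP[h0 h1] := h01 x; rewrite subr_ge0 h1 gerBl.
- apply: le_lt_trans Hh; rewrite le_eqVlt; apply/orP; left; apply/eqP; apply: eq_integral => x _.
  congr EFin; rewrite !indicE in_setC; case: (x \in A) => /=.
    by rewrite sub0r normrN.
  by rewrite subKr add0r normrN.
Qed.

Lemma approximableI A B : approximable A -> approximable B -> approximable (A `&` B).
Proof.
move=> [mA HA] [mB HB]; split; first exact: measurableI.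
move=> e e0; have e2 : 0 < e / 2 by rewrite divr_gt0.
have [h [ch h01 Hh]] := HA _ e2; have [k [ck k01 Hk]] := HB _ e2.
exists (fun x => h x * k x); split.
- exact: continuousM_fun.
- move=> x; have /andP[h0 h1] := h01 x; have /andP[k0 k1] := k01 x.
  by rewrite mulr_ge0 // mulr_ile1.
- apply: (@le_lt_trans _ _ (\int[nu]_x (`|\1_A x - h x|%:E + `|\1_B x - k x|%:E))%E).
    apply: ge0_le_integral => //.
    + apply/measurable_EFinP; apply: mdiff; [exact: measurableI|exact: continuousM_fun].
    + by apply: emeasurable_funD; apply/measurable_EFinP; exact: mdiff.
    + move=> x _; rewrite -EFinD lee_fin indicI /=.
      have -> : \1_A x * \1_B x - h x * k x = \1_A x * (\1_B x - k x) + k x * (\1_A x - h x) by ring.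
      apply: le_trans (ler_normD _ _) _; rewrite !normrM addrC.
      have /andP[a0 a1] := indic01 A x; have /andP[k0 k1] := k01 x.
      by rewrite (ger0_norm a0) (ger0_norm k0); apply: lerD; rewrite ler_piMl.
  rewrite ge0_integralD //; [|by apply/measurable_EFinP; exact: mdiff..].
  by rewrite [e]splitr EFinD; exact: lteD.
Qed.

Lemma approximable_lim (A : set T) (B : nat -> set T) : measurable A -> (forall n, approximable (B n)) ->
  (forall x, \1_(B n) x @[n --> \oo] --> (\1_A x : R)) -> approximable A.
Proof.
move=> mA HB cB; split => // e e0; have e2 : 0 < e / 2 by rewrite divr_gt0.
have mB n : measurable (B n) by have [] := HB n.
have mAB n : measurable_fun setT (fun x : T => `|\1_A x - \1_(B n) x| : R).
  by apply: measurableT_comp => //; apply: measurable_funB; exact: measurable_indic.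
have [n Hn] : exists n, (\int[nu]_x `|\1_A x - \1_(B n) x|%:E < (e / 2)%:E)%E.
  apply: (@bounded_cvg0 _ _ _ nu (fun n x => `|\1_A x - \1_(B n) x|) 1) => // [n x|x].
    rewrite normr_ge0 /= !indicE; case: (x \in A); case: (x \in B n) => /=.
    - by rewrite subrr normr0.
    - by rewrite subr0 normr1.
    - by rewrite sub0r normrN normr1.
    - by rewrite subrr normr0.
  have /cvgrPdist_lt H := cB x.
  by apply/cvgrPdist_lt => eps /H; apply: filterS => n /=; rewrite sub0r normrN normr_id.
have [_ /(_ _ e2)[h [ch h01 Hh]]] := HB n.
exists h; split => //.
apply: (@le_lt_trans _ _ (\int[nu]_x (`|\1_A x - \1_(B n) x|%:E + `|\1_(B n) x - h x|%:E))%E).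
  apply: ge0_le_integral => //.
  + by apply/measurable_EFinP; exact: mdiff.
  + by apply: emeasurable_funD; apply/measurable_EFinP => //; exact: mdiff.
  + move=> x _; rewrite -EFinD lee_fin.
    by apply: le_trans (ler_normD _ _); rewrite addrA subrK.
rewrite ge0_integralD //; [|by apply/measurable_EFinP|by apply/measurable_EFinP; exact: mdiff].
by rewrite [e]splitr EFinD; exact: lteD.
Qed.

Lemma approximable0 : approximable set0.
Proof.
split => // e e0; exists (fun=> 0); split.
- exact: cst_continuous.
- by move=> x; rewrite lexx ler01.
- under eq_integral do rewrite indic0 subrr normr0.
  by rewrite integral0 lte_fin.
Qed.

Lemma approximable_bigcup (F : nat -> set T) : (forall n, approximable (F n)) ->
  approximable (\bigcup_n F n).
Proof.
move=> HF; pose B n := \big[setU/set0]_(i < n) F i.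
have HB n : approximable (B n).
  elim: n => [|n IH]; first by rewrite /B big_ord0; exact: approximable0.
  rewrite /B big_ord_recr /= -[X in approximable X]setCK setCU.
  by apply: approximableC; apply: approximableI; apply: approximableC.
apply: (approximable_lim _ HB).
  by apply: bigcupT_measurable => n; have [] := HF n.
move=> x; rewrite indicE; case: (boolP (x \in _)) => [|]; rewrite ?inE ?notin_setE => Fx.
  have [k _ Fk] := Fx; apply: cvg_near_cst; exists k.+1 => // n /= kn.
  rewrite indicE mem_set // /B -bigcup_mkord.
  by exists k => //=; exact: leq_trans kn.
apply: cvg_near_cst; apply: nearW => n; rewrite indicE memNset //.
by rewrite /B -bigcup_mkord => -[k /= kn Fk]; apply: Fx; exists k.
Qed.

(** With t the positive part of e - |y - x|, the continuous functions k t / (1 + k t) tend to 1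
    inside the ball and vanish outside. *)
Lemma approximable_ball (x : V) (e : R) : approximable [set y : T | `|y - x| < e].
Proof.
split; first exact: borel_ball.
move=> eps eps0.
pose s (y : V) := e - `|y - x|.
pose t y := (s y + `|s y|) / 2.
pose h (k : nat) y := k%:R * t y / (1 + k%:R * t y).
have cs : continuous s by apply: continuousB_fun; [exact: cst_continuous|exact: continuous_dist].
have ct : continuous t.
  apply: continuousM_fun; last exact: cst_continuous.
  by apply: continuousD_fun => //; exact: continuous_norm_fun.
have t0 y : 0 <= t y.
  by rewrite /t divr_ge0 // -lerBlDl sub0r; have := ler_norm (- s y); rewrite normrN.
have tpos y : 0 < s y -> t y = s y by move=> sy; rewrite /t gtr0_norm //; field.
have tneg y : s y <= 0 -> t y = 0 by move=> sy; rewrite /t ler0_norm // subrr mul0r.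
have den k y : 0 < 1 + k%:R * t y by rewrite ltr_pwDl // mulr_ge0.
have ch k : continuous (h k).
  apply: continuousM_fun; first by apply: continuousM_fun => //; exact: cst_continuous.
  apply: continuous_inv_fun; first by move=> y; rewrite gt_eqF.
  by apply: continuousD_fun; [|apply: continuousM_fun => //]; exact: cst_continuous.
have h01 k y : 0 <= h k y <= 1.
  apply/andP; split; last by rewrite /h ler_pdivrMr // mul1r lerDr.
  by apply: divr_ge0; [apply: mulr_ge0; [exact: ler0n|exact: t0]|exact: ltW].
pose A := [set y : T | `|y - x| < e].
have mA : measurable A by exact: borel_ball.
have [k Hk] : exists k, (\int[nu]_y `|\1_A y - h k y|%:E < eps%:E)%E; last by exists (h k).
apply: (@bounded_cvg0 _ _ _ nu (fun k y => `|\1_A y - h k y|) 1) => // [k|k y|y].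
- exact: mdiff.
- rewrite normr_ge0 /= ler_norml; have /andP[a0 a1] := indic01 A y; have /andP[k0 k1] := h01 k y.
  by apply/andP; split; lra.
have [sy|sy] := ltP 0 (s y); last first.
  rewrite (_ : (fun k => _) = fun=> 0); first exact: cvg_cst.
  apply/funext => k; rewrite /h tneg // mulr0 mul0r subr0 indicE memNset ?normr0 //.
  by rewrite /A /=; apply/negP; rewrite -leNgt -subr_le0.
apply/cvgrPdist_lt => r r0; exists (Num.truncn (s y * r)^-1).+1 => // k /= kN.
rewrite sub0r normrN normr_id indicE mem_set; last by rewrite /A /= -subr_gt0.
rewrite /h tpos //.
have sr : 0 < s y * r by rewrite mulr_gt0.
have kr : (s y * r)^-1 < k%:R.
  by apply: lt_le_trans (truncnS_gt _) _; rewrite ler_nat.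
have d0 : 0 < 1 + k%:R * s y by have := den k y; rewrite tpos.
have -> : 1 - k%:R * s y / (1 + k%:R * s y) = (1 + k%:R * s y)^-1 by field; rewrite gt_eqF.
rewrite gtr0_norm ?invr_gt0 // -[r]invrK ltf_pV2 ?posrE ?invr_gt0 //.
move: kr; rewrite invfM -ltr_pdivlMl ?invr_gt0 // invrK => kr.
by apply: lt_le_trans kr _; rewrite mulrC lerDr.
Qed.

Lemma approximable_open (A : set V) : open A -> approximable (A : set T).
Proof.
move=> oA.
pose F (n : nat) : set T := match (unpickle n : option ('rV[rat]_d * nat)) with
  | Some (q, k) => [set y : T | `|y - ratrow q| < k.+1%:R^-1 /\
      (forall z : V, `|z - ratrow q| < k.+1%:R^-1 -> A z)]
  | None => set0 end.
have -> : A = \bigcup_n F n.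
  apply/seteqP; split => [x Ax|x [n _]].
    have [e e0 He] := open_ballP oA Ax.
    have e2 : 0 < e / 2 by rewrite divr_gt0.
    have [k ke] := ball_inv_nat e2.
    have k0 : 0 < k.+1%:R^-1 :> R by rewrite invr_gt0.
    have [q xq] := ratrow_dense x k0.
    exists (pickle (q, k)) => //; rewrite /F pickleK; split => // z zq; apply: He.
    apply: le_lt_trans (ler_distD (ratrow q) _ _) _.
    by rewrite [e]splitr; apply: ltrD; [exact: lt_trans ke|rewrite distrC; exact: lt_trans ke].
  by rewrite /F; case: unpickle => // -[q k] [xq H]; exact: H.
apply: approximable_bigcup => n; rewrite /F; case: unpickle => [[q k]|]; last exact: approximable0.
have [H|H] := pselect (forall z : V, `|z - ratrow q| < k.+1%:R^-1 -> A z).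
  have -> : [set y : T | `|y - ratrow q| < k.+1%:R^-1 /\ (forall z : V, `|z - ratrow q| < k.+1%:R^-1 -> A z)] =
    [set y : T | `|y - ratrow q| < k.+1%:R^-1] by apply/seteqP; split => [y []|y] //.
  exact: approximable_ball.
rewrite (_ : [set y : T | _] = set0); first exact: approximable0.
by apply/seteqP; split => [y []|y] //.
Qed.

Lemma measurable_approximable (A : set T) : measurable A -> approximable A.
Proof.
apply: smallest_sub => [|B oB]; last exact: approximable_open.
split; [exact: approximable0| |exact: approximable_bigcup].
by move=> B HB; rewrite setTD; exact: approximableC.
Qed.


Section density.
Variable r : R.
Hypothesis r1 : 1 <= r.
Local Notation nrm u := (Lnorm nu r%:E (EFin \o (u : T -> R))).

(** The closure in L^r of the bounded continuous functions. *)
Definition in_closure (u : T -> R) := measurable_fun setT u /\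
  forall e : R, 0 < e -> exists h : V -> R,
    [/\ continuous h, exists M, forall x, `|h x| <= M & (nrm (fun x => u x - h x)%R < e%:E)%E].

Let r0 : 0 < r. Proof. exact: lt_le_trans r1. Qed.
Let r1E : (1 <= r%:E)%E. Proof. by rewrite lee_fin. Qed.

Let powR_le1 (a : R) : 0 <= a -> a <= 1 -> a `^ (r - 1) <= 1.
Proof.
move=> a0 a1; have : a `^ (r - 1) <= 1 `^ (r - 1).
  by apply: ge0_ler_powR; rewrite ?nnegrE ?subr_ge0.
by rewrite powR1.
Qed.

Lemma Lnorm_lt (u : T -> R) (e : R) : 0 < e ->
  (\int[nu]_x (`|u x|%:E `^ r) < (e `^ r)%:E)%E -> (nrm u < e%:E)%E.
Proof.
move=> e0 H; rewrite ltNge; apply/negP => en.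
have := @poweR_le _ e%:E _ r (ltW r0) _ en; rewrite lee_fin (ltW e0) => /(_ isT).
by rewrite poweR_Lnorm ?gt_eqF // leNgt => /negP; apply.
Qed.

(** The difference of two functions with values in [0, 1] is at most 1 in absolute value, so its
    r-th power is dominated by the L^1 error. *)
Lemma in_closure_indic A : measurable A -> in_closure (\1_A).
Proof.
move=> mA; split; first exact: measurable_indic.
move=> e e0; have [_ H] := measurable_approximable mA.
have er : 0 < e `^ r by rewrite powR_gt0.
have [h [ch h01 Hh]] := H _ er.
exists h; split => //.
  by exists 1 => x; have /andP[h0 h1] := h01 x; rewrite ger0_norm.
apply: Lnorm_lt => //; apply: le_lt_trans Hh.
have md := mdiff mA ch.
apply: ge0_le_integral => //.
- by move=> x _; exact: poweR_ge0.
- by apply: (measurableT_comp (measurable_poweR r)); exact/measurable_EFinP.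
- exact/measurable_EFinP.
- move=> x _; rewrite poweR_EFin lee_fin.
  have a1 : `|\1_A x - h x| <= 1.
    have /andP[a0 a1] := indic01 A x; have /andP[k0 k1] := h01 x.
    by rewrite ler_norml; apply/andP; split; lra.
  rewrite -mulr_powRB1 // ler_piMr //.
  exact: powR_le1.
Qed.

Lemma LnormZ_fun a (u : T -> R) : measurable_fun setT u -> (nrm (fun x => a * u x)%R = `|a|%:E * nrm u)%E.
Proof.
move=> mu; rewrite unlock.
under eq_integral do rewrite /= normrM powRM // EFinM.
rewrite ge0_integralZl //; last first.
  by apply/measurable_EFinP; apply: (measurableT_comp (measurable_powR r)); exact: measurableT_comp.
rewrite poweRM ?lee_fin ?powR_ge0 //; last by apply: integral_ge0 => x _; rewrite lee_fin powR_ge0.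
by rewrite poweR_EFin -powRrM divff ?gt_eqF // powRr1.
Qed.

Lemma in_closureD a u v : in_closure u -> in_closure v -> in_closure (fun x => a * u x + v x).
Proof.
move=> [mu Hu] [mv Hv]; split.
  by apply: measurable_funD => //; exact: measurable_funM.
move=> e e0; have e2 : 0 < e / 2 by rewrite divr_gt0.
have ea : 0 < e / 2 / (`|a| + 1) by rewrite divr_gt0 // ltr_wpDl.
have [h [ch [M hM] Hh]] := Hu _ ea; have [k [ck [N kN] Hk]] := Hv _ e2.
exists (fun x => a * h x + k x); split.
- by apply: continuousD_fun => //; apply: continuousM_fun => //; exact: cst_continuous.
- exists (`|a| * M + N) => x; apply: le_trans (ler_normD _ _) _; apply: lerD => //.
  by rewrite normrM ler_wpM2l.
have mh : measurable_fun setT (h : T -> R) by exact: continuous_measurable.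
have mk : measurable_fun setT (k : T -> R) by exact: continuous_measurable.
have m1 : measurable_fun setT (fun x : T => a * (u x - h x)).
  by apply: measurable_funM => //; exact: measurable_funB.
have m2 : measurable_fun setT (fun x : T => v x - k x) by exact: measurable_funB.
have -> : (fun x => a * u x + v x - (a * h x + k x)) = (fun x => a * (u x - h x)) \+ (fun x => v x - k x).
  by apply/funext => x /=; ring.
apply: le_lt_trans (eminkowski nu m1 m2 r1E) _.
rewrite [e]splitr EFinD; apply: lteD => //.
rewrite LnormZ_fun; last exact: measurable_funB.
apply: (@le_lt_trans _ _ (`|a|%:E * (e / 2 / (`|a| + 1))%:E)%E).
  by apply: lee_wpmul2l; rewrite ?lee_fin // ltW.
rewrite -EFinM lte_fin mulrCA gtr_pMr // ltr_pdivrMr ?ltr_wpDl // mul1r ltrDl //.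
Qed.

Lemma in_closure_lim (u : T -> R) : measurable_fun setT u ->
  (forall e : R, 0 < e -> exists2 v, in_closure v & (nrm (fun x => u x - v x)%R < e%:E)%E) -> in_closure u.
Proof.
move=> mu H; split => // e e0; have e2 : 0 < e / 2 by rewrite divr_gt0.
have [v [mv Hv] uv] := H _ e2; have [h [ch hM Hh]] := Hv _ e2.
exists h; split => //.
have mh : measurable_fun setT (h : T -> R) by exact: continuous_measurable.
have m1 : measurable_fun setT (fun x : T => u x - v x) by exact: measurable_funB.
have m2 : measurable_fun setT (fun x : T => v x - h x) by exact: measurable_funB.
have -> : (fun x => u x - h x) = (fun x => u x - v x) \+ (fun x => v x - h x).
  by apply/funext => x /=; rewrite addrA subrK.
apply: le_lt_trans (eminkowski nu m1 m2 r1E) _.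
by rewrite [e]splitr EFinD; exact: lteD.
Qed.

Import HBNNSimple.

Lemma in_closure_nnsfun (g : {nnsfun T >-> R}) : in_closure g.
Proof.
rewrite (_ : (g : T -> R) = fun x => \sum_(y <- finmap.enum_fset (fset_set (range g))) y * \1_(g @^-1` [set y]) x); last first.
  by apply/funext => x; rewrite [LHS]fimfunE fsbig_finite.
elim: (finmap.enum_fset (fset_set (range g))) => [|y s IH].
  under eq_fun do rewrite big_nil.
  by have := in_closure_indic measurable0; rewrite indic0.
under eq_fun do rewrite big_cons.
by apply: in_closureD => //; apply: in_closure_indic; exact: measurable_funPTI.
Qed.

Lemma in_closure_ge0 (u : T -> R) : measurable_fun setT u -> (forall x, 0 <= u x) -> (nrm u < +oo)%E -> in_closure u.
Proof.
move=> mu u0 uo; apply: in_closure_lim => // e e0.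
have mE : measurable_fun setT (EFin \o u) by exact/measurable_EFinP.
pose g := nnsfun_approx measurableT mE.
have gcvg x : g n x @[n --> \oo] --> u x.
  have u0E y : [set: T] y -> (0 <= (EFin \o u) y)%E by rewrite lee_fin.
  by have /fine_cvgP[] := cvg_nnsfun_approx measurableT mE u0E (x := x) I.
have gu n x : g n x <= u x.
  have nd : nondecreasing_seq (fun n => g n x) by move=> a b ab; exact/lefP/nd_nnsfun_approx.
  have cg : cvgn (fun n => g n x) by apply/cvg_ex; exists (u x); exact: gcvg.
  have := nondecreasing_cvgn_le nd cg n.
  by rewrite (cvg_lim _ (gcvg x)).
have mw n : measurable_fun setT (fun x : T => `|u x - g n x|).
  by apply: measurableT_comp => //; exact: measurable_funB.
have W0 : (\int[nu]_x (`|u x - g n x|%:E `^ r) @[n --> \oo] --> (0 : \bar R))%E.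
  have -> : (0 = \int[nu]_x cst 0 x :> \bar R)%E by rewrite integral0.
  apply: (@dominated_cvg _ _ _ nu setT measurableT (fun n x => `|u x - g n x|%:E `^ r)%E (cst 0%E) (fun x => (u x)%:E `^ r)%E) => //.
  - by move=> n; apply: (measurableT_comp (measurable_poweR r)); exact/measurable_EFinP.
  - move=> x _; apply/fine_cvgP; split; first exact: nearW.
    apply/cvgrPdist_lt => eps eps0.
    pose m := Num.min 1 eps; have m0 : 0 < m by rewrite lt_min ltr01.
    have /cvgrPdist_lt/(_ _ m0) := gcvg x; apply: filterS => n /= xm.
    rewrite sub0r normrN ger0_norm ?powR_ge0 //.
    have x1 : `|u x - g n x| <= 1 by rewrite ltW // (lt_le_trans xm) // ge_min lexx.
    have xe : `|u x - g n x| < eps by rewrite (lt_le_trans xm) // ge_min lexx orbT.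
    apply: le_lt_trans xe; rewrite -mulr_powRB1 // ler_piMr //.
    exact: powR_le1.
  - apply/integrableP; split; first exact: (measurableT_comp (measurable_poweR r)).
    have := @poweR_lty _ (nrm u) r uo; rewrite poweR_Lnorm ?gt_eqF //.
    apply: le_lt_trans; rewrite le_eqVlt; apply/orP; left; apply/eqP; apply: eq_integral => x _.
    by rewrite /= !ger0_norm ?powR_ge0.
  - move=> n x _; rewrite /= ger0_norm ?powR_ge0 // lee_fin.
    apply: ge0_ler_powR; rewrite ?nnegrE ?(ltW r0) // ger0_norm ?subr_ge0 //.
    by rewrite gerBl.
have er : 0 < e `^ r by rewrite powR_gt0.
have [n _ Hn] : \forall n \near \oo, (\int[nu]_x (`|u x - g n x|%:E `^ r) < (e `^ r)%:E)%E.
  exact: cvge0_lt W0 er.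
exists (g n); first exact: in_closure_nnsfun.
by apply: Lnorm_lt => //; apply: Hn => /=.
Qed.

Lemma Lr_dense (u : T -> R) : measurable_fun setT u -> (nrm u < +oo)%E -> in_closure u.
Proof.
move=> mu uo.
pose up x := Num.max (u x) 0; pose un x := Num.max (- u x) 0.
have mup : measurable_fun setT up by apply: measurable_maxr.
have mun : measurable_fun setT un by apply: measurable_maxr => //; exact: measurableT_comp.
have Hp : in_closure up.
  apply: in_closure_ge0 => //; first by move=> x; rewrite le_max lexx orbT.
  apply: le_lt_trans uo; apply: le_Lnorm => //; apply: nearW => x.
  rewrite ger0_norm ?le_max ?lexx ?orbT // /up; case: (leP (u x) 0) => // _; exact: ler_norm.
have Hn : in_closure un.
  apply: in_closure_ge0 => //; first by move=> x; rewrite le_max lexx orbT.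
  apply: le_lt_trans uo; apply: le_Lnorm => //; apply: nearW => x.
  rewrite ger0_norm ?le_max ?lexx ?orbT // /un; case: (leP (- u x) 0) => // _.
  by rewrite -normrN ler_norm.
rewrite (_ : u = fun x => -1 * un x + up x); first exact: in_closureD.
apply/funext => x; rewrite /up /un mulN1r; have [ux|ux] := leP (u x) 0.
  by rewrite (max_idPl _) ?oppr_ge0 // opprK addr0.
by rewrite (max_idPr _) ?oppr_le0 ?ltW // oppr0 add0r.
Qed.


End density.

End continuous_approximation.

(** * The Mehler semigroup *)

Section Lq_limits.
Context {R : realType}.

Lemma ReB (z w : R[i]) : complex.Re (z - w) = complex.Re z - complex.Re w.
Proof. by case: z; case: w. Qed.

Lemma ImB (z w : R[i]) : complex.Im (z - w) = complex.Im z - complex.Im w.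
Proof. by case: z; case: w. Qed.

Lemma ReM (z w : R[i]) : complex.Re (z * w) = complex.Re z * complex.Re w - complex.Im z * complex.Im w.
Proof. by case: z; case: w. Qed.

Lemma ImM (z w : R[i]) : complex.Im (z * w) = complex.Re z * complex.Im w + complex.Im z * complex.Re w.
Proof. by case: z; case: w. Qed.

Lemma cvge0_intro {U : Type} (F : set_system U) {FF : Filter F} (w : U -> \bar R) :
  (forall t, 0 <= w t)%E -> (forall e : R, 0 < e -> \forall t \near F, (w t < e%:E)%E) -> w @ F --> 0%E.
Proof.
move=> w0 H; apply/fine_cvgP; split.
  have := H 1 ltr01; apply: filterS => t wt; rewrite ge0_fin_numE //.
  exact: lt_trans wt (ltry _).
apply/cvgrPdist_lt => e e0; have := H e e0; apply: filterS => t wt /=.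
have wf : w t \is a fin_num by rewrite ge0_fin_numE //; exact: lt_trans wt (ltry _).
by rewrite sub0r normrN ger0_norm ?fine_ge0 // -lte_fin fineK.
Qed.

Lemma continuous_seq (h : R -> R) (w : nat -> R) (a : R) : continuous h ->
  w k @[k --> \oo] --> a -> h (w k) @[k --> \oo] --> h a.
Proof. by move=> ch cw; apply: continuous_cvg => //; exact: ch. Qed.

Lemma Lnorm_bound {disp} {T : measurableType disp} (nu : probability T R) q (u : T -> R) c :
  (1 <= q)%E -> measurable_fun setT u -> 0 <= c -> (forall x, `|u x| <= c) ->
  (Lnorm nu q (EFin \o u) <= c%:E)%E.
Proof.
move=> q1 mu c0 uc; apply: (@le_trans _ _ (Lnorm nu q (EFin \o cst c))).
  by apply: le_Lnorm => //; apply: nearW => x; rewrite (ger0_norm c0).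
move: q1; case: q => [r||] //.
  rewrite lee_fin => r1; have r0 : 0 < r by exact: lt_le_trans r1.
  rewrite unlock; under eq_integral do rewrite /= (ger0_norm c0).
  rewrite integral_cst // [X in (_ * X)%E]prob1 mule1 poweR_EFin -powRrM divff ?gt_eqF //.
  by rewrite powRr1.
move=> _; rewrite Lnormy; apply/ess_supP; apply: nearW => x /=.
by rewrite ger0_norm.
Qed.

End Lq_limits.

Section mehler_law.
Context {R : realType} {d : nat}.
Variable G : stratifiedGroup R d.
Local Notation V := 'rV[R]_d.
Local Notation T := (borelV R d).
Local Notation mul := (gmul G).
Local Notation lie := (lie_der (gmul G)).
Variable mu : {sigma_finite_measure set (borelV R d) -> \bar R}.
Hypothesis haar_mu : haar_measure G mu.
Variables (p : R -> V -> R) (n : nat) (X : n.-tuple V).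
Hypothesis heat_p : heat_kernel G mu p X.
Hypothesis X_layer : forall i, tnth X i \in layer G 1%N.
Variable nu : probability T R.
Hypothesis nuE : forall A : set T, measurable A -> nu A = (\int[mu]_(x in A) (p 1 x)%:E)%E.
Implicit Types (u v : V -> R) (f h : V -> R[i]).

Let mp1 : measurable_fun setT (p 1 : T -> R).
Proof. by apply: continuous_measurable; apply: schwartz_continuous; exact: (p_schwartz heat_p). Qed.

Let p10 (x : T) : 0 <= p 1 x.
Proof. by rewrite ltW // (p_gt0 heat_p). Qed.

Definition psi (a b : R) (z : T * T) : T := mul (dil G a z.1) (dil G b z.2).

Lemma measurable_psi a b : measurable_fun setT (psi a b).
Proof.
apply: (measurable_gmul G).
  exact: (measurableT_comp (measurable_dil G a) measurable_fst).
exact: (measurableT_comp (measurable_dil G b) measurable_snd).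
Qed.

(** By scaling, dil_a x and dil_b g have laws p_{a^2} and p_{b^2}, and their product has law
    p_{a^2+b^2}. The cases a = 0 and b = 0 are apart because the corresponding law is a Dirac mass
    and has no kernel. *)
Lemma ge0_psi_law a b (F : T -> \bar R) : 0 <= a -> 0 <= b -> measurable_fun setT F -> (forall x, 0 <= F x)%E ->
  (\int[nu]_x \int[nu]_g F (psi a b (x, g)) = \int[nu]_g F (dil G (Num.sqrt (a ^+ 2 + b ^+ 2)) g))%E.
Proof.
move=> a0 b0 mF F0; rewrite /psi /=.
have c1 (c : \bar R) : (\int[nu]_g cst c g = c)%E by rewrite integral_cst // [X in (_ * X)%E]prob1 mule1.
move: b0; rewrite le_eqVlt => /predU1P[<-|b0].
  rewrite expr0n addr0 sqrtr_sqr ger0_norm //; apply: eq_integral => x _.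
  by under eq_integral do rewrite dil0 gmulg0; exact: c1.
move: a0; rewrite le_eqVlt => /predU1P[<-|a0].
  rewrite expr0n add0r sqrtr_sqr gtr0_norm //.
  by under eq_integral => x _ do under eq_integral do rewrite dil0 gmul0g; exact: c1.
have c0 : 0 < Num.sqrt (a ^+ 2 + b ^+ 2) by rewrite sqrtr_gt0 addr_gt0 // exprn_gt0.
have a2 : 0 < a ^+ 2 by rewrite exprn_gt0.
have b2 : 0 < b ^+ 2 by rewrite exprn_gt0.
have mE (H : T -> \bar R) (y : V) : measurable_fun setT H -> measurable_fun setT (fun g : T => H (mul y g)).
  by move=> mH; exact: (measurableT_comp mH (measurable_gmull G y)).
have mD (H : T -> \bar R) c : measurable_fun setT H -> measurable_fun setT (fun g : T => H (dil G c g)).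
  by move=> mH; exact: (measurableT_comp mH (measurable_dil G c)).
have dens := ge0_integral_density mp1 p10 nuE.
pose K (y : T) : \bar R := (\int[mu]_g (F (mul y g) * (p (b ^+ 2) g)%:E))%E.
have mK : measurable_fun setT K.
  apply: (measurable_fun_fubini_tonelli_F (fun z : T * T => F (mul z.1 z.2) * (p (b ^+ 2) z.2)%:E)%E).
    apply: emeasurable_funM; first exact: (measurableT_comp mF (measurable_gmul2 G)).
    exact: (measurableT_comp (measurable_p heat_p b2) measurable_snd).
  by move=> z; rewrite mule_ge0 // lee_fin ltW // (p_gt0 heat_p).
have K0 y : (0 <= K y)%E.
  by apply: integral_ge0 => g _; rewrite mule_ge0 // lee_fin ltW // (p_gt0 heat_p).
transitivity (\int[nu]_x K (dil G a x))%E.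
  apply: eq_integral => x _; rewrite dens //; last exact: (mD (fun y => F (mul (dil G a x) y))) (mE _ _ mF).
  rewrite (p_dil_law haar_mu heat_p X_layer b0 (f := fun y => F (mul (dil G a x) y))) ?mulr1 //.
  exact: mE.
rewrite dens //; last exact: mD.
rewrite (p_dil_law haar_mu heat_p X_layer a0 ltr01 mK K0) mulr1.
under eq_integral do rewrite muleC.
rewrite (p_conv_law haar_mu heat_p a2 b2 mF F0).
rewrite dens //; last exact: mD.
rewrite (p_dil_law haar_mu heat_p X_layer c0 ltr01 mF F0) mulr1 sqr_sqrtr //.
by rewrite addr_ge0 // ltW.
Qed.

Lemma psi_law a b A : 0 <= a -> 0 <= b -> measurable A ->
  (nu \x nu)%E (psi a b @^-1` A) = nu ((dil G (Num.sqrt (a ^+ 2 + b ^+ 2)) : T -> T) @^-1` A).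
Proof.
move=> a0 b0 mA.
have mF : measurable_fun setT (fun x : T => (\1_A x : R)%:E) by apply/measurable_EFinP; exact: measurable_indic.
have F0 (x : T) : (0 <= (\1_A x : R)%:E)%E by rewrite lee_fin.
have mpA : measurable (psi a b @^-1` A) by rewrite -[_ @^-1` _]setTI; exact: measurable_psi.
have mdA : measurable ((dil G (Num.sqrt (a ^+ 2 + b ^+ 2)) : T -> T) @^-1` A).
  by rewrite -[_ @^-1` _]setTI; exact: measurable_dil.
have := ge0_psi_law a0 b0 mF F0.
rewrite -(@fubini_tonelli1 _ _ _ _ _ nu nu (fun z => (\1_A (psi a b z) : R)%:E)) //; last first.
  exact: (measurableT_comp mF (measurable_psi a b)).
have -> : (\int[nu \x nu]_z (\1_A (psi a b z) : R)%:E = (nu \x nu) (psi a b @^-1` A))%E.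
  by rewrite -[in RHS](setIT (psi a b @^-1` A)) -integral_indic.
move=> ->; by rewrite -[in RHS](setIT (_ @^-1` A)) -integral_indic.
Qed.

Definition ma (t : R) := expR (- t).
Definition mb (t : R) := Num.sqrt (1 - expR (- 2 * t)).
(* [opT t f x] is the mean of [f (phi t (x, g))] over the law [nu] of [g]. *)
Definition phi t := psi (ma t) (mb t).

Lemma ma2 t : expR (- 2 * t) = ma t ^+ 2.
Proof. by rewrite /ma -expRM_natl; congr expR; rewrite mulNr mulrN. Qed.

Lemma ma_ge0 t : 0 <= ma t. Proof. exact: expR_ge0. Qed.
Lemma mb_ge0 t : 0 <= mb t. Proof. exact: sqrtr_ge0. Qed.

Lemma ma_le1 t : 0 <= t -> ma t ^+ 2 <= 1.
Proof. by move=> t0; rewrite -ma2 -expR0 ler_expR mulNr oppr_le0 mulr_ge0. Qed.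

Lemma mb2 t : 0 <= t -> mb t ^+ 2 = 1 - ma t ^+ 2.
Proof. by move=> t0; rewrite /mb sqr_sqrtr ma2 // subr_ge0 ma_le1. Qed.

Lemma maD s t : ma (s + t) = ma s * ma t.
Proof. by rewrite /ma opprD expRD. Qed.

Lemma measurable_phi t : measurable_fun setT (phi t).
Proof. exact: measurable_psi. Qed.

(** This is [psi_law] with ma(t)^2 + mb(t)^2 = 1. *)
Lemma phi_inv t A : 0 <= t -> measurable A -> (nu \x nu)%E (phi t @^-1` A) = nu A.
Proof.
move=> t0 mA; rewrite /phi psi_law ?ma_ge0 ?mb_ge0 // mb2 // addrC subrK sqrtr1.
by congr (nu _); apply/seteqP; split => x; rewrite /= dil1.
Qed.

(** Distributing the outer dilation leaves the noise dil_{ma(t) mb(s)} z1 times dil_{mb(t)} z2 to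
    the right of the translate of x. The two merge into one because ma(t)^2 mb(s)^2 + mb(t)^2 = mb(s
    + t)^2. *)
Lemma phi_comp s t (x : T) A : 0 <= s -> 0 <= t -> measurable A ->
  (nu \x nu)%E ((fun z : T * T => phi t (phi s (x, z.1), z.2)) @^-1` A) =
  nu ((fun g : T => phi (s + t) (x, g)) @^-1` A).
Proof.
move=> s0 t0 mA; have st0 : 0 <= s + t by exact: addr_ge0.
pose y := dil G (ma (s + t)) x.
pose B : set T := (fun g : T => mul y g : T) @^-1` A.
have mB : measurable B.
  by have := measurable_gmull G y measurableT mA; rewrite setTI.
have -> : (fun z : T * T => phi t (phi s (x, z.1), z.2)) @^-1` A = psi (ma t * mb s) (mb t) @^-1` B.
  apply/seteqP; split => z; rewrite /B /= /phi /psi /= dilM !dil_comp -gmulA /y maD [ma s * _]mulrC //.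
rewrite psi_law ?mulr_ge0 ?ma_ge0 ?mb_ge0 //.
have -> : Num.sqrt ((ma t * mb s) ^+ 2 + mb t ^+ 2) = mb (s + t).
  rewrite exprMn !mb2 // /mb ma2 maD exprMn; congr Num.sqrt; ring.
by congr (nu _); apply/seteqP; split => z; rewrite /B /= /phi /psi /= /y.
Qed.

Lemma pintE f : measurable_fun setT (re_part f : T -> R) -> measurable_fun setT (im_part f : T -> R) ->
  pint mu p f = cint nu (f : T -> R[i]).
Proof.
move=> mr mi; rewrite /pint /cint.
rewrite (Rintegral_density mp1 p10 nuE mr) (Rintegral_density mp1 p10 nuE mi).
by congr (_ +i* _)%C; apply: eq_Rintegral => g _; rewrite /re_part /im_part ?ReMr ?ImMr.
Qed.

Lemma opTE t f : measurable_fun setT (re_part f : T -> R) -> measurable_fun setT (im_part f : T -> R) ->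
  opT G mu p t f = Kc nu (phi t) (f : T -> R[i]).
Proof.
move=> mr mi; apply/funext => x; rewrite /opT pintE //.
- exact: (measurable_sliceR (measurable_phi t) x mr).
- exact: (measurable_sliceR (measurable_phi t) x mi).
Qed.

Lemma schwartz_measurable u : schwartz u -> measurable_fun setT (u : T -> R).
Proof. by move=> su; apply: continuous_measurable; exact: schwartz_continuous. Qed.

Local Notation hrs := (hr G mu p).
Local Notation L := (lap G X).
Local Notation A := (eulerD G).

Lemma Kr_hr t u x : 0 <= t -> schwartz u ->
  Kr nu (phi t) (u : T -> R) x = hrs (1 - expR (- 2 * t)) u (dil G (ma t) x).
Proof.
move=> t0 su; rewrite /Kr.
have m1 : measurable_fun setT (fun g : T => u (phi t (x, g))).
  exact: (measurable_sliceR (measurable_phi t) x (schwartz_measurable su)).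
rewrite (Rintegral_density mp1 p10 nuE m1) /phi /psi /= ma2 -mb2 //.
set y := dil G (ma t) x; set b := mb t.
have : 0 <= b by exact: mb_ge0.
rewrite le_eqVlt => /predU1P[<-|b0].
  rewrite expr0n hr0; under eq_Rintegral do rewrite dil0 gmulg0.
  rewrite RintegralZl ?(p_int1 heat_p) ?mulr1 //.
  exact: (schwartz_integrable haar_mu (p_schwartz heat_p ltr01)).
have b2 : 0 < b ^+ 2 by rewrite exprn_gt0.
have ii : mu.-integrable setT (EFin \o ((fun g => u (mul y g) * p (b ^+ 2 * 1) g) : T -> R)).
  have := integrable_oppv haar_mu (hr_intble haar_mu heat_p y b2 su).
  by rewrite mulr1; under eq_fun do rewrite opprK (p_opp heat_p) //.
rewrite (p_dil_integral haar_mu heat_p X_layer b0 ltr01 ii) hrE // mulr1.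
rewrite mulr1 in ii.
rewrite -(Rintegral_opp haar_mu ii); apply: eq_Rintegral => g _.
by rewrite (p_opp heat_p).
Qed.

Lemma opT_schwartz t f : 0 <= t -> cschwartz f ->
  opT G mu p t f = cext (fun u x => hrs (1 - expR (- 2 * t)) u (dil G (ma t) x)) f.
Proof.
move=> t0 [sr si]; rewrite opTE; [|exact: schwartz_measurable..].
by apply/funext => x; rewrite KcE /cext !Kr_hr.
Qed.

Lemma time_ge0 (t : R) : 0 <= t -> 0 <= 1 - expR (- 2 * t).
Proof. by move=> t0; rewrite ma2 subr_ge0 ma_le1. Qed.

Lemma schwartz_Kr t u : 0 <= t -> schwartz u ->
  schwartz (fun x => hrs (1 - expR (- 2 * t)) u (dil G (ma t) x)).
Proof.
move=> t0 su; apply: (@schwartz_dil _ _ G (ma t) (hrs (1 - expR (- 2 * t)) u)).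
  by rewrite gt_eqF // expR_gt0.
by apply: (hr_schwartz haar_mu heat_p) => //; exact: time_ge0.
Qed.

Lemma cschwartz_opT t f : 0 <= t -> cschwartz f -> cschwartz (opT G mu p t f).
Proof.
move=> t0 cf; have [sr si] := cf; rewrite opT_schwartz //.
by split; exact: schwartz_Kr.
Qed.

Lemma opT0 f : cschwartz f -> opT G mu p 0 f = f.
Proof.
move=> cf; rewrite opT_schwartz //; apply/funext => x.
rewrite /cext mulr0 expR0 subrr !hr0 /ma oppr0 expR0 !dil1 /re_part /im_part.
by case: (f x).
Qed.

Lemma bounded_slice t u x : (exists M, forall y, `|u y| <= M) -> measurable_fun setT (u : T -> R) ->
  nu.-integrable setT (EFin \o (fun g : T => u (phi t (x, g)))).
Proof.
move=> [M HM] mu'; apply: (@intble_le _ _ _ nu _ (cst M)).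
- exact: (measurable_sliceR (measurable_phi t) x mu').
- by move=> g; exact: HM.
- exact: finite_measure_integrable_cst.
Qed.

Lemma opT_add s t f : 0 <= s -> 0 <= t -> cschwartz f ->
  opT G mu p (s + t) f = opT G mu p s (opT G mu p t f).
Proof.
move=> s0 t0 cf; have [sr si] := cf; have [sr' si'] := cschwartz_opT t0 cf.
have mr := schwartz_measurable sr; have mi := schwartz_measurable si.
rewrite [RHS]opTE; [|exact: schwartz_measurable..].
rewrite !opTE //; apply/funext => x; rewrite !KcE.
have H u : schwartz u -> Kr nu (phi (s + t)) (u : T -> R) x = Kr nu (phi s) (Kr nu (phi t) (u : T -> R)) x.
  move=> su; apply: Kr_comp; [exact: measurable_phi|exact: measurable_phi|exact: measurable_phi| | |].
  - by move=> B mB; exact: phi_comp.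
  - exact: schwartz_measurable.
  - apply: bounded_slice; last exact: schwartz_measurable.
    by have [M _ HM] := schwartz_bounded su; exists M.
by congr (_ +i* _)%C; exact: H.
Qed.

Lemma expR_inv_bounds (y : R) : 0 <= y -> 1 - y <= expR (- y) <= 1 - y + y ^+ 2.
Proof.
move=> y0; rewrite (expR_ge1Dx (- y)) expRN /=.
have y1 : 0 < 1 + y by rewrite ltr_pwDl.
apply: (@le_trans _ _ (1 + y)^-1).
  by rewrite lef_pV2 ?posrE ?expR_gt0 // expR_ge1Dx.
rewrite -div1r ler_pdivrMr //.
have -> : (1 - y + y ^+ 2) * (1 + y) = 1 + y ^+ 3 by ring.
by rewrite lerDl exprn_ge0.
Qed.

Lemma is_derive_flow u x (t : R) : smooth u ->
  is_derive t 1 (fun s : R => u (dil G (expR (- s)) x)) (- A u (dil G (expR (- t)) x)).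
Proof.
move=> su.
have e0 : expR (- t) != 0 by rewrite gt_eqF // expR_gt0.
have d1 : is_derive t 1 (fun s : R => expR (- s)) (- expR (- t)).
  have := is_derive1_comp (is_derive_expR (- t)) (is_deriveN (is_derive_id t 1)).
  by move=> dd; apply: is_derive_eq dd _; rewrite mulrN1.
have d2 := derive_dil_euler G x su e0.
have := is_derive1_comp (f := fun s : R => u (dil G s x)) (g := fun s : R => expR (- s)) d2 d1.
by move=> dd; apply: is_derive_eq dd _; field.
Qed.

Lemma flow_lip u x t M : 0 <= t -> schwartz u -> (forall y, `|A u y| <= M) ->
  `|u (dil G (ma t) x) - u x| <= t * M.
Proof.
rewrite le_eqVlt => /predU1P[<-|t0] su HM; first by rewrite /ma oppr0 expR0 dil1 subrr normr0 mul0r.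
have sm := schwartz_smooth su.
pose g (s : R) := u (dil G (expR (- s)) x).
have dg (s : R) : is_derive s 1 g (- A u (dil G (expR (- s)) x)) by exact: is_derive_flow.
have [c _] : exists2 c, c \in `]0, t[%R & g t - g 0 = - A u (dil G (expR (- c)) x) * (t - 0).
  apply: MVT => //.
  by apply: derivable_within_continuous => s _; have [] := dg s.
rewrite [t - 0]subr0 /g oppr0 expR0 dil1 -/(ma t) => ->.
by rewrite normrM normrN (gtr0_norm t0) mulrC ler_pM2l.
Qed.

Lemma flow_taylor u x t M : 0 <= t -> schwartz u -> (forall y, `|A (A u) y| <= M) ->
  `|u (dil G (ma t) x) - u x + t * A u x| <= t ^+ 2 * M.
Proof.
rewrite le_eqVlt => /predU1P[<-|t0] su HM.
  by rewrite /ma oppr0 expR0 dil1 subrr mul0r addr0 normr0 expr0n mul0r.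
have sm := schwartz_smooth su; have sA := schwartz_euler G su.
pose g (s : R) := u (dil G (expR (- s)) x) + s * A u x.
have dg (s : R) : is_derive s 1 g (- A u (dil G (expR (- s)) x) + A u x).
  have := is_deriveD (is_derive_flow x s sm) (is_deriveM (is_derive_id s 1) (is_derive_cst (A u x) s 1)).
  by move=> dd; apply: is_derive_eq dd _; rewrite scaler0 add0r [_ *: _]mulr1.
have [c] : exists2 c, c \in `]0, t[%R & g t - g 0 = (- A u (dil G (expR (- c)) x) + A u x) * (t - 0).
  apply: MVT => //.
  by apply: derivable_within_continuous => s _; have [] := dg s.
rewrite in_itv /= => /andP[c0 ct]; rewrite [t - 0]subr0 /g oppr0 expR0 dil1 -/(ma t) mul0r addr0 addrAC => ->.
rewrite normrM (gtr0_norm t0) mulrC expr2 -mulrA ler_pM2l //.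
rewrite addrC distrC; apply: le_trans (flow_lip x (ltW c0) sA HM) _.
by rewrite ler_wpM2r ?(ltW ct) // (le_trans _ (HM x)).
Qed.

Definition Nr u x := L u x + A u x.

Lemma schwartz_Nr u : schwartz u -> schwartz (Nr u).
Proof. by move=> su; apply: schwartzD; [exact: schwartz_lap|exact: schwartz_euler]. Qed.

(** T_t u is a heat operator at time s = 1 - e^{-2t}, equivalent to 2t, followed by the dilation
    flow; both factors are expanded to second order. The estimate is uniform, hence valid in all
    L^q(nu) at once. *)
Lemma generator_uniform u : schwartz u -> exists2 C, 0 <= C & forall t x, 0 < t ->
  `|t^-1 * (hrs (1 - expR (- 2 * t)) u (dil G (ma t) x) - u x) + Nr u x| <= t * C.
Proof.
move=> su; have sl := schwartz_lap G X su.
have [M1 M10 H1] := schwartz_bounded (schwartz_lap G X sl).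
have [M2 M20 H2] := schwartz_bounded (schwartz_euler G (schwartz_euler G su)).
have [M3 M30 H3] := schwartz_bounded sl.
have [M4 M40 H4] := schwartz_bounded (schwartz_euler G sl).
(* M1 comes from the heat remainder with s <= 2t, M2 from the flow remainder, 2 M3 from |t - s/2| <=
   2 t^2, and M4 from evaluating L u at the dilated point instead of x. *)
exists (M1 + M2 + 2 * M3 + M4); first by rewrite !addr_ge0 // mulr_ge0.
move=> t x t0; have t0' := ltW t0.
set s := 1 - expR (- 2 * t); have s0 : 0 <= s by exact: time_ge0.
have t2 : 0 <= 2 * t by rewrite mulr_ge0.
have /andP[b1 b2] := expR_inv_bounds t2; rewrite -mulNr in b1 b2.
have st : s <= 2 * t by rewrite /s; lra.
have ts : t - s / 2 <= 2 * t ^+ 2.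
  have : 2 * t - s <= (2 * t) ^+ 2 by rewrite /s; lra.
  by rewrite exprMn; lra.
have E1 := hr_taylor haar_mu heat_p (dil G (ma t) x) s0 su H1.
have E2 := flow_taylor x t0' su H2.
have E4 := flow_lip x t0' sl H4.
set y := dil G (ma t) x in E1 E2 E4 *.
have -> : t^-1 * (hrs s u y - u x) + Nr u x =
  t^-1 * ((hrs s u y - u y + s / 2 * L u y) + (u y - u x + t * A u x) +
    ((t - s / 2) * L u x - s / 2 * (L u y - L u x))).
  by rewrite /Nr; field; rewrite gt_eqF.
rewrite normrM gtr0_norm ?invr_gt0 // mulrC ler_pdivrMr //.
have -> : t * (M1 + M2 + 2 * M3 + M4) * t = t ^+ 2 * M1 + t ^+ 2 * M2 + (2 * t ^+ 2 * M3 + t * (t * M4)) by ring.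
apply: le_trans (ler_normD _ _) _; apply: lerD.
  apply: le_trans (ler_normD _ _) _; apply: lerD => //.
  apply: le_trans E1 _; have : s ^+ 2 <= (2 * t) ^+ 2 by rewrite lerXn2r ?nnegrE.
  rewrite exprMn => s2; have -> : t ^+ 2 * M1 = (2 ^+ 2 * t ^+ 2) * (M1 / 4) by field.
  by rewrite ler_wpM2r // divr_ge0.
apply: le_trans (ler_normB _ _) _; apply: lerD; rewrite normrM.
  have ts0 : 0 <= t - s / 2 by lra.
  by rewrite (ger0_norm ts0) ler_pM.
by rewrite ger0_norm ?divr_ge0 //; apply: ler_pM => //; [rewrite divr_ge0|lra].
Qed.

Lemma opN_cext : opN G X = cext Nr.
Proof.
apply/funext => f; apply/funext => x; rewrite /opN lap_cext /dilA /cext /Nr /eulerD.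
by [].
Qed.

Lemma opT_generator q f : (1 <= q)%E -> cschwartz f ->
  cLnorm nu q (fun x : T => ((t^-1)%:C)%C * (opT G mu p t f x - f x) + opN G X f x) @[t --> 0^'+] --> 0%E.
Proof.
move=> q1 cf; have [sr si] := cf.
have [C1 C10 H1] := generator_uniform sr; have [C2 C20 H2] := generator_uniform si.
apply: cvge0_intro; first by move=> t; exact: Lnorm_ge0.
move=> e e0; have C0 : 0 < C1 + C2 + 1 by rewrite ltr_wpDl // addr_ge0.
near=> t.
have t0 : 0 < t by near: t; exact: nbhs_right_gt.
have te : t < e / (C1 + C2 + 1) by near: t; apply: nbhs_right_lt; rewrite divr_gt0.
rewrite opT_schwartz ?(ltW t0) // opN_cext.
set F := (fun x : T => _).
have ER : re_part F = fun x => t^-1 * (hrs (1 - expR (- 2 * t)) (re_part f) (dil G (ma t) x) - re_part f x) + Nr (re_part f) x.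
  by apply/funext => x; rewrite /F {1}/re_part ReD ReMl ReB.
have EI : im_part F = fun x => t^-1 * (hrs (1 - expR (- 2 * t)) (im_part f) (dil G (ma t) x) - im_part f x) + Nr (im_part f) x.
  by apply/funext => x; rewrite /F {1}/im_part ImD ImMl ImB.
have sm u : schwartz u -> measurable_fun setT ((fun x => t^-1 * (hrs (1 - expR (- 2 * t)) u (dil G (ma t) x) - u x) + Nr u x) : T -> R).
  move=> su; apply: schwartz_measurable; apply: schwartzD; last exact: schwartz_Nr.
  by apply: schwartzZ; apply: schwartzB => //; apply: schwartz_Kr => //; exact: ltW.
have mR : measurable_fun setT (re_part F) by rewrite ER; exact: sm.
have mI : measurable_fun setT (im_part F) by rewrite EI; exact: sm.
have HF := @cLnorm_le _ _ _ nu q F q1 mR mI; apply: le_lt_trans HF _.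
apply: (@le_lt_trans _ _ ((t * C1)%:E + (t * C2)%:E)%E).
  apply: leeD; apply: Lnorm_bound => //; rewrite ?mulr_ge0 ?(ltW t0) //.
  - by move=> x; rewrite ER; exact: H1.
  - by move=> x; rewrite EI; exact: H2.
rewrite -EFinD lte_fin -mulrDr.
have := te; rewrite ltr_pdivlMr // => te'; apply: le_lt_trans te'.
by rewrite ler_pM2l // lerDl.
Unshelve. all: by end_near. Qed.

Lemma Kr_integral t (u : T -> R) : 0 <= t -> nu.-integrable setT (EFin \o u) ->
  \int[nu]_x Kr nu (phi t) u x = \int[nu]_x u x.
Proof.
move=> t0 iu.
(* With [snd] as transition the first move forgets the state and draws a point of law nu; the
   composition rule at an arbitrary point is then the invariance of the integral. *)
have := @Kr_comp _ _ _ nu snd (phi t) snd u point measurable_snd (measurable_phi t) measurable_snd.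
rewrite /Kr /= => <- //.
- by move=> B mB; rewrite -(phi_inv t0 mB); congr ((nu \x nu)%E _); apply/seteqP; split => -[].
- exact: intble_measurable iu.
Qed.

Lemma bounded_integrable u M : (forall y, `|u y| <= M) -> measurable_fun setT (u : T -> R) ->
  nu.-integrable setT (EFin \o (u : T -> R)).
Proof.
move=> HM mu'; apply: (@intble_le _ _ _ nu _ (cst M)) => //.
exact: finite_measure_integrable_cst.
Qed.

Lemma schwartz_nu_integrable u : schwartz u -> nu.-integrable setT (EFin \o (u : T -> R)).
Proof.
by move=> su; have [M _ HM] := schwartz_bounded su; exact: bounded_integrable HM (schwartz_measurable su).
Qed.

Lemma opT_invariant t f : 0 <= t -> cschwartz f -> pint mu p (opT G mu p t f) = pint mu p f.
Proof.
move=> t0 cf; have [sr si] := cf; have [sr' si'] := cschwartz_opT t0 cf.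
rewrite !pintE; [|exact: schwartz_measurable..].
rewrite opTE; [|exact: schwartz_measurable..].
congr (_ +i* _)%C; apply: Kr_integral => //; exact: schwartz_nu_integrable.
Qed.

(** Adding the difference quotient of T_t u, whose integral is 0 by invariance, changes nothing; the
    new integrand is at most t C for every t > 0. *)
Lemma Nr_integral0 u : schwartz u -> \int[nu]_x Nr u x = 0.
Proof.
move=> su; have [C C0 H] := generator_uniform su.
apply: (@squeeze0 _ _ C) => t t0; rewrite expr2 -mulrA ler_pM2l //.
have iu := schwartz_nu_integrable su; have iN := schwartz_nu_integrable (schwartz_Nr su).
have iK := schwartz_nu_integrable (schwartz_Kr (ltW t0) su).
have -> : \int[nu]_x Nr u x = \int[nu]_x (t^-1 * (hrs (1 - expR (- 2 * t)) u (dil G (ma t) x) - u x) + Nr u x).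
  have iD := intbleB iK iu; have iZ := intbleZ t^-1 iD.
  rewrite (RintegralD measurableT iZ iN) (RintegralZl _ measurableT iD) (RintegralB measurableT iK iu).
  rewrite -(Kr_integral (ltW t0) iu).
  have -> : \int[nu]_x hrs (1 - expR (- 2 * t)) u (dil G (ma t) x) = \int[nu]_x Kr nu (phi t) (u : T -> R) x.
    by apply: eq_Rintegral => x _; rewrite Kr_hr // ltW.
  by rewrite subrr mulr0 add0r.
have iw := intbleD (intbleZ t^-1 (intbleB iK iu)) iN.
apply: le_trans (le_normr_Rintegral measurableT iw) _.
rewrite -lee_fin (EFin_Rintegral (intble_norm iw)).
have -> : ((t * C)%:E = \int[nu]_x cst (t * C)%:E x)%E.
  by rewrite integral_cst // [X in (_ * X)%E]prob1 mule1.
apply: ge0_le_integral => //.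
- by case/integrableP: (intble_norm iw).
- by move=> x _; rewrite lee_fin; exact: H.
Qed.

Lemma opN_integral0 f : cschwartz f -> pint mu p (opN G X f) = 0.
Proof.
move=> [sr si]; rewrite opN_cext pintE.
- by rewrite /cint; congr (_ +i* _)%C; exact: Nr_integral0.
- exact: schwartz_measurable (schwartz_Nr sr).
- exact: schwartz_measurable (schwartz_Nr si).
Qed.

Lemma markov_opT q : (1 <= q)%E -> markov_contraction_extension nu q (opT G mu p) (opT G mu p).
Proof.
move=> q1.
have E t f : inLq nu q f -> opT G mu p t f = Kc nu (phi t) (f : T -> R[i]).
  by move=> [mr mi _]; exact: opTE.
have inv t : 0 <= t -> forall B : set T, measurable B -> (nu \x nu)%E (phi t @^-1` B) = nu B.
  by move=> t0 B mB; exact: phi_inv.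
have inK t f : 0 <= t -> inLq nu q f -> inLq nu q (Kc nu (phi t) (f : T -> R[i])).
  by move=> t0; exact: (Kc_inLq (measurable_phi t) (inv t t0)).
split.
- by move=> t f t0 cf; exact: nearW.
- move=> t f t0 fq; rewrite E //; split; first exact: inK.
  exact: (Kc_Lnorm (measurable_phi t) (inv t t0)).
- move=> t a f h t0 fq hq.
  have [fr fi _] := fq; have [hr' hi _] := hq.
  have mre : measurable_fun setT (re_part (fun y : T => a * f y + h y)).
    rewrite (_ : re_part _ = fun y : T => complex.Re a * re_part f y - complex.Im a * im_part f y + re_part h y).
      by apply: measurable_funD => //; apply: measurable_funB; exact: measurable_funM.
    by apply/funext => y; rewrite /re_part ReD ReM.
  have mim : measurable_fun setT (im_part (fun y : T => a * f y + h y)).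
    rewrite (_ : im_part _ = fun y : T => complex.Re a * im_part f y + complex.Im a * re_part f y + im_part h y).
      by apply: measurable_funD => //; apply: measurable_funD; exact: measurable_funM.
    by apply/funext => y; rewrite /im_part ImD ImM.
  rewrite opTE // (E t f fq) (E t h hq).
  exact: (Kc_linear (measurable_phi t) (inv t t0) a q1 fq hq).
- split.
    move=> f fq; rewrite E //; apply: nearW => x; rewrite KcE /Kr /phi /psi.
    have e0 (u : T -> R) : \int[nu]_g u (mul (dil G (ma 0) (x, g).1) (dil G (mb 0) (x, g).2)) = u x.
      rewrite /ma /mb oppr0 mulr0 expR0 subrr sqrtr0.
      under eq_Rintegral do rewrite /= dil1 dil0 gmulg0.
      by rewrite Rintegral_cst // [X in fine X]prob1 mulr1.
    by rewrite !e0 /re_part /im_part; case: (f x).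
  move=> s t f s0 t0 fq; have [fr fi _] := fq; have st0 : 0 <= s + t by exact: addr_ge0.
  have [_ ir ii] := inLq_integrable q1 fq.
  rewrite (E (s + t) f fq) (E t f fq) (E s _ (inK t f t0 fq)).
  have H (u : T -> R) : nu.-integrable setT (EFin \o u) ->
      {ae nu, forall x, Kr nu (phi (s + t)) u x = Kr nu (phi s) (Kr nu (phi t) u) x}.
    move=> iu; have := ae_slice_integrable (measurable_phi (s + t)) (inv _ st0) iu.
    apply: filterS => x ix.
    apply: Kr_comp => //; [exact: measurable_phi|exact: measurable_phi|exact: measurable_phi| |].
      by move=> B mB; exact: phi_comp.
    exact: intble_measurable iu.
  have := H _ ir; have := H _ ii; apply: filterS2 => x h1 h2.
  by rewrite !KcE; congr (_ +i* _)%C.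
- split.
    move=> t t0; rewrite opTE; [|exact: measurable_cst|exact: measurable_cst].
    by apply: nearW => x; rewrite Kc1.
  move=> t f t0 fq f0; rewrite E //.
  exact: (Kc_ge0 (measurable_phi t) (inv t t0) q1 fq f0).
Qed.

Lemma continuous_to_row m (F : R -> 'rV[R]_m) : (forall j, continuous (fun s => F s 0 j)) -> continuous F.
Proof.
move=> cF s; apply/cvgrPdist_le => e e0.
have [dl dl0 H] := continuous_family s (fun j => cF j) e0.
apply/nbhs_ballP; exists dl => //= r /=; rewrite distrC => rs.
apply: row_norm_le; first exact: ltW.
by move=> j; rewrite row_coordB distrC; exact: H.
Qed.

Lemma continuous_row_coord m (j : 'I_m) : continuous (fun x : 'rV[R]_m => x 0 j).
Proof. exact: smooth_continuous (smooth_coord j). Qed.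

(** The parameter is s = e^{-t} rather than t, so that continuity at s = 0 covers the limit t -> +oo
    as well. *)
Lemma continuous_psi_curve v (z : T * T) : continuous v ->
  continuous (fun s : R => v (psi s (Num.sqrt (1 - s ^+ 2)) z)).
Proof.
move=> cv s.
have cd (x : V) : continuous (fun s : R => dil G s x) by exact: continuous_dil.
have cb : continuous (fun s : R => Num.sqrt (1 - s ^+ 2)).
  move=> r; apply: (@continuous_comp _ _ _ (fun s : R => 1 - s ^+ 2) Num.sqrt); last exact: sqrt_continuous.
  by apply: cvgB; [exact: cvg_cst|exact: exprn_continuous].
have cd2 : continuous (fun s : R => dil G (Num.sqrt (1 - s ^+ 2)) z.2).
  by move=> r; apply: (@continuous_comp _ _ _ (fun s : R => Num.sqrt (1 - s ^+ 2)) (fun b => dil G b z.2)); [exact: cb|exact: cd].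
rewrite (_ : (fun s : R => _) = (v \o gm2 G) \o (fun s : R => row_mx (dil G s z.1) (dil G (Num.sqrt (1 - s ^+ 2)) z.2))); last first.
  by apply/funext => r; rewrite /psi /= gm2E.
apply: continuous_comp; last first.
  by apply: continuous_comp; [exact: continuous_gm2|exact: cv].
apply: continuous_to_row => j.
have cc (F : R -> V) k : continuous F -> continuous (fun s : R => F s 0 k).
  move=> cF r; apply: (@continuous_comp _ _ _ F (fun x : V => x 0 k)); first exact: cF.
  exact: continuous_row_coord.
rewrite (_ : (fun s : R => _) = fun s : R => match fintype.split j with
  | inl k => dil G s z.1 0 k | inr k => dil G (Num.sqrt (1 - s ^+ 2)) z.2 0 k end).
  by case: (fintype.split j) => k; [apply: (cc (fun s => dil G s z.1)); exact: cd|exact: cc cd2].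
by apply/funext => r; rewrite mxE.
Qed.

Lemma phiE t (z : T * T) : phi t z = psi (ma t) (Num.sqrt (1 - ma t ^+ 2)) z.
Proof. by rewrite /phi /mb ma2. Qed.

Let dense (Phi_ : nat -> T * T -> T) (Phi : T * T -> T) r :
  1 <= r -> (forall v z, continuous v -> v (Phi_ n z) @[n --> \oo] --> v (Phi z)) ->
  forall (u : T -> R) (e : R), measurable_fun setT u -> (Lnorm nu r%:E (EFin \o u) < +oo)%E -> 0 < e ->
     exists v : T -> R, [/\ measurable_fun setT v, exists M, forall x, (`|v x| <= M)%R,
     forall z, v (Phi_ n z) @[n --> \oo] --> v (Phi z) &
     (Lnorm nu r%:E (EFin \o (fun x => u x - v x)%R) < e%:E)%E].
Proof.
move=> r1 HP u e mu' uo e0; have [_ /(_ _ e0)[v [cv vM Hv]]] := Lr_dense r1 mu' uo.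
exists v; split => //; [exact: continuous_measurable|by move=> z; exact: HP].
Qed.

Lemma opT_strongly_continuous q : (1 <= q < +oo)%E -> strongly_continuous nu q (opT G mu p).
Proof.
case: q => [r||] //; last by rewrite ltxx andbF.
rewrite lee_fin => /andP[r1 _] f t0 fq t00.
have [fr fi _] := fq.
apply: cvge0_intro; first by move=> t; exact: Lnorm_ge0.
move=> e e0.
pose B k := [set t : R | `|t - t0| < k.+1%:R^-1 /\ 0 <= t].
apply: (@near_sequences _ _ B) => [Q [k HQ]|w Hw].
  apply/nbhs_ballP; exists k.+1%:R^-1 => /=; first by rewrite invr_gt0.
  by move=> t; rewrite -ball_normE /= distrC => tk t1; apply: HQ.
have w0 k : 0 <= w k by have [] := Hw k.
have wcvg : w k @[k --> \oo] --> t0.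
  apply/cvgrPdist_lt => eps eps0; have [N HN] := ball_inv_nat eps0.
  exists N => // k /= Nk; have [+ _] := Hw k; rewrite distrC => /lt_trans; apply.
  by apply: le_lt_trans HN; rewrite lef_pV2 ?posrE // ler_nat ltnS.
have mcvg : ma (w k) @[k --> \oo] --> ma t0.
  apply: (@continuous_seq R (fun s => expR (- s))) => // s.
  by apply: continuous_comp; [exact: opp_continuous|exact: continuous_expR].
have HP v z : continuous v -> v (phi (w k) z) @[k --> \oo] --> v (phi t0 z).
  move=> cv; rewrite phiE; under eq_fun do rewrite phiE.
  exact: (continuous_seq (@continuous_psi_curve v z cv) mcvg).
have := @Kc_cvg _ _ _ nu (fun k => phi (w k)) (phi t0) (fun k => measurable_phi _) (measurable_phi _)
  (fun k B mB => phi_inv (w0 k) mB) (fun B mB => phi_inv t00 mB) r f e r1 fq (dense r1 HP) e0.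
case=> N _ HN; exists N; have := HN N (leqnn N).
by rewrite !opTE.
Qed.

(** The limiting transition, at e^{-t} = 0, is [snd], and its operator sends f to the constant given
    by its mean. *)
Lemma opT_ergodic q f : (1 <= q < +oo)%E -> inLq nu q f ->
  cLnorm nu q (fun x : T => opT G mu p t f x - pint mu p f) @[t --> +oo] --> 0%E.
Proof.
case: q => [r||] //; last by rewrite ltxx andbF.
rewrite lee_fin => /andP[r1 _] fq.
have [fr fi _] := fq.
apply: cvge0_intro; first by move=> t; exact: Lnorm_ge0.
move=> e e0.
pose B k := [set t : R | k%:R < t].
apply: (@near_sequences _ _ B) => [Q [k HQ]|w Hw].
  by exists k%:R; split; [exact: num_real|move=> t tk; exact: HQ].
have w0 k : 0 <= w k by rewrite ltW // (le_lt_trans _ (Hw k)).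
have mcvg : ma (w k) @[k --> \oo] --> 0.
  apply/cvgrPdist_lt => eps eps0; exists (Num.truncn eps^-1).+1 => // k /= Nk.
  rewrite sub0r normrN gtr0_norm ?expR_gt0 // /ma expRN -[eps]invrK ltf_pV2 ?posrE ?invr_gt0 ?expR_gt0 //.
  apply: lt_trans (truncnS_gt _) _; apply: (@le_lt_trans _ _ k%:R); first by rewrite ler_nat.
  apply: lt_le_trans (Hw k) _; apply: le_trans (expR_ge1Dx _).
  by rewrite lerDr.
have psi0 z : psi 0 (Num.sqrt (1 - 0 ^+ 2)) z = z.2.
  by rewrite /psi expr0n subr0 sqrtr1 dil1 dil0 gmul0g.
have HP v z : continuous v -> v (phi (w k) z) @[k --> \oo] --> v (snd z : T).
  move=> cv; rewrite -psi0; under eq_fun do rewrite phiE.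
  exact: (continuous_seq (@continuous_psi_curve v z cv) mcvg).
have isnd (C : set T) : measurable C -> (nu \x nu)%E ((snd : T * T -> T) @^-1` C) = nu C.
  move=> mC; rewrite (_ : snd @^-1` C = setT `*` C).
    by rewrite product_measure1E // [X in (X * _)%E]prob1 mul1e.
  by apply/seteqP; split => -[x y] //= [].
have := @Kc_cvg _ _ _ nu (fun k => phi (w k)) snd (fun k => measurable_phi _) measurable_snd
  (fun k B mB => phi_inv (w0 k) mB) isnd r f e r1 fq (dense r1 HP) e0.
case=> N _ HN; exists N; have := HN N (leqnn N).
by rewrite /= opTE // pintE.
Qed.

End mehler_law.

(** * The real part of the generator *)

(** For a zero bracket, x -> -x respects the bracket and is therefore an automorphism of the group.
    It is also the inversion, and a group whose inversion is an automorphism is abelian. *)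
Lemma trivial_bracket_commute {R : realType} {d : nat} (G : stratifiedGroup R d) :
  (forall x y, bracket G x y = 0) -> abelian_group G.
Proof.
move=> br0 x y; apply: oppr_inj.
have opp_br (v w : 'rV[R]_d) : - bracket G v w = bracket G (- v) (- w) by rewrite !br0 oppr0.
by rewrite (gmul_aut (D := -%R) opp_br) -ginvM.
Qed.

Lemma frame_sumr {R : realType} {d : nat} (G : stratifiedGroup R d) g I (r : seq I) (F : I -> 'rV[R]_d) :
  frame G g (\sum_(i <- r) F i) = \sum_(i <- r) frame G g (F i).
Proof.
elim: r => [|i r IH]; last by rewrite !big_cons frameD IH.
by rewrite !big_nil; have := frameZ G g 0 0; rewrite !scale0r.
Qed.

Lemma coframe0 {R : realType} {d : nat} (G : stratifiedGroup R d) g : coframe G g 0 = 0.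
Proof.
have f0 : frame G g 0 = 0 by have := frameZ G g 0 0; rewrite !scale0r.
by rewrite -[in LHS]f0 coframeK.
Qed.

Section real_part.
Context {R : realType} {d : nat}.
Variable G : stratifiedGroup R d.
Local Notation V := 'rV[R]_d.
Local Notation T := (borelV R d).
Local Notation mul := (gmul G).
Local Notation lie := (lie_der (gmul G)).
Variable mu : {sigma_finite_measure set (borelV R d) -> \bar R}.
Hypothesis haar_mu : haar_measure G mu.
Variables (p : R -> V -> R) (n : nat) (X : n.-tuple V).
Hypothesis heat_p : heat_kernel G mu p X.
Hypothesis X_layer : forall i, tnth X i \in layer G 1%N.
Variable nu : probability T R.
Hypothesis nuE : forall A : set T, measurable A -> nu A = (\int[mu]_(x in A) (p 1 x)%:E)%E.
Implicit Types (u v w : V -> R) (f h : V -> R[i]) (i : 'I_n) (j : 'I_d).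

Local Notation L := (lap G X).
Local Notation A := (eulerD G).
Local Notation N := (Nr G X).
Local Notation Xi i := (lie (tnth X i)).

Let ps : schwartz (p 1). Proof. exact: (p_schwartz heat_p). Qed.
Let psm : smooth (p 1). Proof. exact: schwartz_smooth. Qed.
Let pn0 x : p 1 x != 0. Proof. by rewrite gt_eqF // (p_gt0 heat_p). Qed.

(** The derivative of log p along X_i. *)
Definition logp i x := Xi i (p 1) x / p 1 x.
(** The first order part of N once the symmetric operator [symN], which is nabla^* nabla on real
    functions, is removed; [drift] below lists its coefficients as a vector field. *)
Definition driftD u x := A u x + \sum_i logp i x * Xi i u x.
Definition symN u x := L u x - \sum_i logp i x * Xi i u x.
Definition adjX i v x := - Xi i v x - logp i x * v x.
Definition drift j x := euler_field G x 0 j + \sum_i logp i x * frame G x (tnth X i) 0 j.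

Lemma NrE u x : N u x = symN u x + driftD u x.
Proof. by rewrite /Nr /symN /driftD; ring. Qed.

Lemma smooth_logp i : smooth (logp i).
Proof.
apply: smoothM; first exact: smooth_lie.
exact: smooth_inv.
Qed.

Lemma smooth_drift j : smooth (drift j).
Proof.
apply: smoothD; first exact/moderate_smooth/moderate_euler_field.
apply: smooth_sum => i; apply: smoothM; first exact: smooth_logp.
exact: smooth_frame.
Qed.

Lemma driftD_sum u x : smooth u -> driftD u x = \sum_j drift j x * 'D_(coordv j) u x.
Proof.
move=> su; rewrite /driftD eulerD_sum //.
have -> : \sum_i logp i x * Xi i u x =
    \sum_j \sum_i logp i x * (frame G x (tnth X i) 0 j * 'D_(coordv j) u x).
  by rewrite exchange_big; apply: eq_bigr => i _; rewrite lie_sum // mulr_sumr.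
rewrite -big_split; apply: eq_bigr => j _ /=.
by rewrite /drift mulrDl mulr_suml; congr (_ + _); apply: eq_bigr => i _; rewrite mulrA.
Qed.

Lemma driftDM u v x : smooth u -> smooth v ->
  driftD (fun y => u y * v y) x = u x * driftD v x + v x * driftD u x.
Proof.
move=> su sv; rewrite /driftD eulerD_M // !mulrDr !mulr_sumr addrACA -big_split; congr (_ + _).
by apply: eq_bigr => i _; rewrite lieM //=; ring.
Qed.

Lemma driftD_coord j x : driftD (fun y => y 0 j) x = drift j x.
Proof.
rewrite driftD_sum; last exact: smooth_coord.
transitivity (\sum_k drift k x * (coordv k : V) 0 j).
  by apply: eq_bigr => k _; congr (_ * _); exact: (congr1 (@^~ x) (derive_coord j (coordv k))).
under eq_bigr do rewrite /coordv mxE.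
by rewrite (bigD1 j) //= !eqxx mulr1 big1 ?addr0 // => k kj; rewrite [j == k]eq_sym (negbTE kj) mulr0.
Qed.

Lemma schwartz_Rintegral_sum (F : 'I_n -> V -> R) : (forall i, schwartz (F i)) ->
  \int[mu]_x (\sum_i F i x) = \sum_i \int[mu]_x F i x.
Proof.
move=> sF; elim: (index_enum _) => [|i r IH].
  by under eq_Rintegral do rewrite big_nil; rewrite big_nil Rintegral_cst // mul0r.
rewrite big_cons -IH -RintegralD //; [|exact: (schwartz_integrable haar_mu)|].
  by apply: eq_Rintegral => x _; rewrite big_cons.
by apply: (schwartz_integrable haar_mu); exact: schwartz_sum.
Qed.

(** The coefficients [logp] are smooth but no growth bound is known for them, so [symN u] and
    [driftD u] need not be Schwartz. Their products with p are, since the denominators cancel, and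
    this suffices to pair them with Schwartz functions. *)
Definition tame v := schwartz (fun x => v x * p 1 x).

Lemma schwartz_tame v : schwartz v -> tame v.
Proof. by move=> sv; exact: schwartz_mul. Qed.

Lemma tameN v : tame v -> tame (fun x => - v x).
Proof. by move=> /schwartzN; rewrite /tame; under eq_fun do rewrite -mulNr. Qed.

Lemma tame_logp i v : schwartz v -> tame (fun x => logp i x * v x).
Proof.
move=> sv; rewrite /tame (_ : (fun x => _) = fun x => Xi i (p 1) x * v x).
  by apply: schwartz_mul => //; exact: schwartz_lie.
by apply/funext => x; rewrite /logp; field.
Qed.

Lemma tame_sum (F : 'I_n -> V -> R) : (forall i, tame (F i)) -> tame (fun x => \sum_i F i x).
Proof. by move=> tF; rewrite /tame; under eq_fun do rewrite mulr_suml; exact: schwartz_sum. Qed.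

Lemma tameD u v : tame u -> tame v -> tame (fun x => u x + v x).
Proof. by move=> tu tv; rewrite /tame; under eq_fun do rewrite mulrDl; exact: schwartzD. Qed.

Lemma tame_driftD u : schwartz u -> tame (driftD u).
Proof.
move=> su; apply: tameD; first exact/schwartz_tame/schwartz_euler.
by apply: tame_sum => i; apply: tame_logp; exact: schwartz_lie.
Qed.

Lemma tame_symN u : schwartz u -> tame (symN u).
Proof.
move=> su; apply: tameD; first exact/schwartz_tame/schwartz_lap.
by apply: tameN; apply: tame_sum => i; apply: tame_logp; exact: schwartz_lie.
Qed.

Lemma tame_adjX i u : schwartz u -> tame (adjX i u).
Proof.
move=> su; apply: tameD; first exact/schwartz_tame/schwartzN/schwartz_lie.
by apply: tameN; exact: tame_logp.
Qed.

Fact ip_subproof : {F : (V -> R) -> (V -> R) -> R | forall u v, F u v = \int[mu]_x (u x * v x * p 1 x)}.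
Proof. by exists (fun u v => \int[mu]_x (u x * v x * p 1 x)). Qed.

(* Sealed for the same reason as [hr]. *)
Definition ip := sval ip_subproof.

Lemma ipE u v : ip u v = \int[mu]_x (u x * v x * p 1 x).
Proof. exact: (svalP ip_subproof). Qed.

Lemma eq_ip u w v : u =1 w -> ip u v = ip w v.
Proof. by move=> /funext ->. Qed.

Lemma ipC u v : ip u v = ip v u.
Proof. by rewrite !ipE; apply: eq_Rintegral => x _; rewrite [u x * _]mulrC. Qed.

Lemma ip_schwartz u v : tame u -> schwartz v -> schwartz (fun x => u x * v x * p 1 x).
Proof.
by move=> tu sv; under eq_fun do rewrite mulrAC; exact: schwartz_mul.
Qed.

Lemma ip_intble u v : tame u -> schwartz v -> mu.-integrable setT (EFin \o ((fun x => u x * v x * p 1 x) : T -> R)).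
Proof. by move=> tu sv; exact: (schwartz_integrable haar_mu (ip_schwartz tu sv)). Qed.

Lemma ipD u w v : tame u -> tame w -> schwartz v -> ip (fun x => u x + w x) v = ip u v + ip w v.
Proof.
move=> tu tw sv; rewrite !ipE -RintegralD //; [|exact: ip_intble..].
by apply: eq_Rintegral => x _; rewrite !mulrDl.
Qed.

Lemma ipZ c u v : tame u -> schwartz v -> ip (fun x => c * u x) v = c * ip u v.
Proof.
move=> tu sv; rewrite !ipE -RintegralZl //; last exact: ip_intble.
by apply: eq_Rintegral => x _; rewrite !mulrA.
Qed.

Lemma ipN u v : tame u -> schwartz v -> ip (fun x => - u x) v = - ip u v.
Proof. by move=> tu sv; rewrite -mulN1r -ipZ //; apply: eq_ip => x; rewrite mulN1r. Qed.

Lemma ip_sum (F : 'I_n -> V -> R) v : (forall i, tame (F i)) -> schwartz v ->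
  ip (fun x => \sum_i F i x) v = \sum_i ip (F i) v.
Proof.
move=> tF sv; under eq_bigr do rewrite ipE; rewrite ipE -schwartz_Rintegral_sum; last by move=> i; exact: ip_schwartz.
by apply: eq_Rintegral => x _; rewrite !mulr_suml.
Qed.

Lemma ip_bound u v (a b : R) : schwartz u -> schwartz v -> (forall x, `|u x| <= a) -> (forall x, `|v x| <= b) ->
  `|ip u v| <= a * b.
Proof.
move=> su sv ua vb; have iuv := ip_intble (schwartz_tame su) sv.
rewrite ipE; apply: le_trans (le_normr_Rintegral measurableT iuv) _.
have ip1 := schwartz_integrable haar_mu ps.
have -> : a * b = \int[mu]_x (a * b * p 1 x).
  by rewrite RintegralZl // (p_int1 heat_p ltr01) mulr1.
apply: le_Rintegral => //; [exact: (intble_norm iuv)|exact: (intbleZ (a * b) ip1)|].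
move=> x _; rewrite !normrM [`|p 1 x|]gtr0_norm ?(p_gt0 heat_p) // ler_pM2r ?(p_gt0 heat_p) //.
by rewrite ler_pM.
Qed.

(** The integral of X_i(u v p) vanishes; the term with X_i p gives the logarithmic derivative in the
    adjoint. *)
Lemma ip_adjX i u v : schwartz u -> schwartz v -> ip (Xi i u) v = ip u (adjX i v).
Proof.
move=> su sv; have smu := schwartz_smooth su; have smv := schwartz_smooth sv.
have tl := schwartz_tame (schwartz_lie G (tnth X i) su).
have := integral_lie0 haar_mu (tnth X i) (ip_schwartz (schwartz_tame su) sv).
rewrite (_ : lie _ _ = fun x => Xi i u x * v x * p 1 x - u x * adjX i v x * p 1 x); last first.
  apply/funext => x; rewrite !lieM //; last exact: smoothM.
  by rewrite /adjX /logp; field.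
rewrite RintegralB //; first by rewrite !ipE => /eqP; rewrite subr_eq0 => /eqP.
  exact: ip_intble.
under eq_fun do rewrite [u _ * _]mulrC.
by apply: ip_intble => //; exact: tame_adjX.
Qed.

Lemma symNE u x : symN u x = \sum_i adjX i (Xi i u) x.
Proof. by rewrite /symN lapE -opprD -big_split -sumrN; apply: eq_bigr => i _; rewrite /adjX opprD. Qed.

Lemma ip_symN u v : schwartz u -> schwartz v -> ip (symN u) v = \sum_i ip (Xi i u) (Xi i v).
Proof.
move=> su sv; rewrite (_ : symN u = fun x => \sum_i adjX i (Xi i u) x); last by apply/funext => x; exact: symNE.
rewrite ip_sum //; last by move=> i; apply: tame_adjX; exact: schwartz_lie.
apply: eq_bigr => i _; transitivity (ip (Xi i v) (Xi i u)); last exact: ipC.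
rewrite (ip_adjX i sv (schwartz_lie G (tnth X i) su)); exact: ipC.
Qed.

(** N u has mean 0 by invariance of nu, and so does its symmetric part because [symN u] times p is
    minus the sum of the X_i(p X_i u). *)
Lemma driftD_integral0 u : schwartz u -> \int[mu]_x (driftD u x * p 1 x) = 0.
Proof.
move=> su; have := Nr_integral0 haar_mu heat_p X_layer nuE su.
have mp1 : measurable_fun setT (p 1 : T -> R) by exact: schwartz_measurable.
have p10 (x : T) : 0 <= p 1 x by rewrite ltW // (p_gt0 heat_p).
rewrite (Rintegral_density mp1 p10 nuE); last exact: schwartz_measurable (schwartz_Nr G X su).
have -> : \int[mu]_x (N u x * p 1 x) = \int[mu]_x (symN u x * p 1 x) + \int[mu]_x (driftD u x * p 1 x).
  rewrite -RintegralD //; [|exact: (schwartz_integrable haar_mu (tame_symN su))|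
    exact: (schwartz_integrable haar_mu (tame_driftD su))].
  by apply: eq_Rintegral => x _; rewrite NrE mulrDl.
rewrite (_ : \int[mu]_x (symN u x * p 1 x) = 0) ?add0r //.
pose F i y := p 1 y * Xi i u y.
have sF i : schwartz (F i) by apply: schwartz_mul => //; exact: schwartz_lie.
have -> : \int[mu]_x (symN u x * p 1 x) = \int[mu]_x (\sum_i - Xi i (F i) x).
  apply: eq_Rintegral => x _; rewrite symNE mulr_suml; apply: eq_bigr => i _.
  rewrite /F lieM //; last exact/smooth_lie/schwartz_smooth.
  by rewrite /adjX /logp; field.
rewrite schwartz_Rintegral_sum => [|i]; last exact/schwartzN/schwartz_lie.
rewrite big1 // => i _; rewrite (_ : (fun x => - _) = fun x => -1 * Xi i (F i) x).
  rewrite RintegralZl //; first by rewrite integral_lie0 // mulr0.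
  by apply: (schwartz_integrable haar_mu); exact: schwartz_lie.
by apply/funext => x; rewrite mulN1r.
Qed.

(** D is a derivation, so D(u v) = u D v + v D u has mean 0 against p. *)
Lemma ip_driftD u v : schwartz u -> schwartz v -> ip (driftD u) v = - ip u (driftD v).
Proof.
move=> su sv; have sm := schwartz_smooth; apply/eqP; rewrite -addr_eq0; apply/eqP.
have := driftD_integral0 (schwartz_mul su sv); rewrite [ip u _]ipC.
rewrite !ipE -RintegralD //; [|exact: ip_intble (tame_driftD su) sv|exact: ip_intble (tame_driftD sv) su].
move=> <-; apply: eq_Rintegral => x _; rewrite driftDM; [ring|exact: sm..].
Qed.

(** Coordinate functions are not Schwartz; the test function is x_j p, and since D p = 0 too,
    Leibniz' rule leaves p times the coefficient. *)
Lemma driftD_eq0_field x : (forall u, schwartz u -> driftD u x = 0) -> forall j, drift j x = 0.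
Proof.
move=> D0 j.
have := D0 _ (schwartzM (moderate_coord j) ps).
rewrite driftDM //; last exact: smooth_coord.
rewrite (D0 _ ps) mulr0 add0r driftD_coord => /eqP; rewrite mulf_eq0 (negbTE (pn0 x)) => /eqP //.
Qed.

(* Along the one-parameter group of a vector Z of a layer m >= 2, the left
   invariant frame fixes Z, so the dilation field m Z is never horizontal. *)
Lemma driftD_neq0 : ~ abelian_group G -> exists2 u, schwartz u & exists x, driftD u x <> 0.
Proof.
move=> nab; apply: contrapT => H; apply: nab; apply: trivial_bracket_commute.
have D0 x u : schwartz u -> driftD u x = 0.
  by move=> su; apply: contrapT => ?; apply: H; exists u => //; exists x.
have Z0 (k : 'I_(step G)) Z : (0 < k)%N -> Z \in layer G k.+1 -> Z = 0.
  move=> k0 Zk.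
  have eZ : euler_field G Z = k.+1%:R *: Z.
    rewrite /euler_field (bigD1 k) //= (lpi_layer _ Zk) eqxx big1 ?addr0 // => l lk.
    by rewrite (lpi_layer _ Zk) (negbTE lk) scaler0.
  (* The frame at Z fixes Z, so this vector is the drift at Z, assumed to vanish. The frame being
     invertible, its argument is 0, and the projection on the layer of Z, which kills the X_i, gives
     Z = 0. *)
  have E0 : frame G Z (k.+1%:R *: Z + \sum_i logp i Z *: tnth X i) = 0.
    rewrite frameD frameZ -{1}[Z]scale1r frame_exp -eZ.
    apply/rowP => j; rewrite row_coordD [RHS]mxE -(driftD_eq0_field (D0 Z) j) /drift; congr (_ + _).
    rewrite frame_sumr summxE; apply: eq_bigr => i _.
    by rewrite frameZ row_coordZ.
  have := coframeK G Z (k.+1%:R *: Z + \sum_i logp i Z *: tnth X i).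
  rewrite E0 coframe0 => /(congr1 (lpi k)).
  rewrite linear0 linearD linearZ linear_sum /= (lpi_layer _ Zk) eqxx big1 => [|i _].
    by rewrite addr0 => /esym/eqP; rewrite scaler_eq0 pnatr_eq0 => /eqP.
  rewrite linearZ /= (@lpi_layer _ _ G (Ordinal (step_gt0 G))) //.
  by case: eqP => [/(congr1 val) /= kE|_]; [rewrite kE in k0|rewrite scaler0].
move=> x y; rewrite br_lpi big1 // => i _; rewrite big1 // => j _.
have := br_layer (ltn0Sn i) (ltn0Sn j) (lpi_mem i x) (lpi_mem j y); rewrite addSn addnS.
have [lt|le] := ltnP (i + j).+1 (step G); first exact: (Z0 (Ordinal lt)).
by rewrite layer_out // memv0 => /eqP.
Qed.

Local Notation intip u v := (mu.-integrable setT (EFin \o ((fun x => u x * v x * p 1 x) : T -> R))).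

Lemma pdot_ip f h : let fr := re_part f in let fi := im_part f in
  let hr := re_part h in let hi := im_part h in
  intip fr hr -> intip fi hi -> intip fi hr -> intip fr hi ->
  pdot mu p f h = ((ip fr hr + ip fi hi) +i* (ip fi hr - ip fr hi))%C.
Proof.
move=> fr fi hr hi i1 i2 i3 i4; rewrite /pdot /pint /cint !ipE -RintegralD // -RintegralB //.
congr (_ +i* _)%C; apply: eq_Rintegral => x _; rewrite /fr /fi /hr /hi /re_part /im_part ?ReMr ?ImMr ?ReM ?ImM;
  by case: (h x) => a b /=; ring.
Qed.

Definition ctame f := tame (re_part f) /\ tame (im_part f).

Lemma pdotE f h : ctame f -> cschwartz h -> let fr := re_part f in let fi := im_part f in
  let hr := re_part h in let hi := im_part h in
  pdot mu p f h = ((ip fr hr + ip fi hi) +i* (ip fi hr - ip fr hi))%C.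
Proof. by move=> [t1 t2] [s1 s2] fr fi hr hi; apply: pdot_ip; exact: ip_intble. Qed.

Lemma pdotEr f h : cschwartz f -> ctame h -> let fr := re_part f in let fi := im_part f in
  let hr := re_part h in let hi := im_part h in
  pdot mu p f h = ((ip hr fr + ip hi fi) +i* (ip hr fi - ip hi fr))%C.
Proof.
move=> [s1 s2] [t1 t2] fr fi hr hi; rewrite pdot_ip.
- by rewrite (ipC fr) (ipC fi) (ipC fi) (ipC fr).
- by under eq_fun do rewrite [re_part f _ * _]mulrC; exact: ip_intble.
- by under eq_fun do rewrite [im_part f _ * _]mulrC; exact: ip_intble.
- by under eq_fun do rewrite [im_part f _ * _]mulrC; exact: ip_intble.
- by under eq_fun do rewrite [re_part f _ * _]mulrC; exact: ip_intble.
Qed.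

Lemma vfield_adj_cext i : vfield_adj G p (tnth X i) = cext (adjX i).
Proof.
apply/funext => h; apply/funext => x; rewrite /vfield_adj /vfield /cext /adjX /logp /re_part /im_part.
by case: (h x) => a b; apply/eqP; rewrite eq_complex /= !mul0r subr0 addr0 !eqxx.
Qed.

Lemma nablastar_nabla_cext : nablastar_nabla G p X = cext symN.
Proof.
apply/funext => f; apply/funext => x; rewrite /nablastar_nabla /cext !symNE.
under eq_bigr do rewrite vfield_adj_cext /vfield.
by elim: (index_enum _) => [|i r IH]; rewrite ?big_nil // !big_cons IH.
Qed.

Lemma pdot_vfield_adj i f h : cschwartz f -> cschwartz h ->
  pdot mu p (vfield G (tnth X i) f) h = pdot mu p f (vfield_adj G p (tnth X i) h).
Proof.
move=> [fr fi] [hr hi]; rewrite vfield_adj_cext pdotE //; last first.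
  by split; exact/schwartz_tame/schwartz_lie.
rewrite pdotEr //; last by split; exact: tame_adjX.
by congr (_ +i* _)%C; rewrite !ip_adjX // ?(ipC (re_part f)) ?(ipC (im_part f)).
Qed.

(** This is -i D, so that iC = D: antisymmetry of the real operator D is symmetry of C. *)
Definition driftC f x := (driftD (im_part f) x +i* - driftD (re_part f) x)%C.

Lemma driftC_first_order : first_order_diffop driftC.
Proof.
exists (fun=> 0), (fun j x => (0 +i* - drift j x)%C); split.
- by split; exact: smooth_cst.
- by move=> j; split; [exact: smooth_cst|apply: smoothN; exact: smooth_drift].
move=> f [/schwartz_smooth sr /schwartz_smooth si] x; rewrite mul0r add0r /driftC !driftD_sum // -sumrN.
elim: (index_enum _) => [|j r IH]; rewrite ?big_nil // !big_cons -IH /cext.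
by apply/eqP; rewrite eq_complex /= !mul0r !mulNr opprK sub0r !add0r !eqxx.
Qed.

Lemma driftC_neq0 : ~ abelian_group G -> exists2 f, cschwartz f & exists x, driftC f x <> 0.
Proof.
move=> /driftD_neq0[u su [x Dx]]; exists (fun y => (u y)%:C%C); first exact: cschwartz_real.
by exists x => -[_ /eqP]; rewrite oppr_eq0 => /eqP.
Qed.

Lemma driftC_sym f h : cschwartz f -> cschwartz h ->
  pdot mu p (driftC f) h = pdot mu p f (driftC h).
Proof.
move=> [fr fi] [hr hi].
rewrite pdotE //; last by split; [exact: tame_driftD|apply: tameN; exact: tame_driftD].
rewrite pdotEr //; last by split; [exact: tame_driftD|apply: tameN; exact: tame_driftD].
have tD u : schwartz u -> tame (driftD u) by exact: tame_driftD.
have E w z : schwartz w -> schwartz z -> ip (fun x => - driftD w x) z = ip (driftD z) w.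
  by move=> sw sz; rewrite (ipN (tD _ sw) sz) (ip_driftD sw sz) opprK; exact: ipC.
have E' w z : schwartz w -> schwartz z -> ip (driftD w) z = - ip (driftD z) w.
  by move=> sw sz; rewrite (ip_driftD sw sz); congr (- _); exact: ipC.
have ReC g : re_part (driftC g) = driftD (im_part g) by [].
have ImC g : im_part (driftC g) = fun x => - driftD (re_part g) x by [].
rewrite !ReC !ImC (E _ _ fr hi) (E _ _ hr fi) (E _ _ fr hr) (E _ _ hr fr).
by rewrite [ip _ _ + _]addrC (E' _ _ fi hi) (E' _ _ fr hr) !opprK [X in (_ +i* X)%C]addrC.
Qed.

Lemma opN_drift f h : pdot mu p (opN G X f) h
  = pdot mu p (fun x => nablastar_nabla G p X f x + ('i)%C * driftC f x) h.
Proof.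
congr (pdot mu p _ h); apply/funext => x; rewrite opN_cext nablastar_nabla_cext /cext !NrE /driftC.
by apply/eqP; rewrite eq_complex /=; apply/andP; split; apply/eqP; ring.
Qed.

Lemma ip_Nr u v : schwartz u -> schwartz v -> ip (N u) v = ip (symN u) v + ip (driftD u) v.
Proof.
move=> su sv; rewrite -ipD //; [|exact: tame_symN|exact: tame_driftD].
by apply: eq_ip => x; rewrite NrE.
Qed.

Lemma ip_driftD0 u : schwartz u -> ip (driftD u) u = 0.
Proof.
by move=> su; have := ip_driftD su su; rewrite (ipC u) => /eqP; rewrite -addr_eq0 -mulr2n mulrn_eq0 => /eqP.
Qed.

Lemma ip_symN_sym u v : schwartz u -> schwartz v -> ip (symN u) v = ip (symN v) u.
Proof. by move=> su sv; rewrite (ip_symN su sv) (ip_symN sv su); apply: eq_bigr => i _; exact: ipC. Qed.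

Lemma grad_norm2_ip f : cschwartz f -> \int[mu]_x (grad_norm2 G X f x * p 1 x) =
  ip (symN (re_part f)) (re_part f) + ip (symN (im_part f)) (im_part f).
Proof.
move=> [fr fi]; rewrite !ip_symN // -big_split /=.
pose F i x := Xi i (re_part f) x * Xi i (re_part f) x * p 1 x + Xi i (im_part f) x * Xi i (im_part f) x * p 1 x.
have st u i : schwartz u -> tame (Xi i u) by move=> su; exact/schwartz_tame/schwartz_lie.
transitivity (\int[mu]_x (\sum_i F i x)).
  apply: eq_Rintegral => x _; rewrite /grad_norm2 mulr_suml; apply: eq_bigr => i _.
  by rewrite sqr_normc /F /vfield /cext /= mulrDl !expr2.
rewrite schwartz_Rintegral_sum => [|i].
  apply: eq_bigr => i _; rewrite !ipE RintegralD //; apply: ip_intble; by [exact: st|exact: schwartz_lie].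
by apply: schwartzD; apply: ip_schwartz; by [exact: st|exact: schwartz_lie].
Qed.

Lemma pdot_opN f : cschwartz f -> pdot mu p (opN G X f) f =
  ((ip (symN (re_part f)) (re_part f) + ip (symN (im_part f)) (im_part f))
   +i* (2 * ip (driftD (im_part f)) (re_part f)))%C.
Proof.
move=> cf; have [sr si] := cf; rewrite opN_cext pdotE //; last first.
  by split; exact/schwartz_tame/schwartz_Nr.
rewrite /cext /re_part /im_part /= -/(re_part f) -/(im_part f) !ip_Nr //.
rewrite (ip_driftD0 sr) (ip_driftD0 si) !addr0 (ip_symN_sym sr si) (ip_driftD sr si).
rewrite (ipC (re_part f) (driftD (im_part f))).
by congr (_ +i* _)%C; ring.
Qed.

Lemma dirichlet_form f : cschwartz f ->
  complex.Re (pdot mu p (opN G X f) f) = \int[mu]_x (grad_norm2 G X f x * p 1 x) /\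
  ((\int[mu]_x (grad_norm2 G X f x * p 1 x))%:C)%C = pdot mu p (nablastar_nabla G p X f) f.
Proof.
move=> cf; have [sr si] := cf; rewrite pdot_opN // grad_norm2_ip //; split => //.
rewrite nablastar_nabla_cext pdotE //; last by split; exact: tame_symN.
by congr (_ +i* _)%C; rewrite [X in _ - X]ip_symN_sym // subrr.
Qed.

Lemma pdot_opN_real f : cschwartz f -> (forall x, complex.Im (f x) = 0) ->
  complex.Im (pdot mu p (opN G X f) f) = 0.
Proof.
move=> cf f0; have [sr si] := cf; rewrite pdot_opN //= ip_driftD // (_ : ip _ _ = 0) ?oppr0 ?mulr0 //.
rewrite ipE; under eq_Rintegral do rewrite /im_part f0 !mul0r.
by rewrite Rintegral_cst // mul0r.
Qed.

Lemma schwartz_inLq q f : (1 <= q)%E -> cschwartz f -> inLq nu q f.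
Proof.
move=> q1 [sr si]; have [M M0 HM] := schwartz_bounded sr; have [M' M0' HM'] := schwartz_bounded si.
have mr := schwartz_measurable sr; have mi := schwartz_measurable si.
split => //; apply: le_lt_trans (@cLnorm_le _ _ _ nu q f q1 mr mi) _.
apply: (@le_lt_trans _ _ (M%:E + M'%:E)%E); last by rewrite ltry.
by apply: leeD; apply: Lnorm_bound.
Qed.

(** Symmetry of all T_t passes to N by differentiating at t = 0, then to D since [symN] is
    symmetric. As D is also antisymmetric, D u is orthogonal to all Schwartz functions, against
    [driftD_neq0]. *)
Lemma opT_not_selfadjoint : ~ abelian_group G ->
  ~ (forall t : R, 0 < t -> forall f h, inLq nu 2%:E f -> inLq nu 2%:E h ->
       pdot mu p (opT G mu p t f) h = pdot mu p f (opT G mu p t h)).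
Proof.
move=> nab sa; have [u su [x]] := driftD_neq0 nab; apply.
pose K t w y := hr G mu p (1 - expR (- 2 * t)) w (dil G (ma t) y).
have sK t w : 0 < t -> schwartz w -> schwartz (K t w).
  by move=> t0 sw; exact: (schwartz_Kr haar_mu heat_p (ltW t0) sw).
have q2 : (1 <= (2 : R)%:E)%E by rewrite lee_fin ler1n.
have Ksym t w z : 0 < t -> schwartz w -> schwartz z -> ip (K t w) z = ip (K t z) w.
  move=> t0 sw sz; have cw := cschwartz_real sw; have cz := cschwartz_real sz.
  have := sa t t0 _ _ (schwartz_inLq q2 cw) (schwartz_inLq q2 cz).
  rewrite !(opT_schwartz haar_mu heat_p X_layer nuE (ltW t0)) //.
  have i0 a : ip a (fun=> 0) = 0.
    by rewrite ipE; under eq_Rintegral do rewrite mulr0 mul0r; rewrite Rintegral_cst // mul0r.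
  have [cw1 cw2] := cw; have [cz1 cz2] := cz.
  rewrite pdotE //; last by split; [exact: (schwartz_tame (sK t _ t0 cw1))|exact: (schwartz_tame (sK t _ t0 cw2))].
  rewrite pdotEr //; last by split; [exact: (schwartz_tame (sK t _ t0 cz1))|exact: (schwartz_tame (sK t _ t0 cz2))].
  by move=> [+ _]; rewrite /re_part /im_part /= !i0 !addr0.
have Nsym w z : schwartz w -> schwartz z -> ip (N w) z = ip (N z) w.
  move=> sw sz; have [C1 C10 H1] := generator_uniform haar_mu heat_p sw.
  have [C2 C20 H2] := generator_uniform haar_mu heat_p sz.
  have [M1 M10 B1] := schwartz_bounded sw; have [M2 M20 B2] := schwartz_bounded sz.
  apply/eqP; rewrite -subr_eq0; apply/eqP; apply: (@squeeze0 _ _ (C1 * M2 + C2 * M1)) => t t0.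
  (* The error of the difference quotient, uniformly O(t). By symmetry of T_t the difference
     quotients cancel in the antisymmetrised pairing, which is thus O(t) and independent of t. *)
  pose e (a : V -> R) y := t^-1 * (K t a y - a y) + N a y.
  have se a : schwartz a -> schwartz (e a).
    move=> sa'; apply: schwartzD; last exact: schwartz_Nr.
    by apply: schwartzZ; apply: schwartzB => //; exact: sK.
  have ee a b : schwartz a -> schwartz b -> ip (e a) b = t^-1 * (ip (K t a) b - ip a b) + ip (N a) b.
    move=> sa' sb; have sKa := sK t a t0 sa'.
    have tKa := schwartz_tame sKa; have ta := schwartz_tame sa'.
    have sB := schwartzB sKa sa'; have tZ := schwartz_tame (schwartzZ t^-1 sB).
    rewrite (ipD tZ (schwartz_tame (schwartz_Nr G X sa')) sb) (ipZ _ (schwartz_tame sB) sb).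
    by rewrite (ipD tKa (tameN ta) sb) (ipN ta sb).
  have -> : ip (N w) z - ip (N z) w = ip (e w) z - ip (e z) w.
    by rewrite !ee // (Ksym t w z) // (ipC w); ring.
  rewrite expr2 -mulrA ler_pM2l // mulrDr !mulrA.
  apply: le_trans (ler_normB _ _) _; apply: lerD; apply: ip_bound => //; try exact: se.
  - by move=> y; exact: H1.
  - by move=> y; exact: H2.
have D0 z : schwartz z -> ip (driftD u) z = 0.
  move=> sz; have := Nsym u z su sz; rewrite !ip_Nr // (ip_symN_sym su sz) => /addrI.
  rewrite (ip_driftD sz su) (ipC z) => /eqP.
  by rewrite -addr_eq0 -mulr2n mulrn_eq0 => /eqP.
have E := schwartz_weak_eq haar_mu (tame_driftD su) (@schwartz0 _ _).
have {}E : (fun y => driftD u y * p 1 y) = fun=> 0.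
  apply: E => w sw; transitivity (0 : R).
    by rewrite -(D0 w sw) ipE; apply: eq_Rintegral => y _; ring.
  by under [RHS]eq_Rintegral do rewrite mulr0; rewrite Rintegral_cst // mul0r.
have := congr1 (@^~ x) E => /= /eqP; rewrite mulf_eq0 (negbTE (pn0 x)) orbF => /eqP //.
Qed.

End real_part.

Theorem theorem3 (R : realType) (d : nat) (G : stratifiedGroup R d)
    (n : nat) (X : n.-tuple 'rV[R]_d) (basisX : basis_of (layer G 1%N) X)
    (mu : {measure set (borelV R d) -> \bar R}) (haar_mu : haar_measure G mu)
    (p : R -> 'rV[R]_d -> R) (heat_p : heat_kernel G mu p X)
    (nu : {measure set (borelV R d) -> \bar R})
    (nuE : forall A : set (borelV R d), measurable A ->
      nu A = (\int[mu]_(x in A) (p 1 x)%:E)%E) :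
  ([/\ forall (t : R) (f : 'rV[R]_d -> R[i]) (x : 'rV[R]_d), 0 <= t -> cschwartz f ->
         opT G mu p t f x
         = heat G mu p (1 - expR (- 2 * t)) f (dil G (expR (- t)) x),
       forall (t : R) (f : 'rV[R]_d -> R[i]), 0 <= t -> cschwartz f -> cschwartz (opT G mu p t f),
       forall f : 'rV[R]_d -> R[i], cschwartz f -> opT G mu p 0 f = f,
       forall (s t : R) (f : 'rV[R]_d -> R[i]), 0 <= s -> 0 <= t -> cschwartz f ->
         opT G mu p (s + t) f = opT G mu p s (opT G mu p t f) &
       forall (q : \bar R) (f : 'rV[R]_d -> R[i]), (1 <= q)%E -> cschwartz f ->
         cLnorm nu q (fun x : borelV R d =>
           ((t^-1)%:C)%C * (opT G mu p t f x - f x) + opN G X f x)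
         @[t --> 0^'+] --> 0%E]) /\
  ((forall (t : R) (f : 'rV[R]_d -> R[i]), 0 <= t -> cschwartz f ->
      pint mu p (opT G mu p t f) = pint mu p f) /\
   (forall f : 'rV[R]_d -> R[i], cschwartz f -> pint mu p (opN G X f) = 0)) /\
  (exists S : R -> ('rV[R]_d -> R[i]) -> ('rV[R]_d -> R[i]),
     [/\ forall q : \bar R, (1 <= q)%E ->
           markov_contraction_extension nu q (opT G mu p) S,
         forall q : \bar R, (1 <= q < +oo)%E -> strongly_continuous nu q S,
         forall (q : \bar R) (f : 'rV[R]_d -> R[i]), (1 <= q < +oo)%E -> inLq nu q f ->
           cLnorm nu q (fun x : borelV R d => S t f x - pint mu p f)
             @[t --> +oo] --> 0%E &
         ~ abelian_group G ->
         ~ (forall t : R, 0 < t -> forall f h : 'rV[R]_d -> R[i],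
              inLq nu 2%:E f -> inLq nu 2%:E h ->
              pdot mu p (S t f) h = pdot mu p f (S t h))]) /\
  ((forall (i : 'I_n) (f h : 'rV[R]_d -> R[i]), cschwartz f -> cschwartz h ->
      pdot mu p (vfield G (tnth X i) f) h
      = pdot mu p f (vfield_adj G p (tnth X i) h)) /\
   (exists C : ('rV[R]_d -> R[i]) -> ('rV[R]_d -> R[i]),
     [/\ first_order_diffop C,
         ~ abelian_group G -> exists2 f : 'rV[R]_d -> R[i], cschwartz f & exists x, C f x <> 0,
         forall f h : 'rV[R]_d -> R[i], cschwartz f -> cschwartz h ->
           pdot mu p (C f) h = pdot mu p f (C h) &
         forall f h : 'rV[R]_d -> R[i], cschwartz f -> cschwartz h ->
           pdot mu p (opN G X f) h
           = pdot mu p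
               (fun x => nablastar_nabla G p X f x + ('i)%C * C f x) h]) /\
   (forall f : 'rV[R]_d -> R[i], cschwartz f ->
      complex.Re (pdot mu p (opN G X f) f)
        = Rintegral mu setT (fun x => grad_norm2 G X f x * p 1 x) /\
      ((Rintegral mu setT (fun x => grad_norm2 G X f x * p 1 x))%:C)%C
        = pdot mu p (nablastar_nabla G p X f) f) /\
   (forall f : 'rV[R]_d -> R[i], cschwartz f -> (forall x, complex.Im (f x) = 0) ->
      complex.Im (pdot mu p (opN G X f) f) = 0)).
Proof.
(* The bare measures mu and nu are replaced by equal ones known to be sigma-finite and a
   probability. *)
have [m muE] := sigma_finite_measure_of (mu_sigma_finite haar_mu).
rewrite muE in haar_mu heat_p nuE * => {muE mu}.
have nu1 : nu setT = 1%E by rewrite nuE //; have [/(_ 1 ltr01)[]] := heat_p.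
have [nu' nu'E] := probability_of nu1.
rewrite nu'E in nuE * => {nu'E nu1 nu}.
have X_layer i : tnth X i \in layer G 1%N by apply: (basis_mem basisX); exact: mem_tnth.
split.
  split.
  - move=> t f x t0 cf; rewrite (opT_schwartz haar_mu heat_p X_layer nuE t0 cf).
    by rewrite (heat_cext G m p).
  - by move=> t f; exact: (cschwartz_opT haar_mu heat_p X_layer nuE).
  - by move=> f; exact: (opT0 haar_mu heat_p X_layer nuE).
  - by move=> s t f; exact: (opT_add haar_mu heat_p X_layer nuE).
  - by move=> q f; exact: (opT_generator haar_mu heat_p X_layer nuE).
split.
  split.
  - by move=> t f; exact: (opT_invariant haar_mu heat_p X_layer nuE).
  - by move=> f; exact: (opN_integral0 haar_mu heat_p X_layer nuE).
split.
  (* The integral formula itself provides the extension, simultaneously for all q: on a measurable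
     representative it is the mean over the noise, and changing f on a null set changes it on a null
     set only. *)
  exists (opT G m p); split.
  - by move=> q; exact: (markov_opT haar_mu heat_p X_layer nuE).
  - by move=> q; exact: (opT_strongly_continuous haar_mu heat_p X_layer nuE).
  - by move=> q f; exact: (opT_ergodic haar_mu heat_p X_layer nuE).
  - exact: (opT_not_selfadjoint haar_mu heat_p X_layer nuE).
split; first by move=> i f h; exact: (pdot_vfield_adj haar_mu heat_p).
split.
  exists (driftC G p X); split.
  - exact: (driftC_first_order heat_p).
  - exact: (driftC_neq0 heat_p X_layer).
  - by move=> f h; exact: (driftC_sym haar_mu heat_p X_layer nuE).
  - by move=> f h _ _; exact: opN_drift.
split; first by move=> f; exact: (dirichlet_form haar_mu heat_p X_layer nuE).
by move=> f; exact: (pdot_opN_real haar_mu heat_p X_layer nuE).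
Qed.
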